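(* Let $((G,\pi_G),(G^*,\pi_{G^*}))$ be a pair of dual Poisson Lie groups contained in a Drinfeld double $D$, with double symplectic groupoid $(\Gamma,\pi_\Gamma)$. Let $(\mathcal Y,\pi_{\mathcal Y})$, $(\mathcal Z,\pi_{\mathcal Z})$ be local Poisson groupoids over Poisson manifolds $(Y,\pi_Y)$, $(Z,\pi_Z)$, let $$\mu_{\mathcal Y}:(\mathcal Y,\pi_{\mathcal Y})\to(G,\pi_G),\qquad \mu_{\mathcal Z}:(\mathcal Z,\pi_{\mathcal Z})\to(G^*,-\pi_{G^*})$$ be morphisms of local Poisson groupoids, and let $\lhd_G$ be a right Poisson action of $(\Gamma_G,-\pi_\Gamma)$ on $\mu_{\mathcal Y}$ and $\lhd_{G^*}$ a right Poisson action of $(\Gamma_{G^*},\pi_\Gamma)$ on $\mu_{\mathcal Z}$, satisfying the twisted multiplicativity properties $$\tilde y_1\tilde y_2\lhd_G(\gamma_2\star\gamma_1)=(\tilde y_1\lhd_G\gamma_1)(\tilde y_2\lhd_G\gamma_2),\qquad \tilde z_1\tilde z_2\lhd_{G^*}(\gamma_1\gamma_2)=(\tilde z_1\lhd_{G^*}\gamma_1)(\tilde z_2\lhd_{G^*}\gamma_2)$$ whenever both sides are defined (with $\gamma_2,\gamma_1$ composable in $\Gamma_{G^*}$ in the first identity, and $\gamma_1,\gamma_2$ composable in $\Gamma_G$ in the second). Let $\varrho_Y$ and $\vartheta_Z$ be the induced actions of $G^*$ on $Y$ and of $G$ on $Z$, written $(y,u)\mapsto y^u$ and $(g,z)\mapsto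 g[z]$. Then the following maps determine a well-defined local groupoid structure on $\mathcal Y\times\mathcal Z$ over $Y\times Z$, denoted $\mathcal Y\times_{\mathcal L}\mathcal Z$: - source: $\theta(\tilde y,\tilde z)=(\theta_{\mathcal Y}(\tilde y),\ \mu_{\mathcal Y}(\tilde y)[\theta_{\mathcal Z}(\tilde z)])$; - target: $\tau(\tilde y,\tilde z)=(\tau_{\mathcal Y}(\tilde y)^{\mu_{\mathcal Z}(\tilde z)},\ \tau_{\mathcal Z}(\tilde z))$; - identity bisection: $\varepsilon(y,z)=(\varepsilon_{\mathcal Y}(y),\varepsilon_{\mathcal Z}(z))$; - inverse: $\iota(\tilde y,\tilde z)=\big(\iota_{\mathcal Y}(\tilde y\lhd_G\gamma),\ \iota_{\mathcal Z}(\tilde z\lhd_{G^*}\gamma)\big)$ with $\gamma=\gamma_{\mu_{\mathcal Y}(\tilde y),\mu_{\mathcal Z}(\tilde z)}$, defined when $(\tilde z,\tilde y)\in R_{\mathcal L}^{-1}\big(O_{\mathcal Z,\mathcal Y}\cap(\mathcal Z^{(-1)}\times\mathcal Y^{(-1)})\big)$; - multiplication: $(\tilde y_1,\tilde z_1)\cdot(\tilde y_2,\tilde z_2)=\big(\tilde y_1(\gamma\rhd_G\tilde y_2),\ (\gamma\rhd_{G^*}\tilde z_1)\tilde z_2\big)$ with $\gamma=\gamma^{\mu_{\mathcal Z}(\tilde z_1),\mu_{\mathcal Y}(\tilde y_2)}$, defined when $\tau(\tilde y_1,\tilde z_1)=\theta(\tilde y_2,\tilde z_2)$, $(\tilde z_1,\tilde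 y_2)\in O_{\mathcal Z,\mathcal Y}$ and the products on the right-hand side are defined in $\mathcal Y$ and $\mathcal Z$. Moreover $(\mathcal Y\times_{\mathcal L}\mathcal Z,\ \pi_{\mathcal Y}\times\pi_{\mathcal Z})$ is a local Poisson groupoid over $(Y\times Z,\ \pi_Y\times_{(\varrho_Y,\vartheta_Z)}\pi_Z)$, and the map $$\mu:(\mathcal Y\times_{\mathcal L}\mathcal Z,\ \pi_{\mathcal Y}\times\pi_{\mathcal Z})\to(D,\pi_D),\qquad \mu(\tilde y,\tilde z)=\mu_{\mathcal Y}(\tilde y)\mu_{\mathcal Z}(\tilde z),$$ is a morphism of local Poisson groupoids.
   Context: Manifolds are real smooth or complex, and maps and tensors smooth or holomorphic accordingly. Conventions: $a\wedge b=a\otimes b-b\otimes a$; repeated indices are summed; $x^L,x^R$ are the left/right invariant tensor fields with value $x$ at $e$. Dual Poisson Lie groups. A Poisson Lie group $(G,\pi_G)$ has Lie bialgebra $(\mathfrak g,\delta_{\mathfrak g})$, $\delta_{\mathfrak g}(x)=[x^R,\pi_G](e)$. $((G,\pi_G),(G^*,\pi_{G^*}))$ is a pair of dual Poisson Lie groups if the Lie bialgebra of $(G^*,\pi_{G^*})$ is the dual Lie bialgebra $(\mathfrak g^*,\delta_{\mathfrak g^*})$ (the bracket of $\mathfrak g^*$ is dual to $\delta_{\mathfrak g}$, and $\delta_{\mathfrak g^*}$ is dual to the bracket of $\mathfrak g$). The double Lie algebra is $\mathfrak d=\mathfrak g\oplus\mathfrak g^*$ with the form $\langle x+\xi,y+\eta\rangle=\langle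 x,\eta\rangle+\langle y,\xi\rangle$ and the unique Lie bracket for which $\mathfrak g,\mathfrak g^*$ are subalgebras and the form is ad-invariant. A Drinfeld double is a Lie group $D$ with Lie algebra $\mathfrak d$; it is assumed that $G$ and $G^*$ are subgroups of $D$ (with Lie algebras $\mathfrak g,\mathfrak g^*\subset\mathfrak d$). Let $(x_i)$ be a basis of $\mathfrak g$ and $(\xi^i)$ the dual basis of $\mathfrak g^*$; $\pi_D=\Lambda^L-\Lambda^R$ with $\Lambda=\tfrac12x_i\wedge\xi^i$. Then $(G,\pi_G)$ and $(G^*,-\pi_{G^*})$ are Poisson Lie subgroups of $(D,\pi_D)$. Double symplectic groupoid. $\Gamma=\{(g,u,u',g')\in G\times G^*\times G^*\times G: gu=u'g'\}$, $p(g,u,u',g')=gu\in D$. The projection $p_L:\Gamma\to G\times G^*$ to the first two factors is a local diffeomorphism, and $\pi_\Gamma$ is the (non-degenerate) Poisson structure with $p_L(\pi_\Gamma)=(\pi_G,\pi_{G^*})-(x_i^L,0)\wedge(0,(\xi^i)^R)$. Groupoid $\Gamma_{G^*}$ over $G^*$: source $\theta_{G^*}=u$, target $\tau_{G^*}=u'$, units $\varepsilon_{G^*}(u)=(e,u,u,e)$, inverse $\iota_{G^*}(g,u,u',g')=(g^{-1},u',u,g'^{-1})$, and when $u_1'=u_2$, $(g_1,u_1,u_1',g_1')\star(g_2,u_2,u_2',g_2')=(g_2g_1,u_1,u_2',g_2'g_1')$. Groupoid $\Gamma_G$ over $G$: source $\theta_G=g$, target $\tau_G=g'$, units $\varepsilon_G(g)=(g,e,e,g)$,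 inverse $\iota_G(g,u,u',g')=(g',u^{-1},u'^{-1},g)$, and when $g_1'=g_2$, $(g_1,u_1,u_1',g_1')(g_2,u_2,u_2',g_2')=(g_1,u_1u_2,u_1'u_2',g_2')$. $(\Gamma_G,\pi_\Gamma)$ and $(\Gamma_{G^*},\pi_\Gamma)$ are symplectic groupoids over $(G,\pi_G)$ and $(G^*,\pi_{G^*})$. Local dressing. $O_\Gamma\subset\Gamma$ is the maximal open subset containing $\varepsilon_G(G)\cup\varepsilon_{G^*}(G^* )$ on which $p$ is a diffeomorphism onto its image; $O_{G,G^*}\subset G\times G^*$ and $O_{G^*,G}\subset G^*\times G$ are the images of $O_\Gamma$ under the projections to the first two and last two factors. For $(g,u)\in O_{G,G^*}$, $\gamma_{g,u}=(g,u,g[u],g^u)$ is the element of $O_\Gamma$ with first two entries $(g,u)$; for $(u',g')\in O_{G^*,G}$, $\gamma^{u',g'}$ is the element of $O_\Gamma$ with last two entries $(u',g')$. $O^{21}_{G^*,G}=\{(u,g):(g,u)\in O_{G,G^*}\}$. Groupoids. In a groupoid, $g_1g_2$ is defined when $\tau(g_1)=\theta(g_2)$ ($\theta$ source, $\tau$ target). A local Lie groupoid $\mathcal G\rightrightarrows Y$: submersions $\theta,\tau:\mathcal G\to Y$, an embedding $\varepsilon:Y\to\mathcal G$, a multiplication defined on an open neighbourhood $\mathcal G^{(2)}_0$ of $\{(\varepsilon(\theta(g)),g)\}\cup\{(g,\varepsilon(\tau(g)))\}$ in $\{(g_1,g_2):\tau(g_1)=\theta(g_2)\}$, and an involution $\iota$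 of an open neighbourhood $\mathcal G^{(-1)}$ of $\varepsilon(Y)$, satisfying the Lie groupoid axioms (in particular $(g_1g_2)g_3=g_1(g_2g_3)$) wherever they make sense. A local Poisson groupoid $(\mathcal G,\pi)$ is a local Lie groupoid with a Poisson structure such that $\{(g_1,g_2,g_1g_2)\}$ is coisotropic in $(\mathcal G^3,\pi\times\pi\times(-\pi))$; it is over $(Y,\pi_Y)$ where $\theta(\pi)=-\tau(\pi)=\pi_Y$. Morphisms of local Poisson groupoids are local groupoid morphisms that are Poisson maps; a Poisson Lie group is a Poisson groupoid over a point. A right Poisson action of a symplectic groupoid $(\mathcal G\rightrightarrows Y,\pi)$ on $\mu:(X,\pi_X)\to Y$ is a right Lie groupoid action $x\lhd g$ (defined when $\mu(x)=\theta(g)$) with moment map $\mu$ such that $\{(x,g,x\lhd g)\}$ is coisotropic in $(X\times\mathcal G\times X,\pi_X\times\pi\times(-\pi_X))$. Structure maps of $\mathcal Y,\mathcal Z$ carry subscripts $\mathcal Y,\mathcal Z$. Induced actions: $\varepsilon_{\mathcal Y}(y^u)=\varepsilon_{\mathcal Y}(y)\lhd_G(e,u,u,e)$ and $\varepsilon_{\mathcal Z}(g[z])=\varepsilon_{\mathcal Z}(z)\lhd_{G^*}(g,e,e,g)$, for $y\in Y,u\in G^*,z\in Z,g\in G$; they are a right Poisson action $\varrho_Y$ of $(G^*,\pi_{G^*})$ on $(Y,\pi_Y)$ and a left Poisson action $\vartheta_Z$ of $(G,\pi_G)$ on $(Z,\pi_Z)$. With the same symbols for infinitesimal actions, $\varrho_Y(\xi)(y)=\frac{d}{dt}|_{0}\,y^{\exp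 t\xi}$, $\vartheta_Z(x)(z)=\frac{d}{dt}|_0\exp(tx)[z]$, the mixed product Poisson structure is $\pi_Y\times_{(\varrho_Y,\vartheta_Z)}\pi_Z=(\pi_Y,\pi_Z)-(\varrho_Y(\xi^i),0)\wedge(0,\vartheta_Z(x_i))$. $\gamma\rhd_G\tilde y:=\tilde y\lhd_G\iota_G(\gamma)$ (when $\tau_G(\gamma)=\mu_{\mathcal Y}(\tilde y)$) and $\gamma\rhd_{G^*}\tilde z:=\tilde z\lhd_{G^*}\iota_{G^*}(\gamma)$ (when $\tau_{G^*}(\gamma)=\mu_{\mathcal Z}(\tilde z)$). $O_{\mathcal Z,\mathcal Y}=(\mu_{\mathcal Z}\times\mu_{\mathcal Y})^{-1}(O_{G^*,G})$, $O^{21}_{\mathcal Z,\mathcal Y}=(\mu_{\mathcal Z}\times\mu_{\mathcal Y})^{-1}(O^{21}_{G^*,G})$, and $R_{\mathcal L}:O^{21}_{\mathcal Z,\mathcal Y}\to O_{\mathcal Z,\mathcal Y}$ is the diffeomorphism $R_{\mathcal L}(\tilde z,\tilde y)=(\tilde z\lhd_{G^*}\gamma,\ \tilde y\lhd_G\gamma)$, $\gamma=\gamma_{\mu_{\mathcal Y}(\tilde y),\mu_{\mathcal Z}(\tilde z)}$.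
   Formalization: Twisted multiplicativity also requires the acted-on elements to stay composable; associativity, involutivity and inverse laws hold after shrinking the domains, or on the stated domains if those of Y, Z are action-stable and contain (x,x^-1), (x^-1,x), as for Lie groupoids. *)

(* Defs.v *)
From mathcomp Require Import all_boot all_order all_algebra.
From mathcomp Require Import complex.
From mathcomp Require Import all_classical all_reals all_analysis.

Set Implicit Arguments.
Unset Strict Implicit.
Unset Printing Implicit Defensive.

Import Order.TTheory GRing.Theory Num.Theory.
Import numFieldNormedType.Exports.

Local Open Scope classical_set_scope.
Local Open Scope ring_scope.

Inductive real_or_complex (R : realType) : numFieldType -> Prop :=
| RealScalars : real_or_complex R (R : numFieldType)
| ComplexScalars : real_or_complex R (R[i] : numFieldType).

(** A manifold carries one preferred chart [chart p], with inverse [cinv p],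
    around each point [p].  The tangent space at [p] is the space of row
    vectors ['rV[K]_dim], read in the preferred chart at [p]; a bivector at [p]
    is a matrix [b], standing for the tensor \sum_(i, j) b i j e_i (x) e_j. *)

Record atlas (K : numFieldType) (T : topologicalType) := Atlas {
  adim : nat;
  acdom : T -> set T;
  achart : T -> T -> 'rV[K]_adim;
  acinv : T -> 'rV[K]_adim -> T }.

Record premanifold (K : numFieldType) := Premanifold {
  pcar :> topologicalType;
  patlas : atlas K pcar }.

Section Calculus.
Variable K : numFieldType.
Implicit Types M N P : premanifold K.

Definition mdim M : nat := adim (patlas M).
Definition cdom M : M -> set M := @acdom _ _ (patlas M).
Definition chart M : M -> M -> 'rV[K]_(mdim M) := @achart _ _ (patlas M).
Definition cinv M : M -> 'rV[K]_(mdim M) -> M := @acinv _ _ (patlas M).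

(* If [K] is R[i], then [differentiable] means holomorphic, and asking for all
   iterated derivatives is no restriction. *)
Fixpoint Ck (k : nat) (n : nat) (U : set 'rV[K]_n) (f : 'rV[K]_n -> K) : Prop :=
  match k with
  | 0%N => forall x, U x -> {for x, continuous f}
  | k'.+1 => (forall x, U x -> differentiable f x) /\
             (forall v, Ck k' U (fun x => 'D_v f x))
  end.

Definition is_manifold M : Prop :=
  [/\ hausdorff_space M, @second_countable M
    & [/\ (forall p : M, open (cdom p) /\ cdom p p),
          (forall p : M, open (chart p @` cdom p)),
          (forall p q : M, cdom p q ->
             cinv p (chart p q) = q /\ {for q, continuous (chart p)}),
          (forall (p : M) x, (chart p @` cdom p) x -> {for x, continuous (cinv p)})
        & (forall (p q : M) k j,
             Ck k (chart p @` (cdom p `&` cdom q))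
                  (fun x => chart q (cinv p x) 0 j))]].

Definition smoothf_at M (f : M -> K) (p : M) : Prop :=
  exists U : set 'rV[K]_(mdim M),
    [/\ open U, U (chart p p) & forall k, Ck k U (f \o cinv p)].

Definition coord M (p : M) (j : 'I_(mdim M)) : M -> K := fun q => chart p q 0 j.

Definition smooth_at M N (f : M -> N) (p : M) : Prop :=
  {for p, continuous f} /\ forall j, smoothf_at (coord (f p) j \o f) p.

Definition smooth M N (f : M -> N) : Prop := forall p, smooth_at f p.

(* Smoothness on a subset, by local smooth extension. It is used for open
   subsets and for closed submanifolds of open subsets. *)
Definition smooth_on M N (S : set M) (f : M -> N) : Prop :=
  forall p, S p -> exists F : M -> N,
    smooth_at F p /\ \forall q \near p, S q -> F q = f q.

Definition pd M (f : M -> K) (p : M) (v : 'rV[K]_(mdim M)) : K :=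
  'D_v (f \o cinv p) (chart p p).

(* The differential of [f] at [p] is [v |-> v *m jac f p]. *)
Definition jac M N (f : M -> N) (p : M) : 'M[K]_(mdim M, mdim N) :=
  \matrix_(i, j) pd (coord (f p) j \o f) p (delta_mx 0 i).

Definition diffeo_onto_image M N (A : set M) (f : M -> N) : Prop :=
  [/\ open (f @` A), smooth_on A f
    & exists h : N -> M, (forall x, A x -> h (f x) = x) /\ smooth_on (f @` A) h].

Definition local_diffeo M N (f : M -> N) : Prop :=
  forall p, exists A : set M, [/\ open A, A p & diffeo_onto_image A f].

Definition submersion M N (f : M -> N) : Prop :=
  smooth f /\ forall p, row_full (jac f p).

Definition embedding M N (f : M -> N) : Prop :=
  [/\ smooth f, injective f, (forall p, row_free (jac f p))
    & forall A : set M, open A -> exists2 B : set N, open B & f @^-1` B = A].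

Definition prodM M N : premanifold K :=
  @Premanifold K (M * N)%type
    (@Atlas K (M * N)%type (mdim M + mdim N)
       (fun p => cdom p.1 `*` cdom p.2)
       (fun p q => row_mx (chart p.1 q.1) (chart p.2 q.2))
       (fun p v => (cinv p.1 (lsubmx v), cinv p.2 (rsubmx v)))).

Definition vfield M := M -> 'rV[K]_(mdim M).
Definition bivector M := M -> 'M[K]_(mdim M).

Definition vapp M (X : vfield M) (f : M -> K) : M -> K := fun p => pd f p (X p).

Definition lie_bracket M (X Y : vfield M) : vfield M := fun p =>
  \row_i (vapp X (vapp Y (coord p i)) p - vapp Y (vapp X (coord p i)) p).

Definition bracket M (b : bivector M) (f g : M -> K) : M -> K := fun p =>
  \sum_i \sum_j b p i j * pd f p (delta_mx 0 i)
                        * pd g p (delta_mx 0 j).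

(* The Schouten bracket [X, b], that is, the Lie derivative of [b] along [X]. *)
Definition lie_derivative M (X : vfield M) (b : bivector M) : bivector M :=
  fun p => \matrix_(i, j)
    (vapp X (bracket b (coord p i) (coord p j)) p
     - bracket b (vapp X (coord p i)) (coord p j) p
     - bracket b (coord p i) (vapp X (coord p j)) p).

Definition is_poisson M (b : bivector M) : Prop :=
  [/\ (forall p, (b p)^T = - b p),
      (forall p f g, smoothf_at f p -> smoothf_at g p ->
         smoothf_at (bracket b f g) p)
    & (forall p f g h, smoothf_at f p -> smoothf_at g p -> smoothf_at h p ->
         bracket b f (bracket b g h) p + bracket b g (bracket b h f) p
         + bracket b h (bracket b f g) p = 0)].

Definition push m n (J : 'M[K]_(m, n)) (b : 'M[K]_m) : 'M[K]_n :=
  J^T *m b *m J.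

Definition poisson_map M N (bM : bivector M) (bN : bivector N) (f : M -> N) : Prop :=
  smooth f /\ forall p, push (jac f p) (bM p) = bN (f p).

Definition negB M (b : bivector M) : bivector M := fun p => - b p.

Definition prodB M N (bM : bivector M) (bN : bivector N) : bivector (prodM M N) :=
  fun p => block_mx (bM p.1) 0 0 (bN p.2).

Definition wedge n (a b : 'rV[K]_n) : 'M[K]_n := a^T *m b - b^T *m a.

(* For a submanifold [S], coisotropy is closure of the vanishing ideal under
   the bracket; germs are used since there are no holomorphic bump functions. *)
Definition coisotropic M (b : bivector M) (S : set M) : Prop :=
  forall p f g, S p -> smoothf_at f p -> smoothf_at g p ->
    (\forall q \near p, S q -> f q = 0) ->
    (\forall q \near p, S q -> g q = 0) ->
    bracket b f g p = 0.

End Calculus.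

Record manifold (K : numFieldType) := Manifold {
  mfd :> premanifold K;
  mfdP : is_manifold mfd }.

Record lieGroup (K : numFieldType) := LieGroup {
  lgroup :> manifold K;
  lmul : lgroup -> lgroup -> lgroup;
  lone : lgroup;
  linv : lgroup -> lgroup;
  lmulA : associative lmul;
  lmul1g : left_id lone lmul;
  lmulg1 : right_id lone lmul;
  lmulVg : left_inverse lone linv lmul;
  lmulgV : right_inverse lone linv lmul;
  smooth_lmul : @smooth K (prodM lgroup lgroup) lgroup (fun p => lmul p.1 p.2);
  smooth_linv : @smooth K lgroup lgroup linv }.

Arguments lone {K} l.

Record lieHom (K : numFieldType) (G H : lieGroup K) := LieHom {
  lhom :> G -> H;
  smooth_lhom : smooth lhom;
  lhomM : forall g h, lhom (lmul g h) = lmul (lhom g) (lhom h) }.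

Section LieGroups.
Variable K : numFieldType.
Implicit Types G Gs H D : lieGroup K.

Lemma lmulK G (g h : G) : lmul (linv g) (lmul g h) = h.
Proof. by rewrite lmulA lmulVg lmul1g. Qed.

Lemma lmulgI G (g h k : G) : lmul g h = lmul g k -> h = k.
Proof. by move=> e; rewrite -(lmulK g h) e lmulK. Qed.

Lemma lhom1 G H (f : lieHom G H) : f (lone G) = lone H.
Proof. by apply: (@lmulgI _ (f (lone G))); rewrite -lhomM !lmulg1. Qed.

Lemma lhomV G H (f : lieHom G H) g : f (linv g) = linv (f g).
Proof. by apply: (@lmulgI _ (f g)); rewrite -lhomM !lmulgV lhom1. Qed.

Definition left_inv G (x : 'rV[K]_(mdim G)) : vfield G :=
  fun g => x *m jac (lmul g) (lone G).
Definition right_inv G (x : 'rV[K]_(mdim G)) : vfield G :=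
  fun g => x *m jac (fun h => lmul h g) (lone G).

Definition left_invB G (b : 'M[K]_(mdim G)) : bivector G :=
  fun g => push (jac (lmul g) (lone G)) b.
Definition right_invB G (b : 'M[K]_(mdim G)) : bivector G :=
  fun g => push (jac (fun h => lmul h g) (lone G)) b.

Definition lie G (x y : 'rV[K]_(mdim G)) : 'rV[K]_(mdim G) :=
  lie_bracket (left_inv x) (left_inv y) (lone G).

Definition cobracket G (b : bivector G) (x : 'rV[K]_(mdim G)) : 'M[K]_(mdim G) :=
  lie_derivative (right_inv x) b (lone G).

Definition poisson_lie_group G (b : bivector G) : Prop :=
  is_poisson b /\
  @poisson_map K (prodM G G) G (prodB b b) b (fun p => lmul p.1 p.2).

Definition bil m n (B : 'M[K]_(m, n)) (x : 'rV[K]_m) (y : 'rV[K]_n) : K :=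
  (x *m B *m y^T) 0 0.

(* [pr] is the pairing that identifies the Lie algebra of [Gs] with the dual of
   the Lie algebra of [G]. *)
Definition dual_lie_bialgebras G Gs (bG : bivector G) (bGs : bivector Gs)
    (pr : 'M[K]_(mdim G, mdim Gs)) : Prop :=
  [/\ row_free pr, row_full pr,
      (forall x xi eta, bil pr x (lie xi eta) =
         bil (cobracket bG x) (xi *m pr^T) (eta *m pr^T))
    & (forall x y xi, bil pr (lie x y) xi =
         bil (cobracket bGs xi) (x *m pr) (y *m pr))].

(* [E] sends (x, xi) to x + xi, and [Q] is the form
   <x + xi, y + eta> = <x, eta> + <y, xi>. *)
Definition drinfeld_double G Gs D (pr : 'M[K]_(mdim G, mdim Gs))
    (jG : lieHom G D) (jGs : lieHom Gs D) : Prop :=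
  let E := col_mx (jac jG (lone G)) (jac jGs (lone Gs)) in
  [/\ injective jG, injective jGs, row_free E, row_full E
    & exists2 Q : 'M[K]_(mdim D), E *m Q *m E^T = block_mx 0 pr pr^T 0
        & forall a b c : 'rV[K]_(mdim D),
            bil Q (lie a b) c + bil Q b (lie a c) = 0].

Definition dual_bases n m1 m2 (pr : 'M[K]_(m1, m2))
    (x : 'M[K]_(n, m1)) (xi : 'M[K]_(n, m2)) : Prop :=
  [/\ row_full x, row_full xi & x *m pr *m xi^T = 1%:M].

(* The value at [lone D] of [piD] is transported there along [jG] and [jGs],
   whose values at the unit are only propositionally equal to [lone D]. *)
Definition piD G Gs D (jG : lieHom G D) (jGs : lieHom Gs D) n
    (x : 'M[K]_(n, mdim G)) (xi : 'M[K]_(n, mdim Gs)) : bivector D :=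
  let Lambda : 'M[K]_(mdim D) := 2^-1 *: \sum_(i < n)
    wedge (row i x *m jac jG (lone G)) (row i xi *m jac jGs (lone Gs)) in
  fun d => left_invB Lambda d - right_invB Lambda d.

End LieGroups.

(** The maps are total; [gmul] and [ginv] are meaningful on [gmdom] and [gidom]
    only.  [gmul a b] composes [a] with [b] when the target of [a] is the
    source of [b]. *)

Record lgroupoid (K : numFieldType) (A B : premanifold K) := LGroupoid {
  gsrc : A -> B;
  gtgt : A -> B;
  gunit : B -> A;
  gmul : A -> A -> A;
  gmdom : set (A * A);
  ginv : A -> A;
  gidom : set A }.

Section Groupoids.
Variable K : numFieldType.
Implicit Types A B X : premanifold K.

Definition composable A B (Gr : lgroupoid A B) : set (A * A) :=
  [set p | gtgt Gr p.1 = gsrc Gr p.2].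

(* Everything in the notion of local Lie groupoid except associativity, the
   inverse laws, and the involutivity of the inverse. *)
Definition local_groupoid_maps A B (Gr : lgroupoid A B) : Prop :=
  [/\ [/\ submersion (gsrc Gr), submersion (gtgt Gr) & embedding (gunit Gr)],
      [/\ (exists2 W : set (A * A), open W & gmdom Gr = W `&` composable Gr),
          (forall a, gmdom Gr (gunit Gr (gsrc Gr a), a)),
          (forall a, gmdom Gr (a, gunit Gr (gtgt Gr a))),
          open (gidom Gr) & forall y, gidom Gr (gunit Gr y)],
      @smooth_on K (prodM A A) A (gmdom Gr) (fun p => gmul Gr p.1 p.2) /\
      smooth_on (gidom Gr) (ginv Gr),
      [/\ (forall y, gsrc Gr (gunit Gr y) = y),
          (forall y, gtgt Gr (gunit Gr y) = y),
          (forall a b, gmdom Gr (a, b) ->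
             gsrc Gr (gmul Gr a b) = gsrc Gr a /\
             gtgt Gr (gmul Gr a b) = gtgt Gr b)
        & (forall a, gidom Gr a ->
             gsrc Gr (ginv Gr a) = gtgt Gr a /\
             gtgt Gr (ginv Gr a) = gsrc Gr a)]
    & (forall a, gmul Gr (gunit Gr (gsrc Gr a)) a = a /\
                 gmul Gr a (gunit Gr (gtgt Gr a)) = a)].

Definition local_lie_groupoid A B (Gr : lgroupoid A B) : Prop :=
  [/\ local_groupoid_maps Gr,
      (forall a, gidom Gr a -> gidom Gr (ginv Gr a) /\ ginv Gr (ginv Gr a) = a),
      (forall a, gidom Gr a ->
         (gmdom Gr (a, ginv Gr a) ->
            gmul Gr a (ginv Gr a) = gunit Gr (gsrc Gr a)) /\
         (gmdom Gr (ginv Gr a, a) ->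
            gmul Gr (ginv Gr a) a = gunit Gr (gtgt Gr a)))
    & (forall a b c,
         gmdom Gr (a, b) -> gmdom Gr (gmul Gr a b, c) ->
         gmdom Gr (b, c) -> gmdom Gr (a, gmul Gr b c) ->
         gmul Gr (gmul Gr a b) c = gmul Gr a (gmul Gr b c))].

Definition coisotropic_mul A B (Gr : lgroupoid A B) (bA : bivector A) : Prop :=
  @coisotropic K (prodM (prodM A A) A) (prodB (prodB bA bA) (negB bA))
    [set p | gmdom Gr p.1 /\ p.2 = gmul Gr p.1.1 p.1.2].

Definition local_poisson_groupoid A B (Gr : lgroupoid A B)
    (bA : bivector A) (bB : bivector B) : Prop :=
  [/\ local_lie_groupoid Gr, is_poisson bA /\ is_poisson bB,
      coisotropic_mul Gr bA, poisson_map bA bB (gsrc Gr)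
    & poisson_map bA (negB bB) (gtgt Gr)].

Definition symplectic_groupoid A B (Gr : lgroupoid A B)
    (bA : bivector A) (bB : bivector B) : Prop :=
  [/\ gmdom Gr = composable Gr, gidom Gr = setT, local_poisson_groupoid Gr bA bB
    & forall a, bA a \in unitmx].

Definition restrict_groupoid A B (Gr : lgroupoid A B)
    (W : set (A * A)) (V : set A) : lgroupoid A B :=
  LGroupoid (gsrc Gr) (gtgt Gr) (gunit Gr) (gmul Gr) W (ginv Gr) V.

Definition group_morphism A B (Gr : lgroupoid A B) (H : lieGroup K)
    (mu : A -> H) : Prop :=
  [/\ smooth mu,
      (forall a b, gmdom Gr (a, b) -> mu (gmul Gr a b) = lmul (mu a) (mu b)),
      (forall y, mu (gunit Gr y) = lone H)
    & (forall a, gidom Gr a -> mu (ginv Gr a) = linv (mu a))].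

Definition poisson_group_morphism A B (Gr : lgroupoid A B) (bA : bivector A)
    (H : lieGroup K) (bH : bivector H) (mu : A -> H) : Prop :=
  group_morphism Gr mu /\ poisson_map bA bH mu.

Definition right_action A B X (Gr : lgroupoid A B) (mu : X -> B)
    (act : X -> A -> X) : Prop :=
  [/\ @smooth_on K (prodM X A) X [set p | mu p.1 = gsrc Gr p.2]
        (fun p => act p.1 p.2),
      (forall x a, mu x = gsrc Gr a -> mu (act x a) = gtgt Gr a),
      (forall x, act x (gunit Gr (mu x)) = x)
    & (forall x a b, mu x = gsrc Gr a -> gmdom Gr (a, b) ->
         act (act x a) b = act x (gmul Gr a b))].

Definition poisson_right_action A B X (Gr : lgroupoid A B) (bA : bivector A)
    (bX : bivector X) (mu : X -> B) (act : X -> A -> X) : Prop :=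
  right_action Gr mu act /\
  @coisotropic K (prodM (prodM X A) X) (prodB (prodB bX bA) (negB bX))
    [set p | mu p.1.1 = gsrc Gr p.1.2 /\ p.2 = act p.1.1 p.1.2].

(* Multiplicativity of a partial action of [A] on a local groupoid [X], with
   respect to a partial product [m] on [A] defined on [dm].  The actions
   respect composability; the equation is imposed when both of its sides are
   defined. *)
Definition twisted_multiplicative A B X Y (Xg : lgroupoid X Y) (mu : X -> B)
    (s : A -> B) (act : X -> A -> X) (dm : A -> A -> Prop) (m : A -> A -> A) : Prop :=
  forall x1 x2 c1 c2, gmdom Xg (x1, x2) -> dm c1 c2 ->
    mu x1 = s c1 -> mu x2 = s c2 ->
    composable Xg (act x1 c1, act x2 c2) /\
    (gmdom Xg (act x1 c1, act x2 c2) ->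
       act (gmul Xg x1 x2) (m c1 c2) = gmul Xg (act x1 c1) (act x2 c2)).

(* The domains of the local groupoid [X] are large: they are stable under the
   action, and invertible elements can be multiplied with their inverses.  This
   holds when [X] is a Lie groupoid. *)
Definition stable_domains A B X Y (Xg : lgroupoid X Y) (mu : X -> B)
    (s : A -> B) (act : X -> A -> X) (dm : A -> A -> Prop) : Prop :=
  [/\ (forall x1 x2 c1 c2, gmdom Xg (x1, x2) -> dm c1 c2 ->
         mu x1 = s c1 -> mu x2 = s c2 -> gmdom Xg (act x1 c1, act x2 c2)),
      (forall x c, gidom Xg x -> mu x = s c -> gidom Xg (act x c))
    & (forall x, gidom Xg x ->
         gmdom Xg (x, ginv Xg x) /\ gmdom Xg (ginv Xg x, x))].

End Groupoids.

Section Gamma.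
Variables (K : numFieldType) (G Gs D : lieGroup K).
Variables (jG : lieHom G D) (jGs : lieHom Gs D).

Definition Gamma_eq (g : G) (u u' : Gs) (g' : G) : Prop :=
  lmul (jG g) (jGs u) = lmul (jGs u') (jG g').

Definition Gamma_set : set (G * Gs * Gs * G) :=
  [set x | Gamma_eq x.1.1.1 x.1.1.2 x.1.2 x.2].

(* With the topology induced from G x G* x G* x G. *)
Definition Gamma : topologicalType := set_type Gamma_set.

Definition mkGamma g u u' g' (e : Gamma_eq g u u' g') : Gamma :=
  exist (fun x => x \in Gamma_set) (g, u, u', g') (mem_set e).

Definition Gg (c : Gamma) : G := (sval c).1.1.1.
Definition Gu (c : Gamma) : Gs := (sval c).1.1.2.
Definition Gu' (c : Gamma) : Gs := (sval c).1.2.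
Definition Gg' (c : Gamma) : G := (sval c).2.

Lemma GammaP (c : Gamma) : Gamma_eq (Gg c) (Gu c) (Gu' c) (Gg' c).
Proof. exact: set_mem (svalP c). Qed.

Definition Gp (c : Gamma) : D := lmul (jG (Gg c)) (jGs (Gu c)).
Definition GpL (c : Gamma) : G * Gs := (Gg c, Gu c).
Definition GpR (c : Gamma) : Gs * G := (Gu' c, Gg' c).

Lemma unitG_subproof g : Gamma_eq g (lone Gs) (lone Gs) g.
Proof. by rewrite /Gamma_eq !lhom1 lmulg1 lmul1g. Qed.
Definition Gunit_G (g : G) : Gamma := mkGamma (unitG_subproof g).

Lemma unitGs_subproof u : Gamma_eq (lone G) u u (lone G).
Proof. by rewrite /Gamma_eq !lhom1 lmulg1 lmul1g. Qed.
Definition Gunit_Gs (u : Gs) : Gamma := mkGamma (unitGs_subproof u).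

Lemma invG_subproof (c : Gamma) :
  Gamma_eq (Gg' c) (linv (Gu c)) (linv (Gu' c)) (Gg c).
Proof.
have e := GammaP c; rewrite /Gamma_eq !lhomV.
apply: (@lmulgI _ _ (jGs (Gu' c))).
by rewrite lmulA -e -lmulA !lmulgV lmulg1 lmulA lmulgV lmul1g.
Qed.
Definition Ginv_G (c : Gamma) : Gamma := mkGamma (invG_subproof c).

Lemma invGs_subproof (c : Gamma) :
  Gamma_eq (linv (Gg c)) (Gu' c) (Gu c) (linv (Gg' c)).
Proof.
have e := GammaP c; rewrite /Gamma_eq !lhomV.
apply: (@lmulgI _ _ (jG (Gg c))).
by rewrite [in RHS]lmulA e -lmulA lmulgV lmulg1 lmulA lmulgV lmul1g.
Qed.
Definition Ginv_Gs (c : Gamma) : Gamma := mkGamma (invGs_subproof c).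

Lemma mulG_subproof (c1 c2 : Gamma) : Gg' c1 = Gg c2 ->
  Gamma_eq (Gg c1) (lmul (Gu c1) (Gu c2)) (lmul (Gu' c1) (Gu' c2)) (Gg' c2).
Proof.
move=> e; have e1 := GammaP c1; have e2 := GammaP c2.
rewrite /Gamma_eq !lhomM lmulA e1 -[in RHS]lmulA -e2 -e.
by rewrite lmulA.
Qed.
Definition Gmul_G (c1 c2 : Gamma) : Gamma :=
  if pselect (Gg' c1 = Gg c2) is left e then mkGamma (mulG_subproof e) else c1.

Lemma mulGs_subproof (c1 c2 : Gamma) : Gu' c1 = Gu c2 ->
  Gamma_eq (lmul (Gg c2) (Gg c1)) (Gu c1) (Gu' c2) (lmul (Gg' c2) (Gg' c1)).
Proof.
move=> e; have e1 := GammaP c1; have e2 := GammaP c2.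
by rewrite /Gamma_eq !lhomM -lmulA e1 e lmulA e2 lmulA.
Qed.
Definition Gmul_Gs (c1 c2 : Gamma) : Gamma :=
  if pselect (Gu' c1 = Gu c2) is left e then mkGamma (mulGs_subproof e) else c1.

Variable aGamma : atlas K Gamma.

Definition GammaM : premanifold K := Premanifold aGamma.

Definition Gamma_G : lgroupoid GammaM G :=
  @LGroupoid K GammaM G Gg Gg' Gunit_G Gmul_G
    [set p | Gg' p.1 = Gg p.2] Ginv_G setT.

Definition Gamma_Gs : lgroupoid GammaM Gs :=
  @LGroupoid K GammaM Gs Gu Gu' Gunit_Gs Gmul_Gs
    [set p | Gu' p.1 = Gu p.2] Ginv_Gs setT.

Definition double_symplectic_groupoid (bG : bivector G) (bGs : bivector Gs) n
    (x : 'M[K]_(n, mdim G)) (xi : 'M[K]_(n, mdim Gs)) (bGamma : bivector GammaM) : Prop :=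
  [/\ is_manifold GammaM, @local_diffeo K GammaM (prodM G Gs) GpL,
      (forall c : GammaM,
         push (@jac K GammaM (prodM G Gs) GpL c) (bGamma c) =
         prodB bG bGs (GpL c)
         - \sum_(i < n) wedge (row_mx (left_inv (row i x) (Gg c)) 0)
                              (row_mx 0 (right_inv (row i xi) (Gu c)))),
      symplectic_groupoid Gamma_G bGamma bG
    & symplectic_groupoid Gamma_Gs bGamma bGs].

Definition dressing_domain (O : set Gamma) : Prop :=
  [/\ open O, (forall g, O (Gunit_G g)), (forall u, O (Gunit_Gs u))
    & @diffeo_onto_image K GammaM D O Gp].

Definition maximal_dressing_domain (O : set Gamma) : Prop :=
  dressing_domain O /\
  forall O', dressing_domain O' -> O `<=` O' -> O' = O.

Variable O : set Gamma.

Definition O_GGs : set (G * Gs) := GpL @` O.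
Definition O_GsG : set (Gs * G) := GpR @` O.

(* Outside [O_GGs] and [O_GsG] the values are irrelevant. *)
Definition gammaL (g : G) (u : Gs) : Gamma :=
  xget (Gunit_G (lone G)) [set c | O c /\ GpL c = (g, u)].
Definition gammaR (u' : Gs) (g' : G) : Gamma :=
  xget (Gunit_G (lone G)) [set c | O c /\ GpR c = (u', g')].

Variables (Ym Y Zm Z : manifold K).
Variables (Yg : lgroupoid Ym Y) (Zg : lgroupoid Zm Z).
Variables (muY : Ym -> G) (muZ : Zm -> Gs).
Variables (aY : Ym -> Gamma -> Ym) (aZ : Zm -> Gamma -> Zm).

Definition twisted_multiplicative_Y : Prop :=
  @twisted_multiplicative K GammaM G Ym Y Yg muY Gg aY
    (fun c1 c2 => gmdom Gamma_Gs (c2, c1)) (fun c1 c2 => Gmul_Gs c2 c1).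

Definition twisted_multiplicative_Z : Prop :=
  @twisted_multiplicative K GammaM Gs Zm Z Zg muZ Gu aZ
    (fun c1 c2 => gmdom Gamma_G (c1, c2)) Gmul_G.

Definition stable_domains_Y : Prop :=
  @stable_domains K GammaM G Ym Y Yg muY Gg aY
    (fun c1 c2 => gmdom Gamma_Gs (c2, c1)).

Definition stable_domains_Z : Prop :=
  @stable_domains K GammaM Gs Zm Z Zg muZ Gu aZ
    (fun c1 c2 => gmdom Gamma_G (c1, c2)).

Variables (rho : Y -> Gs -> Y) (theta : G -> Z -> Z).

Definition induced_action_Y : Prop :=
  forall y u, gunit Yg (rho y u) = aY (gunit Yg y) (Gunit_Gs u).

Definition induced_action_Z : Prop :=
  forall g z, gunit Zg (theta g z) = aZ (gunit Zg z) (Gunit_G g).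

(* The derivative at t = 0 of [rho y (exp (t xi))], and of
   [theta (exp (t x)) z]. *)
Definition inf_rho (xi : 'rV[K]_(mdim Gs)) : vfield Y :=
  fun y => xi *m jac (rho y) (lone Gs).
Definition inf_theta (x : 'rV[K]_(mdim G)) : vfield Z :=
  fun z => x *m jac (theta^~ z) (lone G).

Definition mixed_product n (x : 'M[K]_(n, mdim G)) (xi : 'M[K]_(n, mdim Gs))
    (bY : bivector Y) (bZ : bivector Z) : bivector (prodM Y Z) :=
  fun p => prodB bY bZ p
    - \sum_(i < n) wedge (row_mx (inf_rho (row i xi) p.1) 0)
                         (row_mx 0 (inf_theta (row i x) p.2)).

Definition ltimesY (c : Gamma) (y : Ym) : Ym := aY y (Ginv_G c).
Definition ltimesZ (c : Gamma) (z : Zm) : Zm := aZ z (Ginv_Gs c).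

Definition O_ZY : set (Zm * Ym) := [set p | O_GsG (muZ p.1, muY p.2)].
Definition O21_ZY : set (Zm * Ym) := [set p | O_GGs (muY p.2, muZ p.1)].

Definition R_L (p : Zm * Ym) : Zm * Ym :=
  let c := gammaL (muY p.2) (muZ p.1) in (aZ p.1 c, aY p.2 c).

Definition YL_src (p : Ym * Zm) : Y * Z :=
  (gsrc Yg p.1, theta (muY p.1) (gsrc Zg p.2)).

Definition YL_tgt (p : Ym * Zm) : Y * Z :=
  (rho (gtgt Yg p.1) (muZ p.2), gtgt Zg p.2).

Definition YL_unit (p : Y * Z) : Ym * Zm := (gunit Yg p.1, gunit Zg p.2).

Definition YL_mul (p q : Ym * Zm) : Ym * Zm :=
  let c := gammaR (muZ p.2) (muY q.1) in
  (gmul Yg p.1 (ltimesY c q.1), gmul Zg (ltimesZ c p.2) q.2).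

Definition YL_mdom : set ((Ym * Zm) * (Ym * Zm)) :=
  [set pq | let p := pq.1 in let q := pq.2 in
     let c := gammaR (muZ p.2) (muY q.1) in
     [/\ YL_tgt p = YL_src q, O_ZY (p.2, q.1),
         gmdom Yg (p.1, ltimesY c q.1) & gmdom Zg (ltimesZ c p.2, q.2)]].

Definition YL_inv (p : Ym * Zm) : Ym * Zm :=
  let c := gammaL (muY p.1) (muZ p.2) in
  (ginv Yg (aY p.1 c), ginv Zg (aZ p.2 c)).

Definition YL_idom : set (Ym * Zm) :=
  [set p | O21_ZY (p.2, p.1) /\
     (O_ZY `&` (gidom Zg `*` gidom Yg)) (R_L (p.2, p.1))].

Definition product_L : lgroupoid (prodM Ym Zm) (prodM Y Z) :=
  @LGroupoid K (prodM Ym Zm) (prodM Y Z)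
    YL_src YL_tgt YL_unit YL_mul YL_mdom YL_inv YL_idom.

Definition mu_L (p : Ym * Zm) : D := lmul (jG (muY p.1)) (jGs (muZ p.2)).

End Gamma.

(* The maps of [Gr], on their given domains, have all the properties of a local
   Poisson groupoid which do not involve three-fold products or the cancellation
   of inverses; these last ones hold after shrinking the domains to smaller
   neighbourhoods of the units. *)
Definition determines_local_poisson_groupoid (K : numFieldType)
    (A B : premanifold K) (Gr : lgroupoid A B)
    (bA : bivector A) (bB : bivector B) : Prop :=
  [/\ local_groupoid_maps Gr, coisotropic_mul Gr bA
    & exists W V, [/\ W `<=` gmdom Gr, V `<=` gidom Gr
        & local_poisson_groupoid (restrict_groupoid Gr W V) bA bB]].

(* Main.v *)
(* The product is read off from the double groupoid: to compose [(y1, z1)] with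
   [(y2, z2)] one lets [c] in [Gamma], with [mu z1] and [mu y2] on two of its
   sides, act on [y2] and [z1], which exchanges the two middle factors, and
   multiplies in [Ym] and [Zm].

   Twisted multiplicativity applied to units shows that the actions on [Ym] and
   [Zm] move sources and targets by [rho] and [theta]; applied to the square
   completing two exchanges it gives associativity, as soon as the two middle
   factors can be multiplied.  That holds near the degenerate triples, and the
   domain of the product is shrunk, with the help of a metric, so that it always
   holds.

   A function vanishing on the graph of the product pulls back, in terms of the
   exchanged factors, to one vanishing on a fibre product of submersions; by
   Lyusternik's theorem its differential is then a combination of those of the
   defining equations.  The conormals of the four graphs of the two products and
   of the two actions which arise in this way cancel in pairs.

   Source and target are Poisson because the coisotropic graphs of the actions,
   taken at units of the double groupoid, determine the brackets of [mu y] with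
   the source of [y] and of [mu z] with the target of [z]. *)

Require Import Defs.
From mathcomp Require Import all_boot all_order all_algebra.
From mathcomp Require Import complex.
From mathcomp Require Import all_classical all_reals all_analysis.
From mathcomp Require Import ring lra.
(* Again, so that [coord] is the one of [Defs] and not that of [vector]. *)
Require Import Defs.

Set Implicit Arguments.
Unset Strict Implicit.
Unset Printing Implicit Defensive.

Import Order.TTheory GRing.Theory Num.Theory.
Import numFieldNormedType.Exports.

Local Open Scope classical_set_scope.
Local Open Scope ring_scope.

(** * Differential calculus in coordinates *)

(** Two features of the definitions shape the proof. Coisotropy is tested on all germs vanishing on
    a graph, so for the new product one must know that the differential of such a germ lies in the
    span of explicit equations; hence a theorem on level sets, valid for real and complex scalars
    alike. And tangent spaces are read in a chart that changes with the point, so iterated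
    derivatives are first transported to one fixed chart. The maximality of [O] enters through one
    symmetry: [O] is stable under inversion in both groupoid structures, which exchanges the two
    projections of [Gamma]. This carries the smoothness of [gammaL], which comes from the local
    diffeomorphism [GpL], to [gammaR], and it supplies the dressing element of an inverse.
    Associativity needs a product of middle factors that none of the four given products provides.
    It exists near each degenerate triple, but the size of the neighbourhood varies from point to
    point, hence the metric and the variable radius. *)

Lemma near_eq_continuous (S T : topologicalType) (f g : S -> T) x :
  {near x, f =1 g} -> {for x, continuous f} -> {for x, continuous g}.
Proof.
move=> fg cf; have e := nbhs_singleton fg.
have {cf} : f @ x --> f x by exact: cf.
rewrite e => cf; apply: (cvg_trans _ cf); apply: near_eq_cvg.
exact: filterS fg => y.
Qed.

Section Differentials.
Context {K : numFieldType} {V W : normedModType K}.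

Lemma near_eq_differentiable (f g : V -> W) a :
  {near a, f =1 g} -> differentiable f a -> differentiable g a.
Proof.
move=> fg fa; have e := nbhs_singleton fg.
have dfc : continuous ('d f a) by exact: diff_continuous.
have h : g \o shift a = cst (g a) + 'd f a +o_ 0 id.
  apply/eqaddoP => eps e0.
  have := diff_locally fa => /eqaddoP /(_ eps e0) /= hf.
  near=> y.
  have -> : (g \o shift a - (cst (g a) + 'd f a)) y =
            (f \o shift a - (cst (f a) + 'd f a)) y.
    rewrite !fctE /= -e; congr (_ - _).
    by apply/esym; near: y; move: (fg); rewrite (near_shift 0) subr0.
  by near: y.
apply/diff_locallyP; split; last by rewrite (diff_unique dfc h).
by have -> : ('d g a : V -> W) = 'd f a by exact: diff_unique h.
Unshelve. all: by end_near. Qed.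

Lemma differentiable_eps (f : V -> W) a : differentiable f a ->
  forall e, 0 < e ->
  \forall y \near a, `|f y - f a - 'd f a (y - a)| <= e * `|y - a|.
Proof.
move=> /diff_locally /eqaddoP fa e e0; have := fa e e0 => /= h.
rewrite (near_shift 0 a) /=; near=> y.
rewrite /= subr0 addrK -addrA -opprD.
have -> : f (y + a) - (f a + 'd f a y) =
  (f \o shift a - (cst (f a) + 'd f a)) y by [].
by near: y.
Unshelve. all: by end_near. Qed.

End Differentials.

Section Partials.
Variable K : numFieldType.

Lemma row_sum_e n (v : 'rV[K]_n) : v = \sum_i v 0 i *: delta_mx 0 i.
Proof. exact: row_sum_delta. Qed.

Lemma derive_partials n (f : 'rV[K]_n -> K) x v : differentiable f x ->
  'D_v f x = \sum_i v 0 i * 'D_(delta_mx 0 i) f x.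
Proof.
move=> fx; rewrite deriveE// [in LHS](row_sum_e v) linear_sum.
by apply: eq_bigr => i _; rewrite linearZ deriveE.
Qed.

Lemma differentiable_rowP m n (F : 'rV[K]_m -> 'rV[K]_n) x :
  (forall j, differentiable (fun y => F y 0 j) x) -> differentiable F x.
Proof.
move=> h.
have -> : F = \sum_(j < n) (fun y => F y 0 j *: delta_mx 0 j).
  by apply/funext => y; rewrite fct_sumE; exact: row_sum_e.
apply: differentiable_sum => j; exact: differentiableZl.
Qed.

Lemma differentiable_entry m n (F : 'rV[K]_m -> 'rV[K]_n) x j :
  differentiable F x -> differentiable (fun y => F y 0 j) x.
Proof.
move=> Fx; apply: (@differentiable_comp _ _ _ _ F (fun M : 'rV_n => M 0 j)) => //.
exact: differentiable_coord.
Qed.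

Lemma continuous_rowP (T : topologicalType) n (F : T -> 'rV[K]_n) x :
  (forall j, {for x, continuous (fun y => F y 0 j)}) -> {for x, continuous F}.
Proof.
move=> h A [P Pn PA].
have : \forall y \near x, forall j, P 0 j (F y 0 j).
  by apply: filter_forall => j; exact: (h j _ (Pn 0 j)).
by apply: filterS => y Py; apply: PA => i j; rewrite ord1.
Qed.

Lemma derive_entry m n (F : 'rV[K]_m -> 'rV[K]_n) x v j : differentiable F x ->
  'D_v (fun y => F y 0 j) x = ('D_v F x) 0 j.
Proof.
move=> Fx; rewrite !deriveE//; last exact: differentiable_entry.
have -> : (fun y => F y 0 j) = (fun M : 'rV[K]_n => M 0 j) \o F by [].
rewrite diff_comp//; last exact: differentiable_coord.
rewrite /=.
(* The entry map is repackaged as a linear map, so that it is its own differential. *)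
have @g : {linear 'rV[K]_n -> K}.
  by exists (fun N : 'rV[K]_n => N 0 j); do 2![eexists]; do ?[constructor];
     rewrite ?mxE// => ? *; rewrite ?mxE//; move=> ?; rewrite !mxE.
have -> : (fun M : 'rV[K]_n => M 0 j) = g by [].
by rewrite diff_lin//; exact: coord_continuous.
Qed.

Lemma derive_comp_row m n (F : 'rV[K]_m -> 'rV[K]_n) (h : 'rV[K]_n -> K) x v :
  (forall j, differentiable (fun y => F y 0 j) x) -> differentiable h (F x) ->
  'D_v (h \o F) x =
    \sum_j 'D_v (fun y => F y 0 j) x * 'D_(delta_mx 0 j) h (F x).
Proof.
move=> dF dh; have Fx := differentiable_rowP dF.
rewrite deriveE; last exact: differentiable_comp.
rewrite diff_comp//= -!deriveE// derive_partials//.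
by apply: eq_bigr => j _; rewrite derive_entry// deriveE.
Qed.

End Partials.

Section CkTheory.
Variable K : numFieldType.

Lemma Ck_eq k n (U : set 'rV[K]_n) f g : open U ->
  (forall x, U x -> f x = g x) -> Ck k U f -> Ck k U g.
Proof.
elim: k f g => [|k IH] f g oU fg /=.
  move=> cf x Ux; have nfg : {near x, f =1 g}.
    by near=> y; apply: fg; near: y; exact: open_nbhs_nbhs.
  exact: near_eq_continuous nfg (cf _ Ux).
have nfg x : U x -> {near x, f =1 g}.
  move=> Ux; near=> y; apply: fg; near: y; exact: open_nbhs_nbhs.
move=> [df Df]; split=> [x Ux|v].
  exact: near_eq_differentiable (nfg x Ux) (df x Ux).
by apply: IH (Df v) => // x Ux; apply: near_eq_derive; exact: nfg.
Unshelve. all: by end_near. Qed.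

Lemma Ck_sub k n (U V : set 'rV[K]_n) f : V `<=` U -> Ck k U f -> Ck k V f.
Proof.
elim: k f => [|k IH] f VU /=; first by move=> cf x /VU; exact: cf.
by move=> [df Df]; split=> [x /VU|v]; [exact: df | exact: IH].
Qed.

Lemma Ck_pred k n (U : set 'rV[K]_n) f : Ck k.+1 U f -> Ck k U f.
Proof.
elim: k f => [|k IH] f.
  by move=> [df _] x Ux; apply: differentiable_continuous; exact: df.
by move=> [df Df]; split=> // v; apply: IH.
Qed.

Lemma Ck_cst k n (U : set 'rV[K]_n) c : Ck k U (fun=> c).
Proof.
elim: k c => [|k IH] c /=; first by move=> x _; exact: cst_continuous.
split=> [x _|v]; first exact: differentiable_cst.
have -> : (fun x : 'rV[K]_n => 'D_v (fun=> c) x) = (fun=> 0).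
  by apply/funext => x; exact: derive_cst.
exact: IH.
Qed.

Lemma CkD k n (U : set 'rV[K]_n) f g : open U ->
  Ck k U f -> Ck k U g -> Ck k U (fun x => f x + g x).
Proof.
elim: k f g => [|k IH] f g oU.
  by move=> cf cg x Ux; apply: continuousD; [exact: cf | exact: cg].
move=> [df Df] [dg Dg]; split=> [x Ux|v].
  by apply: differentiableD; [exact: df | exact: dg].
apply: (@Ck_eq _ _ _ (fun x => 'D_v f x + 'D_v g x)) => //; last exact: (IH _ _ oU (Df v) (Dg v)).
by move=> x Ux; rewrite deriveD//; apply: diff_derivable; auto.
Qed.

Lemma CkM k n (U : set 'rV[K]_n) f g : open U ->
  Ck k U f -> Ck k U g -> Ck k U (fun x => f x * g x).
Proof.
elim: k f g => [|k IH] f g oU.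
  by move=> cf cg x Ux; apply: continuousM; [exact: cf | exact: cg].
move=> hf hg; have [df Df] := hf; have [dg Dg] := hg; split=> [x Ux|v].
  by apply: differentiableM; [exact: df | exact: dg].
apply: (@Ck_eq _ _ _ (fun x => f x * 'D_v g x + g x * 'D_v f x)) => //.
  by move=> x Ux; rewrite deriveM//; apply: diff_derivable; auto.
apply: CkD => //.
  exact: (IH _ _ oU (Ck_pred hf) (Dg v)).
exact: (IH _ _ oU (Ck_pred hg) (Df v)).
Qed.

Lemma Ck_sum k n (U : set 'rV[K]_n) m (f : 'I_m -> 'rV[K]_n -> K) : open U ->
  (forall i, Ck k U (f i)) -> Ck k U (fun x => \sum_i f i x).
Proof.
move=> oU h; rewrite (_ : (fun x => _) = \sum_i f i); last first.
  by apply/funext => x; rewrite fct_sumE.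
elim/big_ind : _ => //; first exact: Ck_cst.
by move=> a b ha hb; exact: CkD.
Qed.

(** The chain rule writes a derivative of the composite as a sum of products, each made of a
    derivative of [F] and of a derivative of [h] composed with [F]. The induction hypothesis applies
    to the latter once [Ck_pred] has lowered the class of [F]. *)
Lemma Ck_comp k m n (U : set 'rV[K]_m) (V : set 'rV[K]_n)
    (F : 'rV[K]_m -> 'rV[K]_n) h :
  open U -> open V -> (forall j, Ck k U (fun x => F x 0 j)) ->
  (forall x, U x -> V (F x)) -> Ck k V h -> Ck k U (h \o F).
Proof.
elim: k h => [|k IH] h oU oV hF FV hh.
  move=> x Ux; apply: continuous_comp; last exact/hh/FV.
  by apply: continuous_rowP => j; exact: hF.
have dh y : V y -> differentiable h y by move=> Vy; case: hh => + _; exact.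
have dF j x : U x -> differentiable (fun x => F x 0 j) x.
  by move=> Ux; case: (hF j) => + _; exact.
split=> [x Ux|v].
  apply: differentiable_comp; last exact/dh/FV.
  by apply: differentiable_rowP => j; exact: dF.
apply: (@Ck_eq _ _ _ (fun x => \sum_j 'D_v (fun x => F x 0 j) x *
                               'D_(delta_mx 0 j) h (F x))) => //.
  move=> x Ux; rewrite derive_comp_row// => [j|]; first exact: dF.
  exact/dh/FV.
apply: Ck_sum => // j; apply: CkM => //.
  by have [_ D] := hF j; exact: (D v).
have [_ D] := hh.
exact: (IH _ oU oV (fun i => Ck_pred (hF i)) FV (D _)).
Qed.

Lemma Ck_coord k n (U : set 'rV[K]_n) j : Ck k U (fun x => x 0 j).
Proof.
case: k => [|k]; first by move=> x _; exact: coord_continuous.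
split=> [x _|v]; first exact: differentiable_coord.
have -> : 'D_v (fun y : 'rV[K]_n => y 0 j) = (fun=> v 0 j).
  by apply/funext => x; rewrite (derive_entry (F := id)) ?derive_id.
exact: Ck_cst.
Qed.

End CkTheory.

(** * Calculus on manifolds *)

Lemma near_open (T : topologicalType) (x : T) (P : T -> Prop) :
  (\forall y \near x, P y) -> exists V, [/\ open V, V x & forall y, V y -> P y].
Proof.
move=> h; exists (interior [set y | P y]); split=> //.
  exact: open_interior.
by move=> y /interior_subset.
Qed.

Section ManifoldCalculus.
Variable K : numFieldType.
Implicit Types M N P : premanifold K.

(** The chart axioms of [is_manifold] alone. Local calculus rests on these, so they are all that has
    to be verified for products and for [euclid]. *)
Definition charted M : Prop :=
  [/\ (forall p : M, open (cdom p) /\ cdom p p),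
      (forall p : M, open (chart p @` cdom p)),
      (forall p q : M, cdom p q ->
         cinv p (chart p q) = q /\ {for q, continuous (chart p)}),
      (forall (p : M) x, (chart p @` cdom p) x -> {for x, continuous (cinv p)})
    & (forall (p q : M) k j,
         Ck k (chart p @` (cdom p `&` cdom q))
              (fun x => chart q (cinv p x) 0 j))].

Lemma manifold_charted M : is_manifold M -> charted M.
Proof. by case. Qed.

Lemma nbhs_cdom M (p q : M) : charted M -> cdom p q ->
  \forall q' \near q, cdom p q'.
Proof. by move=> [h _ _ _ _] pq; apply: open_nbhs_nbhs; split=> //; case: (h p). Qed.

Lemma cdom_refl M (p : M) : charted M -> cdom p p.
Proof. by move=> [h _ _ _ _]; case: (h p). Qed.

Lemma chartK M (p q : M) : charted M -> cdom p q -> cinv p (chart p q) = q.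
Proof. by move=> [_ _ h _ _] /h[]. Qed.

Lemma chart_continuous M (p q : M) : charted M -> cdom p q ->
  {for q, continuous (chart p)}.
Proof. by move=> [_ _ h _ _] /h[]. Qed.

Lemma cinv_continuous M (p q : M) : charted M -> cdom p q ->
  {for chart p q, continuous (cinv p)}.
Proof. by move=> [_ _ _ h _] pq; apply: h; exists q. Qed.

Lemma near_cinv M (p q : M) (A : set M) : charted M -> cdom p q ->
  (\forall q' \near q, A q') -> \forall x \near chart p q, A (cinv p x).
Proof.
move=> cM pq Aq; have := cinv_continuous cM pq; apply.
by rewrite /= chartK.
Qed.

Lemma near_chart_image M (p q : M) : charted M -> cdom p q ->
  \forall x \near chart p q, (chart p @` cdom p) x.
Proof.
move=> [_ h _ _ _] pq; apply: open_nbhs_nbhs; split; first exact: h.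
by exists q.
Qed.

Lemma cinvK M (p : M) x : charted M -> (chart p @` cdom p) x ->
  chart p (cinv p x) = x /\ cdom p (cinv p x).
Proof. by move=> cM [q pq <-]; rewrite chartK. Qed.

Definition dgrad M (f : M -> K) (p : M) : 'cV[K]_(mdim M) :=
  \col_i pd f p (delta_mx 0 i).

Definition mdiff M (f : M -> K) (p : M) : Prop :=
  differentiable (f \o cinv p) (chart p p).

Lemma smoothf_mdiff M (f : M -> K) p : smoothf_at f p -> mdiff f p.
Proof. by move=> [U [oU Up h]]; case: (h 1%N) => + _; exact. Qed.

Lemma pd_dgrad M (f : M -> K) p v : mdiff f p -> pd f p v = (v *m dgrad f p) 0 0.
Proof.
move=> fp; rewrite /pd derive_partials// mxE.
by apply: eq_bigr => i _; rewrite mxE.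
Qed.

Lemma near_eq_cinv M (f g : M -> K) p : charted M ->
  {near p, f =1 g} -> {near chart p p, f \o cinv p =1 g \o cinv p}.
Proof.
move=> cM fg.
have := @near_cinv M p p [set q | f q = g q] cM (cdom_refl p cM) fg.
exact: filterS.
Qed.

Lemma dgrad_near M (f g : M -> K) p : charted M -> {near p, f =1 g} ->
  dgrad f p = dgrad g p.
Proof.
move=> cM fg; apply/colP => i; rewrite !mxE; apply: near_eq_derive.
exact: near_eq_cinv.
Qed.

Lemma bracketE M (b : bivector M) (f g : M -> K) p :
  bracket b f g p = ((dgrad f p)^T *m b p *m dgrad g p) 0 0.
Proof.
rewrite /bracket mxE exchange_big/=; apply: eq_bigr => j _.
rewrite !mxE big_distrl/=; apply: eq_bigr => i _.
by rewrite !mxE [b p i j * _]mulrC.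
Qed.

Lemma bracket_near M (b : bivector M) (f f' g g' : M -> K) p : charted M ->
  {near p, f =1 f'} -> {near p, g =1 g'} -> bracket b f g p = bracket b f' g' p.
Proof.
by move=> cM ff' gg'; rewrite !bracketE (dgrad_near cM ff') (dgrad_near cM gg').
Qed.

Lemma jacE M N (f : M -> N) p i j :
  jac f p i j = dgrad (coord (f p) j \o f) p i 0.
Proof. by rewrite !mxE. Qed.

Lemma col_jac M N (f : M -> N) p j : col j (jac f p) = dgrad (coord (f p) j \o f) p.
Proof. by apply/colP => i; rewrite !mxE. Qed.

Lemma smoothf_near M (f g : M -> K) p : charted M ->
  {near p, f =1 g} -> smoothf_at f p -> smoothf_at g p.
Proof.
move=> cM fg [U [oU Up h]]; have /near_open[V [oV Vp VE]] := near_eq_cinv cM fg.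
exists (U `&` V); split=> //.
  exact: openI.
move=> k; apply: (@Ck_eq _ _ _ _ (f \o cinv p)); first exact: openI.
  by move=> x [_ /VE].
by apply: (Ck_sub _ (h k)) => x [].
Qed.

Lemma smooth_at_near M N (f g : M -> N) p : charted M ->
  {near p, f =1 g} -> smooth_at f p -> smooth_at g p.
Proof.
move=> cM fg [cf hf]; split; first exact: near_eq_continuous cf.
move=> j; apply: (smoothf_near cM) (hf j).
rewrite /coord /= -(nbhs_singleton fg).
by apply: filterS fg => q /= ->.
Qed.

Lemma jac_near M N (f g : M -> N) p : charted M ->
  {near p, f =1 g} -> jac f p = jac g p.
Proof.
move=> cM fg; apply/matrixP => i j; rewrite !jacE (nbhs_singleton fg).
by rewrite (dgrad_near (g := coord (g p) j \o g) cM)//; apply: filterS fg => q /= ->.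
Qed.

Lemma smooth_at_chart M N (f : M -> N) p : charted M -> charted N ->
  smooth_at f p -> {for chart p p, continuous (fun x => chart (f p) (f (cinv p x)))}
  /\ \forall x \near chart p p, cdom (f p) (f (cinv p x)).
Proof.
move=> cM cN [cf _].
have c1 : {for chart p p, continuous (f \o cinv p)}.
  apply: continuous_comp; first exact/(cinv_continuous cM)/cdom_refl.
  by rewrite chartK//; exact: cdom_refl.
have e : f (cinv p (chart p p)) = f p by rewrite chartK//; exact: cdom_refl.
split.
  apply: (@continuous_comp _ _ _ (f \o cinv p) (chart (f p))) => //=.
  by rewrite e; apply: chart_continuous => //; exact: cdom_refl.
apply: c1; rewrite /= e; apply: nbhs_cdom => //; exact: cdom_refl.
Qed.

Lemma smoothf_comp M N (f : M -> N) (h : N -> K) p : charted M -> charted N ->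
  smooth_at f p -> smoothf_at h (f p) -> smoothf_at (h \o f) p.
Proof.
move=> cM cN sf [V [oV Vp hV]].
have [cF dF] := smooth_at_chart cM cN sf.
have [cf hf] := sf.
have [U hU] := choice hf.
pose F x := chart (f p) (f (cinv p x)).
have e : F (chart p p) = chart (f p) (f p).
  by rewrite /F chartK//; exact: cdom_refl.
(* Smoothness of [f] gives one open set for each coordinate. Their finite intersection is cut down
   further, so that [f] stays in the chart at [f p] and in the domain of [h]. *)
pose A := [set x | [/\ forall j, U j x, cdom (f p) (f (cinv p x)) & V (F x)]].
have nA : nbhs (chart p p) A.
  near=> x; split; last 2 first.
  - by near: x.
  - by near: x; apply: cF; rewrite /= -/(F _) e; exact: open_nbhs_nbhs.
  - near: x; apply: filter_forall => j; apply: open_nbhs_nbhs.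
    by have [] := hU j.
exists (interior A); split=> //; first exact: open_interior.
move=> k; apply: (@Ck_eq _ _ _ _ ((h \o cinv (f p)) \o F)).
- exact: open_interior.
- by move=> x /interior_subset [_ d _] /=; rewrite /F chartK.
- apply: (Ck_comp (V := V)) => //; first exact: open_interior.
    move=> j; have [_ _ hk] := hU j; apply: (Ck_sub _ (hk k)).
    by move=> x /interior_subset[].
  by move=> x /interior_subset[].
Unshelve. all: by end_near. Qed.

Lemma smooth_at_comp M N P (f : M -> N) (g : N -> P) p : charted M -> charted N ->
  smooth_at f p -> smooth_at g (f p) -> smooth_at (g \o f) p.
Proof.
move=> cM cN sf [cg hg]; split.
  by apply: continuous_comp => //; case: sf.
by move=> j; exact: smoothf_comp (hg j).
Qed.

Lemma dgrad_comp M N (f : M -> N) (h : N -> K) p : charted M -> charted N ->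
  smooth_at f p -> mdiff h (f p) -> dgrad (h \o f) p = jac f p *m dgrad h (f p).
Proof.
move=> cM cN sf hd; have [cF dF] := smooth_at_chart cM cN sf.
have e : f (cinv p (chart p p)) = f p by rewrite chartK//; exact: cdom_refl.
apply/colP => i; rewrite !mxE.
pose F x := chart (f p) (f (cinv p x)).
rewrite /pd (@near_eq_derive _ _ _ _ ((h \o cinv (f p)) \o F)); last first.
  by apply: filterS dF => x d /=; rewrite /F chartK.
rewrite derive_comp_row.
- by apply: eq_bigr => j _; rewrite !mxE /F e.
- by move=> j; case: sf => _ /(_ j) /smoothf_mdiff.
- by rewrite /F e.
Qed.

Lemma jac_comp M N P (f : M -> N) (g : N -> P) p : charted M -> charted N ->
  smooth_at f p -> smooth_at g (f p) -> jac (g \o f) p = jac f p *m jac g (f p).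
Proof.
move=> cM cN sf [_ hg]; apply/matrixP => i j; rewrite jacE.
rewrite -[_ \o (g \o f)]/((coord (g (f p)) j \o g) \o f) dgrad_comp//.
  by rewrite -col_jac colE mulmxA -colE mxE.
exact: smoothf_mdiff.
Qed.

End ManifoldCalculus.

(** * Products of manifolds, and charts as smooth maps *)

Section Products.
Variable K : numFieldType.
Implicit Types M N P : premanifold K.

Lemma row_mx_continuous (T : topologicalType) m n (f : T -> 'rV[K]_m)
    (g : T -> 'rV[K]_n) x :
  {for x, continuous f} -> {for x, continuous g} ->
  {for x, continuous (fun y => row_mx (f y) (g y))}.
Proof.
move=> cf cg; apply: continuous_rowP => j; case: (split_ordP j) => k ->.
  rewrite (_ : (fun y => _) = (fun v : 'rV[K]_m => v 0 k) \o f); last first.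
    by apply/funext => y; rewrite /= row_mxEl.
  by apply: continuous_comp => //; exact: coord_continuous.
rewrite (_ : (fun y => _) = (fun v : 'rV[K]_n => v 0 k) \o g); last first.
  by apply/funext => y; rewrite /= row_mxEr.
by apply: continuous_comp => //; exact: coord_continuous.
Qed.

Lemma pair_continuous (S T T' : topologicalType) (f : S -> T) (g : S -> T') x :
  {for x, continuous f} -> {for x, continuous g} ->
  {for x, continuous (fun y => (f y, g y))}.
Proof. by move=> cf cg; apply: cvg_pair; [exact: cf | exact: cg]. Qed.

Lemma prod_chartE M N (p q : prodM M N) :
  chart p q = row_mx (chart p.1 q.1) (chart p.2 q.2).
Proof. by []. Qed.

Lemma prod_imageE M N (p : prodM M N) x :
  (chart p @` cdom p) x <->
  (chart p.1 @` cdom p.1) (lsubmx x) /\ (chart p.2 @` cdom p.2) (rsubmx x).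
Proof.
split.
  move=> [q [q1 q2] <-]; rewrite row_mxKl row_mxKr.
  by split; [exists q.1 | exists q.2].
move=> [[q1 c1 e1] [q2 c2 e2]]; exists (q1, q2) => //.
by rewrite prod_chartE /= e1 e2 hsubmxK.
Qed.

Lemma charted_prod M N : charted M -> charted N -> charted (prodM M N).
Proof.
move=> cM cN; have [M1 M2 M3 M4 M5] := cM; have [N1 N2 N3 N4 N5] := cN.
split.
- move=> p; split; last by split; exact: cdom_refl.
  have -> : cdom p = fst @^-1` cdom p.1 `&` snd @^-1` cdom p.2 by [].
  apply: openI; apply: open_comp => [x _|].
  - exact: cvg_fst.
  - by case: (M1 p.1).
  - exact: cvg_snd.
  - by case: (N1 p.2).
- move=> p.
  have -> : chart p @` cdom p = lsubmx @^-1` (chart p.1 @` cdom p.1) `&`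
                                rsubmx @^-1` (chart p.2 @` cdom p.2).
    by apply/seteqP; split=> x /prod_imageE.
  apply: openI; apply: open_comp => // x _.
    exact: continuous_lsubmx.
  exact: continuous_rsubmx.
- move=> p q [q1 q2]; split.
    rewrite /cinv /chart /= row_mxKl row_mxKr.
    rewrite [X in (X, _)](chartK cM q1) [X in (_, X)](chartK cN q2).
    by case: (q).
  apply: row_mx_continuous.
    apply: (@continuous_comp _ _ _ fst (chart p.1)); first exact: cvg_fst.
    exact: chart_continuous.
  apply: (@continuous_comp _ _ _ snd (chart p.2)); first exact: cvg_snd.
  exact: chart_continuous.
- move=> p x /prod_imageE[x1 x2]; apply: pair_continuous.
    apply: (@continuous_comp _ _ _ lsubmx (cinv p.1)).
      exact: continuous_lsubmx.
    exact: M4.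
  apply: (@continuous_comp _ _ _ rsubmx (cinv p.2)).
    exact: continuous_rsubmx.
  exact: N4.
- move=> p q k j.
  have opn M' (a b : M') : charted M' -> open (chart a @` (cdom a `&` cdom b)).
    move=> cM'; rewrite openE => _ [c [ac bc] <-]; rewrite /interior.
    have h := near_cinv cM' ac (nbhs_cdom cM' bc).
    near=> y; have [ye yd] : chart a (cinv a y) = y /\ cdom a (cinv a y).
      by apply: cinvK => //; near: y; exact: near_chart_image.
    by exists (cinv a y) => //; split=> //; near: y.
  have oU : open (chart p @` (cdom p `&` cdom q)).
    have -> : chart p @` (cdom p `&` cdom q) =
        lsubmx @^-1` (chart p.1 @` (cdom p.1 `&` cdom q.1)) `&`
        rsubmx @^-1` (chart p.2 @` (cdom p.2 `&` cdom q.2)).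
      apply/seteqP; split=> x.
        move=> [r [[a1 a2] [b1 b2]] <-]; split; rewrite /= ?row_mxKl ?row_mxKr.
          by exists r.1.
        by exists r.2.
      move=> [[r1 [a1 b1] e1] [r2 [a2 b2] e2]]; exists (r1, r2) => //.
      by rewrite prod_chartE /= e1 e2 hsubmxK.
    apply: openI; apply: open_comp => [x _|]; try exact: opn.
      exact: continuous_lsubmx.
    exact: continuous_rsubmx.
  case: (split_ordP j) => i ->.
    apply: (@Ck_eq _ _ _ _ ((fun y => chart q.1 (cinv p.1 y) 0 i) \o lsubmx)) => //.
      by move=> x _; rewrite /= [RHS]row_mxEl.
    apply: (Ck_comp (V := chart p.1 @` (cdom p.1 `&` cdom q.1))) => //.
    - exact: opn.
    - move=> l; apply: (@Ck_eq _ _ _ _ (fun x => x 0 (lshift _ l))) => //.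
        by move=> x _; rewrite mxE.
      exact: Ck_coord.
    - move=> _ [r [[a1 a2] [b1 b2]] <-]; rewrite row_mxKl; by exists r.1.
  apply: (@Ck_eq _ _ _ _ ((fun y => chart q.2 (cinv p.2 y) 0 i) \o rsubmx)) => //.
    by move=> x _; rewrite /= [RHS]row_mxEr.
  apply: (Ck_comp (V := chart p.2 @` (cdom p.2 `&` cdom q.2))) => //.
  - exact: opn.
  - move=> l; apply: (@Ck_eq _ _ _ _ (fun x => x 0 (rshift _ l))) => //.
      by move=> x _; rewrite mxE.
    exact: Ck_coord.
  - move=> _ [r [[a1 a2] [b1 b2]] <-]; rewrite row_mxKr; by exists r.2.
Unshelve. all: by end_near. Qed.

Lemma smooth_at_pair M N P (f : M -> N) (g : M -> P) p :
  smooth_at f p -> smooth_at g p ->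
  @smooth_at K M (prodM N P) (fun x => (f x, g x)) p.
Proof.
move=> [cf hf] [cg hg]; split; first exact: pair_continuous.
move=> j; case: (split_ordP j) => i ->.
  rewrite (_ : _ \o _ = coord (f p) i \o f)//.
  by apply/funext => x; rewrite /= /coord [LHS]row_mxEl.
rewrite (_ : _ \o _ = coord (g p) i \o g)//.
by apply/funext => x; rewrite /= /coord [LHS]row_mxEr.
Qed.

Lemma jac_pair M N P (f : M -> N) (g : M -> P) p :
  @jac K M (prodM N P) (fun x => (f x, g x)) p = row_mx (jac f p) (jac g p).
Proof.
apply/matrixP => i j; rewrite jacE; case: (split_ordP j) => k ->.
  rewrite [RHS]row_mxEl jacE (_ : _ \o _ = coord (f p) k \o f)//.
  by apply/funext => x; rewrite /= /coord [LHS]row_mxEl.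
rewrite [RHS]row_mxEr jacE (_ : _ \o _ = coord (g p) k \o g)//.
by apply/funext => x; rewrite /= /coord [LHS]row_mxEr.
Qed.

Lemma chart_id_near M (p : M) : charted M ->
  \forall x \near chart p p, chart p (cinv p x) = x.
Proof.
move=> cM; have := near_chart_image cM (cdom_refl p cM).
by apply: filterS => x /(cinvK cM)[].
Qed.

Lemma smooth_at_id M (p : M) : charted M -> smooth_at (@id M) p.
Proof.
move=> cM; split; first exact: cvg_id.
move=> j; have /near_open[V [oV Vp VE]] := chart_id_near p cM.
exists V; split=> // k.
apply: (@Ck_eq _ _ _ _ (fun x => x 0 j)) => //; last exact: Ck_coord.
by move=> x Vx; rewrite /= /coord VE.
Qed.

Lemma jac_id M (p : M) : charted M -> jac (@id M) p = 1%:M.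
Proof.
move=> cM; apply/matrixP => i j; rewrite jacE !mxE /pd.
rewrite (@near_eq_derive _ _ _ _ (fun x : 'rV[K]_(mdim M) => x 0 j)); last first.
  by apply: filterS (chart_id_near p cM) => x; rewrite /= /coord => ->.
by rewrite (derive_entry (F := id)) ?derive_id// mxE eqxx eq_sym.
Qed.

Lemma smooth_at_cst M N (c : N) (p : M) : smooth_at (fun=> c) p.
Proof.
split; first exact: cst_continuous.
move=> j; exists setT; split=> //; first exact: openT.
move=> k; exact: (Ck_cst _ _ (coord c j c)).
Qed.

Lemma jac_cst M N (c : N) (p : M) : jac (fun=> c) p = 0.
Proof.
by apply/matrixP => i j; rewrite jacE !mxE; exact: derive_cst.
Qed.

Lemma smooth_at_fst M N (p : prodM M N) : charted M -> charted N ->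
  @smooth_at K (prodM M N) M fst p.
Proof.
move=> cM cN; have h := smooth_at_id p (charted_prod cM cN).
split; first exact: cvg_fst.
move=> j; have [_ /(_ (lshift _ j)) hj] := h.
rewrite (_ : _ \o _ = coord p (lshift (mdim N) j) \o id)//.
by apply/funext => x; rewrite /= /coord [RHS]row_mxEl.
Qed.

Lemma smooth_at_snd M N (p : prodM M N) : charted M -> charted N ->
  @smooth_at K (prodM M N) N snd p.
Proof.
move=> cM cN; have h := smooth_at_id p (charted_prod cM cN).
split; first exact: cvg_snd.
move=> j; have [_ /(_ (rshift _ j)) hj] := h.
rewrite (_ : _ \o _ = coord p (rshift (mdim M) j) \o id)//.
by apply/funext => x; rewrite /= /coord [RHS]row_mxEr.
Qed.

Lemma jac_fst_snd M N (p : prodM M N) : charted M -> charted N ->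
  @jac K (prodM M N) M fst p = col_mx 1%:M 0 /\
  @jac K (prodM M N) N snd p = col_mx 0 1%:M.
Proof.
move=> cM cN; have := jac_id p (charted_prod cM cN).
have -> : @id (prodM M N) = (fun x => (x.1, x.2)) by apply/funext => -[].
rewrite jac_pair scalar_mx_block block_mxEh => /eq_row_mx[-> ->].
by [].
Qed.

Lemma jac_fst M N (p : prodM M N) : charted M -> charted N ->
  @jac K (prodM M N) M fst p = col_mx 1%:M 0.
Proof. by move=> cM cN; case: (jac_fst_snd p cM cN). Qed.

Lemma jac_snd M N (p : prodM M N) : charted M -> charted N ->
  @jac K (prodM M N) N snd p = col_mx 0 1%:M.
Proof. by move=> cM cN; case: (jac_fst_snd p cM cN). Qed.

Lemma jac_partial M N P (F : prodM M N -> P) (p : prodM M N) :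
  charted M -> charted N -> smooth_at F p ->
  jac F p = col_mx (jac (fun x => F (x, p.2)) p.1) (jac (fun y => F (p.1, y)) p.2).
Proof.
case: p => p q cM cN sF; have cMN := charted_prod cM cN.
have s1 : @smooth_at K M (prodM M N) (fun x => (x, q)) p.
  by apply: smooth_at_pair; [exact: smooth_at_id | exact: smooth_at_cst].
have s2 : @smooth_at K N (prodM M N) (fun y => (p, y)) q.
  by apply: smooth_at_pair; [exact: smooth_at_cst | exact: smooth_at_id].
rewrite -[LHS]vsubmxK; congr col_mx.
  rewrite [RHS](jac_comp cM cMN s1 sF) jac_pair jac_id// jac_cst.
  by rewrite -[in RHS](vsubmxK (jac F (p, q))) mul_row_col mul1mx mul0mx addr0.
rewrite [RHS](jac_comp cN cMN s2 sF) jac_pair jac_id// jac_cst.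
by rewrite -[in RHS](vsubmxK (jac F (p, q))) mul_row_col mul1mx mul0mx add0r.
Qed.

Lemma dgrad_fst M N (f : M -> K) (p : prodM M N) : charted M -> charted N ->
  mdiff f p.1 -> @dgrad K (prodM M N) (fun x => f x.1) p = col_mx (dgrad f p.1) 0.
Proof.
move=> cM cN fd; have cMN := charted_prod cM cN.
rewrite [LHS](dgrad_comp cMN cM (smooth_at_fst p cM cN) fd) jac_fst//.
by rewrite mul_col_mx mul1mx mul0mx.
Qed.

Lemma dgrad_snd M N (f : N -> K) (p : prodM M N) : charted M -> charted N ->
  mdiff f p.2 -> @dgrad K (prodM M N) (fun x => f x.2) p = col_mx 0 (dgrad f p.2).
Proof.
move=> cM cN fd; have cMN := charted_prod cM cN.
rewrite [LHS](dgrad_comp cMN cN (smooth_at_snd p cM cN) fd) jac_snd//.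
by rewrite mul_col_mx mul1mx mul0mx.
Qed.

(* Row vectors as a manifold, so that the chart [chart p] is itself a map of
   manifolds and changes of charts follow from the chain rule. *)
Definition euclid n : premanifold K :=
  @Premanifold K 'rV[K]_n
    (@Atlas K 'rV[K]_n n (fun=> setT) (fun=> id) (fun=> id)).

Lemma euclid_charted n : charted (euclid n).
Proof.
have sT (p : euclid n) : chart p @` cdom p = setT.
  by apply/seteqP; split=> // x _; exists x.
split.
- by move=> p; split=> //; exact: openT.
- by move=> p; rewrite sT; exact: openT.
- by move=> p q _; split=> //; exact: cvg_id.
- by move=> p x _; exact: cvg_id.
- by move=> p q k j; exact: Ck_coord.
Qed.

Lemma smooth_chart M (p q : M) : charted M -> cdom p q ->
  @smooth_at K M (euclid (mdim M)) (chart p) q.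
Proof.
move=> cM pq; have [_ _ _ _ h] := cM; split; first exact: chart_continuous.
have n1 : \forall x \near chart q q, (chart q @` (cdom q `&` cdom p)) x.
  have qq := cdom_refl q cM; near=> x.
  have [xe xd] : chart q (cinv q x) = x /\ cdom q (cinv q x).
    by apply: cinvK => //; near: x; exact: near_chart_image.
  exists (cinv q x) => //; split=> //; near: x.
  exact: near_cinv cM qq (nbhs_cdom cM pq).
have /near_open[V [oV Vq VE]] := n1.
move=> j; exists V; split=> // k.
exact: Ck_sub VE (h q p k j).
Unshelve. all: by end_near. Qed.

(** Smoothness at [q] refers to the preferred chart at [q]. Here the chart at [p] is kept while the
    point moves, which is what differentiating a second time requires. *)
Lemma smoothf_transition M (f : M -> K) (p : M) : charted M -> smoothf_at f p ->
  \forall q \near p, cdom p q /\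
    @smoothf_at K (euclid (mdim M)) (f \o cinv p) (chart p q).
Proof.
move=> cM [U [oU Up h]]; near=> q; split.
  by near: q; apply: nbhs_cdom => //; exact: cdom_refl.
exists U; split=> //; near: q.
apply: (chart_continuous cM (cdom_refl p cM)).
exact: open_nbhs_nbhs.
Unshelve. all: by end_near. Qed.

Lemma near_chartK M (f : M -> K) (p q : M) : charted M -> cdom p q ->
  {near q, (f \o cinv p) \o chart p =1 f}.
Proof.
move=> cM pq; apply: filterS (nbhs_cdom cM pq) => r pr.
by rewrite /= chartK.
Qed.

Lemma smoothf_at_near M (f : M -> K) (p : M) : charted M -> smoothf_at f p ->
  \forall q \near p, smoothf_at f q.
Proof.
move=> cM /(smoothf_transition cM); apply: filterS => q [pq sq].
apply: (smoothf_near cM (near_chartK f cM pq)).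
exact: (smoothf_comp cM (@euclid_charted _) (smooth_chart cM pq) sq).
Qed.

Lemma dgrad_transition M (f : M -> K) (p q : M) : charted M -> cdom p q ->
  @mdiff K (euclid (mdim M)) (f \o cinv p) (chart p q) ->
  dgrad f q = @jac K M (euclid (mdim M)) (chart p) q *m
              @dgrad K (euclid (mdim M)) (f \o cinv p) (chart p q).
Proof.
move=> cM pq fd; rewrite -(dgrad_near cM (near_chartK f cM pq)).
exact: (dgrad_comp cM (@euclid_charted _) (smooth_chart cM pq) fd).
Qed.

Lemma dgrad_euclid n (f : 'rV[K]_n -> K) x :
  @dgrad K (euclid n) f x = \col_i 'D_(delta_mx 0 i) f x.
Proof. by apply/colP => i; rewrite !mxE. Qed.

Lemma smoothf_coord M (p q : M) j : charted M -> cdom p q -> smoothf_at (coord p j) q.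
Proof. by move=> cM pq; have [_ /(_ j)] := smooth_chart cM pq. Qed.

End Products.

(** * Real and complex scalars *)

(* Naming the structure gives [R[i]] the topology of a numeric field. *)
Definition complexField (R : realType) : numFieldType := R[i].

Section ComplexTopology.
Variable R : realType.
Local Notation C := (complexField R).
Local Notation toC := (real_complex R).

Lemma normc_Re (z : R[i]) : toC `|complex.Re z| <= `|z|.
Proof. exact: normc_ge_Re. Qed.

Lemma normc_Im (z : R[i]) : toC `|complex.Im z| <= `|z|.
Proof.
have := normc_ge_Re (z * 'i%C); rewrite ReiNIm normrN normrM => /le_trans; apply.
rewrite -[leRHS]mulr1 ler_wpM2l// normc_def /= expr0n /= add0r expr1n.
by rewrite sqrtr1.
Qed.

Lemma normc_le (z : R[i]) : `|z| <= toC (`|complex.Re z| + `|complex.Im z|).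
Proof.
rewrite [z in leLHS]complexE (le_trans (ler_normD _ _))// rmorphD lerD//.
  by rewrite normc_def /= expr0n /= addr0 sqrtr_sqr.
rewrite normrM normc_def /= expr0n /= add0r expr1n sqrtr1 mul1r.
by rewrite normc_def /= expr0n /= addr0 sqrtr_sqr.
Qed.

Lemma pos_Re (e : R[i]) : 0 < e -> exists2 d : R, 0 < d & e = toC d.
Proof.
rewrite ltcE /= => /andP[/eqP Ie Re]; exists (complex.Re e) => //.
by rewrite [LHS]complexE Ie mulr0 addr0.
Qed.

Lemma Re_continuous : continuous (fun z : C => complex.Re z).
Proof.
move=> z; apply/(@cvgrPdist_lt _ _ _ _ (nbhs_filter (z : C))) => /= e e0.
have e0' : 0 < toC e by rewrite ltcR.
apply/nbhs_ballP; exists (toC e) => // w zw /=.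
by rewrite -ltcR -raddfB /= (le_lt_trans (normc_Re _)).
Qed.

(** The disc is a closed subset of the image of a compact square of the real plane under (a, b) |->
    a + ib. *)
Lemma disc_compact_C (r : C) : 0 <= r -> compact [set z : C | `|z| <= r].
Proof.
move=> r0; pose f (v : 'rV[R]_2) : C := Complex (v 0 0) (v 0 1).
pose A := [set v : 'rV[R]_2 | forall i, `[- complex.Re r, complex.Re r]%classic (v 0 i)].
have er : r = toC (complex.Re r).
  by rewrite [LHS]complexE (ger0_Im r0) mulr0 addr0.
have cA : compact A.
  apply: (@rV_compact _ _ (fun=> `[- complex.Re r, complex.Re r]%classic)) => _.
  exact: segment_compact.
have cf : continuous f.
  move=> v; apply/(@cvgrPdist_lt _ _ _ _ (nbhs_filter (v : 'rV[R]_2))) => e /pos_Re[d d0 ->].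
  have d2 : 0 < d / 2 by rewrite divr_gt0.
  have h i : \forall w \near (v : 'rV[R]_2), `|v 0 i - (w : 'rV[R]_2) 0 i| < d / 2.
    by have /cvgrPdist_lt := @coord_continuous R 1 2 0 i v; exact.
  apply: filterS2 (h 0) (h 1) => w h0 h1.
  rewrite (le_lt_trans (normc_le _))// ltcR [d]splitr /=.
  exact: ltrD.
have cfA : compact (f @` A).
  by apply: continuous_compact => //; exact: continuous_subspaceT.
apply: subclosed_compact cfA _; last first.
  move=> z zr; exists (\row_i (if i == 0 then complex.Re z else complex.Im z)).
    move=> i; rewrite mxE /= in_itv /= -ler_norml.
    rewrite -lecR -er; case: ifP => _; apply: le_trans zr.
      exact: normc_Re.
    exact: normc_Im.
  by rewrite /f !mxE /=; case: (z).
have -> : [set z : C | `|z| <= r] =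
    (fun z : C => complex.Re `|z|) @^-1` [set x | x <= complex.Re r].
  apply/seteqP; split=> z /=; rewrite er lecE /=.
    by move=> /andP[].
  by move=> ->; rewrite eqxx.
apply: preimage_closed; last exact: closed_le.
move=> z _; apply: (@continuous_comp _ _ _ (fun z : C => `|z| : C) (fun z : C => complex.Re z)).
  exact: norm_continuous.
exact: Re_continuous.
Qed.

End ComplexTopology.

Section Scalars.
Variables (R : realType) (K : numFieldType).
Hypothesis hK : real_or_complex R K.

Lemma disc_compact (r : K) : 0 <= r -> compact [set z : K | `|z| <= r].
Proof.
case: hK r => r r0; last exact: disc_compact_C.
rewrite (_ : mkset _ = `[- r, r]%classic); first exact: segment_compact.
by apply/seteqP; split=> z /=; rewrite in_itv /= ler_norml.
Qed.

(** Norms take values in [K]. The map [nu] turns them into elements of [R] with their order, so that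
    the extreme value theorem and real-valued metrics become available in both cases. *)
Lemma real_part : exists (nu : K -> R) (io : R -> K),
  [/\ continuous nu, (forall a b, nu (a + b) = nu a + nu b),
      (forall a b, a \is Num.real -> b \is Num.real -> (nu a <= nu b) = (a <= b)),
      cancel io nu & forall r, io r \is Num.real].
Proof.
case: hK.
  by exists id, id; split=> // [x|r]; [exact: cvg_id | exact: num_real].
exists (fun z : complexField R => complex.Re z), (real_complex R); split=> //.
- exact: Re_continuous.
- by move=> a b; rewrite raddfD.
- by move=> a b /complex_realP[x ->] /complex_realP[y ->]; rewrite /= lecR.
- by move=> r; apply/complex_realP; exists r.
Qed.

(** Over the complex numbers the mean value theorem holds only for the real and the imaginary part
    of [f], along real times. Adding the two estimates is the origin of the factor 2. *)
Lemma mean_value_bound (f df : K -> K) (c eta : K) :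
  (forall t : K, 0 <= t -> t <= 1 -> is_derive t 1 f (df t)) ->
  (forall t : K, 0 <= t -> t <= 1 -> `|df t - c| <= eta) ->
  `|f 1 - f 0 - c| <= 2 * eta.
Proof.
case: hK f df c eta => f df c eta hd hb.
  have [t] : exists2 t, t \in `]0, 1[%R & f 1 - f 0 = df t * (1 - 0).
    apply: MVT => //.
      by move=> x; rewrite in_itv /= => /andP[x0 x1]; apply: hd; exact: ltW.
    apply: derivable_within_continuous => x; rewrite in_itv /= => /andP[x0 x1].
    by have [] := hd x x0 x1.
  rewrite in_itv /= subr0 mulr1 => /andP[/ltW t0 /ltW t1] ->.
  rewrite (le_trans (hb t t0 t1))// ler_peMl// ?ler1n//.
  by rewrite (le_trans _ (hb t t0 t1)).
(* [p] stands for the real or the imaginary part: real linear, and not increasing norms. *)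
have part (p : R[i] -> R) : (forall a b, p (a - b) = p a - p b) ->
    (forall r z, p (r%:C%C * z) = r * p z) ->
    (forall z, `|p z|%:C%C <= `|z|) -> `|p (f 1 - f 0 - c)|%:C%C <= eta.
  move=> pB pZ pn.
  pose g (t : R) : R := p (f t%:C%C).
  have hg (t : R) : 0 <= t -> t <= 1 -> is_derive t 1 g (p (df t%:C%C)).
    move=> t0 t1.
    have t0' : 0 <= t%:C%C :> complexField R by rewrite ler0c.
    have t1' : t%:C%C <= 1 :> complexField R by rewrite -[1]/(1%:C%C) lecR.
    have [+ hv] := hd _ t0' t1'; rewrite /derivable => cv.
    have {cv hv} : (fun h : complexField R =>
        h^-1 *: (f (h *: 1 + t%:C%C) - f t%:C%C)) @ 0^' --> df t%:C%C.
      by rewrite -hv.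
    move=> /cvgrPdist_lt cv.
    suff : h^-1 *: (g (h *: 1 + t) - g t) @[h --> 0^'] --> p (df t%:C%C).
      by move=> cg; apply: DeriveDef; [apply/cvg_ex; exists (p (df t%:C%C)) | exact/cvg_lim].
    apply/cvgrPdist_lt => e e0.
    have e0' : 0 < e%:C%C :> complexField R by rewrite ltcR.
    have /nbhs_ballP[d /= /pos_Re[d' d'0 ->] hdd] := cv _ e0'.
    apply/nbhs_ballP; exists d' => //= h; rewrite -ball_normE /= sub0r normrN => hd' h0.
    rewrite -ltcR; apply: le_lt_trans (hdd h%:C%C _ _); last 2 first.
    - rewrite -ball_normE /= sub0r normrN normc_def /= expr0n addr0 sqrtr_sqr.
      by rewrite ltcR.
    - by apply: contra_neq h0 => /complexI.
    rewrite /g /= -[h^-1 *: _]/(h^-1 * _) -pB -pZ -pB.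
    apply: le_trans (pn _) _; rewrite le_eqVlt; apply/orP; left; apply/eqP.
    congr (`|_ - _|); rewrite fmorphV; congr (_ * (f _ - _)).
    by rewrite -[h *: 1]/(h * 1) rmorphD rmorphM.
  have [t] : exists2 t, t \in `]0, 1[%R & g 1 - g 0 = p (df t%:C%C) * (1 - 0).
    apply: MVT => //.
      by move=> x; rewrite in_itv /= => /andP[x0 x1]; apply: hg; exact: ltW.
    apply: derivable_within_continuous => x; rewrite in_itv /= => /andP[x0 x1].
    by have [] := hg x x0 x1.
  rewrite in_itv /= subr0 mulr1 => /andP[/ltW t0 /ltW t1] ge.
  rewrite pB pB -[p (f 1) - p (f 0)]/(g 1 - g 0) ge -pB.
  apply: le_trans (pn _) (hb _ _ _); first by rewrite ler0c.
  by rewrite -[1]/(1%:C%C) lecR.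
have hRe : `|complex.Re (f 1 - f 0 - c)|%:C%C <= eta.
  apply: part => [a b|r z|z]; [by rewrite raddfB | by case: z => a b; rewrite /= mul0r subr0|].
  exact: normc_Re.
have hIm : `|complex.Im (f 1 - f 0 - c)|%:C%C <= eta.
  apply: part => [a b|r z|z]; [by rewrite raddfB | by case: z => a b; rewrite /= mul0r addr0|].
  exact: normc_Im.
apply: le_trans (normc_le _) _.
by rewrite rmorphD mulr_natl mulr2n lerD.
Qed.

End Scalars.

(** * Strict differentiability *)

Section RowNorm.
Variable K : numFieldType.

Lemma rv_entry_le n (w : 'rV[K]_n) i : `|w 0 i| <= `|w|.
Proof.
rewrite [leRHS]/Num.norm /= mx_normE -[leLHS]nngE num_le.
exact: (le_bigmax _ _ (0, i)).
Qed.

Lemma rv_norm_le n (w : 'rV[K]_n) c : 0 <= c -> (forall i, `|w 0 i| <= c) -> `|w| <= c.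
Proof.
move=> c0 h; rewrite [leLHS]/Num.norm /= mx_normE.
rewrite -[c]/((NngNum c0)%:num) num_le; apply/bigmax_leP; split=> [|[i j] _] /=.
  by rewrite -num_le.
by rewrite -num_le /= ord1.
Qed.

Lemma rv_norm_mul n p (P : 'M[K]_(n, p)) :
  exists2 c, 0 < c & forall w : 'rV_n, `|w *m P| <= c * `|w|.
Proof.
exists (1 + \sum_i \sum_j `|P i j|).
  by rewrite ltr_pwDl// sumr_ge0// => i _; rewrite sumr_ge0.
move=> w; apply: rv_norm_le => [|j].
  by rewrite mulr_ge0// addr_ge0// sumr_ge0// => i _; rewrite sumr_ge0.
rewrite mxE (le_trans (ler_norm_sum _ _ _))// mulrDl mul1r ler_wpDl//.
rewrite mulr_suml ler_sum// => i _; rewrite normrM mulrC.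
rewrite ler_pM// ?rv_entry_le// (bigD1 j)//= lerDl sumr_ge0//.
Qed.

(** The restriction to [e <= 1] lets the callers bound terms of second order in [e] by terms of
    first order. *)
Lemma le_all_eps (a M : K) : 0 <= a -> 0 <= M ->
  (forall e, 0 < e -> e <= 1 -> a <= e * M) -> a = 0.
Proof.
move=> a0 M0 h; apply/eqP; rewrite eq_le a0 andbT.
apply/negP => /negP an; have ap : 0 < a.
  rewrite lt_neqAle a0 andbT eq_sym; apply: contraNneq an => ->; exact: lexx.
have Dp : 0 < a + M + 1 by rewrite ltr_wpDl// addr_ge0.
(* With this [e] the hypothesis reads a (a + M + 1) <= a M, which is impossible for a > 0. *)
have e0 : 0 < a / (a + M + 1) by rewrite divr_gt0.
have e1 : a / (a + M + 1) <= 1.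
  by rewrite ler_pdivrMr// mul1r -addrA lerDl addr_ge0.
have := h _ e0 e1; rewrite mulrAC ler_pdivlMr// ler_pM2l//.
by rewrite addrAC gerDr lt_geF// ltr_wpDr ?ltr01 ?ltW.
Qed.

End RowNorm.

Section StrictDifferentiability.
Variables (R : realType) (K : numFieldType).
Hypothesis hK : real_or_complex R K.

Lemma is_derive_line n (f : 'rV[K]_n -> K) (a w : 'rV[K]_n) (t : K) :
  derivable f (t *: w + a) w ->
  is_derive t 1 (fun s => f (s *: w + a)) ('D_w f (t *: w + a)).
Proof.
have e : (fun h => h^-1 *: ((((fun s => f (s *: w + a)) \o shift t) (h *: 1)) -
                            f (t *: w + a))) =
         (fun h => h^-1 *: ((f \o shift (t *: w + a)) (h *: w) - f (t *: w + a))).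
  by apply/funext => h /=; rewrite scalerDl -[h *: 1]/(h * 1) mulr1 addrA.
by move=> df; apply: DeriveDef; rewrite /derivable /derive e.
Qed.

(** Apply the mean value bound on the segment from [a] to [b]. It stays in a ball around [x], where
    continuity keeps every partial derivative close to its value at [x]. *)
Lemma strict_diff n (U : set 'rV[K]_n) (f : 'rV[K]_n -> K) x : open U -> U x ->
  Ck 1 U f -> forall e, 0 < e -> exists2 d, 0 < d & forall a b,
    `|a - x| < d -> `|b - x| < d -> `|f b - f a - 'D_(b - a) f x| <= e * `|b - a|.
Proof.
move=> oU Ux [fd Df] e e0.
(* The 2 pays for [mean_value_bound] and n for the sum over the partial derivatives; n + 1 replaces
   n so as not to divide by zero in dimension 0. *)
pose eta := e / (2 * n.+1%:R).
have eta0 : 0 < eta by rewrite divr_gt0// mulr_gt0.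
have : \forall y \near x, U y /\
    forall j, `|'D_(delta_mx 0 j) f y - 'D_(delta_mx 0 j) f x| <= eta.
  near=> y; split; first by near: y; exact: open_nbhs_nbhs.
  near: y; apply: filter_forall => j.
  have /cvgrPdist_le /(_ _ eta0) := Df (delta_mx 0 j) x Ux.
  by apply: filterS => y; rewrite distrC.
move=> /nbhs_ballP[d /= d0 hd]; exists d => // a b ad bd.
pose w := b - a.
have seg (t : K) : 0 <= t -> t <= 1 -> U (t *: w + a) /\
    forall j, `|'D_(delta_mx 0 j) f (t *: w + a) - 'D_(delta_mx 0 j) f x| <= eta.
  move=> t0 t1; apply: hd; rewrite -ball_normE /= distrC.
  have -> : t *: w + a - x = t *: (b - x) + (1 - t) *: (a - x).
    by rewrite /w scalerBl scale1r !scalerBr; apply/rowP => i; rewrite !mxE; ring.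
  rewrite (le_lt_trans (ler_normD _ _))// !normrZ (ger0_norm t0).
  have t1' : 0 <= 1 - t by rewrite subr_ge0.
  rewrite (ger0_norm t1').
  have [->|tn0] := eqVneq t 0; first by rewrite mul0r add0r subr0 mul1r.
  have -> : d = t * d + (1 - t) * d by ring.
  apply: ltr_leD; last by rewrite ler_wpM2l// ltW.
  by rewrite ltr_pM2l// lt_neqAle eq_sym tn0.
have := @mean_value_bound R K hK (fun t => f (t *: w + a))
  (fun t => 'D_w f (t *: w + a)) ('D_w f x) (n%:R * eta * `|w|).
rewrite scale1r scale0r add0r /w subrK => h.
apply: le_trans (h _ _) _.
- move=> t t0 t1; apply: is_derive_line; apply: diff_derivable; apply: fd.
  by case: (seg t t0 t1).
- move=> t t0 t1; have [Ut ht] := seg t t0 t1.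
  rewrite !derive_partials; [|exact: fd|exact: fd].
  rewrite -sumrB; apply: le_trans (ler_norm_sum _ _ _) _.
  have -> : n%:R * eta * `|b - a| = \sum_(i < n) (`|b - a| * eta).
    by rewrite sumr_const card_ord -mulr_natl; ring.
  apply: ler_sum => i _; rewrite -mulrBr normrM ler_pM//; exact: rv_entry_le.
- rewrite mulrA ler_wpM2r// /eta.
  have nN : n%:R <= n.+1%:R :> K by rewrite ler_nat.
  have : 0 < n.+1%:R :> K by [].
  move: nN; move: (n.+1%:R) => N nN N0.
  have -> : 2 * (n%:R * (e / (2 * N))) = e * n%:R / N.
    by field; rewrite gt_eqF.
  by rewrite ler_pdivrMr// ler_wpM2l// ltW.
Unshelve. all: by end_near. Qed.

Lemma deriveZv n (f : 'rV[K]_n -> K) x (s : K) v : differentiable f x ->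
  'D_(s *: v) f x = s * 'D_v f x.
Proof. by move=> fx; rewrite !deriveE// linearZ. Qed.

(** The mean value bound is applied to t |-> f (x + t s u + s v) - f (x + t s u). Its derivative is
    s times the increment of ['D_u f] over the step s v, and strict differentiability of ['D_u f] at
    [x] estimates that increment. *)
Lemma second_difference n (U : set 'rV[K]_n) (f : 'rV[K]_n -> K) x u v :
  open U -> U x -> Ck 2 U f -> forall e, 0 < e -> exists2 d, 0 < d &
  forall s : K, `|s| < d ->
  `|f (x + s *: u + s *: v) - f (x + s *: u) - (f (x + s *: v) - f x)
    - s ^+ 2 * 'D_v ('D_u f) x| <= e * `|s| ^+ 2.
Proof.
move=> oU Ux hf e e0; have [fd Df] := hf.
pose e1 := e / (2 * (`|v| + 1)).
have v1 : 0 < `|v| + 1 by rewrite ltr_wpDl.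
have e10 : 0 < e1 by rewrite divr_gt0// mulr_gt0.
have [d1 d10 h1] := strict_diff oU Ux (Df u) e10.
have /nbhs_ballP[d2 /= d20 h2] : nbhs x U by exact: open_nbhs_nbhs.
have uv1 : 0 < `|u| + `|v| + 1 by rewrite ltr_wpDl// addr_ge0.
(* A common lower bound of [d1] and [d2]. The order of [K] need not be total, so a harmonic sum
   serves as a minimum; the same device recurs below. *)
pose dd := (d1^-1 + d2^-1)^-1.
have dd0 : 0 < dd by rewrite invr_gt0 addr_gt0 ?invr_gt0.
have dd1 : dd <= d1.
  by rewrite /dd -[leRHS]invrK lef_pV2 ?posrE ?addr_gt0 ?invr_gt0// lerDl invr_ge0 ltW.
have dd2 : dd <= d2.
  by rewrite /dd -[leRHS]invrK lef_pV2 ?posrE ?addr_gt0 ?invr_gt0// lerDr invr_ge0 ltW.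
exists (dd / (`|u| + `|v| + 1)); first by rewrite divr_gt0.
move=> s; rewrite ltr_pdivlMr// => sd.
have near_x (t c : K) : `|t| <= 1 -> `|c| <= 1 ->
    `|t *: (s *: u) + (x + c *: (s *: v)) - x| < dd.
  move=> t1 c1; apply: le_lt_trans sd.
  rewrite addrCA addrAC subrr add0r (le_trans (ler_normD _ _))//.
  rewrite !normrZ mulrDr mulr1 mulrDr -addrA lerD//.
    by rewrite -[leRHS]mul1r ler_wpM2r// mulr_ge0.
  by rewrite ler_wpDr// -[leRHS]mul1r ler_wpM2r// mulr_ge0.
have t01 (t : K) : 0 <= t -> t <= 1 -> `|t| <= 1 by move=> t0 t1; rewrite ger0_norm.
have := @mean_value_bound R K hK
  (fun t => f (t *: (s *: u) + (x + 1 *: (s *: v))) -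
            f (t *: (s *: u) + (x + 0 *: (s *: v))))
  (fun t => 'D_(s *: u) f (t *: (s *: u) + (x + 1 *: (s *: v))) -
            'D_(s *: u) f (t *: (s *: u) + (x + 0 *: (s *: v))))
  (s ^+ 2 * 'D_v ('D_u f) x) (e1 * `|v| * `|s| ^+ 2).
rewrite !scale1r !scale0r !add0r addr0 => h.
have -> : x + s *: u + s *: v = s *: u + (x + s *: v).
  by rewrite addrA [s *: u + x]addrC.
rewrite [x + s *: u]addrC; apply: le_trans (h _ _) _.
- move=> t t0 t1; apply: is_deriveB; apply: is_derive_line; apply: diff_derivable.
    apply: fd; apply: h2; rewrite -ball_normE /= distrC.
    rewrite -[s *: v]scale1r; apply: lt_le_trans dd2; apply: near_x.
      exact: t01.
    by rewrite normr1.
  apply: fd; apply: h2; rewrite -ball_normE /= distrC.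
  rewrite -[x in t *: _ + x]addr0 -(scale0r (s *: v)).
  apply: lt_le_trans dd2; apply: near_x; first exact: t01.
  by rewrite normr0.
- move=> t t0 t1.
  set b := t *: (s *: u) + (x + s *: v); set a := t *: (s *: u) + x.
  have bx : `|b - x| < dd.
    by rewrite /b -[s *: v]scale1r; apply: near_x; [exact: t01 | rewrite normr1].
  have ax : `|a - x| < dd.
    rewrite /a -[x in t *: _ + x]addr0 -(scale0r (s *: v)).
    by apply: near_x; [exact: t01 | rewrite normr0].
  have Ub : U b by apply: h2; rewrite -ball_normE /= distrC (lt_le_trans bx).
  have Ua : U a by apply: h2; rewrite -ball_normE /= distrC (lt_le_trans ax).
  rewrite !deriveZv; [|exact: fd|exact: fd].
  have ba : b - a = s *: v by rewrite /b /a opprD addrACA subrr add0r addrAC subrr add0r.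
  have := h1 a b (lt_le_trans ax dd1) (lt_le_trans bx dd1).
  rewrite ba deriveZv; last by case: (Df u) => + _; exact.
  move=> hh; rewrite expr2 -mulrA -mulrBr -mulrBr normrM.
  apply: le_trans (ler_wpM2l (normr_ge0 s) hh) _.
  by rewrite normrZ le_eqVlt; apply/orP; left; apply/eqP; ring.
- rewrite mulrA ler_wpM2r ?exprn_ge0// /e1.
  move: v1; set N := `|v| + 1 => N0.
  have -> : 2 * (e / (2 * N) * `|v|) = e * `|v| / N.
    by field; rewrite gt_eqF.
  rewrite ler_pdivrMr// ler_wpM2l//; first exact: ltW.
  by rewrite /N lerDl.
Qed.

(** The second difference is symmetric in [u] and [v], and both mixed derivatives, multiplied by
    s^2, approximate it up to e |s|^2. *)
Lemma derive_sym n (U : set 'rV[K]_n) (f : 'rV[K]_n -> K) x u v :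
  open U -> U x -> Ck 2 U f -> 'D_v ('D_u f) x = 'D_u ('D_v f) x.
Proof.
move=> oU Ux hf; apply/subr0_eq/normr0_eq0.
apply: (@le_all_eps _ _ 2) => // e e0 e1.
have [d d0 h] := second_difference u v oU Ux hf e0.
have [d' d'0 h'] := second_difference v u oU Ux hf e0.
pose s := (d^-1 + d'^-1)^-1 / 2.
have s0 : 0 < s by rewrite divr_gt0// invr_gt0 addr_gt0 ?invr_gt0.
have half (z : K) : 0 < z -> z / 2 < z.
  by move=> z0; rewrite ltr_pdivrMr// ltr_pMr// ltr1n.
have ss : s < (d^-1 + d'^-1)^-1 by apply: half; rewrite invr_gt0 addr_gt0 ?invr_gt0.
have sd : `|s| < d.
  rewrite gtr0_norm// (lt_le_trans ss)//.
  by rewrite -[leRHS]invrK lef_pV2 ?posrE ?addr_gt0 ?invr_gt0// lerDl invr_ge0 ltW.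
have sd' : `|s| < d'.
  rewrite gtr0_norm// (lt_le_trans ss)//.
  by rewrite -[leRHS]invrK lef_pV2 ?posrE ?addr_gt0 ?invr_gt0// lerDr invr_ge0 ltW.
have := lerD (h' s sd') (h s sd).
set A := f (x + s *: v + s *: u) - _ - _.
have -> : f (x + s *: u + s *: v) - f (x + s *: u) - (f (x + s *: v) - f x) = A.
  by rewrite /A [x + s *: v + s *: u]addrAC; ring.
move=> hh; have s2 : 0 < `|s| ^+ 2 by rewrite exprn_gt0// normr_gt0 gt_eqF.
rewrite -(ler_pM2l s2) -normrX -normrM.
move: hh s2; clearbody A; clear.
move: ('D_v ('D_u f) x) ('D_u ('D_v f) x) => p q hh s2.
have -> : s ^+ 2 * (p - q) = (A - s ^+ 2 * q) - (A - s ^+ 2 * p) by ring.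
apply: le_trans (ler_normB _ _) _; apply: le_trans hh _.
by rewrite normrX [leRHS]mulrC mulrAC mulr_natr mulr2n.
Qed.

End StrictDifferentiability.

(** * Functions vanishing on a level set *)

Section Lyusternik.
Variables (R : realType) (K : numFieldType).
Hypothesis hK : real_or_complex R K.

(** The norm on rows is the maximum norm, so a closed ball is a product of discs. *)
Lemma ball_compact n (r : K) : 0 <= r -> compact [set w : 'rV[K]_n | `|w| <= r].
Proof.
move=> r0.
rewrite (_ : mkset _ = [set w : 'rV[K]_n | forall i, [set z : K | `|z| <= r] (w 0 i)]).
  by apply: (@rV_compact _ _ (fun=> _)) => _; exact: disc_compact hK r r0.
apply/seteqP; split=> w /= h; last exact: rv_norm_le.
by move=> i; apply: le_trans h; exact: rv_entry_le.
Qed.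

Lemma norm_argmin n m (A : set 'rV[K]_n) (psi : 'rV[K]_n -> 'rV[K]_m) :
  A !=set0 -> compact A -> (forall w, A w -> {for w, continuous psi}) ->
  exists2 w0, A w0 & forall w, A w -> `|psi w0| <= `|psi w|.
Proof.
move=> A0 cA cpsi; have [nu [io [cnu _ numono _ _]]] := real_part hK.
have [|w0 Aw0 hw0] := @compact_EVT_min _ R (fun w => nu `|psi w|) A A0 cA.
  apply/continuous_in_subspaceT => w /set_mem Aw.
  apply: (@continuous_comp _ _ _ (fun w => `|psi w|) nu); last exact: cnu.
  apply: (@continuous_comp _ _ _ psi (fun v => `|v|)); first exact: cpsi.
  exact: norm_continuous.
exists w0; first exact: set_mem.
by move=> w Aw; rewrite -numono ?normr_real//; apply: hw0; exact: mem_set.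
Qed.

(* A zero of [psi] is found by minimising [|psi|] over a small ball: at a
   minimum, the Newton step [w - psi w] would at least halve [|psi|]. *)
Lemma near_identity_zero n (psi : 'rV[K]_n -> 'rV[K]_n) (r : K) :
  0 <= r -> 2 * `|psi 0| <= r ->
  (forall w, `|w| <= r -> {for w, continuous psi}) ->
  (forall w w', `|w| <= r -> `|w'| <= r ->
     `|w - psi w - (w' - psi w')| <= `|w - w'| / 2) ->
  exists2 w, `|w| <= r & psi w = 0.
Proof.
move=> r0 hr cpsi lip.
have z0 : `|0 : 'rV[K]_n| <= r by rewrite normr0.
have [w0 w0r hmin] := norm_argmin (ex_intro _ 0 z0) (@ball_compact n r r0) cpsi.
exists w0 => //; apply/eqP; apply/negPn/negP => n0.
have p0 : 0 < `|psi w0| by rewrite normr_gt0.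
have w1r : `|w0 - psi w0| <= r.
  have -> : w0 - psi w0 = (w0 - psi w0 - (0 - psi 0)) - psi 0.
    by rewrite sub0r opprK addrK.
  apply: le_trans (ler_normB _ _) _.
  have -> : r = r / 2 + r / 2 by rewrite -splitr.
  apply: lerD; last by rewrite ler_pdivlMr// mulrC.
  apply: le_trans (lip _ _ w0r z0) _; rewrite subr0 ler_wpM2r//.
have := hmin _ w1r; rewrite -[`|psi (_ - _)|]normrN.
have -> : - psi (w0 - psi w0) =
    (w0 - psi w0) - psi (w0 - psi w0) - (w0 - psi w0) by rewrite addrAC subrr add0r.
move=> h; have := le_trans h (lip _ _ w1r w0r).
rewrite addrAC subrr add0r normrN ler_pdivlMr//.
by rewrite ger_pMr// lern1.
Qed.

Lemma vector_strict_diff m k (U : set 'rV[K]_m) (F : 'rV[K]_m -> 'rV[K]_k) x :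
  open U -> U x -> (forall j, Ck 1 U (fun y => F y 0 j)) ->
  forall e, 0 < e -> exists2 d, 0 < d & forall a b,
    `|a - x| < d -> `|b - x| < d ->
    `|F b - F a - (b - a) *m \matrix_(i, j) 'D_(delta_mx 0 i) (fun y => F y 0 j) x|
      <= e * `|b - a|.
Proof.
move=> oU Ux hF e e0.
have /choice[d hd] : forall j : 'I_k, exists dj : K, 0 < dj /\ forall a b,
    `|a - x| < dj -> `|b - x| < dj ->
    `|F b 0 j - F a 0 j - 'D_(b - a) (fun y => F y 0 j) x| <= e * `|b - a|.
  by move=> j; have [d d0 h] := strict_diff hK oU Ux (hF j) e0; exists d.
(* [(1 + S)^-1] lies below every [d j], and it is positive even when there are no coordinates. *)
pose S := \sum_j (d j)^-1.
have Sp : 0 < 1 + S.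
  by rewrite ltr_pwDl// sumr_ge0// => j _; rewrite invr_ge0 ltW//; case: (hd j).
have Sd j : (1 + S)^-1 <= d j.
  have [dj _] := hd j; rewrite -[leRHS]invrK lef_pV2 ?posrE ?invr_gt0//.
  rewrite ler_wpDl// /S (bigD1 j)//= lerDl sumr_ge0// => i _.
  by rewrite invr_ge0 ltW//; case: (hd i).
exists (1 + S)^-1; first by rewrite invr_gt0.
move=> a b ax bx; apply: rv_norm_le => [|j]; first by rewrite mulr_ge0// ltW.
have [_ h] := hd j; apply: le_trans (h a b _ _).
- rewrite !mxE derive_partials; last by case: (hF j) => + _; exact.
  rewrite le_eqVlt; apply/orP; left; apply/eqP; congr (`|_ - _|).
  by apply: eq_bigr => i _; rewrite !mxE.
- exact: lt_le_trans ax (Sd j).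
- exact: lt_le_trans bx (Sd j).
Qed.

(** For [v] tangent to the level set, [x + t v] misses it by little, and a correction [w *m P]
    brings it back. Since [P *m J = 1], the equation for [w] is a small perturbation of the
    identity, and [near_identity_zero] solves it in the ball of radius e |t|. The matrix [P] depends
    on the point alone, not on [e]. *)
Lemma tangent_points m k (U : set 'rV[K]_m) (F : 'rV[K]_m -> 'rV[K]_k) x
    (J := \matrix_(i, j) 'D_(delta_mx 0 i) (fun y => F y 0 j) x : 'M[K]_(m, k)) v :
  open U -> U x -> (forall j, Ck 1 U (fun y => F y 0 j)) ->
  F x = 0 -> row_full J -> v *m J = 0 ->
  exists P : 'M[K]_(k, m), forall e, 0 < e -> exists2 d, 0 < d &
    forall t : K, `|t| < d -> exists2 w : 'rV_k, `|w| <= e * `|t| &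
      F (x + t *: v + w *m P) = 0.
Proof.
move=> oU Ux hF Fx Jf vJ; exists (pinvmx J) => e e0; set P := pinvmx J.
have PJ : P *m J = 1%:M by exact: mulVpmx.
have [c c0 hc] := rv_norm_mul P.
have v1 : 0 < `|v| + 1 by rewrite ltr_wpDl.
(* As the inverse of a sum, [e1] meets both requirements of [near_identity_zero]: e1 c <= 1/2 makes
   the perturbation a contraction, and 2 e1 |v| <= e makes the initial error small against the
   radius. *)
pose e1 := ((2 * c) + 2 * (`|v| + 1) / e)^-1.
have e1i : 0 < (2 * c) + 2 * (`|v| + 1) / e.
  by rewrite addr_gt0// ?mulr_gt0// invr_gt0.
have e10 : 0 < e1 by rewrite invr_gt0.
have e1c : e1 * c <= 2^-1.
  rewrite mulrC ler_pdivrMr// mulrDr mulKf ?pnatr_eq0// lerDl.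
  by rewrite mulr_ge0// ?invr_ge0// mulr_ge0// ?mulr_ge0// ltW// invr_gt0.
have e1v : 2 * (e1 * `|v|) <= e.
  rewrite mulrCA mulrC ler_pdivrMr// mulrDr -[leLHS]add0r lerD//.
    by rewrite mulr_ge0 ?mulr_ge0// ltW.
  by rewrite [leRHS]mulrC divfK ?gt_eqF// ler_wpM2l// lerDl.
have [d1 d10 h1] := vector_strict_diff oU Ux hF e10.
have /nbhs_ballP[d2 /= d20 h2] : nbhs x U by exact: open_nbhs_nbhs.
pose dd := (d1^-1 + d2^-1)^-1.
have dd0 : 0 < dd by rewrite invr_gt0 addr_gt0 ?invr_gt0.
have dd1 : dd <= d1.
  by rewrite /dd -[leRHS]invrK lef_pV2 ?posrE ?addr_gt0 ?invr_gt0// lerDl invr_ge0 ltW.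
have dd2 : dd <= d2.
  by rewrite /dd -[leRHS]invrK lef_pV2 ?posrE ?addr_gt0 ?invr_gt0// lerDr invr_ge0 ltW.
pose N := `|v| + c * e + 1.
have N0 : 0 < N by rewrite ltr_wpDl// addr_ge0// mulr_ge0// ltW.
exists (dd / N); first by rewrite divr_gt0.
move=> t; rewrite ltr_pdivlMr// => td.
pose pt (w : 'rV[K]_k) := x + t *: v + w *m P.
have ptx w : `|w| <= e * `|t| -> `|pt w - x| < dd.
  move=> hw; apply: le_lt_trans td.
  rewrite /pt addrAC [x + _]addrC addrK (le_trans (ler_normD _ _))// normrZ /N.
  rewrite mulrDr mulr1 mulrDr -addrA lerD// ler_wpDr//.
  apply: le_trans (hc w) _; rewrite mulrCA; apply: ler_wpM2l; first exact: ltW.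
  by rewrite mulrC.
have ptB w w' : pt w - pt w' = (w - w') *m P.
  by rewrite /pt mulmxBl opprD addrACA subrr add0r.
have [||w cw|w w' hw hw'|w hw w0] :=
    @near_identity_zero k (fun w => F (pt w)) (e * `|t|).
- by rewrite mulr_ge0// ltW.
- have p0 : `|pt 0 - x| < dd by apply: ptx; rewrite normr0 mulr_ge0// ltW.
  have := h1 x (pt 0) _ (lt_le_trans p0 dd1).
  rewrite subrr normr0 => /(_ d10); rewrite Fx subr0 {2 3}/pt mul0mx addr0.
  rewrite addrAC subrr add0r -scalemxAl vJ scaler0 subr0 normrZ => hh.
  apply: le_trans (ler_wpM2l _ hh) _ => //.
  by rewrite mulrCA [`|t| * _]mulrC mulrA [X in X * _]mulrC mulrA ler_wpM2r// -mulrA e1v.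
- apply: (@continuous_comp _ _ _ pt F).
    apply: continuous_rowP => j; apply: differentiable_continuous.
    have -> : (fun y : 'rV[K]_k => pt y 0 j) = cst ((x + t *: v) 0 j) +
              \sum_i (fun y : 'rV[K]_k => y 0 i * P i j).
      by apply/funext => y; rewrite !fctE fct_sumE mxE; congr (_ + _); rewrite mxE.
    apply: differentiableD => //; apply: differentiable_sum => i.
    by apply: differentiableM => //; exact: differentiable_coord.
  apply: continuous_rowP => j; apply: differentiable_continuous.
  have [+ _] := hF j; apply; apply: h2; rewrite -ball_normE /= distrC.
  exact: lt_le_trans (ptx w cw) dd2.
- have := h1 _ _ (lt_le_trans (ptx w' hw') dd1) (lt_le_trans (ptx w hw) dd1).
  rewrite ptB -/J -mulmxA PJ mulmx1 => hh.
  have -> : w - F (pt w) - (w' - F (pt w')) = - (F (pt w) - F (pt w') - (w - w')).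
    by apply/rowP => i; rewrite !mxE; ring.
  rewrite normrN; apply: le_trans hh _.
  apply: le_trans (ler_wpM2l (ltW e10) (hc _)) _.
  by rewrite mulrA mulrC ler_wpM2l.
- by exists w.
Qed.

(** At the points x + s v + o(s) of the level set the function [h] vanishes, while its expansion
    there is s 'D_v h + o(s). *)
Lemma derive_zero_on_level m k (U : set 'rV[K]_m) (F : 'rV[K]_m -> 'rV[K]_k) x
    (J := \matrix_(i, j) 'D_(delta_mx 0 i) (fun y => F y 0 j) x : 'M[K]_(m, k))
    (h : 'rV[K]_m -> K) v :
  open U -> U x -> (forall j, Ck 1 U (fun y => F y 0 j)) ->
  F x = 0 -> row_full J -> differentiable h x ->
  (\forall y \near x, F y = 0 -> h y = 0) -> v *m J = 0 -> 'D_v h x = 0.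
Proof.
move=> oU Ux hF Fx Jf dh hz vJ.
have [P hP] := tangent_points oU Ux hF Fx Jf vJ.
have [c c0 hc] := rv_norm_mul P.
have [L L0 hL] := linear_lipschitz (diff_continuous dh).
have hx : h x = 0 by exact: (nbhs_singleton hz).
(* [L * c] bounds the effect of the correction under the differential of [h], with [L] its Lipschitz
   constant. The rest is the remainder of the expansion, of size e (|v| + c e), where e <= 1
   replaces c e by c. *)
apply/normr0_eq0; apply: (@le_all_eps _ _ (L * c + (`|v| + c))) => //.
  by rewrite !addr_ge0// ?mulr_ge0// ltW.
move=> e e0 e1; have [d d0 hd] := hP e e0.
have := filterI hz (differentiable_eps dh e0).
move=> /(_ _) /nbhs_ballP[d1 /= d10 h1].
pose N := `|v| + c * e + 1.
have N0 : 0 < N by rewrite ltr_wpDl// addr_ge0// mulr_ge0// ltW.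
(* Half a harmonic sum, so that s < d and s N < d1 hold together. *)
pose s := (d^-1 + N / d1)^-1 / 2.
have si : 0 < d^-1 + N / d1 by rewrite addr_gt0 ?divr_gt0 ?invr_gt0.
have s0 : 0 < s by rewrite divr_gt0// invr_gt0.
have ss : s < (d^-1 + N / d1)^-1.
  by rewrite ltr_pdivrMr// ltr_pMr ?invr_gt0// ltr1n.
have sd : `|s| < d.
  rewrite gtr0_norm// (lt_le_trans ss)//.
  by rewrite -[leRHS]invrK lef_pV2 ?posrE ?invr_gt0// lerDl ltW// divr_gt0.
have sd1 : s * N < d1.
  rewrite -ltr_pdivlMr// (lt_le_trans ss)//.
  rewrite -[leRHS]invrK invf_div lef_pV2 ?posrE ?divr_gt0//.
  by rewrite lerDr invr_ge0 ltW.
have [w hw Fw] := hd s sd; move: hw; rewrite (gtr0_norm s0) => hw.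
set y := x + s *: v + w *m P in Fw.
have yx : y - x = s *: v + w *m P by rewrite /y addrAC [x + _]addrC addrK.
have wP : `|w *m P| <= c * e * s.
  by apply: le_trans (hc w) _; rewrite -mulrA ler_wpM2l// ltW.
have yn : `|y - x| <= s * (`|v| + c * e).
  rewrite yx (le_trans (ler_normD _ _))// normrZ gtr0_norm// mulrDr lerD//.
  by rewrite [leRHS]mulrC.
have [|hy1 hy2] := h1 y.
  rewrite -ball_normE /= distrC; apply: le_lt_trans yn _; apply: le_lt_trans sd1.
  by apply: ler_wpM2l; [exact: ltW | rewrite /N lerDl].
move: hy2; rewrite (hy1 Fw) hx subr0 sub0r normrN {1}yx linearD linearZ /= => hy2.
have : `|s *: 'd h x v| <= s * (e * (L * c + (`|v| + c))).
  have -> : s *: 'd h x v = (s *: 'd h x v + 'd h x (w *m P)) - 'd h x (w *m P).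
    by rewrite addrK.
  apply: le_trans (ler_normB _ _) _; rewrite mulrDr mulrDr addrC; apply: lerD.
    apply: le_trans (hL _) _; apply: le_trans (ler_wpM2l (ltW L0) wP) _.
    by rewrite le_eqVlt; apply/orP; left; apply/eqP; ring.
  apply: le_trans hy2 _; apply: le_trans (ler_wpM2l (ltW e0) yn) _.
  rewrite mulrCA; apply: ler_wpM2l; first exact: ltW.
  apply: ler_wpM2l; first exact: ltW.
  rewrite lerD2l -[leRHS]mulr1; apply: ler_wpM2l => //; exact: ltW.
by rewrite normrZ gtr0_norm// ler_pM2l// deriveE.
Qed.

End Lyusternik.

(** * Vanishing ideals and coisotropy *)

(** The rows of [1 - A *m pinvmx A] lie in the left kernel of [A], hence are killed by [B]. *)
Lemma left_divides_of_kernel (F : fieldType) m n p (A : 'M[F]_(m, n)) (B : 'M[F]_(m, p)) :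
  (forall v : 'rV_m, v *m A = 0 -> v *m B = 0) -> exists X, B = A *m X.
Proof.
move=> h; exists (pinvmx A *m B).
suff : (1%:M - A *m pinvmx A) *m B = 0.
  by rewrite mulmxBl mul1mx mulmxA => /subr0_eq.
apply/row_matrixP => i; rewrite row_mul row0; apply: h.
by rewrite -row_mul mulmxBl mul1mx mulmxKpV// subrr row0.
Qed.

Section SmoothFunctions.
Variable K : numFieldType.
Implicit Types M N P : premanifold K.

Lemma smoothf_cst M (c : K) (p : M) : smoothf_at (fun=> c) p.
Proof. by exists setT; split=> //; [exact: openT | move=> k; exact: Ck_cst]. Qed.

Lemma smoothfD M (f g : M -> K) p : smoothf_at f p -> smoothf_at g p ->
  smoothf_at (fun q => f q + g q) p.
Proof.
move=> [U [oU Up hU]] [V [oV Vp hV]]; exists (U `&` V); split=> //; first exact: openI.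
move=> k; apply: (@CkD _ _ _ _ (f \o cinv p) (g \o cinv p)).
- exact: openI.
- by apply: Ck_sub (hU k) => x [].
- by apply: Ck_sub (hV k) => x [].
Qed.

Lemma smoothfM M (f g : M -> K) p : smoothf_at f p -> smoothf_at g p ->
  smoothf_at (fun q => f q * g q) p.
Proof.
move=> [U [oU Up hU]] [V [oV Vp hV]]; exists (U `&` V); split=> //; first exact: openI.
move=> k; apply: (@CkM _ _ _ _ (f \o cinv p) (g \o cinv p)).
- exact: openI.
- by apply: Ck_sub (hU k) => x [].
- by apply: Ck_sub (hV k) => x [].
Qed.

Lemma smoothfB M (f g : M -> K) p : smoothf_at f p -> smoothf_at g p ->
  smoothf_at (fun q => f q - g q) p.
Proof.
move=> hf hg; have := smoothfD hf (smoothfM (smoothf_cst (-1) p) hg).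
by rewrite (_ : (fun q => _ + _ * _) = (fun q => f q - g q))//; apply/funext => q; rewrite mulN1r.
Qed.

Lemma smoothf_sum M n (f : 'I_n -> M -> K) p : (forall i, smoothf_at (f i) p) ->
  smoothf_at (fun q => \sum_i f i q) p.
Proof.
move=> h; rewrite (_ : (fun q => _) = \sum_i f i); last first.
  by apply/funext => q; rewrite fct_sumE.
elim/big_ind : _ => //; first exact: smoothf_cst.
by move=> a b; exact: smoothfD.
Qed.

Lemma dgradB M (f g : M -> K) p : mdiff f p -> mdiff g p ->
  dgrad (fun q => f q - g q) p = dgrad f p - dgrad g p.
Proof.
move=> hf hg; apply/colP => i; rewrite !mxE /pd.
by rewrite (@deriveB _ _ _ (f \o cinv p) (g \o cinv p))//; exact: diff_derivable.
Qed.

Lemma dgrad_cst M (c : K) (p : M) : dgrad (fun=> c) p = 0.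
Proof. by apply/colP => i; rewrite !mxE; exact: derive_cst. Qed.

Lemma bracket_cst_r M (b : bivector M) f (c : K) p : bracket b f (fun=> c) p = 0.
Proof. by rewrite bracketE dgrad_cst mulmx0 mxE. Qed.

Lemma smooth_at_coord M N (f : M -> N) p (c : N) j : smooth_at f p -> f p = c ->
  smoothf_at (coord c j \o f) p.
Proof. by move=> [_ h] <-; exact: h. Qed.

(* Vanishing functions are tested on the coordinates of [a1 - a2]. *)
Lemma coisotropic_pairing_near M N N' (b : bivector M) (S : set M) p
    (a1 a2 : M -> N) (c1 c2 : M -> N') :
  coisotropic b S -> S p ->
  smooth_at a1 p -> smooth_at a2 p -> smooth_at c1 p -> smooth_at c2 p ->
  (\forall q \near p, S q -> a1 q = a2 q) ->
  (\forall q \near p, S q -> c1 q = c2 q) ->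
  (jac a1 p - jac a2 p)^T *m b p *m (jac c1 p - jac c2 p) = 0.
Proof.
move=> hS Sp s1 s2 t1 t2 ha hc.
have smf (L : premanifold K) (f1 f2 : M -> L) : smooth_at f1 p -> smooth_at f2 p ->
    f1 p = f2 p -> forall i,
    smoothf_at (fun q => (coord (f1 p) i \o f1) q - (coord (f1 p) i \o f2) q) p /\
    dgrad (fun q => (coord (f1 p) i \o f1) q - (coord (f1 p) i \o f2) q) p =
      col i (jac f1 p - jac f2 p).
  move=> h1 h2 e i; have k1 := smooth_at_coord i h1 erefl.
  have k2 := smooth_at_coord i h2 (esym e).
  split; first exact: smoothfB.
  rewrite (dgradB (smoothf_mdiff k1) (smoothf_mdiff k2)).
  by rewrite linearB /= !col_jac e.
apply/matrixP => i j; rewrite [RHS]mxE.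
have [sf ef] := smf _ _ _ s1 s2 (nbhs_singleton ha Sp) i.
have [sg eg] := smf _ _ _ t1 t2 (nbhs_singleton hc Sp) j.
have := hS p _ _ Sp sf sg; rewrite bracketE ef eg => <-.
- by rewrite tr_col -row_mul !mxE; apply: eq_bigr => k _; rewrite !mxE.
- by apply: filterS ha => q h Sq; rewrite /= (h Sq) subrr.
- by apply: filterS hc => q h Sq; rewrite /= (h Sq) subrr.
Qed.

Lemma coisotropic_pairing M N N' (b : bivector M) (S : set M) p
    (a1 a2 : M -> N) (c1 c2 : M -> N') :
  coisotropic b S -> S p ->
  smooth_at a1 p -> smooth_at a2 p -> smooth_at c1 p -> smooth_at c2 p ->
  (forall q, S q -> a1 q = a2 q) -> (forall q, S q -> c1 q = c2 q) ->
  (jac a1 p - jac a2 p)^T *m b p *m (jac c1 p - jac c2 p) = 0.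
Proof.
by move=> *; apply: (coisotropic_pairing_near (S := S)) => //; apply: nearW.
Qed.

End SmoothFunctions.

Section Multiplier.
Variables (R : realType) (K : numFieldType).
Hypothesis hK : real_or_complex R K.
Implicit Types M N P : premanifold K.

(** Lagrange multipliers for the equation [a1 = a2]. Read in the chart at the common value it is a
    regular level set. The differential of [f] therefore vanishes on the kernel of the difference of
    Jacobians, so it factors through that difference. *)
Lemma vanishing_multiplier M N (a1 a2 : M -> N) (f : M -> K) p :
  charted M -> charted N -> smooth_at a1 p -> smooth_at a2 p -> a1 p = a2 p ->
  row_full (jac a1 p - jac a2 p) -> smoothf_at f p ->
  (\forall q \near p, a1 q = a2 q -> f q = 0) ->
  exists l, dgrad f p = (jac a1 p - jac a2 p) *m l.
Proof.
move=> cM cN s1 s2 e full sf hf; apply: left_divides_of_kernel => v vJ.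
have [_ d1] := smooth_at_chart cM cN s1; have [_ d2] := smooth_at_chart cM cN s2.
have k1 j : smoothf_at (coord (a1 p) j \o a1) p by exact: smooth_at_coord s1 erefl.
have k2 j : smoothf_at (coord (a1 p) j \o a2) p.
  by apply: smooth_at_coord s2 _; rewrite e.
pose F (y : 'rV[K]_(mdim M)) : 'rV[K]_(mdim N) :=
  chart (a1 p) (a1 (cinv p y)) - chart (a1 p) (a2 (cinv p y)).
have Fe j : (fun y => F y 0 j) =
    (fun q => (coord (a1 p) j \o a1) q - (coord (a1 p) j \o a2) q) \o cinv p.
  by apply/funext => y; rewrite /F !mxE.
have /choice[U hU] : forall j, exists U, [/\ open U, U (chart p p) &
    forall k, Ck k U (fun y => F y 0 j)].
  by move=> j; rewrite Fe; exact: smoothfB.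
pose U0 := interior [set y | forall j, U j y].
have U0p : U0 (chart p p).
  have : \forall y \near chart p p, forall j, U j y.
    near=> y; near: y; apply: filter_forall => j.
    by have [oU Up _] := hU j; exact: open_nbhs_nbhs.
  exact.
have vd : 'D_v (f \o cinv p) (chart p p) = 0.
  apply: (derive_zero_on_level hK (U := U0) (F := F)) => //.
  - exact: open_interior.
  - move=> j; have [_ _ h] := hU j; apply: Ck_sub (h 1%N) => y.
    by move=> /interior_subset.
  - by rewrite /F chartK ?e ?subrr//; exact: cdom_refl.
  - move: full; congr (is_true (row_full _)); apply/matrixP => i j.
    rewrite [RHS]mxE Fe.
    have := dgradB (smoothf_mdiff (k1 j)) (smoothf_mdiff (k2 j)).
    move=> /colP /(_ i); rewrite [LHS]mxE /pd => ->.
    by rewrite !mxE e.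
  - exact: smoothf_mdiff.
  - have hf' := near_cinv cM (cdom_refl p cM) hf.
    near=> y => Fy; have hy : a1 (cinv p y) = a2 (cinv p y) -> f (cinv p y) = 0.
      by near: y.
    apply: hy.
    have c1 : cdom (a1 p) (a1 (cinv p y)) by near: y.
    have c2 : cdom (a1 p) (a2 (cinv p y)) by rewrite e; near: y.
    by rewrite -(chartK cN c1) -(chartK cN c2); congr (cinv _ _); exact: subr0_eq.
  - rewrite -[RHS]vJ; congr (_ *m _); apply/matrixP => i j.
    rewrite [LHS]mxE Fe.
    have := dgradB (smoothf_mdiff (k1 j)) (smoothf_mdiff (k2 j)).
    move=> /colP /(_ i); rewrite [LHS]mxE /pd => ->.
    by rewrite !mxE e.
apply/rowP => i; rewrite ord1 [RHS]mxE -pd_dgrad//; exact: smoothf_mdiff.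
Unshelve. all: by end_near. Qed.

End Multiplier.

(** * Poisson brackets *)

Lemma quad_sum (F : comNzRingType) m n (u : 'cV[F]_m) (A : 'M[F]_(m, n)) (v : 'cV[F]_n) :
  (u^T *m A *m v) 0 0 = \sum_k \sum_l A k l * u k 0 * v l 0.
Proof.
rewrite mxE exchange_big /=; apply: eq_bigr => l _; rewrite mxE big_distrl /=.
by apply: eq_bigr => k _; rewrite mxE [u k 0 * _]mulrC.
Qed.

Lemma near_refl (T : topologicalType) (S : Type) (u : T -> S) (p : T) :
  {near p, u =1 u}.
Proof. by apply: nearW. Qed.

Section PoissonTheory.
Variables (R : realType) (K : numFieldType).
Hypothesis hK : real_or_complex R K.
Implicit Types M N : premanifold K.

Lemma bracket_coord_push M (b : bivector M) p q k l :
  push (@jac K M (euclid K (mdim M)) (chart p) q) (b q) k l =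
  bracket b (coord p k) (coord p l) q.
Proof.
rewrite bracketE /push.
have e j : dgrad (coord p j) q = col j (@jac K M (euclid K (mdim M)) (chart p) q).
  exact: esym (@col_jac K M (euclid K (mdim M)) (chart p) q j).
by rewrite !e tr_col -row_mul !mxE; apply: eq_bigr => i _; rewrite !mxE.
Qed.

(** By definition the bracket at [q] is computed in the preferred chart at [q]. The expansion in the
    fixed chart at [p] is what can be differentiated again. *)
Lemma bracket_expand M (b : bivector M) (f g : M -> K) p :
  charted M -> smoothf_at f p -> smoothf_at g p ->
  \forall q \near p, bracket b f g q =
    \sum_k \sum_l bracket b (coord p k) (coord p l) q *
      'D_(delta_mx 0 k) (f \o cinv p) (chart p q) *
      'D_(delta_mx 0 l) (g \o cinv p) (chart p q).
Proof.
move=> cM sf sg; near=> q.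
have [pq sfq] : cdom p q /\ @smoothf_at K (euclid K (mdim M)) (f \o cinv p) (chart p q).
  by near: q; exact: smoothf_transition.
have [_ sgq] : cdom p q /\ @smoothf_at K (euclid K (mdim M)) (g \o cinv p) (chart p q).
  by near: q; exact: smoothf_transition.
rewrite bracketE (dgrad_transition cM pq (smoothf_mdiff sfq)).
rewrite (dgrad_transition cM pq (smoothf_mdiff sgq)) trmx_mul.
rewrite -(mulmxA _ _ (b q)) -mulmxA [_ *m b q *m _]mulmxA mulmxA.
rewrite quad_sum.
apply: eq_bigr => k _; apply: eq_bigr => l _.
by rewrite -bracket_coord_push !dgrad_euclid [in X in _ * X * _]mxE [in X in _ * X]mxE.
Unshelve. all: by end_near. Qed.

Lemma smoothf_partial M (f : M -> K) p v : charted M -> smoothf_at f p ->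
  smoothf_at (fun q => 'D_v (f \o cinv p) (chart p q)) p.
Proof.
move=> cM [U [oU Up h]].
have /near_open[V [oV Vp VE]] := chart_id_near p cM.
exists (U `&` V); split=> //; first exact: openI.
move=> k; apply: (@Ck_eq _ _ _ _ ('D_v (f \o cinv p))).
- exact: openI.
- by move=> x [_ Vx] /=; rewrite VE.
- by have [_ D] := h k.+1; apply: Ck_sub (D v) => x [].
Qed.

Lemma smoothf_bracket M (b : bivector M) (f g : M -> K) p : charted M ->
  (forall k l, smoothf_at (bracket b (coord p k) (coord p l)) p) ->
  smoothf_at f p -> smoothf_at g p -> smoothf_at (bracket b f g) p.
Proof.
move=> cM hb sf sg.
have h : {near p, (fun q => \sum_k \sum_l bracket b (coord p k) (coord p l) q *
      'D_(delta_mx 0 k) (f \o cinv p) (chart p q) *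
      'D_(delta_mx 0 l) (g \o cinv p) (chart p q)) =1 bracket b f g}.
  by have := bracket_expand b cM sf sg; apply: filterS => q /esym.
apply: (smoothf_near cM h).
apply: smoothf_sum => k; apply: smoothf_sum => l.
exact: (smoothfM (smoothfM (hb k l) (smoothf_partial (delta_mx 0 k) cM sf))
  (smoothf_partial (delta_mx 0 l) cM sg)).
Qed.

Lemma dgradM M (f g : M -> K) p : mdiff f p -> mdiff g p ->
  dgrad (fun q => f q * g q) p =
    f (cinv p (chart p p)) *: dgrad g p + g (cinv p (chart p p)) *: dgrad f p.
Proof.
move=> hf hg; apply/colP => i; rewrite !mxE /pd.
by rewrite (@deriveM _ _ (f \o cinv p) (g \o cinv p))//; exact: diff_derivable.
Qed.

Lemma dgrad_sum M n (f : 'I_n -> M -> K) p : (forall i, mdiff (f i) p) ->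
  dgrad (fun q => \sum_i f i q) p = \sum_i dgrad (f i) p.
Proof.
move=> h; apply/colP => j; rewrite !mxE /pd summxE.
have -> : (fun q => \sum_i f i q) \o cinv p = \sum_i (f i \o cinv p).
  by apply/funext => x; rewrite /= fct_sumE.
rewrite derive_sum; last by move=> i; apply: diff_derivable; exact: h.
by apply: eq_bigr => i _; rewrite mxE.
Qed.

Definition hessian M (f : M -> K) (p : M) : 'M[K]_(mdim M) :=
  \matrix_(m, k) 'D_(delta_mx 0 m) ('D_(delta_mx 0 k) (f \o cinv p)) (chart p p).

Lemma hessian_sym M (f : M -> K) p : smoothf_at f p -> (hessian f p)^T = hessian f p.
Proof.
move=> [U [oU Up h]]; apply/matrixP => i j; rewrite !mxE.
exact: (derive_sym hK _ _ oU Up (h 2%N)).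
Qed.

Lemma dgrad_partial M (f : M -> K) p k : charted M ->
  dgrad (fun q => 'D_(delta_mx 0 k) (f \o cinv p) (chart p q)) p = col k (hessian f p).
Proof.
move=> cM; apply/colP => m; rewrite !mxE /pd; apply: near_eq_derive.
by apply: filterS (chart_id_near p cM) => x /= ->.
Qed.

Lemma dgrad_bracket M (b : bivector M) (g h : M -> K) p : charted M ->
  (forall k l, smoothf_at (bracket b (coord p k) (coord p l)) p) ->
  smoothf_at g p -> smoothf_at h p ->
  dgrad (bracket b g h) p =
    \sum_k \sum_l (dgrad g p k 0 * dgrad h p l 0) *:
        dgrad (bracket b (coord p k) (coord p l)) p
    + hessian g p *m (b p *m dgrad h p) + hessian h p *m ((b p)^T *m dgrad g p).
Proof.
move=> cM hb sg sh; rewrite (dgrad_near cM (bracket_expand b cM sg sh)).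
have pp := cdom_refl p cM.
have sB k l : mdiff (bracket b (coord p k) (coord p l)) p by exact: smoothf_mdiff.
have sG k : smoothf_at (fun q => 'D_(delta_mx 0 k) (g \o cinv p) (chart p q)) p.
  exact: smoothf_partial.
have sH k : smoothf_at (fun q => 'D_(delta_mx 0 k) (h \o cinv p) (chart p q)) p.
  exact: smoothf_partial.
have bE k l : bracket b (coord p k) (coord p l) p = b p k l.
  rewrite -bracket_coord_push /push.
  have -> : @jac K M (euclid K (mdim M)) (chart p) p = 1%:M.
    by rewrite -(jac_id p cM); apply/matrixP => i j; rewrite !jacE.
  by rewrite trmx1 mul1mx mulmx1.
rewrite dgrad_sum; last first.
  move=> k; apply: smoothf_mdiff; apply: smoothf_sum => l.
  by apply: smoothfM => //; exact: smoothfM.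
have -> : \sum_i dgrad (fun q => \sum_l bracket b (coord p i) (coord p l) q *
      'D_(delta_mx 0 i) (g \o cinv p) (chart p q) *
      'D_(delta_mx 0 l) (h \o cinv p) (chart p q)) p =
   \sum_k \sum_l ((dgrad g p k 0 * dgrad h p l 0) *:
        dgrad (bracket b (coord p k) (coord p l)) p
     + (b p k l * dgrad h p l 0) *: col k (hessian g p)
     + (b p k l * dgrad g p k 0) *: col l (hessian h p)).
  apply: eq_bigr => k _; rewrite dgrad_sum; last first.
    move=> l; apply: smoothf_mdiff.
    by apply: smoothfM => //; exact: smoothfM.
  apply: eq_bigr => l _.
  rewrite dgradM; [|by apply: smoothf_mdiff; exact: smoothfM|exact: smoothf_mdiff].
  rewrite dgradM; [|by []|exact: smoothf_mdiff].
  rewrite !dgrad_partial// chartK// bE.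
  have gE : 'D_(delta_mx 0 k) (g \o cinv p) (chart p p) = dgrad g p k 0 by rewrite mxE.
  have hE : 'D_(delta_mx 0 l) (h \o cinv p) (chart p p) = dgrad h p l 0 by rewrite mxE.
  rewrite gE hE scalerDr !scalerA addrCA addrA [dgrad h p l 0 * _]mulrC.
  by rewrite [dgrad h p l 0 * _]mulrC addrC addrA [X in _ = X + _]addrC; congr (_ + _); rewrite addrC.
rewrite -!(eq_bigr _ (fun k _ => esym (big_split _ _ _ _ _))).
under eq_bigr do rewrite !big_split /=.
rewrite !big_split /=; congr (_ + _ + _).
- apply/colP => m; rewrite summxE [RHS]mxE; apply: eq_bigr => k _.
  rewrite summxE [(b p *m _) k 0]mxE mulr_sumr; apply: eq_bigr => l _.
  by rewrite !mxE mulrC.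
- rewrite exchange_big; apply/colP => m; rewrite summxE [RHS]mxE; apply: eq_bigr => l _.
  rewrite summxE [((b p)^T *m _) l 0]mxE mulr_sumr; apply: eq_bigr => k _.
  by rewrite !mxE mulrC.
Qed.

(** An iterated bracket of general functions differs from the trilinear combination of those of
    coordinates by two Hessian terms. Symmetry of the Hessian and antisymmetry of [b] make these
    cancel in pairs in the cyclic sum. *)
Lemma jacobi_of_coords M (b : bivector M) p :
  charted M -> (b p)^T = - b p ->
  (forall k l, smoothf_at (bracket b (coord p k) (coord p l)) p) ->
  (forall i k l,
     bracket b (coord p i) (bracket b (coord p k) (coord p l)) p +
     bracket b (coord p k) (bracket b (coord p l) (coord p i)) p +
     bracket b (coord p l) (bracket b (coord p i) (coord p k)) p = 0) ->
  forall f g h, smoothf_at f p -> smoothf_at g p -> smoothf_at h p ->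
     bracket b f (bracket b g h) p + bracket b g (bracket b h f) p
     + bracket b h (bracket b f g) p = 0.
Proof.
move=> cM asym hb hJ.
pose X i k l := bracket b (coord p i) (bracket b (coord p k) (coord p l)) p.
pose S1 (f g h : M -> K) := ((dgrad f p)^T *m b p *m
  (hessian g p *m (b p *m dgrad h p))) 0 0.
have key f g h : smoothf_at f p -> smoothf_at g p -> smoothf_at h p ->
    bracket b f (bracket b g h) p =
    \sum_i \sum_k \sum_l dgrad f p i 0 * dgrad g p k 0 * dgrad h p l 0 * X i k l
    + S1 f g h - S1 f h g.
  move=> sf sg sh; rewrite bracketE dgrad_bracket// asym mulNmx mulmxN.
  rewrite mulmxBr mulmxDr [LHS]mxE [in X in _ + X]mxE [X in X + _]mxE.
  congr (_ + _ - _); rewrite mulmx_sumr summxE [RHS]exchange_big.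
  apply: eq_bigr => k _; rewrite mulmx_sumr summxE [RHS]exchange_big.
  apply: eq_bigr => l _; rewrite -scalemxAr [LHS]mxE -mulmxA.
  rewrite [((dgrad f p)^T *m _) 0 0]mxE mulr_sumr.
  apply: eq_bigr => i _; rewrite [(dgrad f p)^T 0 i]mxE mulrA; congr (_ * _).
    by rewrite mulrC mulrA.
  rewrite /X bracketE -mulmxA.
  have -> : (dgrad (coord p i) p)^T = delta_mx 0 i.
    apply/rowP => m; rewrite mxE -(col_jac id) jac_id// !mxE eqxx /=.
    by [].
  by rewrite -rowE !mxE.
have S1sym f g h : smoothf_at g p -> S1 f g h = S1 h g f.
  move=> sg; rewrite /S1.
  have tr00 (A : 'M[K]_1) : A 0 0 = A^T 0 0 by rewrite mxE.
  rewrite tr00 !trmx_mul hessian_sym// trmxK asym.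
  by rewrite !(mulmxN, mulNmx) opprK !mulmxA.
have rot (F : 'I_(mdim M) -> 'I_(mdim M) -> 'I_(mdim M) -> K) :
    \sum_i \sum_k \sum_l F i k l = \sum_i \sum_k \sum_l F k l i.
  rewrite [RHS]exchange_big /=; apply: eq_bigr => i _.
  by rewrite [RHS]exchange_big.
move=> f g h sf sg sh; rewrite !key//.
rewrite (S1sym f h g)// (S1sym h g f)// (S1sym g f h)//.
set A1 := \sum_i _; set A2 := \sum_i _; set A3 := \sum_i _.
suff : A1 + A2 + A3 = 0.
  move: (S1 f g h) (S1 g h f) (S1 h f g) => s1 s2 s3 <-.
  by move: (A1) (A2) (A3) => a1 a2 a3; ring.
have e2 : A2 = \sum_i \sum_k \sum_l
    (dgrad g p k 0 * dgrad h p l 0 * dgrad f p i 0 * X k l i).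
  exact: (rot (fun i k l => dgrad g p i 0 * dgrad h p k 0 * dgrad f p l 0 * X i k l)).
have e3 : A3 = \sum_i \sum_k \sum_l
    (dgrad h p l 0 * dgrad f p i 0 * dgrad g p k 0 * X l i k).
  pose F3 i k l := dgrad h p i 0 * dgrad f p k 0 * dgrad g p l 0 * X i k l.
  transitivity (\sum_i \sum_k \sum_l F3 k l i); first exact: (rot F3).
  exact: (rot (fun i k l => F3 k l i)).
rewrite e2 e3 /A1 -big_split -big_split; apply: big1 => i _ /=.
rewrite -big_split -big_split; apply: big1 => k _ /=.
rewrite -big_split -big_split; apply: big1 => l _ /=.
have := hJ i k l; rewrite -/(X i k l) -/(X k l i) -/(X l i k) => hX.
move: (dgrad f p i 0) (dgrad g p k 0) (dgrad h p l 0) (X i k l) (X k l i) (X l i k) hX.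
move=> u v w a1 a2 a3 hX; rewrite -[RHS](mulr0 (u * v * w)) -hX.
by ring.
Qed.

End PoissonTheory.

Section PoissonMaps.
Variables (R : realType) (K : numFieldType).
Hypothesis hK : real_or_complex R K.
Implicit Types M N : premanifold K.

Lemma bracket_prod_fst M N (bM : bivector M) (bN : bivector N) (f g : M -> K)
    (p : prodM M N) : charted M -> charted N -> mdiff f p.1 -> mdiff g p.1 ->
  @bracket K (prodM M N) (prodB bM bN) (fun x => f x.1) (fun x => g x.1) p =
  bracket bM f g p.1.
Proof.
move=> cM cN hf hg; rewrite !bracketE !dgrad_fst// tr_col_mx trmx0 /prodB.
by rewrite mul_row_block mul_row_col !(mulmx0, mul0mx, addr0).
Qed.

Lemma bracket_prod_snd M N (bM : bivector M) (bN : bivector N) (f g : N -> K)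
    (p : prodM M N) : charted M -> charted N -> mdiff f p.2 -> mdiff g p.2 ->
  @bracket K (prodM M N) (prodB bM bN) (fun x => f x.2) (fun x => g x.2) p =
  bracket bN f g p.2.
Proof.
move=> cM cN hf hg; rewrite !bracketE !dgrad_snd// tr_col_mx trmx0 /prodB.
by rewrite mul_row_block mul_row_col !(mulmx0, mul0mx, add0r).
Qed.

Lemma bracket_prod_mixed M N (bM : bivector M) (bN : bivector N) (f : M -> K)
    (g : N -> K) (p : prodM M N) : charted M -> charted N -> mdiff f p.1 -> mdiff g p.2 ->
  @bracket K (prodM M N) (prodB bM bN) (fun x => f x.1) (fun x => g x.2) p = 0 /\
  @bracket K (prodM M N) (prodB bM bN) (fun x => g x.2) (fun x => f x.1) p = 0.
Proof.
move=> cM cN hf hg; rewrite !bracketE !dgrad_snd// !dgrad_fst// !tr_col_mx !trmx0 /prodB.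
by rewrite !mul_row_block !mul_row_col !(mulmx0, mul0mx, addr0, add0r) mxE.
Qed.

(** By [jacobi_of_coords] it suffices to treat coordinates, each of which comes from one factor.
    Brackets across the factors vanish on a whole neighbourhood, so every mixed iterated bracket is
    zero. *)
Lemma poisson_prod M N (bM : bivector M) (bN : bivector N) :
  charted M -> charted N -> is_poisson bM -> is_poisson bN ->
  @is_poisson K (prodM M N) (prodB bM bN).
Proof.
move=> cM cN [aM sM jM] [aN sN jN]; have cMN := charted_prod cM cN.
have asym p : (prodB bM bN p)^T = - prodB bM bN p.
  by rewrite /prodB tr_block_mx !trmx0 aM aN opp_block_mx !oppr0.
pose b := prodB bM bN.
have cl (p : prodM M N) i : @coord K (prodM M N) p (lshift (mdim N) i) = (fun x => coord p.1 i x.1).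
  by apply/funext => x; rewrite /coord prod_chartE row_mxEl.
have cr (p : prodM M N) i : @coord K (prodM M N) p (rshift (mdim M) i) = (fun x => coord p.2 i x.2).
  by apply/funext => x; rewrite /coord prod_chartE row_mxEr.
have d1 (p : prodM M N) i : \forall x \near p, mdiff (coord p.1 i) x.1.
  have h : \forall y \near p.1, mdiff (coord p.1 i) y.
    apply: filterS (nbhs_cdom cM (cdom_refl p.1 cM)) => y py.
    exact/smoothf_mdiff/smoothf_coord.
  exact: (cvg_fst h).
have d2 (p : prodM M N) i : \forall x \near p, mdiff (coord p.2 i) x.2.
  have h : \forall y \near p.2, mdiff (coord p.2 i) y.
    apply: filterS (nbhs_cdom cN (cdom_refl p.2 cN)) => y py.
    exact/smoothf_mdiff/smoothf_coord.
  exact: (cvg_snd h).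
have ll (p : prodM M N) i j : {near p, @bracket K (prodM M N) b (fun x => coord p.1 i x.1)
    (fun x => coord p.1 j x.1) =1 (fun x => bracket bM (coord p.1 i) (coord p.1 j) x.1)}.
  by apply: filterS2 (d1 p i) (d1 p j) => x h1 h2; exact: bracket_prod_fst.
have rr (p : prodM M N) i j : {near p, @bracket K (prodM M N) b (fun x => coord p.2 i x.2)
    (fun x => coord p.2 j x.2) =1 (fun x => bracket bN (coord p.2 i) (coord p.2 j) x.2)}.
  by apply: filterS2 (d2 p i) (d2 p j) => x h1 h2; exact: bracket_prod_snd.
have lr (p : prodM M N) i j : {near p, @bracket K (prodM M N) b (fun x => coord p.1 i x.1)
    (fun x => coord p.2 j x.2) =1 (fun=> 0)}.
  apply: filterS2 (d1 p i) (d2 p j) => x h1 h2.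
  by case: (bracket_prod_mixed bM bN cM cN h1 h2).
have rl (p : prodM M N) i j : {near p, @bracket K (prodM M N) b (fun x => coord p.2 i x.2)
    (fun x => coord p.1 j x.1) =1 (fun=> 0)}.
  apply: filterS2 (d2 p i) (d1 p j) => x h1 h2.
  by case: (bracket_prod_mixed bM bN cM cN h2 h1).
have near_sym (f g : prodM M N -> K) (p : prodM M N) : {near p, f =1 g} -> {near p, g =1 f}.
  by apply: filterS => x /esym.
have sc1 (p : M) i : smoothf_at (coord p i) p.
  exact/smoothf_coord/cdom_refl.
have sc2 (p : N) i : smoothf_at (coord p i) p.
  exact/smoothf_coord/cdom_refl.
have sb1 (p : M) i j : smoothf_at (bracket bM (coord p i) (coord p j)) p by exact: sM.
have sb2 (p : N) i j : smoothf_at (bracket bN (coord p i) (coord p j)) p by exact: sN.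
have sb (p : prodM M N) k l : smoothf_at (@bracket K (prodM M N) b (coord p k) (coord p l)) p.
  case: (split_ordP k) => i ->; case: (split_ordP l) => j ->; rewrite ?cl ?cr.
  - apply: (smoothf_near cMN (near_sym _ _ _ (ll p i j))).
    exact: (smoothf_comp cMN cM (smooth_at_fst p cM cN) (sb1 p.1 i j)).
  - by apply: (smoothf_near cMN (near_sym _ _ _ (lr p i j))); exact: smoothf_cst.
  - by apply: (smoothf_near cMN (near_sym _ _ _ (rl p i j))); exact: smoothf_cst.
  - apply: (smoothf_near cMN (near_sym _ _ _ (rr p i j))).
    exact: (smoothf_comp cMN cN (smooth_at_snd p cM cN) (sb2 p.2 i j)).
split=> //.
  by move=> p f g sf sg; exact: smoothf_bracket.
move=> p; apply: (jacobi_of_coords hK) => // i k l.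
have B0 (u : prodM M N -> K) (f g : prodM M N -> K) : {near p, f =1 g} ->
    @bracket K (prodM M N) b u f p = @bracket K (prodM M N) b u g p.
  by move=> fg; exact: (bracket_near b cMN (near_refl u p) fg).
have m1 i' : mdiff (coord p.1 i') p.1 by exact: smoothf_mdiff.
have m2 i' : mdiff (coord p.2 i') p.2 by exact: smoothf_mdiff.
have n1 i' j' : mdiff (bracket bM (coord p.1 i') (coord p.1 j')) p.1 by exact: smoothf_mdiff.
have n2 i' j' : mdiff (bracket bN (coord p.2 i') (coord p.2 j')) p.2 by exact: smoothf_mdiff.
pose Lf i' : prodM M N -> K := fun x => coord p.1 i' x.1.
pose Rf i' : prodM M N -> K := fun x => coord p.2 i' x.2.
pose BB : (prodM M N -> K) -> (prodM M N -> K) -> prodM M N -> K := @bracket K (prodM M N) b.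
have tLLL a c d : BB (Lf a) (BB (Lf c) (Lf d)) p =
    bracket bM (coord p.1 a) (bracket bM (coord p.1 c) (coord p.1 d)) p.1.
  by rewrite /BB (B0 _ _ _ (ll p c d)); exact: bracket_prod_fst.
have tRRR a c d : BB (Rf a) (BB (Rf c) (Rf d)) p =
    bracket bN (coord p.2 a) (bracket bN (coord p.2 c) (coord p.2 d)) p.2.
  by rewrite /BB (B0 _ _ _ (rr p c d)); exact: bracket_prod_snd.
have tRLL a c d : BB (Rf a) (BB (Lf c) (Lf d)) p = 0.
  rewrite /BB (B0 _ _ _ (ll p c d)).
  exact: (bracket_prod_mixed bM bN cM cN (n1 _ _) (m2 _)).2.
have tLRR a c d : BB (Lf a) (BB (Rf c) (Rf d)) p = 0.
  rewrite /BB (B0 _ _ _ (rr p c d)).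
  exact: (bracket_prod_mixed bM bN cM cN (m1 _) (n2 _ _)).1.
have tLR u c d : BB u (BB (Lf c) (Rf d)) p = 0.
  by rewrite /BB (B0 _ _ _ (lr p c d)) bracket_cst_r.
have tRL u c d : BB u (BB (Rf c) (Lf d)) p = 0.
  by rewrite /BB (B0 _ _ _ (rl p c d)) bracket_cst_r.
have clp j : @coord K (prodM M N) p (lshift (mdim N) j) = Lf j by exact: cl.
have crp j : @coord K (prodM M N) p (rshift (mdim M) j) = Rf j by exact: cr.
suff gen u v w : (exists j, u = Lf j) \/ (exists j, u = Rf j) ->
    (exists j, v = Lf j) \/ (exists j, v = Rf j) ->
    (exists j, w = Lf j) \/ (exists j, w = Rf j) ->
    BB u (BB v w) p + BB v (BB w u) p + BB w (BB u v) p = 0.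
  have hc j : (exists m, @coord K (prodM M N) p j = Lf m) \/
              (exists m, @coord K (prodM M N) p j = Rf m).
    case: (split_ordP j) => m ->; [left | right]; exists m; [exact: clp | exact: crp].
  exact: (gen _ _ _ (hc i) (hc k) (hc l)).
clear - tLLL tRRR tRLL tLRR tLR tRL jM jN sc1 sc2.
move=> [[i ->]|[i ->]] [[k ->]|[k ->]] [[l ->]|[l ->]].
- by rewrite !tLLL; exact: jM.
- by rewrite tLR tRL tRLL !addr0.
- by rewrite tRL tRLL tLR !addr0.
- by rewrite tLRR tRL tLR !addr0.
- by rewrite tRLL tLR tRL !addr0.
- by rewrite tLR tLRR tRL !addr0.
- by rewrite tRL tLR tLRR !addr0.
- by rewrite !tRRR; exact: jN.
Qed.

Lemma bracket_push M N (bM : bivector M) (bN : bivector N) (s : M -> N) f g p :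
  charted M -> charted N -> smooth_at s p -> push (jac s p) (bM p) = bN (s p) ->
  mdiff f (s p) -> mdiff g (s p) ->
  bracket bM (f \o s) (g \o s) p = bracket bN f g (s p).
Proof.
move=> cM cN ss e hf hg; rewrite !bracketE (dgrad_comp cM cN ss hf) (dgrad_comp cM cN ss hg) -e /push trmx_mul.
by rewrite !mulmxA.
Qed.

(** Brackets on [N] are those of pulled back functions on [M], restricted along the section [u].
    With source and units in the roles of [s] and [u], the Jacobi identity for the mixed product on
    the base follows from that of the product above it. *)
Lemma poisson_pushforward M N (bM : bivector M) (bN : bivector N)
    (s : M -> N) (u : N -> M) : charted M -> charted N ->
  smooth s -> smooth u -> (forall q, s (u q) = q) ->
  (forall p, push (jac s p) (bM p) = bN (s p)) ->
  is_poisson bM -> is_poisson bN.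
Proof.
move=> cM cN ss su sK pK [aM sM jM].
have bE p f g : mdiff f (s p) -> mdiff g (s p) ->
    bracket bM (f \o s) (g \o s) p = bracket bN f g (s p).
  by move=> hf hg; apply: bracket_push.
have comp (f : N -> K) p : smoothf_at f (s p) -> smoothf_at (f \o s) p.
  by move=> sf; apply: smoothf_comp.
have nearB p f g : smoothf_at f (s p) -> smoothf_at g (s p) ->
    {near p, bracket bM (f \o s) (g \o s) =1 bracket bN f g \o s}.
  move=> sf sg.
  have nf : \forall a \near p, smoothf_at f (s a).
    have [cs _] := ss p; exact: cs (smoothf_at_near cN sf).
  have ng : \forall a \near p, smoothf_at g (s a).
    have [cs _] := ss p; exact: cs (smoothf_at_near cN sg).
  by apply: filterS2 nf ng => a ha hb; apply: bE; exact: smoothf_mdiff.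
have sB q f g : smoothf_at f q -> smoothf_at g q -> smoothf_at (bracket bN f g) q.
  rewrite -{1 2}(sK q) => sf sg.
  have nq : {near q, bracket bM (f \o s) (g \o s) \o u =1 bracket bN f g}.
    have [cu _] := su q.
    have h : \forall a \near q, bracket bM (f \o s) (g \o s) (u a) =
        (bracket bN f g \o s) (u a) := cu _ (nearB _ _ _ sf sg).
    by apply: filterS h => a /= ->; rewrite sK.
  apply: (smoothf_near cN nq); apply: (smoothf_comp cN cM (su q)).
  by apply: sM; exact: comp.
split=> //.
- by move=> q; rewrite -(sK q) -pK /push !trmx_mul trmxK aM mulNmx mulmxN mulmxA.
- move=> q f g h; rewrite -{1 2 3}(sK q) => sf sg sh.
  have JJ f' g' h' : smoothf_at f' (s (u q)) -> smoothf_at g' (s (u q)) ->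
      smoothf_at h' (s (u q)) ->
      bracket bM (f' \o s) (bracket bM (g' \o s) (h' \o s)) (u q) =
      bracket bN f' (bracket bN g' h') q.
    move=> hf hg hh.
    rewrite (bracket_near bM cM (near_refl (f' \o s) (u q)) (nearB _ _ _ hg hh)).
    by rewrite (bE _ _ _ (smoothf_mdiff hf) (smoothf_mdiff (sB _ _ _ hg hh))) sK.
  rewrite -!JJ//; apply: jM; exact: comp.
Qed.

End PoissonMaps.

(** * Metrizability and shrinking of products *)

Definition metrizes (R : realType) (T : topologicalType) (d : T -> T -> R) : Prop :=
  [/\ (forall x, d x x = 0), (forall x y, d x y = d y x),
      (forall x y z, d x z <= d x y + d y z),
      (forall x e, 0 < e -> \forall y \near x, d x y < e)
    & (forall x (U : set T), nbhs x U -> exists2 e, 0 < e & forall y, d x y < e -> U y)].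

Section Metrization.
Variable R : realType.

(** The metric is the supremum of the weighted differences of the [F n]. The weights tend to 0, so
    near a point only finitely many functions matter and the metric is continuous; the last
    hypothesis makes its balls small. *)
Lemma metrizes_of_functions (T : topologicalType) (F : nat -> T -> R) :
  (forall n, continuous (F n)) -> (forall n x, 0 <= F n x <= 1) ->
  (forall x (U : set T), nbhs x U ->
     exists n, 0 < F n x /\ forall y, 0 < F n y -> U y) ->
  exists d : T -> T -> R, metrizes d.
Proof.
move=> cF F01 sep; pose w (n : nat) : R := n.+1%:R^-1.
have w0 n : 0 < w n by rewrite invr_gt0.
have w1 n : w n <= 1 by rewrite invf_le1// ler1n.
pose S x y := [set w n * `|F n x - F n y| | n in [set: nat]].
pose d x y := sup (S x y).
have Fle n x y : `|F n x - F n y| <= 1.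
  by move: (F01 n x) (F01 n y) => /andP[a b] /andP[c e]; rewrite ler_norml; lra.
have ub x y : ubound (S x y) 1.
  by move=> _ [n _ <-]; rewrite mulr_ile1// ltW.
have S0 x y : S x y !=set0 by exists (w 0%N * `|F 0%N x - F 0%N y|), 0%N.
have hs x y : has_sup (S x y) by split=> //; exists 1.
have dge n x y : w n * `|F n x - F n y| <= d x y.
  by apply: sup_upper_bound => //; exists n.
have dle x y c : (forall n, w n * `|F n x - F n y| <= c) -> d x y <= c.
  by move=> h; apply: ge_sup => // _ [n _ <-].
have dge0 x y : 0 <= d x y.
  by apply: le_trans (dge 0%N x y); rewrite mulr_ge0// ltW.
exists d; split.
- move=> x; apply/eqP; rewrite eq_le dge0 andbT; apply: dle => n.
  by rewrite subrr normr0 mulr0.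
- move=> x y; congr sup; apply/seteqP; split=> _ [n _ <-]; exists n => //;
  by rewrite distrC.
- move=> x y z; apply: dle => n.
  apply: le_trans (lerD (dge n x y) (dge n y z)).
  rewrite -mulrDr ler_wpM2l ?(ltW (w0 n))//.
  have -> : F n x - F n z = (F n x - F n y) + (F n y - F n z) by ring.
  exact: ler_normD.
- move=> x e e0; have e2 : 0 < e / 2 by rewrite divr_gt0.
  (* From the index [N] on the weights are at most e / 2, and the differences are at most 1. *)
  pose N := Num.truncn (e / 2)^-1.
  have hN n : (N <= n)%N -> w n <= e / 2.
    move=> Nn; rewrite /w -[leRHS]invrK lef_pV2 ?posrE ?invr_gt0//.
    apply: ltW; apply: lt_le_trans (truncnS_gt _) _.
    by rewrite ler_nat.
  have h : \forall y \near x, forall i : 'I_N, `|F i x - F i y| < e / 2.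
    apply: filter_forall => i.
    by have /cvgrPdist_lt := cF i x; exact.
  apply: filterS h => y hy; apply: (@le_lt_trans _ _ (e / 2)); last first.
    by rewrite ltr_pdivrMr// ltr_pMr// ltr1n.
  apply: dle => n; have [nN|Nn] := ltnP n N.
    apply: le_trans (ltW (hy (Ordinal nN))).
    by rewrite -[leRHS]mul1r ler_wpM2r.
  by rewrite -[leRHS]mulr1 ler_pM// ?(ltW (w0 n))// hN.
- move=> x U Ux; have [n [F0 hU]] := sep x U Ux.
  exists (w n * F n x); first exact: mulr_gt0.
  move=> y dy; apply: hU.
  have := le_lt_trans (dge n x y) dy; rewrite ltr_pM2l//.
  rewrite ltr_norml => /andP[_]; lra.
Qed.

Lemma metrizes_prod (S T : topologicalType) (d : S -> S -> R) (d' : T -> T -> R) :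
  metrizes d -> metrizes d' ->
  metrizes (fun x y : S * T => Num.max (d x.1 y.1) (d' x.2 y.2)).
Proof.
move=> [z s t n u] [z' s' t' n' u']; split.
- by move=> x; rewrite z z' maxxx.
- by move=> x y; rewrite s s'.
- move=> x y w; rewrite ge_max; apply/andP; split.
    by apply: le_trans (t _ y.1 _) _; apply: lerD; rewrite le_max lexx.
  by apply: le_trans (t' _ y.2 _) _; apply: lerD; rewrite le_max lexx orbT.
- move=> x e e0.
  have h1 : \forall y \near x, d x.1 y.1 < e by exact: (cvg_fst (n x.1 e e0)).
  have h2 : \forall y \near x, d' x.2 y.2 < e by exact: (cvg_snd (n' x.2 e e0)).
  by apply: filterS2 h1 h2 => y a b; rewrite gt_max a b.
- move=> x U [[P Q] [/= Px Qx] PQ].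
  have [e e0 he] := u _ _ Px; have [e' e'0 he'] := u' _ _ Qx.
  exists (Num.min e e'); first by rewrite lt_min e0 e'0.
  move=> y; rewrite gt_max !lt_min => /andP[/andP[a _] /andP[_ b]].
  by apply: PQ; split; [exact: he | exact: he'].
Qed.

Variable K : numFieldType.
Hypothesis hK : real_or_complex R K.

(** A truncated distance in the chart, extended by zero. The Hausdorff property makes the compact
    chart ball closed, and that makes the extension continuous at points outside the chart. *)
Lemma bump_function (M : premanifold K) (q : M) (U : set M) : is_manifold M ->
  nbhs q U -> exists g : M -> R, [/\ continuous g, (forall x, 0 <= g x <= 1), 0 < g q
    & forall x, 0 < g x -> U x].
Proof.
move=> mM Uq; have cM := manifold_charted mM; have [hM _ _] := mM.
have [nu [io [cnu nuD numono ioK ior]]] := real_part hK.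
have nu0 : nu 0 = 0 by have := nuD 0 0; rewrite addr0; lra.
have qq := cdom_refl q cM.
have := filterI (near_chart_image cM qq) (near_cinv cM qq Uq).
move=> /(_ _) /nbhs_ballP[e /= e0 he].
(* Any radius strictly below [e] would do: the closed ball must stay in the open one. *)
pose r := e / (e + 1).
have e10 : 0 < e + 1 by rewrite addr_gt0.
have r0 : 0 < r by rewrite divr_gt0.
have re : r < e by rewrite ltr_pdivrMr// mulrDr mulr1 ltrDr mulr_gt0.
pose C := cinv q @` [set v | `|v - chart q q| <= r].
have inball v : `|v - chart q q| <= r -> ball (chart q q) e v.
  by move=> h; rewrite -ball_normE /= distrC (le_lt_trans h).
have cC : compact C.
  apply: continuous_compact.
    apply/continuous_in_subspaceT => v /set_mem hv.
    have [[p' hp' <-] _] := he v (inball v hv).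
    exact: cinv_continuous.
  have -> : [set v | `|v - chart q q| <= r] =
      (fun v => v + chart q q) @` [set v | `|v| <= r].
    apply/seteqP; split=> v /=.
      by move=> h; exists (v - chart q q); rewrite ?subrK.
    by move=> [v' h <-]; rewrite addrK.
  apply: continuous_compact; last exact: (ball_compact hK (ltW r0)).
  apply/continuous_in_subspaceT => v _.
  by apply: (@continuousD _ _ _ id (cst (chart q q))); [exact: cvg_id | exact: cst_continuous].
have clC : closed C by exact: compact_closed.
pose c := nu r.
have nupos a : 0 < a -> 0 < nu a.
  move=> a0; have := numono a 0 (ger0_real (ltW a0)) (real0 _).
  by rewrite nu0 (lt_geF a0) ltNge => ->.
have c0 : 0 < c by exact: nupos.
pose g x : R := if `[< cdom q x >] then
   Num.max 0 (nu (r - `|chart q x - chart q q|) / c) else 0.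
have nuN a : nu (- a) = - nu a by have := nuD a (- a); rewrite subrr nu0; lra.
have gpos x : 0 < g x -> cdom q x /\ `|chart q x - chart q q| <= r.
  rewrite /g; case: asboolP => [qx|_]; last by rewrite ltxx.
  rewrite lt_max ltxx /= pmulr_lgt0 ?invr_gt0// => h; split=> //.
  rewrite -numono ?normr_real ?ger0_real ?(ltW r0)//.
  by move: h; rewrite nuD nuN -/c; lra.
exists g; split.
- move=> x; have [qx|nqx] := pselect (cdom q x).
    have gE : {near x, (fun y => Num.max 0 (nu (r - `|chart q y - chart q q|) / c)) =1 g}.
      by apply: filterS (nbhs_cdom cM qx) => y qy; rewrite /g; case: asboolP.
    apply: near_eq_continuous gE _.
    apply: (@continuous_comp _ _ _ (fun y => nu (r - `|chart q y - chart q q|) / c)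
      (fun z => Num.max 0 z)); last first.
      by apply: continuous_max; [exact: cst_continuous | exact: cvg_id].
    apply: continuousM; last exact: cst_continuous.
    apply: (@continuous_comp _ _ _ (fun y => r - `|chart q y - chart q q|) nu); last exact: cnu.
    apply: (@continuousB _ _ _ (cst r)); first exact: cst_continuous.
    apply: (@continuous_comp _ _ _ (fun y => chart q y - chart q q) (fun v => `|v|)).
      apply: (@continuousB _ _ _ (chart q) (cst (chart q q))); last exact: cst_continuous.
      exact: chart_continuous.
    exact: norm_continuous.
  have nC : \forall y \near x, ~ C y.
    apply: open_nbhs_nbhs; split; first exact: closed_openC.
    move=> [v hv xe]; apply: nqx; rewrite -xe.
    have [im _] := he v (inball v hv).
    by case: (cinvK cM im).
  have gE : {near x, (fun=> 0) =1 g}.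
    apply: filterS nC => y nCy; apply/eqP; rewrite eq_sym eq_le; apply/andP; split.
      rewrite leNgt; apply/negP => /gpos[qy hy]; apply: nCy.
      by exists (chart q y) => //; exact: chartK.
    by rewrite /g; case: asboolP => // _; rewrite le_max lexx.
  by apply: near_eq_continuous gE _; exact: cst_continuous.
- move=> x; rewrite /g; case: asboolP => [_|_]; last by rewrite lexx ler01.
  rewrite le_max lexx /= ge_max ler01 /= ler_pdivrMr// mul1r.
  rewrite numono ?realB ?normr_real ?ger0_real ?(ltW r0)//.
  by rewrite gerBl.
- rewrite /g; case: asboolP => // _; rewrite subrr normr0 subr0 -/c.
  by rewrite lt_max divr_gt0// orbT.
- move=> x /gpos[qx hx]; have [_] := he _ (inball _ hx).
  by rewrite chartK.
Qed.

(** As in the theorem of Urysohn: for each of the countably many pairs of basic open sets one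
    function is chosen that is positive on the first and supported in the second, if there is one.
    Bump functions show that enough pairs admit one. *)
Lemma manifold_metrizable (M : premanifold K) : is_manifold M ->
  exists d : M -> M -> R, metrizes d.
Proof.
move=> mM; have [_ [B cB [oB bB]] _] := mM.
have [e he] : exists e : nat -> set M, forall b, B b -> exists n, e n = b.
  have [->|[f]] := pfcard_geP cB; first by exists (fun=> set0).
  exists f => b Bb; have [n _ <-] := @surj _ _ _ _ f b Bb.
  by exists n.
pose good i j (g : M -> R) := [/\ continuous g, (forall x, 0 <= g x <= 1),
  (forall x, e i x -> 0 < g x) & (forall x, 0 < g x -> e j x)].
pose ij (n : nat) : nat * nat := odflt (0%N, 0%N) (unpickle n).
have /choice[G hG] : forall n : nat, exists g : M -> R,
    [/\ continuous g, (forall x, 0 <= g x <= 1) &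
        (exists g', good (ij n).1 (ij n).2 g') -> good (ij n).1 (ij n).2 g].
  move=> n; have [[g gg]|no] := pselect (exists g', good (ij n).1 (ij n).2 g').
    by exists g; case: (gg).
  exists (fun=> 0); split=> // [|x]; first exact: cst_continuous.
  by rewrite lexx ler01.
apply: (@metrizes_of_functions M G) => [n|n|x U Ux].
- by case: (hG n).
- by case: (hG n).
have [V [BV Vx] VU] := bB x U Ux.
have nV : nbhs x V by apply: open_nbhs_nbhs; split=> //; exact: oB.
have [g [cg g01 gx gV]] := bump_function mM nV.
have ng : nbhs x [set y | 0 < g y].
  exact: (cg x _ (lt_nbhsr gx)).
have [V' [BV' V'x] V'g] := bB x _ ng.
have [j ej] := he _ BV; have [i ei] := he _ BV'.
pose n := pickle (i, j).
have ijn : ij n = (i, j) by rewrite /ij /n pickleK.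
have [_ _ hn] := hG n; move: hn; rewrite ijn /= => hn.
have [|_ _ h1 h2] := hn.
  by exists g; split=> // y; [rewrite ei; exact: V'g | rewrite ej; exact: gV].
exists n; split; first by apply: h1; rewrite ei.
by move=> y /h2; rewrite ej; exact: VU.
Qed.

End Metrization.

(* Near a degenerate triple two of the three entries are close to units.  The
   radius [rad a] of the allowed neighbourhood is 1-Lipschitz for a metric for
   which [l] and [r] do not increase distances; pairs are kept when one entry is
   close to a unit relatively to the radius of the other. *)
Lemma shrink_multiplication (R : realType) (A : topologicalType) (d0 : A -> A -> R)
    (l r : A -> A) (m : A -> A -> A) (D : set (A * A)) (N : set (A * A * A)) :
  metrizes d0 -> continuous l -> continuous r ->
  (forall a, l (l a) = l a) -> (forall a, l (r a) = r a) ->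
  (forall a, r (l a) = l a) -> (forall a, r (r a) = r a) ->
  (forall a b, D (a, b) -> [/\ r a = l b, l (m a b) = l a & r (m a b) = r b]) ->
  (forall a b (B : set A), D (a, b) -> nbhs (m a b) B ->
     \forall q \near (a, b), D q -> B (m q.1 q.2)) ->
  (forall a, D (l a, a)) -> (forall a, D (a, r a)) ->
  (forall a, m (l a) a = a) -> (forall a, m a (r a) = a) ->
  (forall a, nbhs (l a, l a, a) N) -> (forall a, nbhs (l a, a, r a) N) ->
  (forall a, nbhs (a, r a, r a) N) ->
  exists W : set (A * A),
  [/\ W `<=` D, (forall q, W q -> \forall q' \near q, D q' -> W q'),
      (forall a, W (l a, a)), (forall a, W (a, r a))
    & forall a b c, W (a, b) -> W (m a b, c) -> W (b, c) -> W (a, m b c) ->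
        N (a, b, c)].
Proof.
move=> md0 cl cr ll lr rl rr Dc Dm Dl Dr ml mr N1 N2 N3.
have [z0 s0 t0 n0 u0] := md0.
(* Both maps [l] and [r] have the units as image and fix them, so taking this maximum makes each of
   them 1-Lipschitz. *)
pose d x y := Num.max (d0 x y) (Num.max (d0 (l x) (l y)) (d0 (r x) (r y))).
have dge x y : d0 x y <= d x y by rewrite le_max lexx.
have d_l x y : d (l x) (l y) <= d x y.
  by rewrite {1}/d ll ll rl rl !ge_max /d !le_max !lexx !orbT.
have d_r x y : d (r x) (r y) <= d x y.
  by rewrite {1}/d lr lr rr rr !ge_max /d !le_max !lexx !orbT.
have zd x : d x x = 0 by rewrite /d !z0 !maxxx.
have sd x y : d x y = d y x by rewrite /d (s0 x) (s0 (l x)) (s0 (r x)).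
have td x y z : d x z <= d x y + d y z.
  rewrite /d !ge_max; apply/and3P; split; [apply: le_trans (t0 _ y _) _|
    apply: le_trans (t0 _ (l y) _) _|apply: le_trans (t0 _ (r y) _) _];
    by apply: lerD; rewrite !le_max lexx ?orbT.
have d_ge0 x y : 0 <= d x y by have := td x y x; rewrite zd (sd y x); lra.
have nd x e : 0 < e -> \forall y \near x, d x y < e.
  move=> e0; have h1 := n0 x e e0.
  have h2 : \forall y \near x, d0 (l x) (l y) < e := cl x _ (n0 (l x) e e0).
  have h3 : \forall y \near x, d0 (r x) (r y) < e := cr x _ (n0 (r x) e e0).
  by apply: filterS3 h1 h2 h3 => y a b c; rewrite /d !gt_max a b c.
have ud x U : nbhs x U -> exists2 e, 0 < e & forall y, d x y < e -> U y.
  move=> /u0[e e0 h]; exists e => // y dy; apply: h; exact: le_lt_trans (dge x y) dy.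
pose good a s := forall a1 a2 a3,
  [\/ [/\ d (l a) a1 < s, d (l a) a2 < s & d a a3 < s],
      [/\ d (l a) a1 < s, d a a2 < s & d (r a) a3 < s]
    | [/\ d a a1 < s, d (r a) a2 < s & d (r a) a3 < s]] -> N (a1, a2, a3).
have tri x y z (U : set (A * A * A)) : nbhs (x, y, z) U -> exists2 e, 0 < e &
    forall x' y' z', d x x' < e -> d y y' < e -> d z z' < e -> U (x', y', z').
  move=> [[P Q] [/= [[P1 P2] [/= P1x P2y] PP] Qz] PQ].
  have [e1 e10 h1] := ud _ _ P1x; have [e2 e20 h2] := ud _ _ P2y.
  have [e3 e30 h3] := ud _ _ Qz.
  exists (Num.min e1 (Num.min e2 e3)); first by rewrite !lt_min e10 e20.
  move=> x' y' z'; rewrite !lt_min => /and3P[a _ _] /and3P[_ b _] /and3P[_ _ c].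
  by apply: PQ; split; [apply: PP; split; [exact: h1 | exact: h2] | exact: h3].
have good_ex a : exists2 s, 0 < s <= 1 & good a s.
  have [e1 e10 h1] := tri _ _ _ _ (N1 a); have [e2 e20 h2] := tri _ _ _ _ (N2 a).
  have [e3 e30 h3] := tri _ _ _ _ (N3 a).
  pose e := Num.min (Num.min e1 1) (Num.min e2 e3).
  exists e; first by rewrite /e !lt_min !ge_min !e10 !e20 !e30 ltr01 lexx !orbT.
  move=> a1 a2 a3 [] [h h' h''].
  - by apply: h1; apply: lt_le_trans; try eassumption; rewrite /e !ge_min lexx.
  - by apply: h2; apply: lt_le_trans; try eassumption; rewrite /e !ge_min lexx !orbT.
  - by apply: h3; apply: lt_le_trans; try eassumption; rewrite /e !ge_min lexx !orbT.
(* The cutoff at 1 keeps the supremum finite where every radius is good. *)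
pose S a := [set s | 0 <= s <= 1 /\ good a s].
have Shs a : has_sup (S a).
  have [s /andP[s_gt0 s1] gs] := good_ex a.
  split; first by exists s; split=> //; rewrite (ltW s_gt0).
  by exists 1 => y [/andP[_ +] _].
pose rad a := sup (S a).
have rad0 a : 0 < rad a.
  have [s /andP[s_gt0 s1] gs] := good_ex a.
  apply: (lt_le_trans s_gt0); apply: sup_upper_bound => //.
  by split=> //; rewrite s1 andbT ltW.
have radN a a1 a2 a3 :
    [\/ [/\ d (l a) a1 < rad a, d (l a) a2 < rad a & d a a3 < rad a],
        [/\ d (l a) a1 < rad a, d a a2 < rad a & d (r a) a3 < rad a]
      | [/\ d a a1 < rad a, d (r a) a2 < rad a & d (r a) a3 < rad a]] -> N (a1, a2, a3).
  have H x y z : x < rad a -> y < rad a -> z < rad a ->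
      exists2 s, good a s & [/\ x < s, y < s & z < s].
    move=> xr yr zr; pose M := Num.max x (Num.max y z).
    have Mr : M < rad a by rewrite /M !gt_max xr yr.
    have e0 : 0 < rad a - M by rewrite subr_gt0.
    have [s [_ gs]] := sup_adherent e0 (Shs a); rewrite -/(rad a) subKr => Ms.
    exists s => //; move: Ms; rewrite /M !gt_max => /and3P[? ? ?].
    by split.
  by move=> [] [h1 h2 h3]; have [s gs [? ? ?]] := H _ _ _ h1 h2 h3; apply: gs;
    [apply: Or31|apply: Or32|apply: Or33].
have radL a b : rad a <= rad b + d a b.
  apply: ge_sup; first by case: (Shs a).
  move=> s [/andP[s_ge0 s1] gs]; have [sd'|ds] := leP s (d a b).
    by apply: le_trans sd' _; rewrite lerDr ltW.
  rewrite -lerBlDr; apply: sup_upper_bound => //; split.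
    by have := d_ge0 a b; lra.
  have step x y z : d x y <= d a b -> d y z < s - d a b -> d x z < s.
    by have := td x y z; clear; lra.
  have la := d_l a b; have ra := d_r a b.
  move=> a1 a2 a3 h; apply: gs; case: h => -[h1 h2 h3].
  - by apply: Or31; split; apply: step; try eassumption.
  - by apply: Or32; split; apply: step; try eassumption.
  - by apply: Or33; split; apply: step; try eassumption.
(* A crude margin: the estimates below add a few distances, each controlled by [k] times a radius,
   and compare the sum with one full radius. *)
pose k : R := 1 / 100.
pose w a := d a (l a) + d a (r a).
pose W1 q := w q.1 < k * rad q.2 /\ d (m q.1 q.2) q.2 < k * rad q.2.
pose W2 q := w q.2 < k * rad q.1 /\ d (m q.1 q.2) q.1 < k * rad q.1.
exists [set q | D q /\ (W1 q \/ W2 q)]; split.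
- by move=> q [].
- move=> [a b] [Dab Wab].
  (* The room left in the strict inequalities of whichever alternative holds. Moving the two entries
     and their product by a tenth of it keeps the same alternative. *)
  pose slack := Num.min 1 (if pselect (W1 (a, b)) is left _ then
     Num.min (k * rad b - w a) (k * rad b - d (m a b) b) else
     Num.min (k * rad a - w b) (k * rad a - d (m a b) a)).
  have sl0 : 0 < slack.
    rewrite /slack; case: pselect => [[/= h1 h2]|nW].
      by rewrite !lt_min ltr01 !subr_gt0 h1 h2.
    case: Wab => // -[/= h1 h2].
    by rewrite !lt_min ltr01 !subr_gt0 h1 h2.
  have e0 : 0 < slack / 10 by lra.
  have h1 : \forall q \near (a, b), d a q.1 < slack / 10.
    exact: (cvg_fst (nd a _ e0)).
  have h2 : \forall q \near (a, b), d b q.2 < slack / 10.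
    exact: (cvg_snd (nd b _ e0)).
  have h3 := Dm _ _ _ Dab (nd (m a b) _ e0).
  apply: filterS3 h1 h2 h3 => -[a' b'] /= ha hb hm Dab'.
  split=> //; have {}hm := hm Dab'.
  have p1 := d_l a a'; have p2 := d_r a a'; have p3 := d_l b b'; have p4 := d_r b b'.
  have q1 := td a' a (l a'); have q2 := td a (l a) (l a').
  have q3 := td a' a (r a'); have q4 := td a (r a) (r a').
  have q5 := td b' b (l b'); have q6 := td b (l b) (l b').
  have q7 := td b' b (r b'); have q8 := td b (r b) (r b').
  have r1 := td (m a' b') (m a b) b'; have r2 := td (m a b) b b'.
  have r3 := td (m a' b') (m a b) a'; have r4 := td (m a b) a a'.
  have v1 := radL b b'; have v2 := radL a a'.
  have sa := sd a a'; have sb := sd b b'; have sm := sd (m a b) (m a' b').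
  move: sl0 ha hb hm; rewrite /slack; case: pselect => [[/= g1 g2]|nW].
    set s := Num.min _ _ => sp ha hb hm; left; rewrite /W1 /=.
    have sl1 : s <= k * rad b - w a by rewrite /s !ge_min lexx !orbT.
    have sl2 : s <= k * rad b - d (m a b) b by rewrite /s !ge_min lexx !orbT.
    by split; rewrite /w /k in sl1 sl2 *; lra.
  have [/= g1 g2] : W2 (a, b) by case: Wab => // /nW.
  set s := Num.min _ _ => sp ha hb hm; right; rewrite /W2 /=.
  have sl1 : s <= k * rad a - w b by rewrite /s !ge_min lexx !orbT.
  have sl2 : s <= k * rad a - d (m a b) a by rewrite /s !ge_min lexx !orbT.
  by split; rewrite /w /k in sl1 sl2 *; lra.
- move=> a; split; first exact: Dl.
  have ra := rad0 a.
  by left; rewrite /W1 /= /w ll rl ml !zd /k; split; lra.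
- move=> a; split; first exact: Dr.
  have ra := rad0 a.
  by right; rewrite /W2 /= /w lr rr mr !zd /k; split; lra.
- move=> a b c [Dab Wab] [Dab_c Wab_c] [Dbc Wbc] [Da_bc Wa_bc].
  have [rab lmab rmab] := Dc _ _ Dab; have [rbc lmbc rmbc] := Dc _ _ Dbc.
  set ab := m a b in Wab_c lmab rmab Wab *; set bc := m b c in Wa_bc lmbc rmbc Wbc *.
  have a0 := rad0 a; have b0 := rad0 b; have c0 := rad0 c.
  have around_a : d b (l b) < rad a -> d c (l b) < rad a -> N (a, b, c).
    move=> h1 h2; apply: (radN a); apply: Or33; rewrite zd rab.
    by split=> //; rewrite sd.
  have around_c : d a (l c) < rad c -> d b (l c) < rad c -> N (a, b, c).
    move=> h1 h2; apply: (radN c); apply: Or31; rewrite zd.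
    by split=> //; rewrite sd.
  have around_b : d a (l b) < rad b -> d c (l c) < rad b -> N (a, b, c).
    move=> h1 h2; apply: (radN b); apply: Or32; rewrite zd rbc.
    by split=> //; rewrite sd.
  have L1 := radL bc c; have L2 := radL ab a; have L3 := radL b c.
  have L4 := radL a b; have L5 := radL b a; have L6 := radL c b; have L7 := radL a c.
  have S1 := sd b c; have S2 := sd a b; have S3 := sd b (l b); have S4 := sd b (l c).
  have S5 := sd bc (l b); have S9 := sd c (l c); have S10 := sd ab a.
  have S11 := sd c bc.
  have G1 := d_ge0 a (l a); have G2 := d_ge0 a (l b); have G3 := d_ge0 b (l b).
  have G4 := d_ge0 b (l c); have G5 := d_ge0 c (l c); have G6 := d_ge0 c (r c).
  have G7 := d_ge0 ab (l a); have G8 := d_ge0 ab (l c); have G9 := d_ge0 bc (l b).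
  have G10 := d_ge0 bc (r c).
  rewrite /W1 /W2 /w /= lmab rmab lmbc rmbc rab rbc -/ab -/bc /k in Wab Wab_c Wbc Wa_bc.
  have T1 := td a (l b) (l c); have T2 := td (l b) b (l c).
  have T3 := td b (l b) c; have T3' := td (l b) bc c; have T4 := td a (l b) b.
  have T5 := td c (l c) (l b); have T5' := td (l c) b (l b).
  have T6 := td a ab (l c); have T6' := td a (l c) b; have T7 := td b (l c) c.
  have T8 := td c bc (l c); have T8' := td bc (l b) (l c); have T9 := td a (l c) c.
  (* The pairs (a, b) and (b, c) say which entries are small relative to which. If [a] and [c] are
     both small relative to [b], this suffices with centre [b]. Otherwise (a, bc) or (ab, c)
     supplies the missing comparison between the outer entries, and the centre is [a] or [c]. *)
  case: Wab => -[A1 A2]; case: Wbc => -[B1 B2].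
  + case: Wa_bc => -[C1 C2]; apply: around_c.
    * by clear - C1 B1 B2 T1 T2 S3 L1 G1 G3 G4; lra.
    * by clear - B1 G3 c0; lra.
    * by clear - C1 A1 B1 B2 T1 T2 T3 T3' T4 S3 S5 L3 L4 G1 G2 G3 G4 G10 b0 c0; lra.
    * by clear - B1 G3 c0; lra.
  + apply: around_b.
      by clear - A1 G1 b0; lra.
    by clear - B1 G6 b0; lra.
  + case: Wab_c => -[C1 C2]; last first.
      apply: around_a; first by clear - A1 G4 a0; lra.
      by clear - C1 A1 A2 T5 T5' S4 L2 G3 G4 G6; lra.
    case: Wa_bc => -[E1 E2]; apply: around_c.
    * by clear - E1 B1 B2 T1 T2 S3 L1 G1 G3 G4; lra.
    * by clear - B1 G3 c0; lra.
    * clear - A1 A2 B1 B2 C1 E1 T6 T8 T8' T2 T9 S3 S5 S9 S10 S11 L7 G3 G4 G7 G10 a0 c0.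
      by lra.
    * by clear - B1 G3 c0; lra.
  + case: Wab_c => -[C1 C2]; apply: around_a.
    * by clear - A1 G4 a0; lra.
    * clear - A1 A2 B1 C1 T5 T5' T6 T6' T7 S4 S9 S10 S1 S2 L5 L6 G3 G4 G5 G6 G7 G8 a0 b0 c0.
      by lra.
    * by clear - A1 G4 a0; lra.
    * by clear - C1 A1 A2 T5 T5' S4 L2 G3 G4 G6; lra.
Qed.

(** * Maps on submanifolds and Lie groups *)

Section SmoothOn.
Variable K : numFieldType.
Implicit Types M N P : premanifold K.

Lemma mfd_charted (M : manifold K) : charted M.
Proof. exact: manifold_charted (mfdP M). Qed.

Lemma smooth_on_comp M N P (S : set N) (T : set M) (f : N -> P) (h : M -> N) p :
  charted M -> charted N -> smooth_on S f -> smooth_at h p -> S (h p) ->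
  (\forall q \near p, T q -> S (h q)) ->
  exists F : M -> P, smooth_at F p /\ \forall q \near p, T q -> F q = f (h q).
Proof.
move=> cM cN sf sh Shp hS; have [F [sF hF]] := sf _ Shp.
exists (F \o h); split; first exact: smooth_at_comp.
have [ch _] := sh; have hF' : \forall q \near p, S (h q) -> F (h q) = f (h q) := ch _ hF.
by apply: filterS2 hS hF' => q a b Tq; apply: b; apply: a.
Qed.

Lemma smooth_on_comp_at M N P (S : set N) (f : N -> P) (h : M -> N) p :
  charted M -> charted N -> smooth_on S f -> smooth_at h p ->
  (\forall q \near p, S (h q)) -> smooth_at (f \o h) p.
Proof.
move=> cM cN sf sh hS; have Sp := nbhs_singleton hS.
have hS' : \forall q \near p, [set: M] q -> S (h q) by apply: filterS hS => q.
have [F [sF hF]] := smooth_on_comp cM cN sf sh Sp hS'.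
by apply: smooth_at_near sF => //; apply: filterS hF => q ->.
Qed.

Lemma smooth_on_continuous M N (S : set M) (f : M -> N) p (B : set N) :
  smooth_on S f -> S p -> nbhs (f p) B -> \forall q \near p, S q -> B (f q).
Proof.
move=> sf Sp Bp; have [F [[cF _] hF]] := sf p Sp.
have FB : \forall q \near p, B (F q).
  by apply: cF; rewrite (nbhs_singleton hF).
by apply: filterS2 hF FB => q a b Sq; rewrite -a.
Qed.

Lemma smooth_on_open M N (S : set M) (f : M -> N) p : charted M -> open S -> S p ->
  smooth_on S f -> smooth_at f p.
Proof.
move=> cM oS Sp sf; have [F [sF hF]] := sf p Sp.
apply: smooth_at_near sF => //; have nS : nbhs p S by exact: open_nbhs_nbhs.
by apply: filterS2 hF nS => q; exact.
Qed.

Lemma smooth_on_at M N (S : set M) (f : M -> N) :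
  (forall p, S p -> smooth_at f p) -> smooth_on S f.
Proof. by move=> h p Sp; exists f; split; [exact: h | apply: nearW]. Qed.

(** A local smooth inverse takes its values in the domain of [f], where it must agree with the
    global left inverse [g]. Hence [g] is smooth at the points of the image, and [f] is open. *)
Lemma local_diffeo_inverse M N (f : M -> N) (g : N -> M) : charted N ->
  local_diffeo f -> (forall c, g (f c) = c) ->
  forall c, smooth_at g (f c) /\
    forall B, nbhs c B -> nbhs (f c) (f @` B).
Proof.
move=> cN lf gf c; have [A [oA Ac [oI _ [h [hf sh]]]]] := lf c.
have nI : nbhs (f c) (f @` A) by apply: open_nbhs_nbhs; split=> //; exists c.
have [F [sF hF]] : exists F : N -> M, smooth_at F (f c) /\
    \forall q \near f c, (f @` A) q -> F q = h q by apply: sh; exists c.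
have Fg : {near f c, F =1 g}.
  apply: filterS2 hF nI => q a b; rewrite (a b).
  by case: b => x Ax <-; rewrite hf// gf.
have sg := smooth_at_near cN Fg sF; split=> // B Bc.
have [cg _] := sg; have gB : \forall q \near f c, B (g q).
  by apply: cg; rewrite gf.
by apply: filterS2 gB nI => q a [x _ qx]; exists (g q) => //; rewrite -qx gf.
Qed.

(* Coordinates see a map only through its germ, so a map with a smooth left
   inverse has an injective differential. *)
Lemma jac_cancel M N (f : M -> N) (g : N -> M) p : charted M -> charted N ->
  smooth_at f p -> smooth_at g (f p) -> (forall q, g (f q) = q) ->
  jac f p *m jac g (f p) = 1%:M.
Proof.
move=> cM cN sf sg gf; rewrite -(jac_comp cM cN sf sg) -(jac_id p cM).
by congr (jac _ p); apply/funext => q; exact: gf.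
Qed.

Lemma embedding_of_section M N (f : M -> N) (g : N -> M) : charted M -> charted N ->
  smooth f -> smooth g -> (forall q, g (f q) = q) -> embedding f.
Proof.
move=> cM cN sf sg gf; split=> //.
- exact: can_inj gf.
- move=> p; apply/row_freeP; exists (jac g (f p)); exact: jac_cancel.
- move=> A oA; exists (g @^-1` A).
    by apply: open_comp => // q _; case: (sg q).
  by apply/seteqP; split=> q /=; rewrite gf.
Qed.

Lemma push_comp m n p (J : 'M[K]_(m, n)) (L : 'M[K]_(n, p)) b :
  push L (push J b) = push (J *m L) b.
Proof. by rewrite /push trmx_mul !mulmxA. Qed.

Lemma pushB m n (J : 'M[K]_(m, n)) b c : push J (b - c) = push J b - push J c.
Proof. by rewrite /push mulmxBr mulmxBl. Qed.

Lemma pushN m n (J : 'M[K]_(m, n)) b : push J (- b) = - push J b.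
Proof. by rewrite /push mulmxN mulNmx. Qed.

Lemma push_col m1 m2 n (J1 : 'M[K]_(m1, n)) (J2 : 'M[K]_(m2, n)) b1 b2 :
  push (col_mx J1 J2) (block_mx b1 0 0 b2) = push J1 b1 + push J2 b2.
Proof.
rewrite /push tr_col_mx mul_row_block mul_row_col.
by rewrite !mulmx0 addr0 add0r.
Qed.

End SmoothOn.

#[local] Hint Resolve mfd_charted charted_prod : core.

Section LieGroupCalculus.
Variable K : numFieldType.
Implicit Types G H : lieGroup K.

Lemma smooth_lmul_pair (M : premanifold K) G (f g : M -> G) p : charted M ->
  smooth_at f p -> smooth_at g p -> smooth_at (fun x => lmul (f x) (g x)) p.
Proof.
move=> cM sf sg.
have cGG : charted (prodM G G) by auto.
exact: (@smooth_at_comp K M (prodM G G) G (fun x => (f x, g x))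
  (fun q => lmul q.1 q.2) p cM cGG (smooth_at_pair sf sg) (smooth_lmul _)).
Qed.

Lemma smooth_lmull G (g h : G) : smooth_at (lmul g) h.
Proof.
apply: smooth_lmul_pair => //; [exact: smooth_at_cst | exact: smooth_at_id].
Qed.

Lemma smooth_lmulr G (g h : G) : smooth_at (fun k => lmul k g) h.
Proof.
apply: smooth_lmul_pair => //; [exact: smooth_at_id | exact: smooth_at_cst].
Qed.

Lemma jac_lmul G (p : prodM G G) :
  @jac K (prodM G G) G (fun p => lmul p.1 p.2) p =
  col_mx (jac (fun h => lmul h p.2) p.1) (jac (lmul p.1) p.2).
Proof. by rewrite jac_partial//; exact: smooth_lmul. Qed.

Lemma jac_lmullM G (a b : G) :
  jac (lmul (lmul a b)) (lone G) = jac (lmul b) (lone G) *m jac (lmul a) b.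
Proof.
have := jac_comp (mfd_charted G) (mfd_charted G) (smooth_lmull b (lone G))
  (smooth_lmull a (lmul b (lone G))).
rewrite (lmulg1 b) => <-; congr (jac _ (lone G)); apply/funext => h /=.
by rewrite -(lmulA a b h).
Qed.

Lemma jac_lmulrM G (a b : G) :
  jac (fun h => lmul h (lmul a b)) (lone G) =
  jac (fun h => lmul h a) (lone G) *m jac (fun h => lmul h b) a.
Proof.
have := jac_comp (mfd_charted G) (mfd_charted G) (smooth_lmulr a (lone G))
  (smooth_lmulr b (lmul (lone G) a)).
rewrite (lmul1g a) => <-; congr (jac _ (lone G)); apply/funext => h /=.
by rewrite (lmulA h a b).
Qed.

Lemma jac_lmullr G (a b : G) :
  jac (lmul a) (lone G) *m jac (fun h => lmul h b) a =
  jac (fun h => lmul h b) (lone G) *m jac (lmul a) b.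
Proof.
have := jac_comp (mfd_charted G) (mfd_charted G) (smooth_lmull a (lone G))
  (smooth_lmulr b (lmul a (lone G))).
have := jac_comp (mfd_charted G) (mfd_charted G) (smooth_lmulr b (lone G))
  (smooth_lmull a (lmul (lone G) b)).
rewrite (lmulg1 a) (lmul1g b) => <- <-; congr (jac _ (lone G)).
by apply/funext => h /=; rewrite (lmulA a h b).
Qed.

(** Multiplicativity of a difference of invariant tensors, for any value [b]: the left translate of
    the right-invariant one and the right translate of the left-invariant one agree by [jac_lmullr]
    and cancel. *)
Lemma left_right_invB_mul G (b : 'M[K]_(mdim G)) (p q : G) :
  left_invB b (lmul p q) - right_invB b (lmul p q) =
  push (jac (fun d => lmul d q) p) (left_invB b p - right_invB b p) +
  push (jac (lmul p) q) (left_invB b q - right_invB b q).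
Proof.
rewrite /left_invB /right_invB !pushB !push_comp jac_lmullM jac_lmulrM jac_lmullr.
by rewrite [RHS]addrC addrA subrK.
Qed.

End LieGroupCalculus.

(** * The double groupoid *)

Section GammaAlgebra.
Variables (K : numFieldType) (G Gs D : lieGroup K).
Variables (jG : lieHom G D) (jGs : lieHom Gs D).
Notation Gam := (Gamma jG jGs).
Implicit Types c : Gam.

Lemma Gamma_ext c c' : Gg c = Gg c' -> Gu c = Gu c' -> Gu' c = Gu' c' ->
  Gg' c = Gg' c' -> c = c'.
Proof.
move=> e1 e2 e3 e4; apply: val_inj; move: e1 e2 e3 e4.
rewrite /Gg /Gu /Gu' /Gg' /=.
by case: c => [[[[a b] c0] d] h]; case: c' => [[[[a' b'] c'] d'] h'] /= -> -> -> ->.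
Qed.

Lemma Gmul_GE c1 c2 : Gg' c1 = Gg c2 ->
  [/\ Gg (Gmul_G c1 c2) = Gg c1, Gu (Gmul_G c1 c2) = lmul (Gu c1) (Gu c2),
      Gu' (Gmul_G c1 c2) = lmul (Gu' c1) (Gu' c2) & Gg' (Gmul_G c1 c2) = Gg' c2].
Proof. by move=> e; rewrite /Gmul_G; case: pselect. Qed.

Lemma Gmul_GsE c1 c2 : Gu' c1 = Gu c2 ->
  [/\ Gg (Gmul_Gs c1 c2) = lmul (Gg c2) (Gg c1), Gu (Gmul_Gs c1 c2) = Gu c1,
      Gu' (Gmul_Gs c1 c2) = Gu' c2 & Gg' (Gmul_Gs c1 c2) = lmul (Gg' c2) (Gg' c1)].
Proof. by move=> e; rewrite /Gmul_Gs; case: pselect. Qed.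

Lemma linvK (H : lieGroup K) (g : H) : linv (linv g) = g.
Proof. by apply: (@lmulgI _ _ (linv g)); rewrite lmulgV lmulVg. Qed.

Lemma linvM (H : lieGroup K) (g h : H) : linv (lmul g h) = lmul (linv h) (linv g).
Proof.
apply: (@lmulgI _ _ (lmul g h)); rewrite lmulgV.
by rewrite -(lmulA g h) (lmulA h) lmulgV lmul1g lmulgV.
Qed.

Lemma linv1 (H : lieGroup K) : linv (lone H) = lone H.
Proof. by apply: (@lmulgI _ _ (lone H)); rewrite lmulgV lmul1g. Qed.

(** Inversion in both groupoid structures, (g, u, u', g') |-> (g'^-1, u'^-1, u^-1, g^-1). It carries
    facts about the first two entries to the last two. *)
Definition Ginv2 c : Gam := Ginv_G (Ginv_Gs c).

Lemma Ginv2K c : Ginv2 (Ginv2 c) = c.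
Proof. by apply: Gamma_ext; exact: linvK. Qed.

Lemma GpL_Ginv2 c : GpL (Ginv2 c) = (linv (Gg' c), linv (Gu' c)).
Proof. by []. Qed.

Lemma GpR_Ginv2 c : GpR (Ginv2 c) = (linv (Gu c), linv (Gg c)).
Proof. by []. Qed.

Lemma Gp_Ginv2 c : Gp (Ginv2 c) = linv (Gp c).
Proof. by rewrite /Gp (GammaP c) linvM -!lhomV. Qed.

Lemma Gp_R c : Gp c = lmul (jGs (Gu' c)) (jG (Gg' c)).
Proof. exact: GammaP. Qed.

Hypothesis disj : forall g u, jG g = jGs u -> g = lone G /\ u = lone Gs.

Lemma linv_eq (H : lieGroup K) (g h : H) : lmul (linv g) h = lone H -> h = g.
Proof. by move=> e; rewrite -[RHS]lmulg1 -e lmulA lmulgV lmul1g. Qed.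

Lemma linv_eqr (H : lieGroup K) (g h : H) : lmul h (linv g) = lone H -> h = g.
Proof. by move=> e; rewrite -[RHS]lmul1g -e -lmulA lmulVg lmulg1. Qed.

Lemma prodL_inj g u g1 u1 : lmul (jG g) (jGs u) = lmul (jG g1) (jGs u1) ->
  g = g1 /\ u = u1.
Proof.
move=> e; have : jG (lmul (linv g) g1) = jGs (lmul u (linv u1)).
  rewrite !lhomM !lhomV; apply: (@lmulgI _ _ (jG g)).
  rewrite lmulA lmulgV lmul1g lmulA e -lmulA lmulgV lmulg1.
  by [].
by move=> /disj[/linv_eq -> /linv_eqr ->].
Qed.

Lemma prodR_inj u g u1 g1 : lmul (jGs u) (jG g) = lmul (jGs u1) (jG g1) ->
  u = u1 /\ g = g1.
Proof.
move=> e; have : jG (lmul g (linv g1)) = jGs (lmul (linv u) u1).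
  rewrite !lhomM !lhomV; apply: (@lmulgI _ _ (jGs u)).
  rewrite [in RHS]lmulA lmulgV lmul1g lmulA e -lmulA lmulgV lmulg1.
  by [].
by move=> /disj[/linv_eqr -> /linv_eq ->].
Qed.

Lemma Gp_inj c c' : Gp c = Gp c' -> c = c'.
Proof.
move=> e; have [e1 e2] := prodL_inj e.
have [e3 e4] : Gu' c = Gu' c' /\ Gg' c = Gg' c'.
  by apply: prodR_inj; rewrite -!Gp_R.
exact: Gamma_ext.
Qed.

Lemma GpL_inj c c' : Gg c = Gg c' -> Gu c = Gu c' -> c = c'.
Proof. by move=> e1 e2; apply: Gp_inj; rewrite /Gp e1 e2. Qed.

Lemma GpR_inj c c' : Gu' c = Gu' c' -> Gg' c = Gg' c' -> c = c'.
Proof. by move=> e1 e2; apply: Gp_inj; rewrite !Gp_R e1 e2. Qed.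

Variable O : set Gam.

Lemma gammaLP g u : O_GGs O (g, u) ->
  [/\ O (gammaL O g u), Gg (gammaL O g u) = g & Gu (gammaL O g u) = u].
Proof.
move=> [c Oc ce]; have : [set c | O c /\ GpL c = (g, u)] (gammaL O g u).
  by apply: (xgetPex _ (ex_intro _ c _)).
by move=> [Oc' [-> ->]].
Qed.

Lemma gammaRP u' g' : O_GsG O (u', g') ->
  [/\ O (gammaR O u' g'), Gu' (gammaR O u' g') = u' & Gg' (gammaR O u' g') = g'].
Proof.
move=> [c Oc ce]; have : [set c | O c /\ GpR c = (u', g')] (gammaR O u' g').
  by apply: (xgetPex _ (ex_intro _ c _)).
by move=> [Oc' [-> ->]].
Qed.

Lemma gammaL_eq c g u : O_GGs O (g, u) -> Gg c = g -> Gu c = u -> gammaL O g u = c.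
Proof. by move=> /gammaLP[_ e1 e2] h1 h2; apply: GpL_inj; rewrite ?e1 ?e2. Qed.

Lemma gammaR_eq c u g : O_GsG O (u, g) -> Gu' c = u -> Gg' c = g -> gammaR O u g = c.
Proof. by move=> /gammaRP[_ e1 e2] h1 h2; apply: GpR_inj; rewrite ?e1 ?e2. Qed.

End GammaAlgebra.

(** * Symmetry of the dressing domain and smoothness of dressing *)

Section DressingDomain.
Variables (K : numFieldType) (G Gs D : lieGroup K).
Variables (jG : lieHom G D) (jGs : lieHom Gs D).
Notation Gam := (Gamma jG jGs).
Variable aGamma : atlas K Gam.
Notation GM := (GammaM aGamma).
Notation GP := (@Gp _ _ _ _ jG jGs).
Hypothesis cG : charted GM.
Hypothesis sinv_G : smooth (M := GM) (N := GM) (@Ginv_G _ _ _ _ jG jGs).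
Hypothesis sinv_Gs : smooth (M := GM) (N := GM) (@Ginv_Gs _ _ _ _ jG jGs).
Hypothesis ldL : @local_diffeo K GM (prodM G Gs) (@GpL _ _ _ _ jG jGs).
Variable O : set Gam.
Hypothesis hO : maximal_dressing_domain aGamma O.

(** A common element of the two subgroups yields a unit of each groupoid structure with the same
    image in [D]. Both units lie in [O], where [Gp] is injective. *)
Lemma disjoint_subgroups g u : jG g = jGs u -> g = lone G /\ u = lone Gs.
Proof.
move=> e; have [[_ O1 O2 [_ _ [h [hK _]]]] _] := hO.
have : Gunit_G jG jGs g = Gunit_Gs jG jGs u.
  rewrite -(hK _ (O1 g)) -(hK _ (O2 u)); congr h.
  by rewrite /Gp /= !lhom1 lmulg1 lmul1g.
move=> E; split; first by have := congr1 (@Gg _ _ _ _ _ _) E.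
by have := congr1 (@Gu _ _ _ _ _ _) E.
Qed.

Let disj := disjoint_subgroups.

Lemma smooth_Ginv2 : smooth (M := GM) (N := GM) (@Ginv2 _ _ _ _ jG jGs).
Proof. by move=> c; exact: (smooth_at_comp cG cG (sinv_Gs c) (sinv_G _)). Qed.

(** Adding to [O] its preimage under [Ginv2] gives another dressing domain: [Gp] is injective on all
    of [Gamma] and intertwines [Ginv2] with inversion in [D], so its inverse is smooth on both
    pieces of the image. Maximality then forces equality. *)
Lemma O_Ginv2 c : O c -> O (Ginv2 c).
Proof.
have [[oO O1 O2 [oI sp [h [hK sh]]]] max] := hO.
pose O' : set Gam := O `|` (@Ginv2 _ _ _ _ jG jGs @^-1` O).
have cinv : continuous (@Ginv2 _ _ _ _ jG jGs : Gam -> Gam).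
  by move=> x; case: (smooth_Ginv2 x).
suff -> : O = O' by rewrite /O' => -[Oc|Oc]; [right; rewrite /= Ginv2K | left].
apply/esym; apply: max; last by move=> x; left.
split.
- by apply: openU => //; apply: open_comp => // x _; exact: cinv.
- by move=> g; left.
- by move=> u; left.
have linvc : continuous (@linv _ D) by move=> x; case: (smooth_linv x).
have imE : [set Gp x | x in O'] = GP @` O `|` @linv _ D @^-1` (GP @` O).
  apply/seteqP; split=> d.
    move=> [x [Ox|Ox] <-]; first by left; exists x.
    by right; exists (Ginv2 x) => //; rewrite Gp_Ginv2.
  move=> [[x Ox <-]|[x Ox xe]]; first by exists x => //; left.
  by exists (Ginv2 x); [right; rewrite /= Ginv2K | rewrite Gp_Ginv2 xe linvK].
have oI' : open (GP @` O') by rewrite imE; apply: openU => //; apply: open_comp.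
have s1 x : O x -> @smooth_at K GM D GP x.
  by move=> Ox; exact: (smooth_on_open cG oO Ox sp).
pose h' (d : D) : GM := xget (Gunit_G jG jGs (lone G)) [set x | Gp x = d].
have h'K x : h' (Gp x) = x.
  apply: (Gp_inj disj); have := @xgetPex _ (Gunit_G jG jGs (lone G)) [set y | Gp y = Gp x].
  by apply; exists x.
have s2 d : (GP @` O) d -> smooth_at h' d.
  move=> Id; have [F [sF hF]] := sh d Id.
  apply: (smooth_at_near (mfd_charted D) _ sF).
  have nI : nbhs d (GP @` O) by exact: open_nbhs_nbhs.
  apply: filterS2 hF nI => y a b; rewrite (a b).
  by case: b => x Ox <-; rewrite hK// h'K.
split=> //.
- apply: smooth_on_at => x [Ox|Ox]; first exact: s1.
  have e : GP = (@linv _ D) \o GP \o (@Ginv2 _ _ _ _ jG jGs).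
    by apply/funext => y; rewrite /= Gp_Ginv2 linvK.
  rewrite e; apply: (smooth_at_comp cG cG (smooth_Ginv2 x)).
  exact: (smooth_at_comp cG (mfd_charted D) (s1 _ Ox) (smooth_linv _)).
exists h'; split=> // d; rewrite imE => -[Id|Id].
  by exists h'; split; [exact: s2 | apply: nearW].
exists h'; split; last by apply: nearW.
have e : {near d, (@Ginv2 _ _ _ _ jG jGs) \o h' \o (@linv _ D) =1 h'}.
  have : nbhs d (@linv _ D @^-1` (GP @` O)).
    by apply: open_nbhs_nbhs; split=> //; apply: open_comp.
  apply: filterS => y [x Ox xe]; rewrite /= -xe h'K -[y]linvK -xe.
  by rewrite -Gp_Ginv2 h'K.
apply: (@smooth_at_near K D GM _ _ d (mfd_charted D) e).
apply: (@smooth_at_comp K D D GM _ _ d (mfd_charted D) (mfd_charted D) (smooth_linv _)).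
exact: (@smooth_at_comp K D GM GM _ _ _ (mfd_charted D) cG (s2 _ Id) (smooth_Ginv2 _)).
Qed.

(** [GpL] is injective because the subgroups meet trivially, so a chosen global left inverse is
    smooth by [local_diffeo_inverse]; it agrees with [gammaL] on the open set [O_GGs O]. *)
Lemma gammaL_smooth (p : prodM G Gs) : O_GGs O p ->
  @smooth_at K (prodM G Gs) GM (fun q => gammaL O q.1 q.2) p /\
  nbhs p (O_GGs O).
Proof.
move=> [c Oc <-]; have [[oO _ _ _] _] := hO.
pose gL (q : prodM G Gs) : GM := xget (Gunit_G jG jGs (lone G)) [set x | GpL x = q].
have gLK x : gL (GpL x) = x.
  have : GpL (gL (GpL x)) = GpL x.
    by apply: (@xgetPex _ _ [set y | GpL y = GpL x]); exists x.
  by move=> [e1 e2]; exact: (GpL_inj disj).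
have cGG : charted (prodM G Gs) by auto.
have [sg op] := local_diffeo_inverse cGG ldL gLK c.
have nO : nbhs (GpL c) (O_GGs O) by apply: op; exact: open_nbhs_nbhs.
split=> //; apply: (smooth_at_near cGG _ sg).
apply: filterS nO => q [x Ox <-]; rewrite gLK /=.
by apply/esym/(gammaL_eq disj) => //; exists x.
Qed.

Lemma gammaR_gammaL u' g' : O_GsG O (u', g') ->
  O_GGs O (linv g', linv u') /\ gammaR O u' g' = Ginv2 (gammaL O (linv g') (linv u')).
Proof.
move=> h; have [Oc e1 e2] := gammaRP h; set c := gammaR _ _ _ in Oc e1 e2 *.
have h' : O_GGs O (linv g', linv u').
  exists (Ginv2 c); first exact: O_Ginv2.
  by rewrite GpL_Ginv2 e1 e2.
split=> //; rewrite (gammaL_eq disj (c := Ginv2 c) h') ?Ginv2K//.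
  exact: (congr1 (@linv _ _) e2).
exact: (congr1 (@linv _ _) e1).
Qed.

Lemma O_GsG_inv u' g' : O_GsG O (u', g') <-> O_GGs O (linv g', linv u').
Proof.
split; first by case/gammaR_gammaL.
move=> h; have [Oc e1 e2] := gammaLP h; exists (Ginv2 (gammaL O (linv g') (linv u'))).
  exact: O_Ginv2.
by rewrite GpR_Ginv2 e1 e2 !linvK.
Qed.

(** The local diffeomorphism is [GpL], not [GpR]; conjugating [gammaL] with inversions makes up for
    this. *)
Lemma gammaR_smooth (p : prodM Gs G) : O_GsG O p ->
  @smooth_at K (prodM Gs G) GM (fun q => gammaR O q.1 q.2) p /\
  nbhs p (O_GsG O).
Proof.
case: p => u' g' h; have cG1 : charted (prodM Gs G) by auto.
have cG2 : charted (prodM G Gs) by auto.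
have [h' _] := gammaR_gammaL h.
pose iv (q : prodM Gs G) : prodM G Gs := (linv q.2, linv q.1).
have siv : @smooth_at K (prodM Gs G) (prodM G Gs) iv (u', g').
  apply: smooth_at_pair.
    exact: (smooth_at_comp cG1 (mfd_charted G) (smooth_at_snd _ (mfd_charted Gs) (mfd_charted G)) (smooth_linv _)).
  exact: (smooth_at_comp cG1 (mfd_charted Gs) (smooth_at_fst _ (mfd_charted Gs) (mfd_charted G)) (smooth_linv _)).
have [sL nL] := gammaL_smooth h'.
have nR : nbhs (u', g') (O_GsG O).
  have [civ _] := siv; have : \forall q \near (u', g'), O_GGs O (iv q) := civ _ nL.
  by apply: filterS => -[a b] /= /O_GsG_inv.
split=> //; pose F : prodM Gs G -> GM := fun q => Ginv2 (gammaL O (iv q).1 (iv q).2).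
apply: (@smooth_at_near K (prodM Gs G) GM F _ (u', g') cG1).
  by apply: filterS nR => -[a b] /gammaR_gammaL[_ e]; rewrite /F /= e.
have s1 := @smooth_at_comp K (prodM Gs G) (prodM G Gs) GM iv _ (u', g') cG1 cG2 siv sL.
exact: (@smooth_at_comp K (prodM Gs G) GM GM _ _ (u', g') cG1 cG s1 (smooth_Ginv2 _)).
Qed.

End DressingDomain.

(** * Local groupoids and twisted actions *)

Lemma near_all (T : topologicalType) (p : T) (P : T -> Prop) :
  (forall q, P q) -> \forall q \near p, P q.
Proof. by move=> h; apply: nearW. Qed.

Section LocalGroupoidFacts.
Variables (K : numFieldType) (A B : premanifold K) (Gr : lgroupoid A B).
Hypothesis hGr : local_lie_groupoid Gr.

Lemma gsrc_smooth : smooth (gsrc Gr).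
Proof. by have [[[[s _] _ _] _ _ _ _] _ _ _] := hGr. Qed.

Lemma gtgt_smooth : smooth (gtgt Gr).
Proof. by have [[[_ [s _] _] _ _ _ _] _ _ _] := hGr. Qed.

Lemma gsrc_full a : row_full (jac (gsrc Gr) a).
Proof. by have [[[[_ s] _ _] _ _ _ _] _ _ _] := hGr. Qed.

Lemma gtgt_full a : row_full (jac (gtgt Gr) a).
Proof. by have [[[_ [_ s] _] _ _ _ _] _ _ _] := hGr. Qed.

Lemma gunit_smooth : smooth (gunit Gr).
Proof. by have [[[_ _ [s _ _ _]] _ _ _ _] _ _ _] := hGr. Qed.

Lemma gsrc_unit y : gsrc Gr (gunit Gr y) = y.
Proof. by have [[_ _ _ [h _ _ _] _] _ _ _] := hGr. Qed.

Lemma gtgt_unit y : gtgt Gr (gunit Gr y) = y.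
Proof. by have [[_ _ _ [_ h _ _] _] _ _ _] := hGr. Qed.

Lemma gmdom_unitl a : gmdom Gr (gunit Gr (gsrc Gr a), a).
Proof. by have [[_ [_ h _ _ _] _ _ _] _ _ _] := hGr. Qed.

Lemma gmdom_unitr a : gmdom Gr (a, gunit Gr (gtgt Gr a)).
Proof. by have [[_ [_ _ h _ _] _ _ _] _ _ _] := hGr. Qed.

Lemma gmul_unitl a : gmul Gr (gunit Gr (gsrc Gr a)) a = a.
Proof. by have [[_ _ _ _ h] _ _ _] := hGr; have [] := h a. Qed.

Lemma gmul_unitr a : gmul Gr a (gunit Gr (gtgt Gr a)) = a.
Proof. by have [[_ _ _ _ h] _ _ _] := hGr; have [] := h a. Qed.

Lemma gmdom_composable a b : gmdom Gr (a, b) -> gtgt Gr a = gsrc Gr b.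
Proof. by have [[_ [[W _ ->] _ _ _ _] _ _ _] _ _ _] := hGr => -[]. Qed.

Lemma gmdom_open : exists2 W : set (A * A), open W & gmdom Gr = W `&` composable Gr.
Proof. by have [[_ [h _ _ _ _] _ _ _] _ _ _] := hGr. Qed.

Lemma gmdom_near a b : gmdom Gr (a, b) ->
  \forall q \near (a, b), composable Gr q -> gmdom Gr q.
Proof.
have [W oW ->] := gmdom_open; move=> [Wab _].
have : nbhs (a, b) W by exact: open_nbhs_nbhs.
by apply: filterS => q Wq.
Qed.

Lemma gidom_open : open (gidom Gr).
Proof. by have [[_ [_ _ _ h _] _ _ _] _ _ _] := hGr. Qed.

Lemma gidom_unit y : gidom Gr (gunit Gr y).
Proof. by have [[_ [_ _ _ _ h] _ _ _] _ _ _] := hGr. Qed.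

Lemma gmul_smooth : @smooth_on K (prodM A A) A (gmdom Gr) (fun p => gmul Gr p.1 p.2).
Proof. by have [[_ _ [h _] _ _] _ _ _] := hGr. Qed.

Lemma ginv_smooth : smooth_on (gidom Gr) (ginv Gr).
Proof. by have [[_ _ [_ h] _ _] _ _ _] := hGr. Qed.

Lemma gsrc_mul a b : gmdom Gr (a, b) -> gsrc Gr (gmul Gr a b) = gsrc Gr a.
Proof. by have [[_ _ _ [_ _ h _] _] _ _ _] := hGr => /h[]. Qed.

Lemma gtgt_mul a b : gmdom Gr (a, b) -> gtgt Gr (gmul Gr a b) = gtgt Gr b.
Proof. by have [[_ _ _ [_ _ h _] _] _ _ _] := hGr => /h[]. Qed.

Lemma gsrc_inv a : gidom Gr a -> gsrc Gr (ginv Gr a) = gtgt Gr a.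
Proof. by have [[_ _ _ [_ _ _ h] _] _ _ _] := hGr => /h[]. Qed.

Lemma gtgt_inv a : gidom Gr a -> gtgt Gr (ginv Gr a) = gsrc Gr a.
Proof. by have [[_ _ _ [_ _ _ h] _] _ _ _] := hGr => /h[]. Qed.

Lemma gidom_inv a : gidom Gr a -> gidom Gr (ginv Gr a).
Proof. by have [_ h _ _] := hGr => /h[]. Qed.

Lemma ginvK a : gidom Gr a -> ginv Gr (ginv Gr a) = a.
Proof. by have [_ h _ _] := hGr => /h[]. Qed.

Lemma gmul_inv a : gidom Gr a -> gmdom Gr (a, ginv Gr a) ->
  gmul Gr a (ginv Gr a) = gunit Gr (gsrc Gr a).
Proof. by have [_ _ h _] := hGr => /h[+ _]. Qed.

Lemma gmul_invl a : gidom Gr a -> gmdom Gr (ginv Gr a, a) ->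
  gmul Gr (ginv Gr a) a = gunit Gr (gtgt Gr a).
Proof. by have [_ _ h _] := hGr => /h[_ +]. Qed.

Lemma gmul_assoc a b c : gmdom Gr (a, b) -> gmdom Gr (gmul Gr a b, c) ->
  gmdom Gr (b, c) -> gmdom Gr (a, gmul Gr b c) ->
  gmul Gr (gmul Gr a b) c = gmul Gr a (gmul Gr b c).
Proof. by have [_ _ _ h] := hGr; exact: h. Qed.

(** The inverse of a unit has source [y], so its product with that unit is always defined. The unit
    law and the inverse law evaluate it in two ways. *)
Lemma ginv_unit y : ginv Gr (gunit Gr y) = gunit Gr y.
Proof.
have hy := gidom_unit y; have e := gsrc_inv hy; rewrite gtgt_unit in e.
have d := gmdom_unitl (ginv Gr (gunit Gr y)); rewrite e in d.
by rewrite -[LHS]gmul_unitl e (gmul_inv hy d) gsrc_unit.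
Qed.

End LocalGroupoidFacts.

Section Triples.
Variable K : numFieldType.
Variables (M1 M2 M3 : premanifold K).
Hypotheses (c1 : charted M1) (c2 : charted M2) (c3 : charted M3).
Notation M123 := (prodM (prodM M1 M2) M3).
Implicit Types (p : M123) (P : premanifold K).

Let c12 : charted (prodM M1 M2). Proof. by auto. Qed.
Let c123 : charted M123. Proof. by auto. Qed.

Lemma triple_fst P (f : M1 -> P) p : smooth_at f p.1.1 ->
  @smooth_at K M123 P (fun q => f q.1.1) p /\
  @jac K M123 P (fun q => f q.1.1) p = col_mx (col_mx (jac f p.1.1) 0) 0.
Proof.
move=> sf; have s1 := @smooth_at_fst K (prodM M1 M2) M3 p c12 c3.
have s2 := @smooth_at_fst K M1 M2 p.1 c1 c2.
have s3 := @smooth_at_comp K (prodM M1 M2) M1 P fst f p.1 c12 c1 s2 sf.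
split; first exact: (@smooth_at_comp K M123 (prodM M1 M2) P fst (f \o fst) p c123 c12 s1 s3).
rewrite [LHS](@jac_comp K M123 (prodM M1 M2) P fst (f \o fst) p c123 c12 s1 s3).
rewrite (@jac_comp K (prodM M1 M2) M1 P fst f p.1 c12 c1 s2 sf) !jac_fst//.
by rewrite !mul_col_mx !mul1mx !mul0mx.
Qed.

Lemma triple_snd P (f : M2 -> P) p : smooth_at f p.1.2 ->
  @smooth_at K M123 P (fun q => f q.1.2) p /\
  @jac K M123 P (fun q => f q.1.2) p = col_mx (col_mx 0 (jac f p.1.2)) 0.
Proof.
move=> sf; have s1 := @smooth_at_fst K (prodM M1 M2) M3 p c12 c3.
have s2 := @smooth_at_snd K M1 M2 p.1 c1 c2.
have s3 := @smooth_at_comp K (prodM M1 M2) M2 P snd f p.1 c12 c2 s2 sf.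
split; first exact: (@smooth_at_comp K M123 (prodM M1 M2) P fst (f \o snd) p c123 c12 s1 s3).
rewrite [LHS](@jac_comp K M123 (prodM M1 M2) P fst (f \o snd) p c123 c12 s1 s3).
rewrite (@jac_comp K (prodM M1 M2) M2 P snd f p.1 c12 c2 s2 sf) jac_fst// jac_snd//.
by rewrite !mul_col_mx !mul1mx !mul0mx.
Qed.

Lemma triple_thd P (f : M3 -> P) p : smooth_at f p.2 ->
  @smooth_at K M123 P (fun q => f q.2) p /\
  @jac K M123 P (fun q => f q.2) p = col_mx 0 (jac f p.2).
Proof.
move=> sf; have s1 := @smooth_at_snd K (prodM M1 M2) M3 p c12 c3.
split; first exact: (@smooth_at_comp K M123 M3 P snd f p c123 c3 s1 sf).
rewrite [LHS](@jac_comp K M123 M3 P snd f p c123 c3 s1 sf) jac_snd//.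
by rewrite !mul_col_mx !mul1mx !mul0mx.
Qed.

Lemma triple_pairing m n (b1 : bivector M1) (b2 : bivector M2) (b3 : bivector M3)
    (a1 : 'M[K]_(mdim M1, m)) (a2 : 'M[K]_(mdim M2, m)) (a3 : 'M[K]_(mdim M3, m))
    (d1 : 'M[K]_(mdim M1, n)) (d2 : 'M[K]_(mdim M2, n)) (d3 : 'M[K]_(mdim M3, n)) p :
  (col_mx (col_mx a1 a2) a3)^T *m prodB (prodB b1 b2) b3 p *m col_mx (col_mx d1 d2) d3 =
  a1^T *m b1 p.1.1 *m d1 + a2^T *m b2 p.1.2 *m d2 + a3^T *m b3 p.2 *m d3.
Proof.
rewrite !tr_col_mx /prodB !mul_row_block !mul_row_col.
by rewrite !(mulmx0, addr0, add0r) mul_row_col.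
Qed.

End Triples.

(* The actions of [Gamma_G] on [Ym] and of [Gamma_Gs] on [Zm] are both of the
   following kind; [A] is the induced action of the opposite factor on the base,
   and [r], [q] are the components of [c] which move source and target. *)
Section TwistedAction.
Variables (K : numFieldType) (C : premanifold K) (B H : lieGroup K).
Variables (X Y : manifold K) (Xg : lgroupoid X Y) (mu : X -> B).
Variables (s t : C -> B) (r q : C -> H) (eps : H -> C) (E : B -> C).
Variables (act : X -> C -> X) (A : H -> Y -> Y).
Hypothesis cC : charted C.
Hypothesis hX : local_lie_groupoid Xg.
Hypothesis smu : smooth mu.
Hypothesis mu_unit : forall y, mu (gunit Xg y) = lone B.
Hypotheses (st : smooth t) (sr : smooth r) (sq : smooth q) (seps : smooth eps).
Hypothesis s_eps : forall h, s (eps h) = lone B.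
Hypothesis r_eps : forall h, r (eps h) = h.
Hypotheses (s_E : forall b, s (E b) = b) (r_E : forall b, r (E b) = lone H)
  (q_E : forall b, q (E b) = lone H) (eps1 : eps (lone H) = E (lone B)).
Hypothesis sact : @smooth_on K (prodM X C) X [set p | mu p.1 = s p.2]
  (fun p => act p.1 p.2).
Hypothesis mu_act : forall x c, mu x = s c -> mu (act x c) = t c.
Hypothesis act_E : forall x, act x (E (mu x)) = x.
Hypothesis src_act : forall x c, mu x = s c -> gsrc Xg (act x c) = A (r c) (gsrc Xg x).
Hypothesis tgt_act : forall x c, mu x = s c -> gtgt Xg (act x c) = A (q c) (gtgt Xg x).
Hypothesis A_unit : forall h y, gunit Xg (A h y) = act (gunit Xg y) (eps h).

Lemma act_smooth (M : premanifold K) (f : M -> X) (c : M -> C) p : charted M ->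
  smooth_at f p -> smooth_at c p -> (\forall m \near p, mu (f m) = s (c m)) ->
  smooth_at (fun m => act (f m) (c m)) p.
Proof.
move=> cM sf sc h; have cXC : charted (prodM X C) by auto.
exact: (@smooth_on_comp_at K M (prodM X C) X _ _ (fun m => (f m, c m)) p cM cXC sact
  (smooth_at_pair sf sc) h).
Qed.

(** The induced action is given by its values on units only; its smoothness comes from writing it as
    the source of an acted unit. *)
Lemma base_action_smooth : @smooth K (prodM H Y) Y (fun p => A p.1 p.2).
Proof.
move=> p; have cHY : charted (prodM H Y) by auto.
have -> : (fun p : prodM H Y => A p.1 p.2) =
    gsrc Xg \o (fun p => act (gunit Xg p.2) (eps p.1)).
  by apply/funext => z; rewrite /= -A_unit gsrc_unit.
apply: (@smooth_at_comp K (prodM H Y) X Y _ _ p cHY (mfd_charted X)); last exact: gsrc_smooth.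
apply: act_smooth => //; last by apply: (@near_all (prodM H Y)) => m; rewrite mu_unit s_eps.
  exact: (@smooth_at_comp K (prodM H Y) Y X _ _ p cHY (mfd_charted Y)
    (smooth_at_snd _ (mfd_charted H) (mfd_charted Y)) (gunit_smooth hX _)).
exact: (@smooth_at_comp K (prodM H Y) H C _ _ p cHY (mfd_charted H)
    (smooth_at_fst _ (mfd_charted H) (mfd_charted Y)) (seps _)).
Qed.

Lemma base_action1 y : A (lone H) y = y.
Proof.
have : gsrc Xg (gunit Xg (A (lone H) y)) = y.
  by rewrite A_unit eps1 -(mu_unit y) act_E gsrc_unit.
by rewrite gsrc_unit.
Qed.

Lemma base_action_comp (M : premanifold K) (f : M -> H) (g : M -> Y) p : charted M ->
  smooth_at f p -> smooth_at g p ->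
  smooth_at (fun m => A (f m) (g m)) p /\
  jac (fun m => A (f m) (g m)) p =
    jac f p *m jac (A^~ (g p)) (f p) + jac g p *m jac (A (f p)) (g p).
Proof.
move=> cM sf sg; have cHY : charted (prodM H Y) by auto.
have sp := smooth_at_pair sf sg; split.
  exact: (@smooth_at_comp K M (prodM H Y) Y (fun m => (f m, g m)) (fun q => A q.1 q.2)
    p cM cHY sp (base_action_smooth _)).
have := @jac_comp K M (prodM H Y) Y (fun m => (f m, g m)) (fun q => A q.1 q.2)
    p cM cHY sp (base_action_smooth _).
rewrite jac_pair (jac_partial (mfd_charted H) (mfd_charted Y) (base_action_smooth _)).
by rewrite mul_row_col.
Qed.

Variables (bX : bivector X) (bC : bivector C) (bY : bivector Y).
Hypothesis coact : @coisotropic K (prodM (prodM X C) X) (prodB (prodB bX bC) (negB bX))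
    [set p | mu p.1.1 = s p.1.2 /\ p.2 = act p.1.1 p.1.2].

Notation S := [set p : (X * C) * X | mu p.1.1 = s p.1.2 /\ p.2 = act p.1.1 p.1.2].

Let cX := mfd_charted X.

Let J_tgt (p : prodM (prodM X C) X) :
  [/\ @smooth_at K (prodM (prodM X C) X) B (fun q => mu q.2) p,
      @smooth_at K (prodM (prodM X C) X) B (fun q => t q.1.2) p
    & @jac K (prodM (prodM X C) X) B (fun q => mu q.2) p -
      @jac K (prodM (prodM X C) X) B (fun q => t q.1.2) p =
      col_mx (col_mx 0 (- jac t p.1.2)) (jac mu p.2)].
Proof.
have [s1 ->] := triple_thd cX cC cX (smu p.2).
have [s2 ->] := triple_snd cX cC cX (st p.1.2).
split=> //.
by rewrite !opp_col_mx add_col_mx !oppr0 !addr0 !add0r.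
Qed.

Let J_base (v : C -> H) (w : X -> Y) (p : prodM (prodM X C) X) : smooth v -> smooth w ->
  [/\ @smooth_at K (prodM (prodM X C) X) Y (fun q => w q.2) p,
      @smooth_at K (prodM (prodM X C) X) Y (fun q => A (v q.1.2) (w q.1.1)) p
    & @jac K (prodM (prodM X C) X) Y (fun q => w q.2) p -
      @jac K (prodM (prodM X C) X) Y (fun q => A (v q.1.2) (w q.1.1)) p =
      col_mx (col_mx (- (jac w p.1.1 *m jac (A (v p.1.2)) (w p.1.1)))
        (- (jac v p.1.2 *m jac (A^~ (w p.1.1)) (v p.1.2)))) (jac w p.2)].
Proof.
move=> sv sw; have [s1 ->] := triple_thd cX cC cX (sw p.2).
have [s2 j2] := triple_snd cX cC cX (sv p.1.2).
have [s3 j3] := triple_fst cX cC cX (sw p.1.1).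
have cXCX : charted (prodM (prodM X C) X) by auto.
have [s4 ->] := base_action_comp cXCX s2 s3.
split=> //; rewrite j2 j3 !mul_col_mx !mul0mx !add_col_mx !addr0 !add0r.
by rewrite !opp_col_mx add_col_mx !oppr0 !addr0 !add0r.
Qed.

(** Coisotropy of the graph at the point where a unit of [C] fixes [x], tested on the coordinates of
    mu x' - t c and of w x' - A (v c) (w x), with x' the result of the action. The first has no
    component along [x], so one term in [C] and one in x' remain. *)
Let base_pairing (v : C -> H) (w : X -> Y) (x : X) : smooth v -> smooth w ->
  (forall x c, mu x = s c -> w (act x c) = A (v c) (w x)) ->
  v (E (mu x)) = lone H ->
  (jac mu x)^T *m bX x *m jac w x =
  (jac t (E (mu x)))^T *m bC (E (mu x)) *m jac v (E (mu x)) *m jac (A^~ (w x)) (lone H).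
Proof.
move=> sv sw hw v1; pose p : prodM (prodM X C) X := ((x, E (mu x)), x).
have Sp : S p by split; rewrite /= ?s_E ?act_E.
have [a1 a2 ea] := J_tgt p; have [b1 b2 eb] := J_base p sv sw.
have := coisotropic_pairing coact Sp a1 a2 b1 b2.
rewrite ea eb triple_pairing /= /negB v1 trmx0 !mul0mx add0r.
rewrite [(- _)^T]linearN/= !mulNmx mulmxN opprK mulmxN mulNmx.
move=> h; rewrite -[RHS]mulmxA; apply/esym/subr0_eq; apply: h => y [h1 ->].
  exact: mu_act.
exact: hw.
Qed.

Lemma base_pairing_src x : (jac mu x)^T *m bX x *m jac (gsrc Xg) x =
  (jac t (E (mu x)))^T *m bC (E (mu x)) *m jac r (E (mu x)) *m
    jac (A^~ (gsrc Xg x)) (lone H).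
Proof. by apply: base_pairing => //; exact: gsrc_smooth. Qed.

Lemma base_pairing_tgt x : (jac mu x)^T *m bX x *m jac (gtgt Xg) x =
  (jac t (E (mu x)))^T *m bC (E (mu x)) *m jac q (E (mu x)) *m
    jac (A^~ (gtgt Xg x)) (lone H).
Proof. by apply: base_pairing => //; exact: gtgt_smooth. Qed.

(** Coisotropy of the graph where [eps h] moves the unit at [y], with the defect of source
    equivariance paired with itself. The three components of its differential give the three
    terms. *)
Lemma base_action_poisson h y :
  (forall x, push (jac (gsrc Xg) x) (bX x) = bY (gsrc Xg x)) ->
  bY (A h y) = push (jac (A h) y) (bY y) +
    push (jac (A^~ y) h) (push (jac r (eps h)) (bC (eps h))).
Proof.
move=> hp; have se : mu (gunit Xg y) = s (eps h) by rewrite mu_unit s_eps.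
pose p : prodM (prodM X C) X := ((gunit Xg y, eps h), gunit Xg (A h y)).
have Sp : S p by split; rewrite /= ?A_unit.
have [b1 b2 eb] := J_base p sr (gsrc_smooth hX).
have := coisotropic_pairing coact Sp b1 b2 b1 b2.
rewrite eb triple_pairing /= /negB r_eps (gsrc_unit hX) !linearN/=.
rewrite !mulNmx !opprK => hh.
rewrite !push_comp -[in bY y](gsrc_unit hX y) -hp push_comp -[in LHS](gsrc_unit hX (A h y)) -hp.
apply/esym/subr0_eq; rewrite /push; apply: hh => z [h1 ->]; exact: src_act.
Qed.

End TwistedAction.

(** * The product groupoid *)

Section PairProjections.
Variables (K : numFieldType) (M N P : premanifold K).
Hypotheses (cM : charted M) (cN : charted N).

Lemma smooth_fst_comp (f : M -> P) (p : prodM M N) : smooth_at f p.1 ->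
  @smooth_at K (prodM M N) P (fun q => f q.1) p /\
  @jac K (prodM M N) P (fun q => f q.1) p = col_mx (jac f p.1) 0.
Proof.
move=> sf; have s1 := smooth_at_fst p cM cN; have cMN := charted_prod cM cN.
split; first exact: (@smooth_at_comp K (prodM M N) M P fst f p cMN cM s1 sf).
rewrite [LHS](@jac_comp K (prodM M N) M P fst f p cMN cM s1 sf) jac_fst//.
by rewrite mul_col_mx mul1mx mul0mx.
Qed.

Lemma smooth_snd_comp (f : N -> P) (p : prodM M N) : smooth_at f p.2 ->
  @smooth_at K (prodM M N) P (fun q => f q.2) p /\
  @jac K (prodM M N) P (fun q => f q.2) p = col_mx 0 (jac f p.2).
Proof.
move=> sf; have s1 := smooth_at_snd p cM cN; have cMN := charted_prod cM cN.
split; first exact: (@smooth_at_comp K (prodM M N) N P snd f p cMN cN s1 sf).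
rewrite [LHS](@jac_comp K (prodM M N) N P snd f p cMN cN s1 sf) jac_snd//.
by rewrite mul_col_mx mul1mx mul0mx.
Qed.

End PairProjections.

Lemma row_full_block_upper (F : fieldType) m1 m2 n1 n2 (A : 'M[F]_(m1, n1))
    (B : 'M[F]_(m1, n2)) (C : 'M[F]_(m2, n2)) :
  row_full A -> row_full C -> row_full (block_mx A B 0 C).
Proof.
move=> /row_fullP[A' AK] /row_fullP[C' CK]; apply/row_fullP.
exists (block_mx A' (- (A' *m B *m C')) 0 C').
rewrite mulmx_block !mulmx0 !mul0mx !addr0 !add0r AK CK mulNmx -(mulmxA _ C' C) CK mulmx1 addrN.
by rewrite -scalar_mx_block.
Qed.

Lemma row_full_block_lower (F : fieldType) m1 m2 n1 n2 (A : 'M[F]_(m1, n1))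
    (B : 'M[F]_(m2, n1)) (C : 'M[F]_(m2, n2)) :
  row_full A -> row_full C -> row_full (block_mx A 0 B C).
Proof.
move=> /row_fullP[A' AK] /row_fullP[C' CK]; apply/row_fullP.
exists (block_mx A' 0 (- (C' *m B *m A')) C').
rewrite mulmx_block !mulmx0 !mul0mx !addr0 !add0r AK CK mulNmx -(mulmxA _ A' A) AK mulmx1 addNr.
by rewrite -scalar_mx_block.
Qed.

Lemma relatively_open (T : topologicalType) (A C : set T) : A `<=` C ->
  (forall q, A q -> \forall q' \near q, C q' -> A q') ->
  exists2 W, open W & A = W `&` C.
Proof.
move=> AC h; exists (interior [set q | C q -> A q]); first exact: open_interior.
apply/seteqP; split=> q; first by move=> Aq; split; [exact: h | exact: AC].
by move=> [/interior_subset].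
Qed.

Section MixedSums.
Variable K : numFieldType.

Lemma sum_wedge_mixed n m1 m2 (a : 'I_n -> 'rV[K]_m1) (b : 'I_n -> 'rV[K]_m2) :
  \sum_i wedge (row_mx (a i) 0) (row_mx 0 (b i)) =
  block_mx 0 (\sum_i (a i)^T *m b i) (- \sum_i (b i)^T *m a i) 0.
Proof.
rewrite -sumrN; apply: (big_rec3 (fun s t r => s = block_mx 0 t r 0)).
  by rewrite block_mx0.
move=> i s t r _ ->; rewrite /wedge !tr_row_mx !trmx0 !mul_col_row !(mulmx0, mul0mx).
by rewrite opp_block_mx !add_block_mx !oppr0 !addr0 !add0r.
Qed.

Lemma push_row m n1 n2 (A : 'M[K]_(m, n1)) (B : 'M[K]_(m, n2)) b :
  push (row_mx A B) b = block_mx (push A b) (A^T *m b *m B) (B^T *m b *m A) (push B b).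
Proof. by rewrite /push tr_row_mx mul_col_mx mul_col_row. Qed.

Lemma tr_mul3 m n p q (A : 'M[K]_(m, n)) (b : 'M[K]_(m, p)) (B : 'M[K]_(p, q)) :
  (A^T *m b *m B)^T = B^T *m b^T *m A.
Proof. by rewrite !trmx_mul trmxK mulmxA. Qed.

Lemma tr_sum_outer n m1 m2 (a : 'I_n -> 'rV[K]_m1) (b : 'I_n -> 'rV[K]_m2) :
  (\sum_i (a i)^T *m b i)^T = \sum_i (b i)^T *m a i.
Proof.
by rewrite raddf_sum; apply: eq_bigr => i _; rewrite /= trmx_mul trmxK.
Qed.

Lemma tr_opp m n (A : 'M[K]_(m, n)) : (- A)^T = - A^T.
Proof. by rewrite linearN. Qed.

Lemma mul4 m n p q r (A : 'M[K]_(m, n)) (B : 'M[K]_(n, p)) (C : 'M[K]_(p, q))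
    (E : 'M[K]_(q, r)) : A *m B *m C *m E = A *m (B *m C *m E).
Proof. by rewrite !mulmxA. Qed.

Lemma push_upper m1 m2 n1 n2 (A : 'M[K]_(m1, n1)) (B : 'M[K]_(m1, n2))
    (C : 'M[K]_(m2, n2)) b1 b2 :
  push (block_mx A B 0 C) (block_mx b1 0 0 b2) =
  block_mx (push A b1) (A^T *m b1 *m B) (B^T *m b1 *m A) (push B b1 + push C b2).
Proof.
rewrite /push tr_block_mx trmx0 !mulmx_block.
by rewrite !(mulmx0, mul0mx, addr0, add0r).
Qed.

Lemma push_lower m1 m2 n1 n2 (A : 'M[K]_(m1, n1)) (B : 'M[K]_(m2, n1))
    (C : 'M[K]_(m2, n2)) b1 b2 :
  push (block_mx A 0 B C) (block_mx b1 0 0 b2) =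
  block_mx (push A b1 + push B b2) (B^T *m b2 *m C) (C^T *m b2 *m B) (push C b2).
Proof.
rewrite /push tr_block_mx trmx0 !mulmx_block.
by rewrite !(mulmx0, mul0mx, addr0, add0r).
Qed.

End MixedSums.

Section GroupTranslations.
Variables (K : numFieldType) (H : lieGroup K).

Lemma lmul_comp (M : premanifold K) (f h : M -> H) p : charted M ->
  smooth_at f p -> smooth_at h p ->
  smooth_at (fun m => lmul (f m) (h m)) p /\
  jac (fun m => lmul (f m) (h m)) p =
    jac f p *m jac (fun k => lmul k (h p)) (f p) + jac h p *m jac (lmul (f p)) (h p).
Proof.
move=> cM sf sh; have cHH : charted (prodM H H) by auto.
have sp := smooth_at_pair sf sh; split; first exact: smooth_lmul_pair.
have := @jac_comp K M (prodM H H) H (fun m => (f m, h m)) (fun q => lmul q.1 q.2)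
    p cM cHH sp (smooth_lmul _).
by rewrite jac_pair jac_lmul mul_row_col.
Qed.

Lemma jac_lmul1 (g : H) : jac (lmul (lone H)) g = 1%:M.
Proof.
rewrite -(jac_id g (mfd_charted H)); congr (jac _ g).
by apply/funext => h; rewrite lmul1g.
Qed.

Lemma jac_lmulr1 (g : H) : jac (fun h => lmul h (lone H)) g = 1%:M.
Proof.
rewrite -(jac_id g (mfd_charted H)); congr (jac _ g).
by apply/funext => h; rewrite lmulg1.
Qed.

Lemma left_inv1 v : left_inv v (lone H) = v.
Proof. by rewrite /left_inv jac_lmul1 mulmx1. Qed.

Lemma right_inv1 v : right_inv v (lone H) = v.
Proof. by rewrite /right_inv jac_lmulr1 mulmx1. Qed.

End GroupTranslations.

Section FourfoldProducts.
Variable K : numFieldType.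

Lemma comp_pair (L M N P : premanifold K) (F : prodM M N -> P) (f : L -> M) (h : L -> N) p :
  charted L -> charted M -> charted N -> smooth_at f p -> smooth_at h p ->
  smooth_at F (f p, h p) ->
  smooth_at (fun m => F (f m, h m)) p /\
  jac (fun m => F (f m, h m)) p =
    jac f p *m usubmx (jac F (f p, h p) : 'M[K]_(mdim M + mdim N, mdim P)) +
    jac h p *m dsubmx (jac F (f p, h p) : 'M[K]_(mdim M + mdim N, mdim P)).
Proof.
move=> cL cM cN sf sh sF; have cMN := charted_prod cM cN; have sp := smooth_at_pair sf sh.
split; first exact: (@smooth_at_comp K L (prodM M N) P (fun m => (f m, h m)) F p cL cMN sp sF).
have := @jac_comp K L (prodM M N) P (fun m => (f m, h m)) F p cL cMN sp sF.
by rewrite jac_pair -[X in _ = _ *m X]vsubmxK mul_row_col.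
Qed.

Variables (M1 M2 M3 M4 : premanifold K).
Hypotheses (c1 : charted M1) (c2 : charted M2) (c3 : charted M3) (c4 : charted M4).
Notation Q := (prodM (prodM M1 M2) (prodM M3 M4)).
Implicit Types (p : Q) (P : premanifold K).

Let c12 := charted_prod c1 c2.
Let c34 := charted_prod c3 c4.

Lemma four_1 P (f : M1 -> P) p : smooth_at f p.1.1 ->
  @smooth_at K Q P (fun q => f q.1.1) p /\
  @jac K Q P (fun q => f q.1.1) p = col_mx (col_mx (jac f p.1.1) 0) 0.
Proof.
move=> sf; have [s1 j1] := smooth_fst_comp c1 c2 (p := p.1) sf.
by have [s2 j2] := smooth_fst_comp c12 c34 (p := p) s1; rewrite j1 in j2.
Qed.

Lemma four_2 P (f : M2 -> P) p : smooth_at f p.1.2 ->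
  @smooth_at K Q P (fun q => f q.1.2) p /\
  @jac K Q P (fun q => f q.1.2) p = col_mx (col_mx 0 (jac f p.1.2)) 0.
Proof.
move=> sf; have [s1 j1] := smooth_snd_comp c1 c2 (p := p.1) sf.
by have [s2 j2] := smooth_fst_comp c12 c34 (p := p) s1; rewrite j1 in j2.
Qed.

Lemma four_3 P (f : M3 -> P) p : smooth_at f p.2.1 ->
  @smooth_at K Q P (fun q => f q.2.1) p /\
  @jac K Q P (fun q => f q.2.1) p = col_mx 0 (col_mx (jac f p.2.1) 0).
Proof.
move=> sf; have [s1 j1] := smooth_fst_comp c3 c4 (p := p.2) sf.
by have [s2 j2] := smooth_snd_comp c12 c34 (p := p) s1; rewrite j1 in j2.
Qed.

Lemma four_4 P (f : M4 -> P) p : smooth_at f p.2.2 ->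
  @smooth_at K Q P (fun q => f q.2.2) p /\
  @jac K Q P (fun q => f q.2.2) p = col_mx 0 (col_mx 0 (jac f p.2.2)).
Proof.
move=> sf; have [s1 j1] := smooth_snd_comp c3 c4 (p := p.2) sf.
by have [s2 j2] := smooth_snd_comp c12 c34 (p := p) s1; rewrite j1 in j2.
Qed.

Lemma row_full_col m1 m2 n (A : 'M[K]_(m1, n)) (B : 'M[K]_(m2, n)) :
  row_full A -> row_full (col_mx A B).
Proof.
move=> /row_fullP[A' AK]; apply/row_fullP; exists (row_mx A' 0).
by rewrite mul_row_col mul0mx addr0.
Qed.

Lemma pair_pairing (M N : premanifold K) m k (b1 : bivector M) (b2 : bivector N)
    (a1 : 'M[K]_(mdim M, m)) (a2 : 'M[K]_(mdim N, m))
    (d1 : 'M[K]_(mdim M, k)) (d2 : 'M[K]_(mdim N, k)) (p : prodM M N) :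
  (col_mx a1 a2)^T *m prodB b1 b2 p *m col_mx d1 d2 =
  a1^T *m b1 p.1 *m d1 + a2^T *m b2 p.2 *m d2.
Proof.
rewrite tr_col_mx /prodB mul_row_block mul_row_col.
by rewrite !(mulmx0, addr0, add0r).
Qed.

End FourfoldProducts.

(** In [product_coisotropic] the hypotheses are the isotropy relations of the graphs of [aZ], of
    [aY], and of the products of [Zg] and [Yg]. Here [p] and [r] belong to the two exchanged factors
    and [q] to [Gamma], whose structure enters the two actions with opposite signs; [u], [a], [b],
    [s] belong to the four original factors and [w], [t] to the result. *)
Lemma alternating_sum (V : zmodType) (p q r a b s t u w : V) :
  p + q - a = 0 -> r - q - b = 0 -> p + s - t = 0 -> u + r - w = 0 ->
  u + a + (b + s) - (w + t) = 0.
Proof.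
move=> /subr0_eq <- /subr0_eq <- /subr0_eq <- /subr0_eq <-; apply/eqP; rewrite subr_eq0.
rewrite (addrC r) -(addrA u) !addrA -[u + p + q - q]addrA addrN addr0.
by rewrite -(addrA u p r) (addrC p r) !addrA.
Qed.

Section GraphCoisotropy.
Variable K : numFieldType.
Variables (M1 M2 M3 P : premanifold K).
Hypotheses (c1 : charted M1) (c2 : charted M2) (c3 : charted M3).
Variables (F : prodM M1 M2 -> M3) (s : M1 -> P) (t : M2 -> P).
Notation T := (prodM (prodM M1 M2) M3).
Variable p : T.

(** With [conormal_snd], the components over [M1] and [M2] of a conormal vector of the graph of [F]
    on the locus [s = t]: [d] is its component over [M3], and [l] the multiplier of the equation
    [s = t]. *)
Definition conormal_fst (d : 'cV[K]_(mdim M3)) (l : 'cV[K]_(mdim P)) : 'cV[K]_(mdim M1) :=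
  - (usubmx (jac F p.1 : 'M[K]_(mdim M1 + mdim M2, mdim M3)) *m d) + jac s p.1.1 *m l.
Definition conormal_snd (d : 'cV[K]_(mdim M3)) (l : 'cV[K]_(mdim P)) : 'cV[K]_(mdim M2) :=
  - (dsubmx (jac F p.1 : 'M[K]_(mdim M1 + mdim M2, mdim M3)) *m d) - jac t p.1.2 *m l.

(* The conormal space of the graph of [F] over the fibre product of [s] and [t]
   is isotropic. *)
Lemma graph_coisotropic (b1 : bivector M1) (b2 : bivector M2) (b3 : bivector M3) S :
  @coisotropic K T (prodB (prodB b1 b2) b3) S -> S p ->
  smooth_at F p.1 -> smooth_at s p.1.1 -> smooth_at t p.1.2 ->
  (\forall q \near p, S q -> q.2 = F q.1) ->
  (forall q, S q -> s q.1.1 = t q.1.2) ->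
  forall d d' l l',
  (conormal_fst d l)^T *m b1 p.1.1 *m conormal_fst d' l' +
  (conormal_snd d l)^T *m b2 p.1.2 *m conormal_snd d' l' + d^T *m b3 p.2 *m d' = 0.
Proof.
move=> co Sp sF ss st hF hst d d' l l'.
have cT : charted T by auto.
have c12 : charted (prodM M1 M2) by auto.
have [s1 j1] := triple_thd c1 c2 c3 (p := p) (smooth_at_id p.2 c3).
have [s2 j2] := triple_fst c1 c2 c3 (p := p) ss.
have [s3 j3] := triple_snd c1 c2 c3 (p := p) st.
have [s4 j4] := smooth_fst_comp c12 c3 (p := p) sF.
have sa := smooth_at_pair s1 s2; have sb := smooth_at_pair s4 s3.
have hq : \forall q \near p, S q -> (q.2, s q.1.1) = (F q.1, t q.1.2).
  by apply: filterS hF => q h Sq; rewrite -h// hst.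
have := coisotropic_pairing_near co Sp sa sb sa sb hq hq.
rewrite !jac_pair j1 j2 j3 j4 jac_id//.
set J := (X in X^T *m _ *m X) => h.
have JE e k : J *m col_mx e k = col_mx (col_mx (conormal_fst e k) (conormal_snd e k)) e.
  rewrite /J mulmxBl !mul_row_col !mul_col_mx !mul0mx mul1mx.
  rewrite -[X in _ - (col_mx (X *m _) _ + _)]vsubmxK mul_col_mx.
  rewrite !(add_col_mx, opp_col_mx) !(addr0, add0r, oppr0).
  by rewrite add_col_mx add0r /conormal_fst /conormal_snd (addrC (jac s _ *m _)) opprD.
have : (J *m col_mx d l)^T *m prodB (prodB b1 b2) b3 p *m (J *m col_mx d' l') = 0.
  have -> : forall (m k : nat) (A : 'M[K]_(m, k)) B (v v' : 'cV[K]_k),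
      (A *m v)^T *m B *m (A *m v') = v^T *m (A^T *m B *m A) *m v'.
    by move=> m k A B v v'; rewrite trmx_mul !mulmxA.
  by rewrite h mulmx0 mul0mx.
by rewrite !JE triple_pairing.
Qed.

End GraphCoisotropy.

(** * The two actions, the induced actions and dressing *)

Section DressedPair.
Variables (R : realType) (K : numFieldType) (hK : real_or_complex R K).
Variables (G Gs D : lieGroup K).
Variables (jG : lieHom G D) (jGs : lieHom Gs D) (n : nat).
Variables (bG : bivector G) (bGs : bivector Gs).
Variables (x : 'M[K]_(n, mdim G)) (xi : 'M[K]_(n, mdim Gs)).
Variables (aGamma : atlas K (Gamma jG jGs)) (bGamma : bivector (GammaM aGamma)).
Variables (O : set (Gamma jG jGs)) (Ym Y Zm Z : manifold K).
Variables (Yg : lgroupoid Ym Y) (Zg : lgroupoid Zm Z).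
Variables (bYm : bivector Ym) (bY : bivector Y) (bZm : bivector Zm) (bZ : bivector Z).
Variables (muY : Ym -> G) (muZ : Zm -> Gs).
Variables (aY : Ym -> Gamma jG jGs -> Ym) (aZ : Zm -> Gamma jG jGs -> Zm).
Variables (rho : Y -> Gs -> Y) (theta : G -> Z -> Z).

Record dressed_pair : Prop := DressedPair {
  dp_Gamma : double_symplectic_groupoid bG bGs x xi bGamma;
  dp_O : maximal_dressing_domain aGamma O;
  dp_Y : local_poisson_groupoid Yg bYm bY;
  dp_Z : local_poisson_groupoid Zg bZm bZ;
  dp_muY : poisson_group_morphism Yg bYm bG muY;
  dp_muZ : poisson_group_morphism Zg bZm (negB bGs) muZ;
  dp_aY : poisson_right_action (Gamma_G aGamma) (negB bGamma) bYm muY aY;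
  dp_aZ : poisson_right_action (Gamma_Gs aGamma) bGamma bZm muZ aZ;
  dp_twY : twisted_multiplicative_Y aGamma Yg muY aY;
  dp_twZ : twisted_multiplicative_Z aGamma Zg muZ aZ;
  dp_rho : induced_action_Y Yg aY rho;
  dp_theta : induced_action_Z Zg aZ theta }.

Hypothesis S : dressed_pair.
Notation Gam := (Gamma jG jGs).
Notation GM := (GammaM aGamma).
Notation YZ := (prodM Ym Zm).
Notation YLZ := (product_L O Yg Zg muY muZ aY aZ rho theta).
Implicit Types (c : Gam) (y : Ym) (z : Zm) (g : G) (u : Gs).

Lemma charted_Gamma : charted GM.
Proof. by have [[/manifold_charted]] := S. Qed.
Let cG := charted_Gamma.

Let lG : local_lie_groupoid (Gamma_G aGamma).
Proof. by have [[_ _ _ [_ _ [h _ _ _ _] _] _]] := S. Qed.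
Let lGs : local_lie_groupoid (Gamma_Gs aGamma).
Proof. by have [[_ _ _ _ [_ _ [h _ _ _ _] _]]] := S. Qed.

Lemma lie_Y : local_lie_groupoid Yg. Proof. by have [_ _ []] := S. Qed.
Lemma lie_Z : local_lie_groupoid Zg. Proof. by have [_ _ _ []] := S. Qed.

Lemma Gg_smooth : @smooth K GM G (@Gg _ _ _ _ jG jGs).
Proof. exact: (gsrc_smooth lG). Qed.
Lemma Gg'_smooth : @smooth K GM G (@Gg' _ _ _ _ jG jGs).
Proof. exact: (gtgt_smooth lG). Qed.
Lemma Gu_smooth : @smooth K GM Gs (@Gu _ _ _ _ jG jGs).
Proof. exact: (gsrc_smooth lGs). Qed.
Lemma Gu'_smooth : @smooth K GM Gs (@Gu' _ _ _ _ jG jGs).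
Proof. exact: (gtgt_smooth lGs). Qed.
Lemma Gunit_G_smooth : @smooth K G GM (@Gunit_G _ _ _ _ jG jGs).
Proof. exact: (gunit_smooth lG). Qed.
Lemma Gunit_Gs_smooth : @smooth K Gs GM (@Gunit_Gs _ _ _ _ jG jGs).
Proof. exact: (gunit_smooth lGs). Qed.
Lemma Ginv_G_smooth : @smooth K GM GM (@Ginv_G _ _ _ _ jG jGs).
Proof. by move=> c; apply: (smooth_on_open cG openT) (ginv_smooth lG). Qed.
Lemma Ginv_Gs_smooth : @smooth K GM GM (@Ginv_Gs _ _ _ _ jG jGs).
Proof. by move=> c; apply: (smooth_on_open cG openT) (ginv_smooth lGs). Qed.

Lemma GpL_local_diffeo : @local_diffeo K GM (prodM G Gs) (@GpL _ _ _ _ jG jGs).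
Proof. by have [[]] := S. Qed.

Lemma disjoint_GGs g u : jG g = jGs u -> g = lone G /\ u = lone Gs.
Proof. exact: (disjoint_subgroups (dp_O S)). Qed.

Lemma muY_smooth : smooth muY. Proof. by have [[]] := dp_muY S. Qed.
Lemma muZ_smooth : smooth muZ. Proof. by have [[]] := dp_muZ S. Qed.
Lemma muY_unit (y : Y) : muY (gunit Yg y) = lone G.
Proof. by have [[_ _ h _] _] := dp_muY S. Qed.
Lemma muZ_unit (z : Z) : muZ (gunit Zg z) = lone Gs.
Proof. by have [[_ _ h _] _] := dp_muZ S. Qed.
Lemma muY_mul y1 y2 : gmdom Yg (y1, y2) -> muY (gmul Yg y1 y2) = lmul (muY y1) (muY y2).
Proof. by have [[_ h _ _] _] := dp_muY S; exact: h. Qed.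
Lemma muZ_mul z1 z2 : gmdom Zg (z1, z2) -> muZ (gmul Zg z1 z2) = lmul (muZ z1) (muZ z2).
Proof. by have [[_ h _ _] _] := dp_muZ S; exact: h. Qed.
Lemma muY_inv y : gidom Yg y -> muY (ginv Yg y) = linv (muY y).
Proof. by have [[_ _ _ h] _] := dp_muY S; exact: h. Qed.
Lemma muZ_inv z : gidom Zg z -> muZ (ginv Zg z) = linv (muZ z).
Proof. by have [[_ _ _ h] _] := dp_muZ S; exact: h. Qed.

Lemma muY_act y c : muY y = Gg c -> muY (aY y c) = Gg' c.
Proof. by have [[_ h _ _] _] := dp_aY S; exact: h. Qed.
Lemma muZ_act z c : muZ z = Gu c -> muZ (aZ z c) = Gu' c.
Proof. by have [[_ h _ _] _] := dp_aZ S; exact: h. Qed.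
Lemma actY_unit y : aY y (Gunit_G jG jGs (muY y)) = y.
Proof. by have [[_ _ h _] _] := dp_aY S; exact: h. Qed.
Lemma actZ_unit z : aZ z (Gunit_Gs jG jGs (muZ z)) = z.
Proof. by have [[_ _ h _] _] := dp_aZ S; exact: h. Qed.
Lemma actY_mul y c1 c2 : muY y = Gg c1 -> Gg' c1 = Gg c2 ->
  aY (aY y c1) c2 = aY y (Gmul_G c1 c2).
Proof. by have [[_ _ _ h] _] := dp_aY S; exact: h. Qed.
Lemma actZ_mul z c1 c2 : muZ z = Gu c1 -> Gu' c1 = Gu c2 ->
  aZ (aZ z c1) c2 = aZ z (Gmul_Gs c1 c2).
Proof. by have [[_ _ _ h] _] := dp_aZ S; exact: h. Qed.
Lemma actY_smooth_on : @smooth_on K (prodM Ym GM) Ym [set p | muY p.1 = Gg p.2]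
  (fun p => aY p.1 p.2).
Proof. by have [[h _ _ _] _] := dp_aY S; exact: h. Qed.
Lemma actZ_smooth_on : @smooth_on K (prodM Zm GM) Zm [set p | muZ p.1 = Gu p.2]
  (fun p => aZ p.1 p.2).
Proof. by have [[h _ _ _] _] := dp_aZ S; exact: h. Qed.

Lemma twistY y1 y2 c1 c2 : gmdom Yg (y1, y2) -> Gu' c2 = Gu c1 ->
  muY y1 = Gg c1 -> muY y2 = Gg c2 ->
  gtgt Yg (aY y1 c1) = gsrc Yg (aY y2 c2) /\
  (gmdom Yg (aY y1 c1, aY y2 c2) ->
    aY (gmul Yg y1 y2) (Gmul_Gs c2 c1) = gmul Yg (aY y1 c1) (aY y2 c2)).
Proof. by move=> a b; exact: (dp_twY S a b). Qed.

Lemma twistZ z1 z2 c1 c2 : gmdom Zg (z1, z2) -> Gg' c1 = Gg c2 ->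
  muZ z1 = Gu c1 -> muZ z2 = Gu c2 ->
  gtgt Zg (aZ z1 c1) = gsrc Zg (aZ z2 c2) /\
  (gmdom Zg (aZ z1 c1, aZ z2 c2) ->
    aZ (gmul Zg z1 z2) (Gmul_G c1 c2) = gmul Zg (aZ z1 c1) (aZ z2 c2)).
Proof. by move=> a b; exact: (dp_twZ S a b). Qed.

(** Only the composability clause of [twistY] is used: the left factor is a unit and stays one, at a
    base point moved by [rho], so its target is known. *)
Lemma srcY_act y c : muY y = Gg c -> gsrc Yg (aY y c) = rho (gsrc Yg y) (Gu' c).
Proof.
move=> e; have [+ _] := twistY (c1 := Gunit_Gs jG jGs (Gu' c)) (c2 := c)
  (gmdom_unitl lie_Y y) erefl (muY_unit _) e.
by rewrite -(dp_rho S) (gtgt_unit lie_Y).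
Qed.

Lemma tgtY_act y c : muY y = Gg c -> gtgt Yg (aY y c) = rho (gtgt Yg y) (Gu c).
Proof.
move=> e; have [+ _] := twistY (c1 := c) (c2 := Gunit_Gs jG jGs (Gu c))
  (gmdom_unitr lie_Y y) erefl e (muY_unit _).
by rewrite -(dp_rho S) (gsrc_unit lie_Y).
Qed.

Lemma srcZ_act z c : muZ z = Gu c -> gsrc Zg (aZ z c) = theta (Gg c) (gsrc Zg z).
Proof.
move=> e; have [+ _] := twistZ (c1 := Gunit_G jG jGs (Gg c)) (c2 := c)
  (gmdom_unitl lie_Z z) erefl (muZ_unit _) e.
by rewrite -(dp_theta S) (gtgt_unit lie_Z).
Qed.

Lemma tgtZ_act z c : muZ z = Gu c -> gtgt Zg (aZ z c) = theta (Gg' c) (gtgt Zg z).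
Proof.
move=> e; have [+ _] := twistZ (c1 := c) (c2 := Gunit_G jG jGs (Gg' c))
  (gmdom_unitr lie_Z z) erefl e (muZ_unit _).
by rewrite -(dp_theta S) (gsrc_unit lie_Z).
Qed.

Lemma Gunit1 : Gunit_G jG jGs (lone G) = Gunit_Gs jG jGs (lone Gs).
Proof. exact: Gamma_ext. Qed.

Lemma theta1 (z : Z) : theta (lone G) z = z.
Proof.
exact: (@base_action1 K GM Gs G Zm Z Zg muZ (@Gunit_G _ _ _ _ jG jGs)
  (@Gunit_Gs _ _ _ _ jG jGs) aZ theta lie_Z muZ_unit Gunit1 actZ_unit (dp_theta S)).
Qed.

Lemma rho1 (y : Y) : rho y (lone Gs) = y.
Proof.
exact: (@base_action1 K GM G Gs Ym Y Yg muY (@Gunit_Gs _ _ _ _ jG jGs)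
  (@Gunit_G _ _ _ _ jG jGs) aY (fun u (y : Y) => rho y u) lie_Y muY_unit (esym Gunit1)
  actY_unit (fun u (y : Y) => dp_rho S y u)).
Qed.

(** Composition in the groupoid over [Gs] multiplies the entries in [G] in reverse order. This is
    why a right action of the groupoid induces a left action of [G]. *)
Lemma thetaM g1 g2 (z : Z) : theta (lmul g1 g2) z = theta g1 (theta g2 z).
Proof.
apply: (can_inj (gsrc_unit lie_Z)); rewrite !(dp_theta S) actZ_mul// ?muZ_unit//.
congr aZ; have [e1 e2 e3 e4] := @Gmul_GsE K G Gs D jG jGs (Gunit_G jG jGs g2)
  (Gunit_G jG jGs g1) erefl.
by apply: Gamma_ext; rewrite ?e1 ?e2 ?e3 ?e4.
Qed.

Lemma rhoM (y : Y) u1 u2 : rho y (lmul u1 u2) = rho (rho y u1) u2.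
Proof.
apply: (can_inj (gsrc_unit lie_Y)); rewrite !(dp_rho S) actY_mul// ?muY_unit//.
congr aY; have [e1 e2 e3 e4] := @Gmul_GE K G Gs D jG jGs (Gunit_Gs jG jGs u1)
  (Gunit_Gs jG jGs u2) erefl.
by apply: Gamma_ext; rewrite ?e1 ?e2 ?e3 ?e4.
Qed.

Lemma thetaK g (z : Z) : theta (linv g) (theta g z) = z.
Proof. by rewrite -thetaM lmulVg theta1. Qed.

Lemma thetaVK g (z : Z) : theta g (theta (linv g) z) = z.
Proof. by rewrite -thetaM lmulgV theta1. Qed.

Lemma rhoK (y : Y) u : rho (rho y u) (linv u) = y.
Proof. by rewrite -rhoM lmulgV rho1. Qed.

Lemma rhoVK (y : Y) u : rho (rho y (linv u)) u = y.
Proof. by rewrite -rhoM lmulVg rho1. Qed.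

Lemma theta_comp (M : premanifold K) (f : M -> G) (h : M -> Z) p : charted M ->
  smooth_at f p -> smooth_at h p ->
  smooth_at (fun m => theta (f m) (h m)) p /\
  jac (fun m => theta (f m) (h m)) p =
    jac f p *m jac (theta^~ (h p)) (f p) + jac h p *m jac (theta (f p)) (h p).
Proof.
exact: (@base_action_comp K GM Gs G Zm Z Zg muZ (@Gu _ _ _ _ jG jGs)
  (@Gunit_G _ _ _ _ jG jGs) aZ theta cG lie_Z muZ_unit Gunit_G_smooth (fun=> erefl)
  actZ_smooth_on (dp_theta S)).
Qed.

Lemma rho_comp (M : premanifold K) (f : M -> Gs) (h : M -> Y) p : charted M ->
  smooth_at f p -> smooth_at h p ->
  smooth_at (fun m => rho (h m) (f m)) p /\
  jac (fun m => rho (h m) (f m)) p =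
    jac f p *m jac (rho (h p)) (f p) + jac h p *m jac (rho^~ (f p)) (h p).
Proof.
exact: (@base_action_comp K GM G Gs Ym Y Yg muY (@Gg _ _ _ _ jG jGs)
  (@Gunit_Gs _ _ _ _ jG jGs) aY (fun u (y : Y) => rho y u) cG lie_Y muY_unit Gunit_Gs_smooth
  (fun=> erefl) actY_smooth_on (fun u (y : Y) => dp_rho S y u)).
Qed.

Lemma actY_smooth (M : premanifold K) (f : M -> Ym) (c : M -> GM) p : charted M ->
  smooth_at f p -> smooth_at c p -> (\forall m \near p, muY (f m) = Gg (c m)) ->
  smooth_at (fun m => aY (f m) (c m)) p.
Proof.
exact: (@act_smooth K GM G Ym muY (@Gg _ _ _ _ jG jGs) aY cG actY_smooth_on).
Qed.

Lemma actZ_smooth (M : premanifold K) (f : M -> Zm) (c : M -> GM) p : charted M ->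
  smooth_at f p -> smooth_at c p -> (\forall m \near p, muZ (f m) = Gu (c m)) ->
  smooth_at (fun m => aZ (f m) (c m)) p.
Proof.
exact: (@act_smooth K GM Gs Zm muZ (@Gu _ _ _ _ jG jGs) aZ cG actZ_smooth_on).
Qed.

Let lY := lie_Y.
Let lZ := lie_Z.
Let cYm : charted Ym := mfd_charted Ym.
Let cZm : charted Zm := mfd_charted Zm.
Let cYZ : charted YZ. Proof. by auto. Qed.

Lemma gammaR_unique c : O c -> gammaR O (Gu' c) (Gg' c) = c.
Proof. by move=> Oc; apply: (gammaR_eq disjoint_GGs) => //; exists c. Qed.

Lemma gammaL_unique c : O c -> gammaL O (Gg c) (Gu c) = c.
Proof. by move=> Oc; apply: (gammaL_eq disjoint_GGs) => //; exists c. Qed.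

Lemma O_unit_G g : O (Gunit_G jG jGs g).
Proof. by have [_ [[_ h _ _] _]] := S. Qed.

Lemma O_unit_Gs u : O (Gunit_Gs jG jGs u).
Proof. by have [_ [[_ _ h _] _]] := S. Qed.

Lemma gammaR_1g g : gammaR O (lone Gs) g = Gunit_G jG jGs g.
Proof. exact: (gammaR_unique (O_unit_G g)). Qed.

Lemma gammaR_u1 u : gammaR O u (lone G) = Gunit_Gs jG jGs u.
Proof. exact: (gammaR_unique (O_unit_Gs u)). Qed.

Lemma gammaL_11 : gammaL O (lone G) (lone Gs) = Gunit_G jG jGs (lone G).
Proof. exact: (gammaL_unique (O_unit_G _)). Qed.

Lemma Ginv_G_unit g : Ginv_G (Gunit_G jG jGs g) = Gunit_G jG jGs g.
Proof. by apply: Gamma_ext => //; exact: linv1. Qed.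

Lemma Ginv_G_unit_Gs u : Ginv_G (Gunit_Gs jG jGs u) = Gunit_Gs jG jGs (linv u).
Proof. exact: Gamma_ext. Qed.

Lemma Ginv_Gs_unit u : Ginv_Gs (Gunit_Gs jG jGs u) = Gunit_Gs jG jGs u.
Proof. by apply: Gamma_ext => //; exact: linv1. Qed.

Lemma Ginv_Gs_unit_G g : Ginv_Gs (Gunit_G jG jGs g) = Gunit_G jG jGs (linv g).
Proof. exact: Gamma_ext. Qed.

Lemma gammaR_comp_smooth (M : premanifold K) (f : M -> Zm) (h : M -> Ym) p : charted M ->
  smooth_at f p -> smooth_at h p -> O_ZY O muY muZ (f p, h p) ->
  @smooth_at K M GM (fun m => gammaR O (muZ (f m)) (muY (h m))) p /\
  \forall m \near p, O_ZY O muY muZ (f m, h m).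
Proof.
move=> cM sf sh Op; have s1 := smooth_at_comp cM cZm sf (muZ_smooth (f p)).
have s2 := smooth_at_comp cM cYm sh (muY_smooth (h p)).
have sp := smooth_at_pair s1 s2; have cGG : charted (prodM Gs G) by auto.
have [sg ng] := gammaR_smooth cG Ginv_G_smooth Ginv_Gs_smooth
  GpL_local_diffeo (dp_O S) Op.
split; first exact: (@smooth_at_comp K M (prodM Gs G) GM
  (fun m => (muZ (f m), muY (h m))) _ p cM cGG sp sg).
have [cp _] := sp; exact: (cp _ ng).
Qed.

Lemma gammaL_comp_smooth (M : premanifold K) (f : M -> Ym) (h : M -> Zm) p : charted M ->
  smooth_at f p -> smooth_at h p -> O_GGs O (muY (f p), muZ (h p)) ->
  @smooth_at K M GM (fun m => gammaL O (muY (f m)) (muZ (h m))) p /\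
  \forall m \near p, O_GGs O (muY (f m), muZ (h m)).
Proof.
move=> cM sf sh Op; have s1 := smooth_at_comp cM cYm sf (muY_smooth (f p)).
have s2 := smooth_at_comp cM cZm sh (muZ_smooth (h p)).
have sp := smooth_at_pair s1 s2; have cGG : charted (prodM G Gs) by auto.
have [sg ng] := gammaL_smooth GpL_local_diffeo (dp_O S) Op.
split; first exact: (@smooth_at_comp K M (prodM G Gs) GM
  (fun m => (muY (f m), muZ (h m))) _ p cM cGG sp sg).
have [cp _] := sp; exact: (cp _ ng).
Qed.

Lemma ltimes_comp_smooth (M : premanifold K) (f : M -> Zm) (h : M -> Ym) p : charted M ->
  smooth_at f p -> smooth_at h p -> O_ZY O muY muZ (f p, h p) ->
  smooth_at (fun m => ltimesY aY (gammaR O (muZ (f m)) (muY (h m))) (h m)) p /\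
  smooth_at (fun m => ltimesZ aZ (gammaR O (muZ (f m)) (muY (h m))) (f m)) p.
Proof.
move=> cM sf sh Op; have [sc nO] := gammaR_comp_smooth cM sf sh Op; split.
  apply: (actY_smooth cM sh (smooth_at_comp cM cG sc (Ginv_G_smooth _))).
  by apply: filterS nO => m /gammaRP[_ _ e]; rewrite /= -[LHS]e.
apply: (actZ_smooth cM sf (smooth_at_comp cM cG sc (Ginv_Gs_smooth _))).
by apply: filterS nO => m /gammaRP[_ e _]; rewrite /= -[LHS]e.
Qed.

Lemma act_comp_smooth (M : premanifold K) (f : M -> Ym) (h : M -> Zm) p : charted M ->
  smooth_at f p -> smooth_at h p -> O_GGs O (muY (f p), muZ (h p)) ->
  smooth_at (fun m => aY (f m) (gammaL O (muY (f m)) (muZ (h m)))) p /\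
  smooth_at (fun m => aZ (h m) (gammaL O (muY (f m)) (muZ (h m)))) p.
Proof.
move=> cM sf sh Op; have [sc nO] := gammaL_comp_smooth cM sf sh Op; split.
  apply: (actY_smooth cM sf sc).
  by apply: filterS nO => m /gammaLP[_ e _]; rewrite /= -[LHS]e.
apply: (actZ_smooth cM sh sc).
by apply: filterS nO => m /gammaLP[_ _ e]; rewrite /= -[LHS]e.
Qed.

Lemma ltimesY_spec y c : muY y = Gg' c ->
  [/\ muY (ltimesY aY c y) = Gg c,
      gsrc Yg (ltimesY aY c y) = rho (gsrc Yg y) (linv (Gu' c)) &
      gtgt Yg (ltimesY aY c y) = rho (gtgt Yg y) (linv (Gu c))].
Proof.
move=> e; have e' : muY y = Gg (Ginv_G c) by [].
by split; [exact: (muY_act e') | exact: (srcY_act e') | exact: (tgtY_act e')].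
Qed.

Lemma ltimesZ_spec z c : muZ z = Gu' c ->
  [/\ muZ (ltimesZ aZ c z) = Gu c,
      gsrc Zg (ltimesZ aZ c z) = theta (linv (Gg c)) (gsrc Zg z) &
      gtgt Zg (ltimesZ aZ c z) = theta (linv (Gg' c)) (gtgt Zg z)].
Proof.
move=> e; have e' : muZ z = Gu (Ginv_Gs c) by [].
by split; [exact: (muZ_act e') | exact: (srcZ_act e') | exact: (tgtZ_act e')].
Qed.

(** The exchange moves the middle source by the inverse of [rho] and the middle target by the
    inverse of [theta], so the two components of the equation between target and source become
    composability in [Yg] and in [Zg]. *)
Lemma composable_ltimes (p q : YZ) : O_ZY O muY muZ (p.2, q.1) ->
  let c := gammaR O (muZ p.2) (muY q.1) in
  composable YLZ (p, q) <->
  composable Yg (p.1, ltimesY aY c q.1) /\ composable Zg (ltimesZ aZ c p.2, q.2).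
Proof.
move=> /gammaRP[_ e1 e2] c; rewrite -/c in e1 e2.
have [_ sY _] := ltimesY_spec (esym e2); have [_ _ tZ] := ltimesZ_spec (esym e1).
rewrite /composable /= sY tZ e1 e2 /YL_tgt /YL_src; split.
  by move=> /= [<- ->]; rewrite rhoK thetaK.
by move=> /= [-> <-]; rewrite rhoVK thetaVK.
Qed.

(** * The structure maps of the product *)

Lemma src_jac (p : YZ) :
  @smooth_at K YZ (prodM Y Z) (gsrc YLZ) p /\
  @jac K YZ (prodM Y Z) (gsrc YLZ) p =
    block_mx (jac (gsrc Yg) p.1) (jac muY p.1 *m jac (theta^~ (gsrc Zg p.2)) (muY p.1))
             0 (jac (gsrc Zg) p.2 *m jac (theta (muY p.1)) (gsrc Zg p.2)).
Proof.
have [s1 j1] := smooth_fst_comp cYm cZm (gsrc_smooth lY p.1).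
have [s2 j2] := smooth_fst_comp cYm cZm (muY_smooth p.1).
have [s3 j3] := smooth_snd_comp cYm cZm (gsrc_smooth lZ p.2).
have [s4 j4] := theta_comp cYZ s2 s3.
split; first exact: (smooth_at_pair s1 s4).
rewrite [LHS]jac_pair j1 j4 j2 j3 !mul_col_mx !mul0mx add_col_mx addr0 add0r.
by rewrite -block_mxEh.
Qed.

Lemma tgt_jac (p : YZ) :
  @smooth_at K YZ (prodM Y Z) (gtgt YLZ) p /\
  @jac K YZ (prodM Y Z) (gtgt YLZ) p =
    block_mx (jac (gtgt Yg) p.1 *m jac (rho^~ (muZ p.2)) (gtgt Yg p.1)) 0
             (jac muZ p.2 *m jac (rho (gtgt Yg p.1)) (muZ p.2)) (jac (gtgt Zg) p.2).
Proof.
have [s1 j1] := smooth_fst_comp cYm cZm (gtgt_smooth lY p.1).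
have [s2 j2] := smooth_snd_comp cYm cZm (muZ_smooth p.2).
have [s3 j3] := smooth_snd_comp cYm cZm (gtgt_smooth lZ p.2).
have [s4 j4] := rho_comp cYZ s2 s1.
split; first exact: (smooth_at_pair s4 s3).
rewrite [LHS]jac_pair j4 j1 j2 j3 !mul_col_mx !mul0mx add_col_mx addr0 add0r.
by rewrite -block_mxEh.
Qed.

Lemma theta_smoothr g (w : Z) : smooth_at (theta g) w.
Proof.
by have [] := theta_comp (mfd_charted Z) (smooth_at_cst g w) (smooth_at_id w (mfd_charted Z)).
Qed.

Lemma theta_smoothl g (w : Z) : smooth_at (theta^~ w) g.
Proof.
by have [] := theta_comp (mfd_charted G) (smooth_at_id g (mfd_charted G)) (smooth_at_cst w g).
Qed.

Lemma rho_smoothl (w : Y) u : smooth_at (rho^~ u) w.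
Proof.
by have [] := rho_comp (mfd_charted Y) (smooth_at_cst u w) (smooth_at_id w (mfd_charted Y)).
Qed.

Lemma rho_smoothr (w : Y) u : smooth_at (rho w) u.
Proof.
by have [] := rho_comp (mfd_charted Gs) (smooth_at_id u (mfd_charted Gs)) (smooth_at_cst w u).
Qed.

Lemma theta_jac_full g (w : Z) : row_full (jac (theta g) w).
Proof.
apply/row_fullP; exists (jac (theta (linv g)) (theta g w)).
have := jac_cancel (mfd_charted Z) (mfd_charted Z) (theta_smoothr (linv g) (theta g w))
  (theta_smoothr g _) (thetaVK g).
by rewrite thetaK.
Qed.

Lemma rho_jac_full (w : Y) u : row_full (jac (rho^~ u) w).
Proof.
apply/row_fullP; exists (jac (rho^~ (linv u)) (rho w u)).
have := jac_cancel (mfd_charted Y) (mfd_charted Y) (rho_smoothl (rho w u) (linv u))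
  (rho_smoothl _ u) (fun v : Y => rhoVK v u).
by rewrite rhoK.
Qed.

Lemma row_full_mul m p q (A : 'M[K]_(m, p)) (B : 'M[K]_(p, q)) :
  row_full A -> row_full B -> row_full (A *m B).
Proof.
move=> /row_fullP[A' AK] /row_fullP[B' BK]; apply/row_fullP; exists (B' *m A').
by rewrite -mulmxA (mulmxA A') AK mul1mx.
Qed.

(** The Jacobian is block triangular because the first component of the source ignores [z];
    translation by [theta] is invertible, so both diagonal blocks have full rank. *)
Lemma src_submersion : @submersion K YZ (prodM Y Z) (gsrc YLZ).
Proof.
split=> p; have [s j] := src_jac p; first exact: s.
rewrite j; apply: row_full_block_upper; first exact: gsrc_full.
apply: row_full_mul; [exact: gsrc_full | exact: theta_jac_full].
Qed.

Lemma tgt_submersion : @submersion K YZ (prodM Y Z) (gtgt YLZ).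
Proof.
split=> p; have [s j] := tgt_jac p; first exact: s.
rewrite j; apply: row_full_block_lower; last exact: gtgt_full.
apply: row_full_mul; [exact: gtgt_full | exact: rho_jac_full].
Qed.

Lemma src_unit (w : prodM Y Z) : gsrc YLZ (gunit YLZ w) = w.
Proof.
case: w => a b; rewrite /= /YL_src /= muY_unit theta1.
by rewrite (gsrc_unit lY) (gsrc_unit lZ).
Qed.

Lemma tgt_unit (w : prodM Y Z) : gtgt YLZ (gunit YLZ w) = w.
Proof.
case: w => a b; rewrite /= /YL_tgt /= muZ_unit rho1.
by rewrite (gtgt_unit lY) (gtgt_unit lZ).
Qed.

Lemma unit_smooth : @smooth K (prodM Y Z) YZ (gunit YLZ).
Proof.
move=> w; have [s1 _] := smooth_fst_comp (mfd_charted Y) (mfd_charted Z)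
  (gunit_smooth lY w.1).
have [s2 _] := smooth_snd_comp (mfd_charted Y) (mfd_charted Z) (gunit_smooth lZ w.2).
exact: (smooth_at_pair s1 s2).
Qed.

Lemma unit_embedding : @embedding K (prodM Y Z) YZ (gunit YLZ).
Proof.
apply: (embedding_of_section (g := gsrc YLZ)) => //; first by auto.
- exact: unit_smooth.
- by have [] := src_submersion.
- exact: src_unit.
Qed.

(** [composable_ltimes] translates composability into that of the two exchanged pairs, which depend
    continuously on the factors; the domains of [Yg] and [Zg] are open among composable pairs. *)
Lemma mdom_near (p q : YZ) : gmdom YLZ (p, q) ->
  \forall pq \near (p, q), composable YLZ pq -> gmdom YLZ pq.
Proof.
move=> [C Om Dy Dz]; have cYZ2 : charted (prodM YZ YZ) by auto.
pose w : prodM YZ YZ := (p, q).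
have [sp2 _] := smooth_fst_comp cYZ cYZ (p := w) (smooth_at_snd p cYm cZm).
have [sp1 _] := smooth_fst_comp cYZ cYZ (p := w) (smooth_at_fst p cYm cZm).
have [sq2 _] := smooth_snd_comp cYZ cYZ (p := w) (smooth_at_snd q cYm cZm).
have [sq1 _] := smooth_snd_comp cYZ cYZ (p := w) (smooth_at_fst q cYm cZm).
have [sy sz] := ltimes_comp_smooth cYZ2 sp2 sq1 Om.
have [_ nO] := gammaR_comp_smooth cYZ2 sp2 sq1 Om.
have [c1 _] := smooth_at_pair sp1 sy; have [c2 _] := smooth_at_pair sz sq2.
have n1 := c1 _ (gmdom_near lY Dy); have n2 := c2 _ (gmdom_near lZ Dz).
apply: filterS3 nO n1 n2 => -[p' q'] Om' h1 h2 Cp.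
have [d1 d2] := proj1 (composable_ltimes Om') Cp.
by split=> //; [exact: h1 | exact: h2].
Qed.

Lemma mdom_open : exists2 W, open W & gmdom YLZ = W `&` composable YLZ.
Proof.
apply: relatively_open; first by move=> pq [].
by move=> [p q]; exact: mdom_near.
Qed.

Lemma mdom_unitl (p : YZ) : gmdom YLZ (gunit YLZ (gsrc YLZ p), p).
Proof.
case: p => y z; split; rewrite /= ?muZ_unit.
- exact: tgt_unit.
- rewrite /O_ZY /= muZ_unit; exists (Gunit_G jG jGs (muY y)) => //; exact: O_unit_G.
- by rewrite gammaR_1g /ltimesY Ginv_G_unit actY_unit; exact: (gmdom_unitl lY).
- rewrite gammaR_1g /ltimesZ Ginv_Gs_unit_G -(dp_theta S) thetaK.
  exact: (gmdom_unitl lZ).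
Qed.

Lemma mdom_unitr (p : YZ) : gmdom YLZ (p, gunit YLZ (gtgt YLZ p)).
Proof.
case: p => y z; split; rewrite /= ?muY_unit.
- by rewrite [RHS]src_unit.
- rewrite /O_ZY /= muY_unit; exists (Gunit_Gs jG jGs (muZ z)) => //; exact: O_unit_Gs.
- rewrite gammaR_u1 /ltimesY Ginv_G_unit_Gs -(dp_rho S) rhoK.
  exact: (gmdom_unitr lY).
- by rewrite gammaR_u1 /ltimesZ Ginv_Gs_unit actZ_unit; exact: (gmdom_unitr lZ).
Qed.

Lemma mul_unitl (p : YZ) : gmul YLZ (gunit YLZ (gsrc YLZ p)) p = p.
Proof.
case: p => y z; rewrite /= /YL_mul /= muZ_unit gammaR_1g /ltimesY Ginv_G_unit.
rewrite actY_unit /ltimesZ Ginv_Gs_unit_G -(dp_theta S) thetaK.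
by rewrite (gmul_unitl lY) (gmul_unitl lZ).
Qed.

Lemma mul_unitr (p : YZ) : gmul YLZ p (gunit YLZ (gtgt YLZ p)) = p.
Proof.
case: p => y z; rewrite /= /YL_mul /= muY_unit gammaR_u1 /ltimesZ Ginv_Gs_unit.
rewrite actZ_unit /ltimesY Ginv_G_unit_Gs -(dp_rho S) rhoK.
by rewrite (gmul_unitr lY) (gmul_unitr lZ).
Qed.

Lemma src_tgt_mul (p q : YZ) : gmdom YLZ (p, q) ->
  gsrc YLZ (gmul YLZ p q) = gsrc YLZ p /\ gtgt YLZ (gmul YLZ p q) = gtgt YLZ q.
Proof.
move=> [C Om Dy Dz]; have [_ e1 e2] := gammaRP Om.
move: Dy Dz; rewrite /= /YL_mul /YL_src /YL_tgt /=; set c := gammaR _ _ _ in e1 e2 *.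
rewrite /= in e1 e2; move=> Dy Dz.
have [mY sY tY] := ltimesY_spec (esym e2); have [mZ sZ tZ] := ltimesZ_spec (esym e1).
rewrite (gsrc_mul lY Dy) (gsrc_mul lZ Dz) (gtgt_mul lY Dy) (gtgt_mul lZ Dz).
rewrite (muY_mul Dy) (muZ_mul Dz) mY mZ sZ tY thetaM thetaVK.
by rewrite rhoM rhoVK.
Qed.

Lemma mul_smooth : @smooth_on K (prodM YZ YZ) YZ (gmdom YLZ) (fun w => gmul YLZ w.1 w.2).
Proof.
move=> [p q] [C Om Dy Dz]; have cYZ2 : charted (prodM YZ YZ) by auto.
pose w : prodM YZ YZ := (p, q).
have [sp2 _] := smooth_fst_comp cYZ cYZ (p := w) (smooth_at_snd p cYm cZm).
have [sp1 _] := smooth_fst_comp cYZ cYZ (p := w) (smooth_at_fst p cYm cZm).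
have [sq2 _] := smooth_snd_comp cYZ cYZ (p := w) (smooth_at_snd q cYm cZm).
have [sq1 _] := smooth_snd_comp cYZ cYZ (p := w) (smooth_at_fst q cYm cZm).
have [sy sz] := ltimes_comp_smooth cYZ2 sp2 sq1 Om.
have cYY : charted (prodM Ym Ym) by auto.
have cZZ : charted (prodM Zm Zm) by auto.
have [F [sF hF]] := smooth_on_comp cYZ2 cYY (gmul_smooth lY) (smooth_at_pair sp1 sy) Dy
  (@near_all _ w _ (fun pq (h : gmdom YLZ pq) => let: And4 _ _ d _ := h in d)).
have [F' [sF' hF']] := smooth_on_comp cYZ2 cZZ (gmul_smooth lZ) (smooth_at_pair sz sq2) Dz
  (@near_all _ w _ (fun pq (h : gmdom YLZ pq) => let: And4 _ _ _ d := h in d)).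
exists (fun pq => (F pq, F' pq)); split; first exact: smooth_at_pair.
by apply: filterS2 hF hF' => -[p' q'] h h' D'; rewrite h// h'.
Qed.

Lemma R_L_smooth y z : O21_ZY O muY muZ (z, y) ->
  smooth_at (fun m : YZ => aY m.1 (gammaL O (muY m.1) (muZ m.2))) (y, z) /\
  smooth_at (fun m : YZ => aZ m.2 (gammaL O (muY m.1) (muZ m.2))) (y, z).
Proof.
move=> h; exact: (act_comp_smooth cYZ (smooth_at_fst (y, z) cYm cZm)
  (smooth_at_snd (y, z) cYm cZm) h).
Qed.

Lemma idom_open : open (gidom YLZ).
Proof.
rewrite openE => -[y z] [d1 [d2 [iz iy]]]; rewrite /interior.
have [sy sz] := R_L_smooth d1.
have [_ n1] := gammaL_comp_smooth cYZ (smooth_at_fst (y, z) cYm cZm)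
  (smooth_at_snd (y, z) cYm cZm) d1.
have [_ n2] := gammaR_comp_smooth cYZ sz sy d2.
have [c1 _] := sy; have [c2 _] := sz.
have n3 : \forall m \near ((y, z) : YZ),
    gidom Yg (aY m.1 (gammaL O (muY m.1) (muZ m.2))) := c1 _ (open_nbhs_nbhs (conj (gidom_open lY) iy)).
have n4 : \forall m \near ((y, z) : YZ),
    gidom Zg (aZ m.2 (gammaL O (muY m.1) (muZ m.2))) := c2 _ (open_nbhs_nbhs (conj (gidom_open lZ) iz)).
apply: filterS3 (filterI n1 n2) n3 n4 => -[y' z'] [a b] d e.
by split.
Qed.

Lemma idom_unit (w : prodM Y Z) : gidom YLZ (gunit YLZ w).
Proof.
case: w => a b; have d1 : O_GGs O (lone G, lone Gs).
  by exists (Gunit_G jG jGs (lone G)) => //; exact: O_unit_G.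
have d2 : O_GsG O (lone Gs, lone G).
  by exists (Gunit_G jG jGs (lone G)) => //; exact: O_unit_G.
have ey := actY_unit (gunit Yg a); have ez := actZ_unit (gunit Zg b).
rewrite muY_unit in ey; rewrite muZ_unit -Gunit1 in ez.
split; first by rewrite /O21_ZY /= muY_unit muZ_unit.
rewrite /R_L /= muY_unit muZ_unit gammaL_11 ey ez; split.
  by rewrite /O_ZY /= muY_unit muZ_unit.
by split; [exact: (gidom_unit lZ) | exact: (gidom_unit lY)].
Qed.

Lemma inv_smooth : @smooth_on K YZ YZ (gidom YLZ) (ginv YLZ).
Proof.
move=> [y z] [d1 [d2 [iz iy]]]; have [sy sz] := R_L_smooth d1.
have [F [sF hF]] := smooth_on_comp cYZ cYm (ginv_smooth lY) sy iy
  (@near_all YZ (y, z) _ (fun m (h : gidom YLZ m) => proj2 (proj2 (proj2 h)))).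
have [F' [sF' hF']] := smooth_on_comp cYZ cZm (ginv_smooth lZ) sz iz
  (@near_all YZ (y, z) _ (fun m (h : gidom YLZ m) => proj1 (proj2 (proj2 h)))).
exists (fun m => (F m, F' m)); split; first exact: smooth_at_pair.
by apply: filterS2 hF hF' => m h h' D'; rewrite h// h'.
Qed.

Lemma src_tgt_inv (p : YZ) : gidom YLZ p ->
  gsrc YLZ (ginv YLZ p) = gtgt YLZ p /\ gtgt YLZ (ginv YLZ p) = gsrc YLZ p.
Proof.
case: p => y z [d1 [d2 [iz iy]]]; have [_ e1 e2] := gammaLP d1.
rewrite /= /YL_inv /YL_src /YL_tgt /=.
rewrite /R_L /= in iz iy; set c := gammaL _ _ _ in e1 e2 iz iy *.
rewrite /= in e1 e2.
rewrite (gsrc_inv lY iy) (gtgt_inv lY iy) (gsrc_inv lZ iz) (gtgt_inv lZ iz).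
rewrite (muY_inv iy) (muZ_inv iz) (muY_act (esym e1)) (muZ_act (esym e2)).
rewrite (srcY_act (esym e1)) (tgtY_act (esym e1)).
rewrite (srcZ_act (esym e2)) (tgtZ_act (esym e2)).
by rewrite rhoK thetaK e1 e2.
Qed.

Lemma product_maps : local_groupoid_maps YLZ.
Proof.
split.
- by split; [exact: src_submersion | exact: tgt_submersion | exact: unit_embedding].
- split; [exact: mdom_open | exact: mdom_unitl | exact: mdom_unitr | exact: idom_open |
    exact: idom_unit].
- by split; [exact: mul_smooth | exact: inv_smooth].
- split; [exact: src_unit | exact: tgt_unit | exact: src_tgt_mul | exact: src_tgt_inv].
- by move=> p; split; [exact: mul_unitl | exact: mul_unitr].
Qed.

(** * Brackets on the double groupoid; source and target as Poisson maps *)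

Notation gg := (@Gg _ _ _ _ jG jGs : GM -> G).
Notation gu := (@Gu _ _ _ _ jG jGs : GM -> Gs).
Notation gu' := (@Gu' _ _ _ _ jG jGs : GM -> Gs).
Notation gg' := (@Gg' _ _ _ _ jG jGs : GM -> G).

Let PG : local_poisson_groupoid (Gamma_G aGamma) bGamma bG.
Proof. by have [_ _ _ []] := dp_Gamma S. Qed.
Let PGs : local_poisson_groupoid (Gamma_Gs aGamma) bGamma bGs.
Proof. by have [_ _ _ _ []] := dp_Gamma S. Qed.

Lemma bGamma_tr c : (bGamma c)^T = - bGamma c.
Proof. by have [_ [[h _ _] _] _ _ _] := PG. Qed.

Lemma bracket_g_u c : (jac gg c)^T *m bGamma c *m jac gu c =
  - \sum_i (left_inv (row i x) (Gg c))^T *m right_inv (row i xi) (Gu c).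
Proof.
have [_ _ h _ _] := dp_Gamma S; have := h c; rewrite sum_wedge_mixed /prodB.
have j : @jac K GM (prodM G Gs) (@GpL _ _ _ _ jG jGs) c = row_mx (jac gg c) (jac gu c).
  exact: jac_pair.
rewrite j push_row opp_block_mx add_block_mx => e.
by have [_ -> _ _] := eq_block_mx e; rewrite add0r.
Qed.

(** The definition of [bGamma] yields the brackets of [Gg] with [Gu] only. Coisotropy of the product
    of [c] with the unit at its target, tested on the equation for [Gg] of a product and on
    [Gu' c1 = Gu c2], carries [bracket_g_u] at that unit to [c] by a right translation. *)
Lemma bracket_g_u' c : (jac gg c)^T *m bGamma c *m jac gu' c =
  - \sum_i (right_inv (row i x) (Gg c))^T *m right_inv (row i xi) (Gu' c).
Proof.
have [_ _ co _ _] := PGs.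
pose e : GM := Gunit_Gs jG jGs (Gu' c).
pose p : prodM (prodM GM GM) GM := ((c, e), c).
have Sp : [set p | gmdom (Gamma_Gs aGamma) p.1 /\ p.2 = gmul (Gamma_Gs aGamma) p.1.1 p.1.2] p.
  by split=> //=; rewrite -[LHS](gmul_unitr lGs c).
have cT : charted (prodM (prodM GM GM) GM) by auto.
have [s1 j1] := triple_thd cG cG cG (p := p) (Gg_smooth c).
have [s2 j2] := triple_snd cG cG cG (p := p) (Gg_smooth e).
have [s3 j3] := triple_fst cG cG cG (p := p) (Gg_smooth c).
have [s4 j4] := triple_fst cG cG cG (p := p) (Gu'_smooth c).
have [s5 j5] := triple_snd cG cG cG (p := p) (Gu_smooth e).
have [s6 j6] := lmul_comp cT s2 s3.
have ha (q : prodM (prodM GM GM) GM) : Gu' q.1.1 = Gu q.1.2 /\ q.2 = Gmul_Gs q.1.1 q.1.2 ->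
    Gg q.2 = lmul (Gg q.1.2) (Gg q.1.1).
  by move=> [+ ->] => /Gmul_GsE[-> _ _ _].
have hb (q : prodM (prodM GM GM) GM) : Gu' q.1.1 = Gu q.1.2 /\ q.2 = Gmul_Gs q.1.1 q.1.2 ->
    Gu' q.1.1 = Gu q.1.2 by case.
have := coisotropic_pairing co Sp s1 s6 s4 s5 ha hb.
rewrite j1 j6 j2 j3 j4 j5 /= !mul_col_mx !mul0mx !(add_col_mx, opp_col_mx).
rewrite jac_lmul1 mulmx1 !(add0r, addr0, oppr0) triple_pairing /= mulmx0 addr0.
rewrite !tr_opp !mulNmx mulmxN opprK trmx_mul => /eqP; rewrite addrC subr_eq0 => /eqP <-.
rewrite mul4 bracket_g_u mulmxN mulmx_sumr; congr (- _).
by apply: eq_bigr => i _; rewrite left_inv1 mulmxA -trmx_mul.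
Qed.

(** The same argument in the other groupoid, where entries in [Gs] are multiplied, now starting from
    [bracket_g_u'] at a unit. *)
Lemma bracket_u'_g' c : (jac gu' c)^T *m bGamma c *m jac gg' c =
  \sum_i (left_inv (row i xi) (Gu' c))^T *m right_inv (row i x) (Gg' c).
Proof.
have [_ _ co _ _] := PG.
pose e : GM := Gunit_G jG jGs (Gg' c).
pose p : prodM (prodM GM GM) GM := ((c, e), c).
have Sp : [set p | gmdom (Gamma_G aGamma) p.1 /\ p.2 = gmul (Gamma_G aGamma) p.1.1 p.1.2] p.
  by split=> //=; rewrite -[LHS](gmul_unitr lG c).
have cT : charted (prodM (prodM GM GM) GM) by auto.
have [s1 j1] := triple_thd cG cG cG (p := p) (Gu'_smooth c).
have [s2 j2] := triple_snd cG cG cG (p := p) (Gu'_smooth e).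
have [s3 j3] := triple_fst cG cG cG (p := p) (Gu'_smooth c).
have [s4 j4] := triple_fst cG cG cG (p := p) (Gg'_smooth c).
have [s5 j5] := triple_snd cG cG cG (p := p) (Gg_smooth e).
have [s6 j6] := lmul_comp cT s3 s2.
have ha (q : prodM (prodM GM GM) GM) : Gg' q.1.1 = Gg q.1.2 /\ q.2 = Gmul_G q.1.1 q.1.2 ->
    Gu' q.2 = lmul (Gu' q.1.1) (Gu' q.1.2).
  by move=> [+ ->] => /Gmul_GE[_ _ -> _].
have hb (q : prodM (prodM GM GM) GM) : Gg' q.1.1 = Gg q.1.2 /\ q.2 = Gmul_G q.1.1 q.1.2 ->
    Gg' q.1.1 = Gg q.1.2 by case.
have := coisotropic_pairing co Sp s1 s6 s4 s5 ha hb.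
rewrite j1 j6 j2 j3 j4 j5 /= !mul_col_mx !mul0mx !(add_col_mx, opp_col_mx).
rewrite jac_lmulr1 mulmx1 !(add0r, addr0, oppr0) triple_pairing /= mulmx0 addr0.
rewrite !tr_opp !mulNmx mulmxN opprK trmx_mul => /eqP; rewrite addrC subr_eq0 => /eqP <-.
rewrite mul4 -[(jac gu' e)^T *m _ *m _]trmxK tr_mul3 bGamma_tr mulmxN mulNmx.
rewrite bracket_g_u' opprK tr_sum_outer mulmx_sumr.
by apply: eq_bigr => i _; rewrite right_inv1 mulmxA -trmx_mul.
Qed.

(** A left action is generated by right-invariant fields: differentiate theta (h g) w at h = e. *)
Lemma inf_thetaE v g (w : Z) :
  inf_theta theta v (theta g w) = right_inv v g *m jac (theta^~ w) g.
Proof.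
rewrite /inf_theta /right_inv -mulmxA; congr (_ *m _).
have := jac_comp (mfd_charted G) (mfd_charted G) (smooth_lmulr g (lone G))
  (theta_smoothl (lmul (lone G) g) w).
rewrite (lmul1g g) => <-; congr (jac _ (lone G)); apply/funext => h /=.
by rewrite thetaM.
Qed.

Lemma inf_rhoE v (w : Y) u :
  inf_rho rho v (rho w u) = left_inv v u *m jac (rho w) u.
Proof.
rewrite /inf_rho /left_inv -mulmxA; congr (_ *m _).
have := jac_comp (mfd_charted Gs) (mfd_charted Gs) (smooth_lmull u (lone Gs))
  (rho_smoothr w (lmul u (lone Gs))).
rewrite (lmulg1 u) => <-; congr (jac _ (lone Gs)); apply/funext => h /=.
by rewrite rhoM.
Qed.

(** [base_pairing_src] reduces this to the bracket of [Gg'] and [Gu'] at a unit of the groupoid over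
    [G]. The sign of [negB bGamma] and that of the exchanged arguments cancel. *)
Lemma pairing_muY_src y : (jac muY y)^T *m bYm y *m jac (gsrc Yg) y =
  \sum_i (right_inv (row i x) (muY y))^T *m inf_rho rho (row i xi) (gsrc Yg y).
Proof.
have [_ co] := dp_aY S.
rewrite (@base_pairing_src K GM G Gs Ym Y Yg muY gg gg' gu' (@Gunit_Gs _ _ _ _ jG jGs)
  (@Gunit_G _ _ _ _ jG jGs) aY (fun u (v : Y) => rho v u) cG lY muY_smooth muY_unit
  Gg'_smooth Gu'_smooth Gunit_Gs_smooth (fun=> erefl) (fun=> erefl)
  (fun=> erefl) actY_smooth_on muY_act actY_unit srcY_act
  (fun u (v : Y) => dp_rho S v u) _ _ co y).
rewrite /negB mulmxN mulNmx -[(jac gg' _)^T *m _ *m _]trmxK tr_mul3 bGamma_tr mulmxN mulNmx.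
rewrite mulNmx tr_opp mulNmx opprK bracket_u'_g' tr_sum_outer mulmx_suml.
by apply: eq_bigr => i _; rewrite left_inv1 -mulmxA.
Qed.

Lemma pairing_muZ_tgt z : (jac muZ z)^T *m bZm z *m jac (gtgt Zg) z =
  \sum_i (left_inv (row i xi) (muZ z))^T *m inf_theta theta (row i x) (gtgt Zg z).
Proof.
have [_ co] := dp_aZ S.
rewrite (@base_pairing_tgt K GM Gs G Zm Z Zg muZ gu gu' gg' (@Gunit_G _ _ _ _ jG jGs)
  (@Gunit_Gs _ _ _ _ jG jGs) aZ theta cG lZ muZ_smooth muZ_unit
  Gu'_smooth Gg'_smooth Gunit_G_smooth (fun=> erefl) (fun=> erefl)
  (fun=> erefl) actZ_smooth_on muZ_act actZ_unit tgtZ_act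
  (dp_theta S) _ _ co z).
rewrite bracket_u'_g' mulmx_suml.
by apply: eq_bigr => i _; rewrite right_inv1 -mulmxA.
Qed.

(** Infinitesimal form of the statement that G x Z -> Z is Poisson. It is what the lower diagonal
    block of the source needs. *)
Lemma theta_poisson g (w : Z) : bZ (theta g w) =
  push (jac (theta g) w) (bZ w) + push (jac (theta^~ w) g) (bG g).
Proof.
have [_ co] := dp_aZ S; have [_ _ _ [_ hs] _] := dp_Z S.
rewrite (@base_action_poisson K GM Gs G Zm Z Zg muZ gu gg (@Gunit_G _ _ _ _ jG jGs)
  aZ theta cG lZ muZ_unit Gg_smooth Gunit_G_smooth (fun=> erefl) (fun=> erefl)
  actZ_smooth_on srcZ_act (dp_theta S) _ _ bZ co g w hs).
by have [_ _ _ [_ ->] _] := PG.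
Qed.

Lemma rho_poisson (w : Y) u : bY (rho w u) =
  push (jac (rho^~ u) w) (bY w) + push (jac (rho w) u) (bGs u).
Proof.
have [_ co] := dp_aY S; have [_ _ _ [_ hs] _] := dp_Y S.
rewrite (@base_action_poisson K GM G Gs Ym Y Yg muY gg gu' (@Gunit_Gs _ _ _ _ jG jGs)
  aY (fun u (v : Y) => rho v u) cG lY muY_unit Gu'_smooth Gunit_Gs_smooth
  (fun=> erefl) (fun=> erefl)
  actY_smooth_on srcY_act (fun u (v : Y) => dp_rho S v u) _ _ bY co u w hs).
have [_ _ _ _ [_ h]] := PGs; congr (_ + push _ _).
by rewrite /negB pushN [X in - X]h /negB opprK.
Qed.

Notation bbase := (mixed_product rho theta x xi bY bZ).

Lemma mixed_productE (w : prodM Y Z) : bbase w =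
  block_mx (bY w.1)
    (- \sum_i (inf_rho rho (row i xi) w.1)^T *m inf_theta theta (row i x) w.2)
    (\sum_i (inf_theta theta (row i x) w.2)^T *m inf_rho rho (row i xi) w.1) (bZ w.2).
Proof.
by rewrite /mixed_product sum_wedge_mixed /prodB opp_block_mx add_block_mx !oppr0 !addr0 !add0r opprK.
Qed.

(** The lower diagonal block is the Poisson property of [theta], fed by the Poisson maps [muY] and
    [gsrc Zg]. The off-diagonal blocks are the brackets of [muY] with [gsrc Yg], carried by [theta],
    and they produce the wedge term of the mixed product. *)
Lemma src_poisson : @poisson_map K YZ (prodM Y Z) (prodB bYm bZm) bbase (gsrc YLZ).
Proof.
split=> [p|p]; have [s j] := src_jac p; first exact: s.
have [[_ aYm] [_ _ _ [_ hY] _]] := (dp_muY S, dp_Y S).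
have [_ [[tYm _ _] _] _ _ _] := dp_Y S.
have [_ _ _ [_ hZ] _] := dp_Z S; have [_ hmu] := aYm.
have pr : (jac (gsrc Yg) p.1)^T *m bYm p.1 *m jac muY p.1 =
  - \sum_i (inf_rho rho (row i xi) (gsrc Yg p.1))^T *m right_inv (row i x) (muY p.1).
  by rewrite -[LHS]trmxK tr_mul3 tYm mulmxN mulNmx pairing_muY_src tr_opp tr_sum_outer.
have pl := pairing_muY_src p.1.
have hY' : push (jac (gsrc Yg) p.1) (bYm p.1) = bY (gsrc Yg p.1) by exact: hY.
have hZ' : push (jac (gsrc Zg) p.2) (bZm p.2) = bZ (gsrc Zg p.2) by exact: hZ.
have hmu' : push (jac muY p.1) (bYm p.1) = bG (muY p.1) by exact: hmu.
rewrite j mixed_productE /= /prodB push_upper -!push_comp hY' hZ' hmu' addrC -theta_poisson.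
congr block_mx.
  rewrite mulmxA pr mulNmx mulmx_suml; congr (- _); apply: eq_bigr => i _.
  by rewrite -mulmxA inf_thetaE.
rewrite trmx_mul mul4 pl mulmx_sumr; apply: eq_bigr => i _.
by rewrite mulmxA -trmx_mul inf_thetaE.
Qed.

Lemma tgt_poisson : @poisson_map K YZ (prodM Y Z) (prodB bYm bZm) (negB bbase) (gtgt YLZ).
Proof.
split=> [p|p]; have [s j] := tgt_jac p; first exact: s.
have [[_ [_ hmu]] [_ _ _ _ [_ hY]]] := (dp_muZ S, dp_Y S).
have [_ [[tZm _ _] _] _ _ [_ hZ]] := dp_Z S.
have pl := pairing_muZ_tgt p.2.
have pr : (jac (gtgt Zg) p.2)^T *m bZm p.2 *m jac muZ p.2 =
  - \sum_i (inf_theta theta (row i x) (gtgt Zg p.2))^T *m left_inv (row i xi) (muZ p.2).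
  by rewrite -[LHS]trmxK tr_mul3 tZm mulmxN mulNmx pl tr_opp tr_sum_outer.
have hY' : push (jac (gtgt Yg) p.1) (bYm p.1) = - bY (gtgt Yg p.1) by exact: hY.
have hZ' : push (jac (gtgt Zg) p.2) (bZm p.2) = - bZ (gtgt Zg p.2) by exact: hZ.
have hmu' : push (jac muZ p.2) (bZm p.2) = - bGs (muZ p.2) by exact: hmu.
rewrite j /negB mixed_productE /= /prodB push_lower -!push_comp hY' hZ' hmu' !pushN -opprD.
rewrite -rho_poisson opp_block_mx opprK; congr block_mx.
  rewrite trmx_mul mul4 pl mulmx_sumr; apply: eq_bigr => i _.
  by rewrite mulmxA -trmx_mul inf_rhoE.
rewrite mulmxA pr mulNmx mulmx_suml; congr (- _); apply: eq_bigr => i _.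
by rewrite -mulmxA inf_rhoE.
Qed.

(** * The map to the double is Poisson *)

Lemma mu_L_jac (p : YZ) :
  @smooth_at K YZ D (mu_L jG jGs muY muZ) p /\
  @jac K YZ D (mu_L jG jGs muY muZ) p =
  col_mx (jac muY p.1 *m jac jG (muY p.1) *m
            jac (fun d => lmul d (jGs (muZ p.2))) (jG (muY p.1)))
         (jac muZ p.2 *m jac jGs (muZ p.2) *m jac (lmul (jG (muY p.1))) (jGs (muZ p.2))).
Proof.
have sG := smooth_at_comp cYm (mfd_charted G) (muY_smooth p.1) (smooth_lhom jG (muY p.1)).
have sGs := smooth_at_comp cZm (mfd_charted Gs) (muZ_smooth p.2) (smooth_lhom jGs (muZ p.2)).
have [s1 j1] := smooth_fst_comp cYm cZm sG.
have [s2 j2] := smooth_snd_comp cYm cZm sGs.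
have [s3 j3] := lmul_comp cYZ s1 s2; split; first exact: s3.
rewrite [LHS]j3 j1 j2 !mul_col_mx !mul0mx add_col_mx addr0 add0r.
rewrite (jac_comp cYm (mfd_charted G) (muY_smooth p.1) (smooth_lhom jG (muY p.1))).
by rewrite (jac_comp cZm (mfd_charted Gs) (muZ_smooth p.2) (smooth_lhom jGs (muZ p.2))).
Qed.

Hypothesis hGD : poisson_map bG (piD jG jGs x xi) jG.
Hypothesis hGsD : poisson_map (negB bGs) (piD jG jGs x xi) jGs.

(** The map multiplies two Poisson maps into [D], and [piD] is multiplicative by
    [left_right_invB_mul]. *)
Lemma mu_L_poisson : @poisson_map K YZ D (prodB bYm bZm) (piD jG jGs x xi)
  (mu_L jG jGs muY muZ).
Proof.
split=> [p|p]; have [s j] := mu_L_jac p; first exact: s.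
have [[_ [_ hY]] [_ [_ hZ]]] := (dp_muY S, dp_muZ S).
have hY' : push (jac muY p.1) (bYm p.1) = bG (muY p.1) by exact: hY.
have hZ' : push (jac muZ p.2) (bZm p.2) = negB bGs (muZ p.2) by exact: hZ.
have [[_ hG] [_ hGs]] := (hGD, hGsD).
have hG' : push (jac jG (muY p.1)) (bG (muY p.1)) = piD jG jGs x xi (jG (muY p.1)) by exact: hG.
have hGs' : push (jac jGs (muZ p.2)) (negB bGs (muZ p.2)) = piD jG jGs x xi (jGs (muZ p.2)).
  exact: hGs.
rewrite j /prodB push_col -!push_comp hY' hZ' hG' hGs' /piD.
by rewrite -left_right_invB_mul.
Qed.

Lemma product_poisson :
  is_poisson (prodB bYm bZm : bivector YZ) /\ is_poisson bbase.
Proof.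
have [[_ [hY _] _ _ _] [_ [hZ _] _ _ _]] := (dp_Y S, dp_Z S).
have hp := poisson_prod hK cYm cZm hY hZ; split=> //.
have [ss ps] := src_poisson; have cYZ' : charted (prodM Y Z) by auto.
exact: (@poisson_pushforward K YZ (prodM Y Z) _ _ (gsrc YLZ) (gunit YLZ) cYZ cYZ' ss
  unit_smooth src_unit ps hp).
Qed.

(** * Coisotropy of the product *)

Let cYY : charted (prodM Ym Ym). Proof. by auto. Qed.
Let cZZ : charted (prodM Zm Zm). Proof. by auto. Qed.

Lemma ltimesYK y c : muY y = Gg' c -> aY (ltimesY aY c y) c = y.
Proof.
move=> e; rewrite /ltimesY actY_mul//.
have [a1 a2 a3 a4] := @Gmul_GE _ _ _ _ _ _ (Ginv_G c) c erefl.
rewrite -[RHS]actY_unit; congr aY.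
by apply: Gamma_ext; rewrite ?a1 ?a2 ?a3 ?a4 ?e//= [LHS]lmulVg.
Qed.

Lemma ltimesY_act y c : muY y = Gg c -> ltimesY aY c (aY y c) = y.
Proof.
move=> e; rewrite /ltimesY actY_mul//.
have [a1 a2 a3 a4] := @Gmul_GE _ _ _ _ _ _ c (Ginv_G c) erefl.
rewrite -[RHS]actY_unit; congr aY.
by apply: Gamma_ext; rewrite ?a1 ?a2 ?a3 ?a4 ?e//= [LHS]lmulgV.
Qed.

Lemma ltimesZK z c : muZ z = Gu' c -> aZ (ltimesZ aZ c z) c = z.
Proof.
move=> e; rewrite /ltimesZ actZ_mul//.
have [a1 a2 a3 a4] := @Gmul_GsE _ _ _ _ _ _ (Ginv_Gs c) c erefl.
rewrite -[RHS]actZ_unit; congr aZ.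
by apply: Gamma_ext; rewrite ?a1 ?a2 ?a3 ?a4 ?e//= [LHS]lmulgV.
Qed.

Lemma ltimesZ_act z c : muZ z = Gu c -> ltimesZ aZ c (aZ z c) = z.
Proof.
move=> e; rewrite /ltimesZ actZ_mul//.
have [a1 a2 a3 a4] := @Gmul_GsE _ _ _ _ _ _ c (Ginv_Gs c) erefl.
rewrite -[RHS]actZ_unit; congr aZ.
by apply: Gamma_ext; rewrite ?a1 ?a2 ?a3 ?a4 ?e//= [LHS]lmulVg.
Qed.

Notation P6 := (prodM (prodM YZ YZ) YZ).
Notation Q4 := (prodM (prodM Ym Ym) (prodM Zm Zm)).

(* The graph of the product is parametrized, near a point of it, by its factors
   [y1], [c |>_G y2], [c |>_G* z1], [z2]: with [FY], [FZ] extending the products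
   and [AY], [AZ] the actions, a function vanishing on the graph pulls back to
   one which vanishes where the two pairs are composable. *)
Lemma product_coisotropic : coisotropic_mul YLZ (prodB bYm bZm).
Proof.
move=> [[[y1 z1] [y2 z2]] r] f f' [Dm /= re] sf sf' vf vf'.
have [_ Om Dy Dz] := Dm; have [Oc e1 e2] := gammaRP Om.
rewrite /= in Om Dy Dz Oc e1 e2; set c := gammaR _ _ _ in Dy Dz Oc e1 e2.
have [mY _ _] := ltimesY_spec (esym e2); have [mZ _ _] := ltimesZ_spec (esym e1).
have K2 := ltimesYK (esym e2); have K1 := ltimesZK (esym e1).
set y2t := ltimesY aY c y2 in Dy mY K2; set z1t := ltimesZ aZ c z1 in Dz mZ K1.
have [FY [sFY hFY]] := gmul_smooth lY Dy; have [FZ [sFZ hFZ]] := gmul_smooth lZ Dz.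
have mY' : [set p | muY p.1 = Gg p.2] (y2t, c) by [].
have mZ' : [set p | muZ p.1 = Gu p.2] (z1t, c) by [].
have [AY [sAY hAY]] := actY_smooth_on mY'; have [AZ [sAZ hAZ]] := actZ_smooth_on mZ'.
pose gL (q : prodM G Gs) : GM := gammaL O q.1 q.2.
have OL : O_GGs O (muY y2t, muZ z1t) by rewrite mY mZ; exists c.
have gLc : gL (muY y2t, muZ z1t) = c by rewrite /gL /= mY mZ; exact: (gammaL_unique Oc).
have [sgL nO] := gammaL_smooth GpL_local_diffeo (dp_O S) OL.
have cGGs : charted (prodM G Gs) by auto.
have cQ : charted Q4 by auto.
pose n0 : Q4 := ((y1, y2t), (z1t, z2)).
have [sy1 jy1] := four_1 cYm cYm cZm cZm (p := n0) (smooth_at_id y1 cYm).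
have [sy2 jy2] := four_2 cYm cYm cZm cZm (p := n0) (smooth_at_id y2t cYm).
have [sz1 jz1] := four_3 cYm cYm cZm cZm (p := n0) (smooth_at_id z1t cZm).
have [sz2 jz2] := four_4 cYm cYm cZm cZm (p := n0) (smooth_at_id z2 cZm).
have [smY jmY] := four_2 cYm cYm cZm cZm (p := n0) (muY_smooth y2t).
have [smZ jmZ] := four_3 cYm cYm cZm cZm (p := n0) (muZ_smooth z1t).
pose gh (m : Q4) : GM := gL (muY m.1.2, muZ m.2.1).
have [sgh jgh] := comp_pair cQ (mfd_charted G) (mfd_charted Gs) smY smZ sgL.
rewrite -/gh in sgh jgh; have ghc : gh n0 = c by exact: gLc.
have sAY' : smooth_at AY (y2t, gh n0) by rewrite ghc.
have sAZ' : smooth_at AZ (z1t, gh n0) by rewrite ghc.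
have [sY2 jY2] := comp_pair cQ cYm cG sy2 sgh sAY'.
have [sZ1 jZ1] := comp_pair cQ cZm cG sz1 sgh sAZ'.
have [sY3 jY3] := comp_pair cQ cYm cYm sy1 sy2 sFY.
have [sZ3 jZ3] := comp_pair cQ cZm cZm sz1 sz2 sFZ.
pose Phi (m : Q4) : P6 := (((m.1.1, AZ (m.2.1, gh m)), (AY (m.1.2, gh m), m.2.2)),
  (FY (m.1.1, m.1.2), FZ (m.2.1, m.2.2))).
have sPhi : smooth_at Phi n0.
  exact: (smooth_at_pair (smooth_at_pair (smooth_at_pair sy1 sZ1) (smooth_at_pair sY2 sz2))
    (smooth_at_pair sY3 sZ3)).
have Phi0 : Phi n0 = (((y1, z1), (y2, z2)), r).
  rewrite /Phi ghc /= re /YL_mul /= -/c -/y2t -/z1t.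
  rewrite (nbhs_singleton hAZ mZ') (nbhs_singleton hAY mY') /= K1 K2.
  by rewrite (nbhs_singleton hFY Dy) (nbhs_singleton hFZ Dz).
pose gr : set P6 := [set p | gmdom YLZ p.1 /\ p.2 = gmul YLZ p.1.1 p.1.2].
(* Near [n0] composability already implies that the products are defined, so the two equations
   between source and target suffice: on them all four extensions agree with the actual maps, and
   [gammaR] recovers the element of [Gamma] used by [gh]. *)
have graph : \forall m \near n0,
    gtgt Yg m.1.1 = gsrc Yg m.1.2 -> gtgt Zg m.2.1 = gsrc Zg m.2.2 -> gr (Phi m).
  have [k1 _] := smooth_at_pair smY smZ; have [k2 _] := smooth_at_pair sy2 sgh.
  have [k3 _] := smooth_at_pair sz1 sgh; have [k4 _] := smooth_at_pair sy1 sy2.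
  have [k5 _] := smooth_at_pair sz1 sz2.
  have m1 : \forall m \near n0, O_GGs O (muY m.1.2, muZ m.2.1) := k1 _ nO.
  have hAY' : \forall q \near ((y2t, gh n0) : prodM Ym GM),
      muY q.1 = Gg q.2 -> AY q = aY q.1 q.2 by rewrite ghc.
  have hAZ' : \forall q \near ((z1t, gh n0) : prodM Zm GM),
      muZ q.1 = Gu q.2 -> AZ q = aZ q.1 q.2 by rewrite ghc.
  have m2 : \forall m \near n0, muY m.1.2 = Gg (gh m) -> AY (m.1.2, gh m) = aY m.1.2 (gh m).
    exact: (k2 _ hAY').
  have m3 : \forall m \near n0, muZ m.2.1 = Gu (gh m) -> AZ (m.2.1, gh m) = aZ m.2.1 (gh m).
    exact: (k3 _ hAZ').
  have m4 : \forall m \near n0, gmdom Yg (m.1.1, m.1.2) ->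
    FY (m.1.1, m.1.2) = gmul Yg m.1.1 m.1.2 := k4 _ hFY.
  have m5 : \forall m \near n0, gmdom Zg (m.2.1, m.2.2) ->
    FZ (m.2.1, m.2.2) = gmul Zg m.2.1 m.2.2 := k5 _ hFZ.
  have m6 : \forall m \near n0, composable Yg (m.1.1, m.1.2) -> gmdom Yg (m.1.1, m.1.2).
    exact: (k4 _ (gmdom_near lY Dy)).
  have m7 : \forall m \near n0, composable Zg (m.2.1, m.2.2) -> gmdom Zg (m.2.1, m.2.2).
    exact: (k5 _ (gmdom_near lZ Dz)).
  apply: filterS3 m1 (filterI m2 m3) (filterI (filterI m4 m5) (filterI m6 m7)).
  move=> [[a1 a2] [b1 b2]] /gammaLP[] /=; rewrite -/(gL (muY a2, muZ b1)) /Phi /gh /=.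
  set ga := gL _ => Oga g1 g2 [h2 h3] [[h4 h5] [h6 h7]] ca cb.
  have {}h6 := h6 ca; have {}h7 := h7 cb.
  rewrite (h2 (esym g1)) (h3 (esym g2)) (h4 h6) (h5 h7).
  have w1 := muY_act (esym g1); have w2 := muZ_act (esym g2).
  have w3 := ltimesY_act (esym g1); have w4 := ltimesZ_act (esym g2).
  have w5 := gammaR_unique Oga.
  have Om' : O_ZY O muY muZ (aZ b1 ga, aY a2 ga) by rewrite /O_ZY /= w1 w2; exists ga.
  have Cm := proj2 (composable_ltimes (p := (a1, aZ b1 ga)) (q := (aY a2 ga, b2)) Om').
  rewrite /= w1 w2 w5 w3 w4 in Cm.
  split; last by rewrite /= /YL_mul /= w1 w2 w5 w3 w4.
  by split; rewrite /= ?w1 ?w2 ?w5 ?w3 ?w4//; exact: Cm.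
have cP6 : charted P6 by auto.
have cYZ2 : charted (prodM Y Z) by auto.
have jPhi : jac Phi n0 = row_mx (row_mx
    (row_mx (jac (fun m : Q4 => m.1.1) n0) (jac (fun m : Q4 => AZ (m.2.1, gh m)) n0))
    (row_mx (jac (fun m : Q4 => AY (m.1.2, gh m)) n0) (jac (fun m : Q4 => m.2.2) n0)))
  (row_mx (jac (fun m : Q4 => FY (m.1.1, m.1.2)) n0) (jac (fun m : Q4 => FZ (m.2.1, m.2.2)) n0)).
  exact: (etrans (jac_pair _ _ _) (congr2 row_mx (etrans (jac_pair _ _ _)
    (congr2 row_mx (jac_pair _ _ _) (jac_pair _ _ _))) (jac_pair _ _ _))).
pose Kg := usubmx (jac gL (muY y2t, muZ z1t) : 'M[K]_(mdim G + mdim Gs, mdim GM)).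
pose Ku := dsubmx (jac gL (muY y2t, muZ z1t) : 'M[K]_(mdim G + mdim Gs, mdim GM)).
pose uAY := usubmx (jac AY (y2t, c) : 'M[K]_(mdim Ym + mdim GM, mdim Ym)).
pose dAY := dsubmx (jac AY (y2t, c) : 'M[K]_(mdim Ym + mdim GM, mdim Ym)).
pose uAZ := usubmx (jac AZ (z1t, c) : 'M[K]_(mdim Zm + mdim GM, mdim Zm)).
pose dAZ := dsubmx (jac AZ (z1t, c) : 'M[K]_(mdim Zm + mdim GM, mdim Zm)).
pose uFY := usubmx (jac FY (y1, y2t) : 'M[K]_(mdim Ym + mdim Ym, mdim Ym)).
pose dFY := dsubmx (jac FY (y1, y2t) : 'M[K]_(mdim Ym + mdim Ym, mdim Ym)).
pose uFZ := usubmx (jac FZ (z1t, z2) : 'M[K]_(mdim Zm + mdim Zm, mdim Zm)).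
pose dFZ := dsubmx (jac FZ (z1t, z2) : 'M[K]_(mdim Zm + mdim Zm, mdim Zm)).
rewrite jmY jmZ !mul_col_mx !mul0mx !add_col_mx !(addr0, add0r) -/Kg -/Ku in jgh.
rewrite /= in jgh.
(* Differentiating the identity expressing c' through [Gg c'] and [Gu c']. It splits any covector on
   [Gamma] into a part along [Gg] and a part along [Gu]. *)
have jK : jac (@Gg _ _ _ _ jG jGs : GM -> G) c *m Kg +
    jac (@Gu _ _ _ _ jG jGs : GM -> Gs) c *m Ku = 1%:M.
  have sgL' : smooth_at gL (Gg c, Gu c) by rewrite -mY -mZ.
  have [_ j] := comp_pair cG (mfd_charted G) (mfd_charted Gs) (Gg_smooth c)
    (Gu_smooth c) sgL'.
  rewrite /Kg /Ku mY mZ -j -(@jac_id K GM c cG); apply: (@jac_near K GM GM _ _ c cG).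
  have [[oO _ _ _] _] := dp_O S; have nOc : nbhs (c : GM) O by exact: open_nbhs_nbhs.
  by apply: filterS nOc => c' Oc'; exact: (gammaL_unique Oc').
rewrite jy2 ghc jgh jac_id// !mul_col_mx !mul0mx !add_col_mx !(addr0, add0r) !mul1mx
  -/uAY -/dAY in jY2.
rewrite jz1 ghc jgh jac_id// !mul_col_mx !mul0mx !add_col_mx !(addr0, add0r) !mul1mx
  -/uAZ -/dAZ in jZ1.
rewrite jy1 jy2 !jac_id// !mul_col_mx !mul0mx !add_col_mx !(addr0, add0r) !mul1mx
  -/uFY -/dFY in jY3.
rewrite jz1 jz2 !jac_id// !mul_col_mx !mul0mx !add_col_mx !(addr0, add0r) !mul1mx
  -/uFZ -/dFZ in jZ3.
rewrite jac_id// in jy1; rewrite jac_id// in jz2.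
rewrite [X in row_mx (row_mx (row_mx X _) _) _]jy1 [X in row_mx (row_mx (row_mx _ X) _) _]jZ1
  [X in row_mx (row_mx _ (row_mx X _)) _]jY2 [X in row_mx (row_mx _ (row_mx _ X)) _]jz2
  [X in row_mx _ (row_mx X _)]jY3 [X in row_mx _ (row_mx _ X)]jZ3 in jPhi.
pose a1 (m : Q4) : prodM Y Z := (gtgt Yg m.1.1, gtgt Zg m.2.1).
pose a2 (m : Q4) : prodM Y Z := (gsrc Yg m.1.2, gsrc Zg m.2.2).
have [t1 jt1] := four_1 cYm cYm cZm cZm (p := n0) (gtgt_smooth lY y1).
have [t2 jt2] := four_2 cYm cYm cZm cZm (p := n0) (gsrc_smooth lY y2t).
have [t3 jt3] := four_3 cYm cYm cZm cZm (p := n0) (gtgt_smooth lZ z1t).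
have [t4 jt4] := four_4 cYm cYm cZm cZm (p := n0) (gsrc_smooth lZ z2).
have sa1 : smooth_at a1 n0 := smooth_at_pair t1 t3.
have sa2 : smooth_at a2 n0 := smooth_at_pair t2 t4.
have ja : jac a1 n0 - jac a2 n0 = block_mx (col_mx (jac (gtgt Yg) y1) (- jac (gsrc Yg) y2t)) 0
    0 (col_mx (jac (gtgt Zg) z1t) (- jac (gsrc Zg) z2)).
  rewrite (jac_pair _ _ _ : jac a1 n0 = row_mx _ _) (jac_pair _ _ _ : jac a2 n0 = row_mx _ _).
  rewrite jt1 jt2 jt3 jt4 block_mxEh !(opp_row_mx, add_row_mx, opp_col_mx, add_col_mx).
  by rewrite !(oppr0, addr0, add0r).
have ea : a1 n0 = a2 n0.
  by rewrite /a1 /a2 /= (gmdom_composable lY Dy) (gmdom_composable lZ Dz).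
pose pr1 (v : 'cV[K]_(mdim P6)) : 'cV[K]_(mdim Ym + mdim Zm) :=
  usubmx (usubmx (v : 'cV[K]_((mdim Ym + mdim Zm + (mdim Ym + mdim Zm)) + (mdim Ym + mdim Zm)))).
pose pr2 (v : 'cV[K]_(mdim P6)) : 'cV[K]_(mdim Ym + mdim Zm) :=
  dsubmx (usubmx (v : 'cV[K]_((mdim Ym + mdim Zm + (mdim Ym + mdim Zm)) + (mdim Ym + mdim Zm)))).
pose pr3 (v : 'cV[K]_(mdim P6)) : 'cV[K]_(mdim Ym + mdim Zm) :=
  dsubmx (v : 'cV[K]_((mdim Ym + mdim Zm + (mdim Ym + mdim Zm)) + (mdim Ym + mdim Zm))).
have prE v : v = col_mx (col_mx (col_mx (usubmx (pr1 v)) (dsubmx (pr1 v)))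
    (col_mx (usubmx (pr2 v)) (dsubmx (pr2 v)))) (col_mx (usubmx (pr3 v)) (dsubmx (pr3 v))).
  by rewrite !vsubmxK.
pose pY : prodM (prodM Ym Ym) Ym := ((y1, y2t), gmul Yg y1 y2t).
pose pZ : prodM (prodM Zm Zm) Zm := ((z1t, z2), gmul Zg z1t z2).
pose qY : prodM (prodM Ym GM) Ym := ((y2t, c), aY y2t c).
pose qZ : prodM (prodM Zm GM) Zm := ((z1t, c), aZ z1t c).
have key (h : P6 -> K) : smoothf_at h (Phi n0) ->
    (\forall q \near Phi n0, gr q -> h q = 0) ->
    forall v, v = dgrad h (Phi n0) -> exists l l' nu nu',
    [/\ usubmx (pr1 v) = conormal_fst FY (gtgt Yg) pY (usubmx (pr3 v)) l,
        dsubmx (pr2 v) = conormal_snd FZ (gsrc Zg) pZ (dsubmx (pr3 v)) l',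
        conormal_snd FY (gsrc Yg) pY (usubmx (pr3 v)) l =
          - conormal_fst AY muY qY (usubmx (pr2 v)) nu,
        conormal_fst FZ (gtgt Zg) pZ (dsubmx (pr3 v)) l' =
          - conormal_fst AZ muZ qZ (dsubmx (pr1 v)) nu'
      & conormal_snd AZ (@Gu _ _ _ _ jG jGs : GM -> Gs) qZ (dsubmx (pr1 v)) nu' =
          - conormal_snd AY (@Gg _ _ _ _ jG jGs : GM -> G) qY (usubmx (pr2 v)) nu].
  move=> sh vh v ve.
  have sht := smoothf_comp cQ cP6 sPhi sh.
  have [cPhi _] := sPhi.
  have vht : \forall m \near n0, a1 m = a2 m -> (h \o Phi) m = 0.
    have vh' : \forall m \near n0, gr (Phi m) -> h (Phi m) = 0 := cPhi _ vh.
    by apply: filterS2 graph vh' => m g1 g2 [b1 b2]; apply: g2; exact: g1.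
  have full : row_full (jac a1 n0 - jac a2 n0).
    rewrite ja; apply: row_full_block_upper; apply: row_full_col; exact: gtgt_full.
  have [l0 hl] := vanishing_multiplier hK cQ cYZ2 sa1 sa2 ea full sht vht.
  rewrite (dgrad_comp cQ cP6 sPhi (smoothf_mdiff sh)) -ve jPhi ja in hl.
  rewrite [v in LHS]prE -[l0](@vsubmxK _ (mdim Y) (mdim Z)) in hl.
  move: hl.
  move: (usubmx (pr1 v)) (dsubmx (pr1 v)) (usubmx (pr2 v)) (dsubmx (pr2 v))
    (usubmx (pr3 v)) (dsubmx (pr3 v)) => dy1 dz1 dy2 dz2 dy3 dz3.
  move: (usubmx (l0 : 'cV[K]_(mdim Y + mdim Z))) (dsubmx (l0 : 'cV[K]_(mdim Y + mdim Z))) => l l'.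
  rewrite mul_block_col !mul_row_col !mul_col_mx !mul0mx !mul1mx !add_col_mx !(addr0, add0r).
  rewrite !add_col_mx !(addr0, add0r).
  move=> /eq_col_mx[/eq_col_mx[q1 q2] /eq_col_mx[q3 q4]].
  (* [w] is the covector on [Gamma] pulled back from both acted factors. Its parts [Kg *m w] and
     [Ku *m w] are, up to sign, the multipliers of the equations [muY = Gg] and [muZ = Gu] on the
     graphs of the actions, and by [jK] the two conormal components over [Gamma] become opposite. *)
  rewrite mulNmx in q2; rewrite mulNmx in q4; pose w := dAY *m dy2 + dAZ *m dz1.
  have hw : jac (@Gu _ _ _ _ jG jGs : GM -> Gs) c *m (Ku *m w) =
      w - jac (@Gg _ _ _ _ jG jGs : GM -> G) c *m (Kg *m w).
    apply/eqP; rewrite -subr_eq opprK addrC !mulmxA -mulmxDl; apply/eqP.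
    by rewrite jK mul1mx.
  exists l, l', (- (Kg *m w)), (- (Ku *m w)); rewrite /conormal_fst /conormal_snd.
  rewrite /= -/uFY -/dFY -/uFZ -/dFZ -/uAY -/dAY -/uAZ -/dAZ; split.
  - by rewrite -q1 addrC addrK.
  - by rewrite -q4 addrC addrK.
  - rewrite -q2 mulmxDl mulmxN !mulmxDr !mulmxA.
    move: (jac muY _ *m _ *m _ *m dz1) (uAY *m _) (jac muY _ *m _ *m _ *m dy2) (dFY *m _).
    by move=> b d e a; rewrite opprD !opprK addrC addrK addrCA (addrC b).
  - rewrite -q3 mulmxDl mulmxN !mulmxDr !mulmxA.
    move: (jac muZ _ *m _ *m _ *m dz1) (uAZ *m _) (jac muZ _ *m _ *m _ *m dy2) (uFZ *m _).
    by move=> b d e a; rewrite opprD !opprK addrC addrK -addrA (addrC b).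
  - rewrite !mulmxN !opprK hw /w.
    move: (dAY *m dy2) (dAZ *m dz1) (jac _ _ *m _) => a b d.
    by rewrite opprD opprK (addrC a b) -addrA addKr.
rewrite -Phi0 in sf sf' vf vf' *.
pose v := dgrad f (Phi n0); pose v' := dgrad f' (Phi n0).
have [l [l' [nu [nu' [k1 k2 k3 k4 k5]]]]] := key f sf vf v erefl.
have [m [m' [om [om' [n1 n2 n3 n4 n5]]]]] := key f' sf' vf' v' erefl.
have coY : coisotropic_mul Yg bYm by have [] := dp_Y S.
have coZ : coisotropic_mul Zg bZm by have [] := dp_Z S.
have [_ coaY] := dp_aY S; have [_ coaZ] := dp_aZ S.
have gY : forall q, gmdom Yg q.1 /\ q.2 = gmul Yg q.1.1 q.1.2 -> gtgt Yg q.1.1 = gsrc Yg q.1.2.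
  by move=> [[b1 b2] b3] [/(gmdom_composable lY)].
have gZ : forall q, gmdom Zg q.1 /\ q.2 = gmul Zg q.1.1 q.1.2 -> gtgt Zg q.1.1 = gsrc Zg q.1.2.
  by move=> [[b1 b2] b3] [/(gmdom_composable lZ)].
have FYn : \forall q \near pY, gmdom Yg q.1 /\ q.2 = gmul Yg q.1.1 q.1.2 -> q.2 = FY q.1.
  have h : \forall q \near pY, gmdom Yg q.1 -> FY q.1 = gmul Yg q.1.1 q.1.2.
    exact: (cvg_fst hFY).
  by apply: filterS h => q h [b1 ->]; rewrite h.
have FZn : \forall q \near pZ, gmdom Zg q.1 /\ q.2 = gmul Zg q.1.1 q.1.2 -> q.2 = FZ q.1.
  have h : \forall q \near pZ, gmdom Zg q.1 -> FZ q.1 = gmul Zg q.1.1 q.1.2.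
    exact: (cvg_fst hFZ).
  by apply: filterS h => q h [b1 ->]; rewrite h.
have AYn : \forall q \near qY, muY q.1.1 = Gg q.1.2 /\ q.2 = aY q.1.1 q.1.2 -> q.2 = AY q.1.
  have h : \forall q \near qY, muY q.1.1 = Gg q.1.2 -> AY q.1 = aY q.1.1 q.1.2.
    exact: (cvg_fst hAY).
  by apply: filterS h => q h [b1 ->]; rewrite h.
have AZn : \forall q \near qZ, muZ q.1.1 = Gu q.1.2 /\ q.2 = aZ q.1.1 q.1.2 -> q.2 = AZ q.1.
  have h : \forall q \near qZ, muZ q.1.1 = Gu q.1.2 -> AZ q.1 = aZ q.1.1 q.1.2.
    exact: (cvg_fst hAZ).
  by apply: filterS h => q h [b1 ->]; rewrite h.
(* Isotropy of the four conormal spaces. The relations supplied by [key] identify the components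
   over the exchanged factors and over [Gamma], up to signs which disappear in the bilinear
   expressions. *)
have := graph_coisotropic cYm cYm cYm (p := pY) coY (conj Dy erefl) sFY
  (gtgt_smooth lY _) (gsrc_smooth lY _) FYn gY (usubmx (pr3 v)) (usubmx (pr3 v')) l m.
have := graph_coisotropic cZm cZm cZm (p := pZ) coZ (conj Dz erefl) sFZ
  (gtgt_smooth lZ _) (gsrc_smooth lZ _) FZn gZ (dsubmx (pr3 v)) (dsubmx (pr3 v')) l' m'.
have := graph_coisotropic cYm cG cYm (p := qY) coaY (conj mY erefl) sAY
  (muY_smooth _) (Gg_smooth c) AYn (fun q h => proj1 h)
  (usubmx (pr2 v)) (usubmx (pr2 v')) nu om.
have := graph_coisotropic cZm cG cZm (p := qZ) coaZ (conj mZ erefl) sAZ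
  (muZ_smooth _) (Gu_smooth c) AZn (fun q h => proj1 h)
  (dsubmx (pr1 v)) (dsubmx (pr1 v')) nu' om'.
rewrite -/pY -/pZ -/qY -/qZ bracketE -/v -/v' [in X in _ -> _ -> _ -> _ -> X](prE v)
  [in X in _ -> _ -> _ -> _ -> X](prE v').
rewrite triple_pairing Phi0 re /YL_mul /= -/c -/y2t -/z1t /negB.
rewrite !(tr_opp, mulmxN, mulNmx, opprK) !pair_pairing /= K1 K2 k1 k2 n1 n2 k3 n3 k4 n4 k5 n5.
rewrite !(tr_opp, mulmxN, mulNmx, opprK) => i1 i2 i3 i4.
by rewrite (alternating_sum i1 i2 i3 i4) mxE.
Qed.

(** * Associativity *)

Lemma ltimesY_mul y c1 c2 : Gg' c1 = Gg c2 -> muY y = Gg' c2 ->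
  ltimesY aY (Gmul_G c1 c2) y = ltimesY aY c1 (ltimesY aY c2 y).
Proof.
move=> e ey; rewrite /ltimesY actY_mul//.
have [a1 a2 a3 a4] := Gmul_GE e.
have [b1 b2 b3 b4] := @Gmul_GE _ _ _ _ _ _ (Ginv_G c2) (Ginv_G c1) (esym e).
congr aY; apply: Gamma_ext; rewrite ?b1 ?b2 ?b3 ?b4.
- exact: a4.
- by rewrite -[RHS]linvM -a2.
- by rewrite -[RHS]linvM -a3.
- exact: a1.
Qed.

Lemma ltimesZ_mul z c1 c2 : Gu' c1 = Gu c2 -> muZ z = Gu' c2 ->
  ltimesZ aZ (Gmul_Gs c1 c2) z = ltimesZ aZ c1 (ltimesZ aZ c2 z).
Proof.
move=> e ez; rewrite /ltimesZ actZ_mul//.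
have [a1 a2 a3 a4] := Gmul_GsE e.
have [b1 b2 b3 b4] := @Gmul_GsE _ _ _ _ _ _ (Ginv_Gs c2) (Ginv_Gs c1) (esym e).
congr aZ; apply: Gamma_ext; rewrite ?b1 ?b2 ?b3 ?b4.
- by rewrite -[RHS]linvM -a1.
- exact: a3.
- exact: a2.
- by rewrite -[RHS]linvM -a4.
Qed.

Lemma ltimesY_twist y1 y2 c1 c2 : gmdom Yg (y1, y2) -> Gu' c2 = Gu c1 ->
  muY y1 = Gg' c1 -> muY y2 = Gg' c2 ->
  composable Yg (ltimesY aY c1 y1, ltimesY aY c2 y2) /\
  (gmdom Yg (ltimesY aY c1 y1, ltimesY aY c2 y2) ->
   ltimesY aY (Gmul_Gs c2 c1) (gmul Yg y1 y2) =
   gmul Yg (ltimesY aY c1 y1) (ltimesY aY c2 y2)).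
Proof.
move=> d e e1 e2; have e' : Gu' (Ginv_G c2) = Gu (Ginv_G c1) by exact: (congr1 (@linv _ _) e).
have [h1 h2] := twistY d e' e1 e2; split=> // /h2 <-.
rewrite /ltimesY; congr aY; have [a1 a2 a3 a4] := Gmul_GsE e.
have [b1 b2 b3 b4] := Gmul_GsE e'.
by apply: Gamma_ext; rewrite ?b1 ?b2 ?b3 ?b4 /=; [exact: a4 | rewrite -[RHS]/(linv (Gu c2)) -a2 |
  rewrite -[RHS]/(linv (Gu' c1)) -a3 | exact: a1].
Qed.

Lemma ltimesZ_twist z1 z2 c1 c2 : gmdom Zg (z1, z2) -> Gg' c1 = Gg c2 ->
  muZ z1 = Gu' c1 -> muZ z2 = Gu' c2 ->
  composable Zg (ltimesZ aZ c1 z1, ltimesZ aZ c2 z2) /\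
  (gmdom Zg (ltimesZ aZ c1 z1, ltimesZ aZ c2 z2) ->
   ltimesZ aZ (Gmul_G c1 c2) (gmul Zg z1 z2) =
   gmul Zg (ltimesZ aZ c1 z1) (ltimesZ aZ c2 z2)).
Proof.
move=> d e e1 e2; have e' : Gg' (Ginv_Gs c1) = Gg (Ginv_Gs c2) by exact: (congr1 (@linv _ _) e).
have [h1 h2] := twistZ d e' e1 e2; split=> // /h2 <-.
rewrite /ltimesZ; congr aZ; have [a1 a2 a3 a4] := Gmul_GE e.
have [b1 b2 b3 b4] := Gmul_GE e'.
by apply: Gamma_ext; rewrite ?b1 ?b2 ?b3 ?b4 /=; [rewrite -[RHS]/(linv (Gg c1)) -a1 | exact: a3 |
  exact: a2 | rewrite -[RHS]/(linv (Gg' c2)) -a4].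
Qed.

Notation c12 p q := (gammaR O (muZ p.2) (muY q.1)).
Notation cl p q r := (gammaR O (lmul (Gu (c12 p q)) (muZ q.2)) (muY r.1)).
Notation cr p q r := (gammaR O (muZ p.2) (lmul (muY q.1) (Gg (c12 q r)))).

(* The triple products agree once the middle factors can be multiplied. *)
Definition middle_defined : set (YZ * YZ * YZ) := [set t | 
  let p := t.1.1 in let q := t.1.2 in let r := t.2 in
  (composable Yg (ltimesY aY (c12 p q) q.1, ltimesY aY (cl p q r) r.1) ->
   gmdom Yg (ltimesY aY (c12 p q) q.1, ltimesY aY (cl p q r) r.1)) /\
  (composable Zg (ltimesZ aZ (cr p q r) p.2, ltimesZ aZ (c12 q r) q.2) ->
   gmdom Zg (ltimesZ aZ (cr p q r) p.2, ltimesZ aZ (c12 q r) q.2))].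

Section Triple.
Variables p q r : YZ.
Hypotheses (Dpq : gmdom YLZ (p, q)) (Dpq_r : gmdom YLZ (gmul YLZ p q, r)).
Hypotheses (Dqr : gmdom YLZ (q, r)) (Dp_qr : gmdom YLZ (p, gmul YLZ q r)).

(* The element [d] of [Gamma] completing the square of [c12 p q] and [c12 q r]. *)
Lemma middle_square : exists d : Gam,
  [/\ Gu' d = Gu (c12 p q), Gg' d = Gg (c12 q r), cr p q r = Gmul_Gs d (c12 p q) &
      cl p q r = Gmul_G d (c12 q r)].
Proof.
have [_ Opq Ypq Zpq] := Dpq; have [_ Oqr Yqr Zqr] := Dqr.
have [_ Opqr _ _] := Dpq_r; have [_ Oprq _ _] := Dp_qr.
rewrite /O_ZY /= in Opq Ypq Zpq Oqr Yqr Zqr Opqr Oprq.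
have [w1 e1 e2] := gammaRP Opq; have [w2 e3 e4] := gammaRP Oqr.
have [mY _ _] := ltimesY_spec (esym e4); have [mZ _ _] := ltimesZ_spec (esym e1).
rewrite /= in e1 e2 e3 e4 mY mZ.
rewrite (muZ_mul Zpq) mZ in Opqr; rewrite (muY_mul Yqr) mY in Oprq.
have [w3 e5 e6] := gammaRP Opqr; have [w4 e7 e8] := gammaRP Oprq.
have h : Gu' (cr p q r) = Gu (Ginv_Gs (c12 p q)) := etrans e7 (esym e1).
have [a1 a2 a3 a4] := Gmul_GsE h.
exists (Gmul_Gs (cr p q r) (Ginv_Gs (c12 p q))).
have k1 : Gu' (Gmul_Gs (cr p q r) (Ginv_Gs (c12 p q))) = Gu (c12 p q) by exact: a3.
have k2 : Gg' (Gmul_Gs (cr p q r) (Ginv_Gs (c12 p q))) = Gg (c12 q r).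
  by rewrite a4 e8 -[Gg' (Ginv_Gs _)]/(linv (Gg' _)) e2 lmulK.
split=> //; apply: (GpR_inj disjoint_GGs).
- by have [_ _ -> _] := Gmul_GsE k1; rewrite e7 e1.
- by have [_ _ _ ->] := Gmul_GsE k1; rewrite e8 e2 k2.
- by have [_ _ -> _] := Gmul_GE k2; rewrite e5 e3 k1.
- by have [_ _ _ ->] := Gmul_GE k2; rewrite e6 e4.
Qed.

(** The decompositions of [cr] and [cl] through [d] distribute the outer exchanges over the inner
    products. Both bracketings then become triple products in [Yg] and in [Zg], with the middle
    pairs of [middle_defined]. Those pairs are the images under [d] of pairs already multiplied,
    which is why stable domains define them. *)
Lemma middle_factors :
  composable Yg (ltimesY aY (c12 p q) q.1, ltimesY aY (cl p q r) r.1) /\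
  composable Zg (ltimesZ aZ (cr p q r) p.2, ltimesZ aZ (c12 q r) q.2) /\
  (middle_defined (p, q, r) ->
   gmul YLZ (gmul YLZ p q) r = gmul YLZ p (gmul YLZ q r)) /\
  (stable_domains_Y aGamma Yg muY aY -> stable_domains_Z aGamma Zg muZ aZ ->
   middle_defined (p, q, r)).
Proof.
have [d [d1 d2 d3 d4]] := middle_square.
have [_ Opq Ypq Zpq] := Dpq; have [_ Oqr Yqr Zqr] := Dqr.
have [_ _ Ypqr Zpqr] := Dpq_r; have [_ _ Yprq Zprq] := Dp_qr.
have [w1 e1 e2] := gammaRP Opq; have [w2 e3 e4] := gammaRP Oqr.
have [mY _ _] := ltimesY_spec (esym e4); have [mZ _ _] := ltimesZ_spec (esym e1).
rewrite /= /YL_mul /= in e1 e2 e3 e4 mY mZ Ypq Zpq Yqr Zqr Ypqr Zpqr Yprq Zprq *.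
rewrite (muZ_mul Zpq) mZ in Ypqr Zpqr *; rewrite (muY_mul Yqr) mY in Yprq Zprq *.
have ey : ltimesY aY (cl p q r) r.1 = ltimesY aY d (ltimesY aY (c12 q r) r.1).
  by rewrite d4 ltimesY_mul.
have ez : ltimesZ aZ (cr p q r) p.2 = ltimesZ aZ d (ltimesZ aZ (c12 p q) p.2).
  by rewrite d3 ltimesZ_mul.
have [cY tY] := ltimesY_twist Yqr d1 (esym e2) (etrans mY (esym d2)).
have [cZ tZ] := ltimesZ_twist Zpq d2 (etrans mZ (esym d1)) (esym e3).
rewrite -ey in cY tY; rewrite -ez in cZ tZ; rewrite -d3 in tY; rewrite -d4 in tZ.
split=> //; split=> //; split.
  move=> [/= /(_ cY) mdY /(_ cZ) mdZ].
  rewrite (tY mdY) (tZ mdZ); rewrite (tY mdY) in Yprq; rewrite (tZ mdZ) in Zpqr.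
  by rewrite (gmul_assoc lY Ypq Ypqr mdY Yprq) (gmul_assoc lZ mdZ Zpqr Zqr Zprq).
move=> [sY _ _] [sZ _ _]; split=> _ /=.
  by rewrite ey; apply: (sY _ _ (Ginv_G (c12 p q)) (Ginv_G d) Yqr (congr1 (@linv _ _) d1)
    (esym e2) (etrans mY (esym d2))).
by rewrite ez; apply: (sZ _ _ (Ginv_Gs d) (Ginv_Gs (c12 q r)) Zpq (congr1 (@linv _ _) d2)
  (etrans mZ (esym d1)) (esym e3)).
Qed.

End Triple.

Lemma gammaR_smooth_at (M : premanifold K) (f : M -> Gs) (h : M -> G) m : charted M ->
  smooth_at f m -> smooth_at h m -> O_GsG O (f m, h m) ->
  @smooth_at K M GM (fun w => gammaR O (f w) (h w)) m /\
  \forall w \near m, Gu' (gammaR O (f w) (h w)) = f w /\ Gg' (gammaR O (f w) (h w)) = h w.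
Proof.
move=> cM sf sh Om; have sp := smooth_at_pair sf sh.
have cGG : charted (prodM Gs G) by auto.
have [sg ng] := gammaR_smooth cG Ginv_G_smooth Ginv_Gs_smooth
  GpL_local_diffeo (dp_O S) Om.
split; first exact: (@smooth_at_comp K M (prodM Gs G) GM (fun w => (f w, h w)) _ m cM cGG sp sg).
have [cp _] := sp; have h1 : \forall w \near m, O_GsG O (f w, h w) := cp _ ng.
by apply: filterS h1 => w /gammaRP[_ h1 h2].
Qed.

Lemma ltimesY_smooth_at (M : premanifold K) (c : M -> GM) (f : M -> Ym) m : charted M ->
  smooth_at c m -> smooth_at f m -> (\forall w \near m, muY (f w) = Gg' (c w)) ->
  smooth_at (fun w => ltimesY aY (c w) (f w)) m.
Proof.
move=> cM sc sf h.
exact: (actY_smooth cM sf (smooth_at_comp cM cG sc (Ginv_G_smooth _)) h).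
Qed.

Lemma ltimesZ_smooth_at (M : premanifold K) (c : M -> GM) (f : M -> Zm) m : charted M ->
  smooth_at c m -> smooth_at f m -> (\forall w \near m, muZ (f w) = Gu' (c w)) ->
  smooth_at (fun w => ltimesZ aZ (c w) (f w)) m.
Proof.
move=> cM sc sf h.
exact: (actZ_smooth cM sf (smooth_at_comp cM cG sc (Ginv_Gs_smooth _)) h).
Qed.

(** The exchanged factors depend smoothly on the triple as long as the four dressing elements exist,
    and the domains are open among composable pairs; so the implications of [middle_defined] persist
    nearby. *)
Lemma middle_defined_near (p q r : YZ) :
  O_GsG O (muZ p.2, muY q.1) -> O_GsG O (muZ q.2, muY r.1) ->
  O_GsG O (lmul (Gu (c12 p q)) (muZ q.2), muY r.1) ->
  O_GsG O (muZ p.2, lmul (muY q.1) (Gg (c12 q r))) ->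
  gmdom Yg (ltimesY aY (c12 p q) q.1, ltimesY aY (cl p q r) r.1) ->
  gmdom Zg (ltimesZ aZ (cr p q r) p.2, ltimesZ aZ (c12 q r) q.2) ->
  nbhs (p, q, r) middle_defined.
Proof.
move=> h1 h2 h3 h4 dY dZ; pose t0 : prodM (prodM YZ YZ) YZ := ((p, q), r).
have cT : charted (prodM (prodM YZ YZ) YZ) by auto.
have [p1 _] := triple_fst cYZ cYZ cYZ (p := t0) (smooth_at_fst p cYm cZm).
have [p2 _] := triple_fst cYZ cYZ cYZ (p := t0) (smooth_at_snd p cYm cZm).
have [q1 _] := triple_snd cYZ cYZ cYZ (p := t0) (smooth_at_fst q cYm cZm).
have [q2 _] := triple_snd cYZ cYZ cYZ (p := t0) (smooth_at_snd q cYm cZm).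
have [r1 _] := triple_thd cYZ cYZ cYZ (p := t0) (smooth_at_fst r cYm cZm).
have mp2 := smooth_at_comp cT cZm p2 (muZ_smooth p.2).
have mq1 := smooth_at_comp cT cYm q1 (muY_smooth q.1).
have mq2 := smooth_at_comp cT cZm q2 (muZ_smooth q.2).
have mr1 := smooth_at_comp cT cYm r1 (muY_smooth r.1).
have [s1 n1] := gammaR_smooth_at cT mp2 mq1 h1.
have [s2 n2] := gammaR_smooth_at cT mq2 mr1 h2.
have l1 := smooth_lmul_pair cT (smooth_at_comp cT cG s1 (Gu_smooth _)) mq2.
have l2 := smooth_lmul_pair cT mq1 (smooth_at_comp cT cG s2 (Gg_smooth _)).
have [s3 n3] := gammaR_smooth_at cT l1 mr1 h3.
have [s4 n4] := gammaR_smooth_at cT mp2 l2 h4.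
have y1 : smooth_at (fun t : prodM (prodM YZ YZ) YZ => ltimesY aY (c12 t.1.1 t.1.2) t.1.2.1) t0.
  by apply: (ltimesY_smooth_at cT s1 q1); apply: filterS n1 => t [_ e]; rewrite [RHS]e.
have y2 : smooth_at (fun t : prodM (prodM YZ YZ) YZ => ltimesY aY (cl t.1.1 t.1.2 t.2) t.2.1) t0.
  by apply: (ltimesY_smooth_at cT s3 r1); apply: filterS n3 => t [_ e]; rewrite [RHS]e.
have z1 : smooth_at (fun t : prodM (prodM YZ YZ) YZ => ltimesZ aZ (cr t.1.1 t.1.2 t.2) t.1.1.2) t0.
  by apply: (ltimesZ_smooth_at cT s4 p2); apply: filterS n4 => t [e _]; rewrite [RHS]e.
have z2 : smooth_at (fun t : prodM (prodM YZ YZ) YZ => ltimesZ aZ (c12 t.1.2 t.2) t.1.2.2) t0.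
  by apply: (ltimesZ_smooth_at cT s2 q2); apply: filterS n2 => t [e _]; rewrite [RHS]e.
have [k1 _] := smooth_at_pair y1 y2; have [k2 _] := smooth_at_pair z1 z2.
have m1 : \forall t \near t0,
    composable Yg (ltimesY aY (c12 t.1.1 t.1.2) t.1.2.1, ltimesY aY (cl t.1.1 t.1.2 t.2) t.2.1) ->
    gmdom Yg (ltimesY aY (c12 t.1.1 t.1.2) t.1.2.1, ltimesY aY (cl t.1.1 t.1.2 t.2) t.2.1).
  exact: (k1 _ (gmdom_near lY dY)).
have m2 : \forall t \near t0,
    composable Zg (ltimesZ aZ (cr t.1.1 t.1.2 t.2) t.1.1.2, ltimesZ aZ (c12 t.1.2 t.2) t.1.2.2) ->
    gmdom Zg (ltimesZ aZ (cr t.1.1 t.1.2 t.2) t.1.1.2, ltimesZ aZ (c12 t.1.2 t.2) t.1.2.2).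
  exact: (k2 _ (gmdom_near lZ dZ)).
by apply: filterS2 m1 m2 => t a b; split.
Qed.

Lemma Gg_unit_G g : Gg (Gunit_G jG jGs g) = g. Proof. by []. Qed.
Lemma Gu_unit_G g : Gu (Gunit_G jG jGs g) = lone Gs. Proof. by []. Qed.
Lemma Gg_unit_Gs u : Gg (Gunit_Gs jG jGs u) = lone G. Proof. by []. Qed.
Lemma Gu_unit_Gs u : Gu (Gunit_Gs jG jGs u) = u. Proof. by []. Qed.

Lemma ltimesY_unit y : ltimesY aY (Gunit_G jG jGs (muY y)) y = y.
Proof. by rewrite /ltimesY Ginv_G_unit actY_unit. Qed.

Lemma ltimesZ_unit z : ltimesZ aZ (Gunit_Gs jG jGs (muZ z)) z = z.
Proof. by rewrite /ltimesZ Ginv_Gs_unit actZ_unit. Qed.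

Lemma ltimesY_base (w : Y) u :
  ltimesY aY (Gunit_Gs jG jGs u) (gunit Yg w) = gunit Yg (rho w (linv u)).
Proof. by rewrite /ltimesY Ginv_G_unit_Gs (dp_rho S). Qed.

Lemma ltimesZ_base (w : Z) g :
  ltimesZ aZ (Gunit_G jG jGs g) (gunit Zg w) = gunit Zg (theta (linv g) w).
Proof. by rewrite /ltimesZ Ginv_Gs_unit_G (dp_theta S). Qed.

Lemma O_GsG_1g g : O_GsG O (lone Gs, g).
Proof. by exists (Gunit_G jG jGs g) => //; exact: O_unit_G. Qed.

Lemma O_GsG_u1 u : O_GsG O (u, lone G).
Proof. by exists (Gunit_Gs jG jGs u) => //; exact: O_unit_Gs. Qed.

Let simps := (muY_unit, muZ_unit, gammaR_1g, gammaR_u1, lmul1g, lmulg1,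
  Gg_unit_G, Gu_unit_G, Gg_unit_Gs, Gu_unit_Gs).

Lemma gmdom_units (A B : premanifold K) (Gr : lgroupoid A B) (w : B) :
  local_lie_groupoid Gr -> gmdom Gr (gunit Gr w, gunit Gr w).
Proof. by move=> h; have := gmdom_unitl h (gunit Gr w); rewrite (gsrc_unit h). Qed.

(** In this and the next two degenerate cases every middle pair contains a unit, so its product is
    defined. These are the three neighbourhoods that [shrink_multiplication] asks for. *)
Lemma middle_defined_llp (p : YZ) :
  nbhs (gunit YLZ (gsrc YLZ p), gunit YLZ (gsrc YLZ p), p) middle_defined.
Proof.
case: p => y z; apply: middle_defined_near; rewrite /= /YL_unit /= !simps;
  try exact: O_GsG_1g.
  rewrite Gunit1 ltimesY_base linv1 rho1 ltimesY_unit; exact: (gmdom_unitl lY).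
rewrite !ltimesZ_base thetaK; exact: gmdom_units.
Qed.

Lemma middle_defined_lpr (p : YZ) :
  nbhs (gunit YLZ (gsrc YLZ p), p, gunit YLZ (gtgt YLZ p)) middle_defined.
Proof.
case: p => y z; apply: middle_defined_near; rewrite /= /YL_unit /= !simps;
  try exact: O_GsG_1g; try exact: O_GsG_u1.
  rewrite ltimesY_base rhoK ltimesY_unit; exact: (gmdom_unitr lY).
rewrite ltimesZ_base thetaK ltimesZ_unit; exact: (gmdom_unitl lZ).
Qed.

Lemma middle_defined_prr (p : YZ) :
  nbhs (p, gunit YLZ (gtgt YLZ p), gunit YLZ (gtgt YLZ p)) middle_defined.
Proof.
case: p => y z; apply: middle_defined_near; rewrite /= /YL_unit /= !simps;
  try exact: O_GsG_u1.
  rewrite !ltimesY_base rhoK; exact: gmdom_units.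
rewrite -Gunit1 ltimesZ_base linv1 theta1 ltimesZ_unit; exact: (gmdom_unitr lZ).
Qed.

(** * Inverses *)

Notation gl p := (gammaL O (muY p.1) (muZ p.2)).

(* The products used to derive the inverse laws of the product from those of
   [Yg] and [Zg]. *)
Definition good_inverse : set YZ := [set p |
  [/\ gidom YLZ p, gidom Yg p.1 /\ gidom Zg p.2,
      gmdom Yg (ginv Yg p.1, p.1) /\ gmdom Zg (p.2, ginv Zg p.2),
      gmdom Yg (aY p.1 (gl p), ginv Yg (aY p.1 (gl p))) /\
        gmdom Zg (ginv Zg (aZ p.2 (gl p)), aZ p.2 (gl p))
    & gmdom Yg (p.1, aY (ginv Yg (aY p.1 (gl p))) (Ginv2 (gl p))) /\
        gmdom Zg (aZ (ginv Zg (aZ p.2 (gl p))) (Ginv2 (gl p)), p.2)]].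

Lemma inv_def (p : YZ) :
  ginv YLZ p = (ginv Yg (aY p.1 (gl p)), ginv Zg (aZ p.2 (gl p))).
Proof. by []. Qed.

Lemma mul_def (p q : YZ) : gmul YLZ p q =
  (gmul Yg p.1 (ltimesY aY (gammaR O (muZ p.2) (muY q.1)) q.1),
   gmul Zg (ltimesZ aZ (gammaR O (muZ p.2) (muY q.1)) p.2) q.2).
Proof. by []. Qed.

Lemma R_L_def (p : YZ) :
  R_L O muY muZ aY aZ (p.2, p.1) = (aZ p.2 (gl p), aY p.1 (gl p)).
Proof. by []. Qed.

Lemma inv_mu (p : YZ) : gidom YLZ p ->
  [/\ O (gl p), muY p.1 = Gg (gl p) & muZ p.2 = Gu (gl p)] /\
  [/\ muY (aY p.1 (gl p)) = Gg' (gl p), muZ (aZ p.2 (gl p)) = Gu' (gl p),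
      muY (ginv YLZ p).1 = linv (Gg' (gl p)) & muZ (ginv YLZ p).2 = linv (Gu' (gl p))].
Proof.
move=> [h1 [h2 [iz iy]]]; have [Oc e1 e2] := gammaLP h1; split=> //.
have mY := muY_act (esym e1); have mZ := muZ_act (esym e2).
by split; rewrite // /= ?(muY_inv iy) ?(muZ_inv iz) ?mY ?mZ.
Qed.

(** Let x be [p.1] acted on by c. Twisted multiplicativity for x x^-1, with the one-sided inverse of
    c acting on x and [Ginv2 c] on x^-1, shows that [p.1] times the acted inverse is a unit.
    Multiplying by the inverse of [p.1] and reassociating identifies it; the argument for [p.2] is
    the mirror image. *)
Lemma dressed_inverse (p : YZ) : good_inverse p ->
  aY (ginv Yg (aY p.1 (gl p))) (Ginv2 (gl p)) = ginv Yg p.1 /\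
  aZ (ginv Zg (aZ p.2 (gl p))) (Ginv2 (gl p)) = ginv Zg p.2.
Proof.
move=> [ip [iy iz] [dy dz] [dx dw] [dy' dz']].
have [[Oc e1 e2] [mY mZ miY miZ]] := inv_mu ip; have [h1 [h2 [iw ix]]] := ip.
rewrite /= in iw ix.
set c := gl p in Oc e1 e2 mY mZ miY miZ iw ix dx dw dy' dz' *.
split.
  have Ec : Gu' (Ginv2 c) = Gu (Ginv_G c) by [].
  have eb : muY (ginv Yg (aY p.1 c)) = Gg (Ginv2 c) by exact: miY.
  have [_ tw] := twistY dx Ec mY eb.
  have back : aY (aY p.1 c) (Ginv_G c) = p.1 by exact: (ltimesY_act e1).
  rewrite back in tw; have {}tw := tw dy'.
  have [a1 a2 a3 a4] := Gmul_GsE Ec.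
  have ec : Gmul_Gs (Ginv2 c) (Ginv_G c) = Gunit_Gs jG jGs (linv (Gu' c)).
    apply: Gamma_ext; rewrite ?a1 ?a2 ?a3 ?a4 //; first exact: lmulgV.
    exact: lmulgV.
  rewrite ec (gmul_inv lY ix dx) -(dp_rho S) (srcY_act e1) rhoK in tw.
  set b := aY (ginv Yg _) _ in tw dy' *.
  have tb : gsrc Yg b = gtgt Yg p.1 by rewrite (gmdom_composable lY dy').
  have d1 : gmdom Yg (gmul Yg (ginv Yg p.1) p.1, b).
    by rewrite (gmul_invl lY iy dy) -tb; exact: gmdom_unitl.
  have d2 : gmdom Yg (ginv Yg p.1, gmul Yg p.1 b).
    by rewrite -tw -(gtgt_inv lY iy); exact: gmdom_unitr.
  have := gmul_assoc lY dy d1 dy' d2.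
  rewrite (gmul_invl lY iy dy) -tb (gmul_unitl lY) => ->.
  by rewrite -tw -(gtgt_inv lY iy) (gmul_unitr lY).
have Ec : Gg' (Ginv2 c) = Gg (Ginv_Gs c) by [].
have eb : muZ (ginv Zg (aZ p.2 c)) = Gu (Ginv2 c) by exact: miZ.
have [_ tw] := twistZ dw Ec eb mZ.
have back : aZ (aZ p.2 c) (Ginv_Gs c) = p.2 by exact: (ltimesZ_act e2).
rewrite back in tw; have {}tw := tw dz'.
have [a1 a2 a3 a4] := Gmul_GE Ec.
have ec : Gmul_G (Ginv2 c) (Ginv_Gs c) = Gunit_G jG jGs (linv (Gg' c)).
  apply: Gamma_ext; rewrite ?a1 ?a2 ?a3 ?a4 //; first exact: lmulVg.
  exact: lmulVg.
rewrite ec (gmul_invl lZ iw dw) -(dp_theta S) (tgtZ_act e2) thetaK in tw.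
set b := aZ (ginv Zg _) _ in tw dz' *.
have tb : gtgt Zg b = gsrc Zg p.2 by rewrite (gmdom_composable lZ dz').
have d1 : gmdom Zg (gmul Zg b p.2, ginv Zg p.2).
  by rewrite -tw -(gsrc_inv lZ iz); exact: gmdom_unitl.
have d2 : gmdom Zg (b, gmul Zg p.2 (ginv Zg p.2)).
  by rewrite (gmul_inv lZ iz dz) -tb; exact: gmdom_unitr.
have := gmul_assoc lZ dz' d1 dz d2.
rewrite (gmul_inv lZ iz dz) -tb (gmul_unitr lZ) => <-.
by rewrite -tw -(gsrc_inv lZ iz) (gmul_unitl lZ).
Qed.

(** The dressing element of the inverse is [Ginv2 c], which lies in [O] by [O_Ginv2]; acting by it
    undoes the first inversion by [dressed_inverse]. *)
Lemma product_ginvK (p : YZ) : good_inverse p ->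
  gidom YLZ (ginv YLZ p) /\ ginv YLZ (ginv YLZ p) = p.
Proof.
move=> gp; have [bY' bZ'] := dressed_inverse gp; have [ip [iy iz] _ _ _] := gp.
have [[Oc e1 e2] [mY mZ miY miZ]] := inv_mu ip.
set c := gl p in Oc e1 e2 mY mZ miY miZ bY' bZ' *.
have O2c := O_Ginv2 cG Ginv_G_smooth Ginv_Gs_smooth (dp_O S) Oc.
have ec : gl (ginv YLZ p) = Ginv2 c by rewrite miY miZ; exact: (gammaL_unique O2c).
split; last first.
  rewrite [LHS]inv_def ec /= -/c bY' bZ' (ginvK lY iy) (ginvK lZ iz).
  by case: (p).
split; first by rewrite /O21_ZY /= miY miZ; exists (Ginv2 c).
rewrite R_L_def ec /= -/c bY' bZ'; split.
  rewrite /O_ZY /= (muY_inv iy) (muZ_inv iz) e1 e2; exists (Ginv2 c) => //.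
by split; [exact: gidom_inv | exact: gidom_inv].
Qed.

(** The exchanging element is [Ginv_Gs c] for p p^-1 and [Ginv_G c] for p^-1 p. After the exchange
    each component is an element of [Yg] or [Zg] next to its own inverse. *)
Lemma product_mul_inv (p : YZ) : good_inverse p ->
  (gmdom YLZ (p, ginv YLZ p) -> gmul YLZ p (ginv YLZ p) = gunit YLZ (gsrc YLZ p)) /\
  (gmdom YLZ (ginv YLZ p, p) -> gmul YLZ (ginv YLZ p) p = gunit YLZ (gtgt YLZ p)).
Proof.
move=> gp; have [bY' bZ'] := dressed_inverse gp; have [ip [iy iz] _ _ _] := gp.
have [[Oc e1 e2] [mY mZ miY miZ]] := inv_mu ip; have [h1 [h2 [iw ix]]] := ip.
rewrite /= in iw ix.
have q1 : (ginv YLZ p).1 = ginv Yg (aY p.1 (gl p)) by [].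
have q2 : (ginv YLZ p).2 = ginv Zg (aZ p.2 (gl p)) by [].
set c := gl p in Oc e1 e2 mY mZ miY miZ iw ix bY' bZ' q1 q2 *.
move: (ginv YLZ p) q1 q2 miY miZ => i q1 q2 miY miZ.
split=> -[_ Om dY dZ]; rewrite /O_ZY /= in Om; rewrite [LHS]mul_def.
  rewrite /= miY e2 in Om; rewrite /= miY q1 q2 e2 in dY dZ *.
  have [_ k1 k2] := gammaRP Om.
  have ec : gammaR O (Gu c) (linv (Gg' c)) = Ginv_Gs c.
    by apply: (GpR_inj disjoint_GGs); [exact: k1 | exact: k2].
  have eY : ltimesY aY (Ginv_Gs c) (ginv Yg (aY p.1 c)) = ginv Yg p.1 by exact: bY'.
  have eZ : ltimesZ aZ (Ginv_Gs c) p.2 = aZ p.2 c.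
    by rewrite /ltimesZ; congr aZ; apply: Gamma_ext; rewrite //=; exact: linvK.
  rewrite ec eY eZ in dY dZ *.
  by rewrite (gmul_inv lY iy dY) (gmul_inv lZ iw dZ) (srcZ_act e2) -e1.
rewrite /= miZ e1 in Om; rewrite /= miZ q1 q2 e1 in dY dZ *.
have [_ k1 k2] := gammaRP Om.
have ec : gammaR O (linv (Gu' c)) (Gg c) = Ginv_G c.
  by apply: (GpR_inj disjoint_GGs); [exact: k1 | exact: k2].
have eZ : ltimesZ aZ (Ginv_G c) (ginv Zg (aZ p.2 c)) = ginv Zg p.2.
  rewrite -bZ' /ltimesZ; congr aZ; exact: Gamma_ext.
have eY : ltimesY aY (Ginv_G c) p.1 = aY p.1 c.
  by rewrite /ltimesY; congr aY; apply: Gamma_ext; rewrite //=; exact: linvK.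
rewrite ec eY eZ in dY dZ *.
by rewrite (gmul_invl lY ix dY) (gmul_invl lZ iz dZ) (tgtY_act e1) -e2.
Qed.

(** [p] is recovered from its acted factors by the one-sided inverses of the dressing element, so
    stability brings invertibility back to [p.1] and [p.2]. *)
Lemma good_inverse_stable (p : YZ) :
  stable_domains_Y aGamma Yg muY aY -> stable_domains_Z aGamma Zg muZ aZ ->
  gidom YLZ p -> good_inverse p.
Proof.
move=> [sY iY vY] [sZ iZ vZ] ip; have [[Oc e1 e2] [mY mZ miY miZ]] := inv_mu ip.
have [h1 [h2 [iw ix]]] := ip; rewrite /= in iw ix.
have backY : aY (aY p.1 (gl p)) (Ginv_G (gl p)) = p.1 by exact: (ltimesY_act e1).
have backZ : aZ (aZ p.2 (gl p)) (Ginv_Gs (gl p)) = p.2 by exact: (ltimesZ_act e2).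
have iy : gidom Yg p.1 by rewrite -backY; apply: iY.
have iz : gidom Zg p.2 by rewrite -backZ; apply: iZ.
have [a1 a2] := vY _ iy; have [b1 b2] := vZ _ iz.
have [a3 a4] := vY _ ix; have [b3 b4] := vZ _ iw.
split=> //; split.
  have := sY _ _ (Ginv_G (gl p)) (Ginv2 (gl p)) a3 erefl mY miY.
  by rewrite backY.
have := sZ _ _ (Ginv2 (gl p)) (Ginv_Gs (gl p)) b4 erefl miZ mZ.
by rewrite backZ.
Qed.

Lemma product_ginv_unit (w : prodM Y Z) : ginv YLZ (gunit YLZ w) = gunit YLZ w.
Proof.
case: w => a b; have e : gl (gunit YLZ (a, b)) = Gunit_G jG jGs (lone G).
  by rewrite /= muY_unit muZ_unit gammaL_11.
have ey := actY_unit (gunit Yg a); have ez := actZ_unit (gunit Zg b).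
rewrite muY_unit in ey; rewrite muZ_unit -Gunit1 in ez.
by rewrite inv_def e /= /YL_unit /= ey ez (ginv_unit lY) (ginv_unit lZ).
Qed.

(** At a unit all factors involved are units. Nearby, composability in each required pair follows
    from the laws for sources and targets, and openness of the domains among composable pairs does
    the rest. *)
Lemma good_inverse_unit (w : prodM Y Z) : nbhs (gunit YLZ w) good_inverse.
Proof.
case: w => a b; pose p0 : YZ := (gunit Yg a, gunit Zg b).
have O1 : O_GGs O (muY p0.1, muZ p0.2).
  rewrite /= muY_unit muZ_unit; exists (Gunit_G jG jGs (lone G)) => //.
  exact: O_unit_G.
have sy := smooth_at_fst p0 cYm cZm; have sz := smooth_at_snd p0 cYm cZm.
have [sx sw] := act_comp_smooth cYZ sy sz O1.
have [sc _] := gammaL_comp_smooth cYZ sy sz O1.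
have gl0 : gl p0 = Gunit_G jG jGs (lone G).
  by rewrite /= muY_unit muZ_unit gammaL_11.
have x0 : aY p0.1 (gl p0) = p0.1.
  by have := actY_unit p0.1; rewrite gl0 /= muY_unit.
have w0 : aZ p0.2 (gl p0) = p0.2.
  by have := actZ_unit p0.2; rewrite gl0 Gunit1 /= muZ_unit.
have siY : smooth_at (ginv Yg) (gunit Yg a).
  exact: (smooth_on_open cYm (gidom_open lY) (gidom_unit lY a) (ginv_smooth lY)).
have siZ : smooth_at (ginv Zg) (gunit Zg b).
  exact: (smooth_on_open cZm (gidom_open lZ) (gidom_unit lZ b) (ginv_smooth lZ)).
have siy := smooth_at_comp cYZ cYm sy siY; have siz := smooth_at_comp cYZ cZm sz siZ.
have siYx : smooth_at (ginv Yg) (aY p0.1 (gl p0)) by rewrite x0.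
have siZw : smooth_at (ginv Zg) (aZ p0.2 (gl p0)) by rewrite w0.
have six := smooth_at_comp cYZ cYm sx siYx; have siw := smooth_at_comp cYZ cZm sw siZw.
have s2 := smooth_at_comp cYZ cG sc (smooth_Ginv2 cG Ginv_G_smooth Ginv_Gs_smooth _).
have nid : \forall m \near p0, gidom YLZ m.
  exact: (open_nbhs_nbhs (conj idom_open (idom_unit (a, b)))).
have c20 : Ginv2 (gl p0) = Gunit_G jG jGs (lone G).
  by rewrite gl0; apply: Gamma_ext; exact: linv1.
have sbY : smooth_at (fun m : YZ => aY (ginv Yg (aY m.1 (gl m))) (Ginv2 (gl m))) p0.
  apply: (actY_smooth cYZ six s2); apply: filterS nid => m /inv_mu[_ [_ _ e _]].
  exact: e.
have sbZ : smooth_at (fun m : YZ => aZ (ginv Zg (aZ m.2 (gl m))) (Ginv2 (gl m))) p0.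
  apply: (actZ_smooth cYZ siw s2); apply: filterS nid => m /inv_mu[_ [_ _ _ e]].
  exact: e.
have bY0 : aY (ginv Yg (aY p0.1 (gl p0))) (Ginv2 (gl p0)) = gunit Yg a.
  by rewrite x0 c20 (ginv_unit lY) -[LHS](congr1 (aY _) (congr1 _ (muY_unit a))) actY_unit.
have bZ0 : aZ (ginv Zg (aZ p0.2 (gl p0))) (Ginv2 (gl p0)) = gunit Zg b.
  by rewrite w0 c20 (ginv_unit lZ) Gunit1 -[LHS](congr1 (aZ _) (congr1 _ (muZ_unit b)))
    actZ_unit.
have uY := gmdom_units a lY; have uZ := gmdom_units b lZ.
have nearY (f h : YZ -> Ym) : smooth_at f p0 -> smooth_at h p0 -> f p0 = gunit Yg a ->
    h p0 = gunit Yg a ->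
    \forall m \near p0, composable Yg (f m, h m) -> gmdom Yg (f m, h m).
  move=> sf sh ef eh; have [k _] := smooth_at_pair sf sh.
  by apply: (k [set q | composable Yg q -> gmdom Yg q]); rewrite /= ef eh; exact: gmdom_near.
have nearZ (f h : YZ -> Zm) : smooth_at f p0 -> smooth_at h p0 -> f p0 = gunit Zg b ->
    h p0 = gunit Zg b ->
    \forall m \near p0, composable Zg (f m, h m) -> gmdom Zg (f m, h m).
  move=> sf sh ef eh; have [k _] := smooth_at_pair sf sh.
  by apply: (k [set q | composable Zg q -> gmdom Zg q]); rewrite /= ef eh; exact: gmdom_near.
have iY0 : ginv Yg p0.1 = gunit Yg a by exact: (ginv_unit lY).
have iZ0 : ginv Zg p0.2 = gunit Zg b by exact: (ginv_unit lZ).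
have n1 := nearY _ _ siy sy iY0 erefl; have n2 := nearZ _ _ sz siz erefl iZ0.
have n3 := nearY _ _ sx six x0 (etrans (congr1 _ x0) iY0).
have n4 := nearZ _ _ siw sw (etrans (congr1 _ w0) iZ0) w0.
have n5 := nearY _ _ sy sbY erefl bY0; have n6 := nearZ _ _ sbZ sz bZ0 erefl.
have n7 : \forall m \near p0, gidom Yg m.1.
  have [k _] := sy; exact: (k _ (open_nbhs_nbhs (conj (gidom_open lY) (gidom_unit lY a)))).
have n8 : \forall m \near p0, gidom Zg m.2.
  have [k _] := sz; exact: (k _ (open_nbhs_nbhs (conj (gidom_open lZ) (gidom_unit lZ b)))).
suff : \forall m \near p0, good_inverse m by [].
apply: filterS3 (filterI n1 (filterI n2 n3)) (filterI n4 (filterI n5 n6))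
  (filterI nid (filterI n7 n8)) => m [m1 [m2 m3]] [m4 [m5 m6]] [im [iy iz]].
have [[Oc e1 e2] [mY mZ miY miZ]] := inv_mu im; have [h1 [h2 [iw ix]]] := im.
rewrite /= in iw ix.
split=> //; split.
- by apply: m1; rewrite /composable /= (gtgt_inv lY iy).
- by apply: m2; rewrite /composable /= (gsrc_inv lZ iz).
- by apply: m3; rewrite /composable /= (gsrc_inv lY ix).
- by apply: m4; rewrite /composable /= (gtgt_inv lZ iw).
- apply: m5; rewrite /composable /= (srcY_act (c := Ginv2 (gl m)) miY).
  by rewrite (gsrc_inv lY ix) (tgtY_act e1) rhoK.
- apply: m6; rewrite /composable /= (tgtZ_act (c := Ginv2 (gl m)) miZ).
  by rewrite (gtgt_inv lZ iw) (srcZ_act e2) thetaK.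
Qed.

(** * Restriction of the domains and conclusion *)

Notation bYLZ := (prodB bYm bZm).

Lemma smooth_on_sub (M N : premanifold K) (A B : set M) (f : M -> N) :
  A `<=` B -> smooth_on B f -> smooth_on A f.
Proof.
move=> AB sf p /AB /sf [F [sF hF]]; exists F; split=> //.
by apply: filterS hF => q h /AB.
Qed.

(** Serves twice: for the shrunk domains, and for the full ones when the domains of [Yg] and [Zg]
    are stable. *)
Lemma restricted_product (W : set (YZ * YZ)) (V : set YZ) :
  W `<=` gmdom YLZ -> (forall q, W q -> \forall q' \near q, gmdom YLZ q' -> W q') ->
  (forall p, W (gunit YLZ (gsrc YLZ p), p)) -> (forall p, W (p, gunit YLZ (gtgt YLZ p))) ->
  (forall p q r, W (p, q) -> W (gmul YLZ p q, r) -> W (q, r) -> W (p, gmul YLZ q r) ->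
    middle_defined (p, q, r)) ->
  open V -> (forall w, V (gunit YLZ w)) ->
  (forall p, V p -> good_inverse p /\ V (ginv YLZ p)) ->
  @local_poisson_groupoid K YZ (prodM Y Z) (restrict_groupoid YLZ W V) bYLZ bbase.
Proof.
move=> WD Wo Wl Wr Wm oV Vu Vg.
have VD : V `<=` gidom YLZ by move=> p /Vg[[]].
have [[m1 m2 m3] [m4 m5 m6 m7 m8] [m9 m10] [m11 m12 m13 m14] m15] := product_maps.
have [pA pB] := product_poisson.
split.
- split.
  + split=> //.
    * split=> //; apply: relatively_open; first by move=> q /WD[].
      move=> q Wq; have [W0 oW0 eW0] := m4; have Dq := WD _ Wq; rewrite eW0 in Dq.
      have nW0 : nbhs q W0 by apply: open_nbhs_nbhs; split=> //; case: Dq.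
      have := Wo q Wq; apply: filterS2 nW0 => q' a b Cq; apply: b.
      by rewrite eW0.
    * split; [exact: smooth_on_sub m9 | exact: smooth_on_sub m10].
    * split=> // [a b Wab|a Va]; [exact: m13 (WD _ Wab) | exact: m14 (VD _ Va)].
  + by move=> p Vp; have [g1 g2] := Vg p Vp; have [_ e] := product_ginvK g1.
  + move=> p Vp; have [g1 _] := Vg p Vp; have [h1 h2] := product_mul_inv g1.
    by split=> /WD; [exact: h1 | exact: h2].
  + move=> p q r h1 h2 h3 h4; have md := Wm _ _ _ h1 h2 h3 h4.
    have [_ [_ [h _]]] := middle_factors (WD _ h1) (WD _ h2) (WD _ h3) (WD _ h4).
    exact: h.
- by [].
- move=> t f h [Wt te] sf sh vf vh.
  (* [W] is open in the full domain, so the two graphs have the same germ at [t] and the vanishing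
     conditions agree. *)
  have near_t (k : prodM (prodM YZ YZ) YZ -> K) :
      (\forall s \near t, W s.1 /\ s.2 = gmul YLZ s.1.1 s.1.2 -> k s = 0) ->
      \forall s \near t, gmdom YLZ s.1 /\ s.2 = gmul YLZ s.1.1 s.1.2 -> k s = 0.
    move=> vk; have n1 : \forall s \near t, gmdom YLZ s.1 -> W s.1 by exact: (cvg_fst (Wo _ Wt)).
    by apply: filterS2 n1 vk => s a b [d e]; apply: b; split=> //; exact: a.
  apply: product_coisotropic => //; first by split=> //; exact: WD.
    exact: near_t.
  exact: near_t.
- exact: src_poisson.
- exact: tgt_poisson.
Qed.

Lemma product_shrinks : exists W V, [/\ W `<=` gmdom YLZ, V `<=` gidom YLZ
  & @local_poisson_groupoid K YZ (prodM Y Z) (restrict_groupoid YLZ W V) bYLZ bbase].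
Proof.
have [dY mdY] := manifold_metrizable hK (mfdP Ym).
have [dZ mdZ] := manifold_metrizable hK (mfdP Zm).
have [[m1 m2 m3] [m4 m5 m6 m7 m8] [m9 m10] [m11 m12 m13 m14] m15] := product_maps.
have cl : continuous (fun p : YZ => gunit YLZ (gsrc YLZ p) : YZ).
  move=> p; have [k _] := smooth_at_comp (P := YZ) cYZ (charted_prod (mfd_charted Y) (mfd_charted Z))
    (proj1 m1 p) (unit_smooth _); exact: k.
have cr : continuous (fun p : YZ => gunit YLZ (gtgt YLZ p) : YZ).
  move=> p; have [k _] := smooth_at_comp (P := YZ) cYZ (charted_prod (mfd_charted Y) (mfd_charted Z))
    (proj1 m2 p) (unit_smooth _); exact: k.
have [W [W1 W2 W3 W4 W5]] := shrink_multiplication (metrizes_prod mdY mdZ) cl cr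
  (fun p => congr1 _ (m11 _)) (fun p => congr1 _ (m11 _)) (fun p => congr1 _ (m12 _))
  (fun p => congr1 _ (m12 _))
  (fun p q (h : gmdom YLZ (p, q)) => let: conj a b := m13 p q h in
    And3 (congr1 _ (let: And4 c _ _ _ := h in c)) (congr1 _ a) (congr1 _ b))
  (fun p q B (h : gmdom YLZ (p, q)) hB => smooth_on_continuous m9 h hB)
  m5 m6 (fun p => proj1 (m15 p)) (fun p => proj2 (m15 p))
  middle_defined_llp middle_defined_lpr middle_defined_prr.
pose V0 : set YZ := (good_inverse)°.
(* Intersecting with the preimage under inversion makes [V] stable, because inversion is involutive
   on [good_inverse]. *)
pose V : set YZ := V0 `&` ginv YLZ @^-1` V0.
have V0g : V0 `<=` good_inverse by exact: interior_subset.
have oV0 : open V0 by exact: open_interior.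
have oV : open V.
  rewrite openE => p [Vp Vip]; have [ip _ _ _ _] := V0g _ Vp.
  have [k _] := smooth_on_open cYZ m7 ip m10.
  have n1 : nbhs p V0 by exact: open_nbhs_nbhs.
  have n2 : \forall q \near p, V0 (ginv YLZ q) by exact: (k _ (open_nbhs_nbhs (conj oV0 Vip))).
  by apply: filterS2 n1 n2.
have Vg p : V p -> good_inverse p /\ V (ginv YLZ p).
  move=> [Vp Vip]; have gp := V0g _ Vp; split=> //; split=> //.
  by rewrite -(proj2 (product_ginvK gp)) in Vp.
have Vu w : V (gunit YLZ w).
  have h : V0 (gunit YLZ w) by exact: good_inverse_unit.
  by split=> //; rewrite -product_ginv_unit in h.
exists W, V; split=> //; first by move=> p /Vg[[]].
exact: restricted_product.
Qed.

Lemma product_stable : stable_domains_Y aGamma Yg muY aY -> stable_domains_Z aGamma Zg muZ aZ ->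
  @local_poisson_groupoid K YZ (prodM Y Z) YLZ bYLZ bbase.
Proof.
move=> sY sZ.
have [[m1 m2 m3] [m4 m5 m6 m7 m8] [m9 m10] [m11 m12 m13 m14] m15] := product_maps.
apply: (@restricted_product (gmdom YLZ) (gidom YLZ)) => //.
- by move=> q Dq; exact: near_all.
- move=> p q r h1 h2 h3 h4; have [_ [_ [_ h]]] := middle_factors h1 h2 h3 h4.
  exact: h.
- move=> p ip; have gp := good_inverse_stable sY sZ ip; split=> //.
  by have [] := product_ginvK gp.
Qed.

(** The relation g u = u' g' of [Gamma] is exactly what rewrites the inner factors [muZ p.2] and
    [muY q.1] as those appearing in the product. *)
Lemma mu_L_group_morphism : group_morphism YLZ (mu_L jG jGs muY muZ).
Proof.
split.
- by move=> p; have [] := mu_L_jac p.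
- move=> p q [_ Om dY dZ]; have [_ e1 e2] := gammaRP Om.
  have [mY _ _] := ltimesY_spec (esym e2); have [mZ _ _] := ltimesZ_spec (esym e1).
  rewrite /mu_L mul_def /= in dY dZ e1 e2 mY mZ *.
  rewrite (muY_mul dY) (muZ_mul dZ) mY mZ !lhomM.
  set c := gammaR _ _ _ in e1 e2 *.
  rewrite -lmulA (lmulA (jG (Gg c))) [lmul (jG (Gg c)) _](GammaP c) e1 e2.
  by rewrite !lmulA.
- by move=> w; rewrite /mu_L /= muY_unit muZ_unit !lhom1 lmul1g.
- move=> p ip; have [[Oc e1 e2] [mY mZ miY miZ]] := inv_mu ip.
  move: e1 e2 miY miZ; rewrite /mu_L; move: (ginv YLZ p) (gammaL _ _ _) => i c e1 e2 -> ->.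
  by rewrite e1 e2 [lmul (jG (Gg _)) _](GammaP c) !lhomV linvM.
Qed.

End DressedPair.

Theorem theorem5p4 (R : realType) (K : numFieldType) (hK : real_or_complex R K)
  (* dual Poisson Lie groups in a Drinfeld double *)
  (G Gs D : lieGroup K) (bG : bivector G) (bGs : bivector Gs)
  (pr : 'M[K]_(mdim G, mdim Gs)) (jG : lieHom G D) (jGs : lieHom Gs D)
  (n : nat) (x : 'M[K]_(n, mdim G)) (xi : 'M[K]_(n, mdim Gs))
  (hG : poisson_lie_group bG) (hGs : poisson_lie_group bGs)
  (hdual : dual_lie_bialgebras bG bGs pr)
  (hD : drinfeld_double pr jG jGs)
  (hbases : dual_bases pr x xi)
  (hGD : poisson_map bG (piD jG jGs x xi) jG)
  (hGsD : poisson_map (negB bGs) (piD jG jGs x xi) jGs)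
  (* the double symplectic groupoid *)
  (aGamma : atlas K (Gamma jG jGs)) (bGamma : bivector (GammaM aGamma))
  (hGamma : double_symplectic_groupoid bG bGs x xi bGamma)
  (O : set (Gamma jG jGs)) (hO : maximal_dressing_domain aGamma O)
  (* the local Poisson groupoids, their moment maps and the actions *)
  (Ym Y Zm Z : manifold K) (Yg : lgroupoid Ym Y) (Zg : lgroupoid Zm Z)
  (bYm : bivector Ym) (bY : bivector Y) (bZm : bivector Zm) (bZ : bivector Z)
  (hYg : local_poisson_groupoid Yg bYm bY)
  (hZg : local_poisson_groupoid Zg bZm bZ)
  (muY : Ym -> G) (muZ : Zm -> Gs)
  (hmuY : poisson_group_morphism Yg bYm bG muY)
  (hmuZ : poisson_group_morphism Zg bZm (negB bGs) muZ)
  (aY : Ym -> Gamma jG jGs -> Ym) (aZ : Zm -> Gamma jG jGs -> Zm)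
  (haY : poisson_right_action (Gamma_G aGamma) (negB bGamma) bYm muY aY)
  (haZ : poisson_right_action (Gamma_Gs aGamma) bGamma bZm muZ aZ)
  (htwY : twisted_multiplicative_Y aGamma Yg muY aY)
  (htwZ : twisted_multiplicative_Z aGamma Zg muZ aZ)
  (rho : Y -> Gs -> Y) (theta : G -> Z -> Z)
  (hrho : induced_action_Y Yg aY rho)
  (htheta : induced_action_Z Zg aZ theta) :
  let YLZ := product_L O Yg Zg muY muZ aY aZ rho theta in
  let bYLZ := prodB bYm bZm in
  let bbase := mixed_product rho theta x xi bY bZ in
  [/\ determines_local_poisson_groupoid YLZ bYLZ bbase,
      (stable_domains_Y aGamma Yg muY aY -> stable_domains_Z aGamma Zg muZ aZ ->
         local_poisson_groupoid YLZ bYLZ bbase)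
    & poisson_group_morphism YLZ bYLZ (piD jG jGs x xi)
        (mu_L jG jGs muY muZ)].
Proof.
move=> YLZ bYLZ bbase.
have S : dressed_pair bG bGs x xi bGamma O Yg Zg bYm bY bZm bZ muY muZ aY aZ rho theta by [].
split.
- split; [exact: (product_maps S) | exact: (product_coisotropic hK S) | exact: (product_shrinks hK S)].
- exact: (product_stable hK S).
- split; [exact: (mu_L_group_morphism S) | exact: (mu_L_poisson S hGD hGsD)].
Qed.
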